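(* Let $d\in\{2,3\}$ and let $\Omega\subset\mathbb{R}^d$ be a bounded, simply connected Lipschitz domain. Let $w_*:\Omega\times\mathbb{R}^d\to\mathbb{R}$ be piecewise smooth with respect to $x\in\Omega$, and such that for all $x\in\Omega$ the function $w_*(x,\cdot):\mathbb{R}^d\to\mathbb{R}$ is smooth and satisfies, with constants $L,\gamma>0$ independent of $x$, $$\langle \partial_{\mathbf h} w_*(x,\mathbf u)-\partial_{\mathbf h} w_*(x,\mathbf v),\mathbf u-\mathbf v\rangle\ \ge\ \gamma\,|\mathbf u-\mathbf v|^2,\qquad |\partial_{\mathbf h} w_*(x,\mathbf u)-\partial_{\mathbf h} w_*(x,\mathbf v)|\ \le\ L\,|\mathbf u-\mathbf v|$$ for all $\mathbf u,\mathbf v\in\mathbb{R}^d$ and all $x\in\Omega$. Let $\mathbf j\in L^2(\Omega)^3$ with $\operatorname{div}\mathbf j=0$ if $d=3$, respectively $\mathbf j=j_3\in L^2(\Omega)$ (scalar) if $d=2$. Let $\mathbf h_s\in H(\operatorname{curl};\Omega)$ be a given source field with $\operatorname{curl}\mathbf h_s=\mathbf j$ in $\Omega$. Then the following hold. (1) The constrained minimization problem $$\min_{\mathbf h\in H(\operatorname{curl};\Omega)}\int_\Omega w_*(\mathbf h)\,dx\quad\text{subject to}\quad \operatorname{curl}\mathbf h=\mathbf j\ \text{ in }\Omega$$ and the unconstrained minimization problem $$\min_{\psi\in H^1(\Omega)/\mathbb{R}}\int_\Omega w_*(\mathbf h_s-\nabla\psi)\,dx$$ each have a unique solution. With $\psi$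 the solution of the second problem, the pair $$\mathbf h=\mathbf h_s-\nabla\psi,\qquad \mathbf b=\partial_{\mathbf h}w_*(\mathbf h)$$ is the unique weak solution of the magnetostatic system $$\operatorname{curl}\mathbf h=\mathbf j,\quad \mathbf b=\partial_{\mathbf h}w_*(\mathbf h),\quad \operatorname{div}\mathbf b=0\ \text{ in }\Omega,\qquad \mathbf b\cdot\mathbf n=0\ \text{ on }\partial\Omega.$$ (2) For any $\varepsilon>0$, the penalized problem $$\min_{\mathbf h\in H(\operatorname{curl};\Omega)}\int_\Omega w_*(\mathbf h)+\frac{1}{2\varepsilon}|\operatorname{curl}\mathbf h-\mathbf j|^2\,dx$$ has a unique solution $\mathbf h^\varepsilon$, and $\|\mathbf h^\varepsilon\|_{H(\operatorname{curl})}\le C\,\|\mathbf j\|_{L^2}$. (3) With $\mathbf b^\varepsilon=\partial_{\mathbf h}w_*(\mathbf h^\varepsilon)$, one has $$\|\mathbf h^\varepsilon-\mathbf h\|_{H(\operatorname{curl})}+\|\mathbf b^\varepsilon-\mathbf b\|_{H(\operatorname{div})}\le C'\,\varepsilon\,\|\mathbf j\|_{L^2}.$$ Moreover, the constants $C$, $C'$ in these estimates do not depend on the parameter $\varepsilon$.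
   Context: Notation. $H^1(\Omega)$, $H(\operatorname{curl};\Omega)$, $H(\operatorname{div};\Omega)$, $L^2(\Omega)$ are the usual function spaces of electromagnetic field problems: $H(\operatorname{curl};\Omega)$ (resp. $H(\operatorname{div};\Omega)$) consists of the vector fields in $L^2(\Omega)^d$ whose weak curl (resp. weak divergence) is in $L^2$, with the graph norms $\|\mathbf v\|_{H(\operatorname{curl})}^2=\|\mathbf v\|_{L^2}^2+\|\operatorname{curl}\mathbf v\|_{L^2}^2$ and $\|\mathbf v\|_{H(\operatorname{div})}^2=\|\mathbf v\|_{L^2}^2+\|\operatorname{div}\mathbf v\|_{L^2}^2$. No boundary conditions are imposed in these spaces. $H^1(\Omega)/\mathbb{R}=\{v\in H^1(\Omega):\int_\Omega v\,dx=0\}$. $\langle\cdot,\cdot\rangle$ and $|\cdot|$ are the Euclidean scalar product and norm on $\mathbb{R}^d$; $\mathbf n$ is the unit normal vector on $\partial\Omega$. The function $w_*$ is the magnetic coenergy density; $\partial_{\mathbf h}w_*(x,\cdot)$ is its gradient with respect to the second argument. The argument $x$ is suppressed: $w_*(\mathbf h)$ and $\partial_{\mathbf h}w_*(\mathbf h)$ stand for $x\mapsto w_*(x,\mathbf h(x))$ and $x\mapsto\partial_{\mathbf h}w_*(x,\mathbf h(x))$. Two-dimensional convention. For $d=2$, fields are understood as $\mathbf h=(h_1,h_2,0)$ and $\mathbf j=(0,0,j_3)$ independent of the third coordinate, so that $\operatorname{curl}\mathbf h=\partial_1h_2-\partial_2h_1$ is scalar, $\mathbf j$ is identified with $j_3$,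 and $\operatorname{div}\mathbf j=0$ holds automatically. Weak solution. A weak solution of the magnetostatic system is a pair $\mathbf h\in H(\operatorname{curl};\Omega)$, $\mathbf b\in L^2(\Omega)^d$ with $\operatorname{curl}\mathbf h=\mathbf j$ and $\mathbf b=\partial_{\mathbf h}w_*(\mathbf h)$ in $\Omega$, and $\int_\Omega\mathbf b\cdot\nabla\varphi\,dx=0$ for all $\varphi\in H^1(\Omega)$ (the weak form of $\operatorname{div}\mathbf b=0$ in $\Omega$, $\mathbf b\cdot\mathbf n=0$ on $\partial\Omega$).
   Formalization: The estimates in (2) and (3) are stated under the added assumption that ∂_h w_*(x,0)=0 for a.e. x in Ω; without it they fail, e.g. for j=0 and w_*=|h|²/2+⟨a,h⟩ with constant a≠0, where h^ε=−a. *)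

(* Defs.v *)
From HB Require Import structures.
From mathcomp Require Import all_boot all_order all_algebra.
From mathcomp Require Import all_classical all_reals all_analysis.

Set Implicit Arguments.
Unset Strict Implicit.
Unset Printing Implicit Defensive.

Import Order.TTheory GRing.Theory Num.Theory.
Import numFieldNormedType.Exports.

Local Open Scope classical_set_scope.
Local Open Scope ring_scope.

(* The product sigma-algebra on 'rV[R]_n, as the library has it on tuples; it
   is the Borel sigma-algebra. *)
Section row_measurable.
Context {R : realType} {n : nat}.

Definition row_cylinder : set (set 'rV[R]_n) :=
  [set A | exists (i : 'I_n) (B : set R),
     measurable B /\ A = (fun x : 'rV[R]_n => x ord0 i) @^-1` B].

HB.instance Definition _ := @isMeasurable.Build default_measure_display
  'rV[R]_n <<s row_cylinder >>
  (@sigma_algebra0 _ setT row_cylinder)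
  (@sigma_algebraC _ row_cylinder)
  (@sigma_algebra_bigcup _ setT row_cylinder).

Lemma measurable_coord i : measurable_fun setT (fun x : 'rV[R]_n => x ord0 i).
Proof. by move=> _ B mB; rewrite setTI; apply: sub_sigma_algebra; exists i, B. Qed.

End row_measurable.

Section lebesgue_row.
Context {R : realType}.

Definition row_cons n (p : measurableTypeR R * 'rV[R]_n) : 'rV[R]_n.+1 :=
  \row_i oapp (fun j => p.2 ord0 j) p.1 (unlift ord0 i).

Lemma measurable_row_cons n : measurable_fun setT (@row_cons n).
Proof.
apply: (@measurability _ _ _ _ setT _ row_cylinder) => //.
move=> _ [_ [i [B [mB ->]]] <-]; rewrite setTI.
have -> : @row_cons n @^-1` ((fun x : 'rV[R]_n.+1 => x ord0 i) @^-1` B) =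
    (fun p : measurableTypeR R * 'rV[R]_n =>
      oapp (fun j => p.2 ord0 j) p.1 (unlift ord0 i)) @^-1` B.
  by apply/seteqP; split => p /=; rewrite mxE.
rewrite -[X in measurable X]setTI.
case: (unlift ord0 i) => [j|] /=.
  exact: (measurableT_comp (measurable_coord j) (@measurable_snd _ _ _ _)).
exact: (@measurable_fst _ _ (measurableTypeR R) 'rV[R]_n).
Qed.

Section step.
Variables (n : nat) (m : {sigma_finite_measure set 'rV[R]_n -> \bar R}).

Definition lebesgue_row_step : set 'rV[R]_n.+1 -> \bar R :=
  pushforward (lebesgue_measure \x m)%E (@row_cons n).

HB.instance Definition _ := Measure.copy lebesgue_row_step
  (measure_function_pushforward__canonical__measure_function_Measure
    (lebesgue_measure \x m)%E (@measurable_row_cons n)).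

Lemma lebesgue_row_step_sigma_finite : sigma_finite setT lebesgue_row_step.
Proof.
have /sigma_finiteP[F [FT ndF Foo]] := sigma_finiteT (@lebesgue_measure R).
have /sigma_finiteP[G [GT ndG Goo]] := sigma_finiteT m.
pose tl (x : 'rV[R]_n.+1) : 'rV[R]_n := \row_j x ord0 (lift ord0 j).
pose uncons (x : 'rV[R]_n.+1) : measurableTypeR R * 'rV[R]_n :=
  (x ord0 ord0, tl x).
have consK : cancel (@row_cons n) uncons.
  move=> [a v]; congr pair; first by rewrite mxE unlift_none.
  by apply/rowP => j; rewrite !mxE liftK.
have mtl : measurable_fun setT tl.
  apply: (@measurability _ _ _ _ setT _ row_cylinder) => //.
  move=> _ [_ [i [B [mB ->]]] <-].
  have -> : tl @^-1` ((fun x : 'rV[R]_n => x ord0 i) @^-1` B) =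
      (fun x : 'rV[R]_n.+1 => x ord0 (lift ord0 i)) @^-1` B.
    by apply/seteqP; split => p /=; rewrite mxE.
  exact: measurable_coord.
have mun : measurable_fun setT uncons.
  by apply/measurable_fun_pairP; split; [exact: (measurable_coord ord0)|exact: mtl].
exists (fun k => uncons @^-1` (F k `*` G k)).
  apply/seteqP; split => // x _.
  have [k _ Fk] : (\bigcup_k F k) (x ord0 ord0) by rewrite -FT.
  have [l _ Gl] : (\bigcup_k G k) (tl x) by rewrite -GT.
  exists (maxn k l) => //; split.
    by move: Fk; exact/subsetPset/ndF/leq_maxl.
  by move: Gl; exact/subsetPset/ndG/leq_maxr.
move=> k; have [mF Fk] := Foo k; have [mG Gk] := Goo k; split.
  by rewrite -[X in measurable X]setTI; apply: mun => //; exact: measurableX.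
rewrite /lebesgue_row_step /pushforward -comp_preimage.
have -> : uncons \o @row_cons n = id by apply/funext => p; exact: consK.
by rewrite preimage_id product_measure1E// lte_mul_pinfty// ge0_fin_numE.
Qed.

HB.instance Definition _ := Measure_isSigmaFinite.Build _ _ _
  lebesgue_row_step lebesgue_row_step_sigma_finite.

End step.

(* The n-dimensional Lebesgue measure, as an iterated product measure. *)
Fixpoint lebesgue_row n : {sigma_finite_measure set 'rV[R]_n -> \bar R} :=
  if n is m.+1 then lebesgue_row_step (lebesgue_row m) else \d_(0 : 'rV[R]_0).

End lebesgue_row.

Section euclidean.
Context {R : realType}.

Definition dot n (u v : 'rV[R]_n) : R := \sum_i u ord0 i * v ord0 i.

(* The library norm `|u| on row vectors is the sup norm. *)
Definition enorm n (u : 'rV[R]_n) : R := Num.sqrt (dot u u).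

(* Index arithmetic takes place in 'I_3, that is, modulo 3. *)
Definition cross (u v : 'rV[R]_3) : 'rV[R]_3 :=
  \row_k (u ord0 (k + 1) * v ord0 (k + 2) - u ord0 (k + 2) * v ord0 (k + 1)).

(* Padding by zeros: planar fields are read as fields (h1, h2, 0) in R^3 that
   do not depend on the third coordinate, so that the padded gradient is the
   three-dimensional gradient. It is the identity when n = 3. *)
Definition pad3 n (u : 'rV[R]_n) : 'rV[R]_3 :=
  \row_(k < 3) oapp (fun i : 'I_n => u ord0 i) 0 (insub (k : nat)).

End euclidean.

Section fields.
Context {R : realType} {d : nat}.
Local Notation E := 'rV[R]_d.
Local Notation vol := (@lebesgue_row R d).
Implicit Types (Omega : set E) (f psi phi : E -> R) (h b v : E -> E).

Definition partial (i : 'I_d) f : E -> R := fun x => 'D_(delta_mx ord0 i) f x.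

Definition grad f : E -> E := fun x => \row_i partial i f x.

Definition smooth f : Prop :=
  forall (s : seq 'I_d) (x : E), differentiable (foldr partial f s) x.

Definition test_function Omega phi : Prop :=
  [/\ smooth phi, compact (closure [set x | phi x != 0])
    & closure [set x | phi x != 0] `<=` Omega].

Definition simply_connected Omega : Prop :=
  connected Omega /\
  forall gamma : R -> E,
    {within `[0, 1], continuous gamma} -> gamma @` `[0, 1] `<=` Omega ->
    gamma 0 = gamma 1 ->
    exists H : R * R -> E,
      [/\ {within `[0, 1] `*` `[0, 1], continuous H},
          H @` (`[0, 1] `*` `[0, 1]) `<=` Omega,
          forall t, t \in `[0, 1] -> H (0, t) = gamma t /\ H (1, t) = gamma 0
        & forall s, s \in `[0, 1] -> H (s, 0) = gamma 0 /\ H (s, 1) = gamma 0].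

(* Near each boundary point, and in suitable Cartesian coordinates y = x Q,
   Omega is the set of points below the graph of a Lipschitz function g of the
   coordinates other than the i-th one. *)
Definition lipschitz_domain Omega : Prop :=
  [/\ open Omega, connected Omega, Omega !=set0 &
    forall p : E, (closure Omega `\` Omega) p ->
      exists (Q : 'M[R]_d) (i : 'I_d) (g : 'rV[R]_d.-1 -> R) (V : set E),
        [/\ Q *m Q^T = 1%:M, lipschitz g, nbhs p V &
          forall x, V x ->
            (Omega x <-> (x *m Q) ord0 i < g (col' i (x *m Q)))]].

(* Omega is the union, up to a null set, of finitely many disjoint open pieces
   on which x |-> w x u is smooth up to the boundary, that is, the restriction
   of a smooth function on the whole space. The pieces do not depend on u. *)
Definition piecewise_smooth Omega (w : E -> E -> R) : Prop :=
  exists (N : nat) (U : 'I_N -> set E),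
    [/\ forall k, open (U k) /\ U k `<=` Omega,
        trivIset setT U,
        vol.-negligible (Omega `\` \bigcup_k U k)
      & forall k u, exists W : E -> R,
          smooth W /\ forall x, U k x -> w x u = W x].

(* Elements of L^2 are handled through representatives, identified when they
   agree almost everywhere. A representative need only be almost everywhere
   equal to a Borel function, which is Lebesgue measurability. *)
Definition L2 Omega f : Prop :=
  exists g : E -> R,
    [/\ f = g %[ae vol in Omega], measurable_fun Omega g
      & vol.-integrable Omega (fun x => (g x ^+ 2)%:E)].

Definition L2v Omega n (F : E -> 'rV[R]_n) : Prop :=
  forall k, L2 Omega (fun x => F x ord0 k).

Definition L2norm Omega n (F : E -> 'rV[R]_n) : R :=
  Num.sqrt (\int[vol]_(x in Omega) enorm (F x) ^+ 2).

Definition is_weak_grad Omega psi (g : E -> E) : Prop :=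
  forall phi, test_function Omega phi -> forall i,
    \int[vol]_(x in Omega) (g x ord0 i * phi x) =
    - \int[vol]_(x in Omega) (psi x * partial i phi x).

(* The components of (curl h = c) tested against phi: integration by parts
   turns the integral of (curl h) phi into that of h x grad phi. *)
Definition is_weak_curl Omega h (c : E -> 'rV[R]_3) : Prop :=
  forall phi, test_function Omega phi -> forall k,
    \int[vol]_(x in Omega) (c x ord0 k * phi x) =
    \int[vol]_(x in Omega) (cross (pad3 (h x)) (pad3 (grad phi x))) ord0 k.

Definition is_weak_div Omega (F : E -> 'rV[R]_3) f : Prop :=
  forall phi, test_function Omega phi ->
    \int[vol]_(x in Omega) (f x * phi x) =
    - \int[vol]_(x in Omega) dot (F x) (pad3 (grad phi x)).

(* The square integrable weak derivatives, which are unique almost everywhere;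
   junk when there are none. *)
Definition wgrad Omega psi : E -> E :=
  get [set g | L2v Omega g /\ is_weak_grad Omega psi g].

Definition wcurl Omega h : E -> 'rV[R]_3 :=
  get [set c | L2v Omega c /\ is_weak_curl Omega h c].

Definition wdiv Omega b : E -> R :=
  get [set f | L2 Omega f /\ is_weak_div Omega (fun x => pad3 (b x)) f].

Definition H1 Omega psi : Prop :=
  L2 Omega psi /\ exists g, L2v Omega g /\ is_weak_grad Omega psi g.

Definition H1_mod_R Omega psi : Prop :=
  H1 Omega psi /\ \int[vol]_(x in Omega) psi x = 0.

Definition Hcurl Omega h : Prop :=
  L2v Omega h /\ exists c, L2v Omega c /\ is_weak_curl Omega h c.

Definition Hdiv Omega b : Prop :=
  L2v Omega b /\
  exists f, L2 Omega f /\ is_weak_div Omega (fun x => pad3 (b x)) f.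

Definition Hcurl_norm Omega h : R :=
  Num.sqrt (L2norm Omega h ^+ 2 + L2norm Omega (wcurl Omega h) ^+ 2).

Definition Hdiv_norm Omega b : R :=
  Num.sqrt (L2norm Omega b ^+ 2 + \int[vol]_(x in Omega) wdiv Omega b x ^+ 2).

(* In the plane, j = (0, 0, j3) is identified with the scalar field j3. *)
Definition current_density Omega (j : E -> 'rV[R]_3) : Prop :=
  [/\ L2v Omega j,
      d = 2%N -> forall x, Omega x -> j x ord0 0 = 0 /\ j x ord0 1 = 0
    & d = 3%N -> is_weak_div Omega j (cst 0)].

Definition curl_eq Omega h (j : E -> 'rV[R]_3) : Prop :=
  Hcurl Omega h /\ wcurl Omega h = j %[ae vol in Omega].

Definition is_minimizer (T : Type) (A : set T) (J : T -> \bar R) (u : T) : Prop :=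
  A u /\ forall u', A u' -> (J u <= J u')%E.

Definition uniquely_solvable Omega (V : Type) (A : set (E -> V))
    (J : (E -> V) -> \bar R) : Prop :=
  (exists u, is_minimizer A J u) /\
  forall u u', is_minimizer A J u -> is_minimizer A J u' ->
    u = u' %[ae vol in Omega].

Definition coenergy Omega (w : E -> E -> R) h : \bar R :=
  (\int[vol]_(x in Omega) (w x (h x))%:E)%E.

Definition reduced_field Omega (hs : E -> E) psi : E -> E :=
  fun x => hs x - wgrad Omega psi x.

Definition reduced_coenergy Omega w hs psi : \bar R :=
  coenergy Omega w (reduced_field Omega hs psi).

Definition penalized_coenergy Omega (w : E -> E -> R) (j : E -> 'rV[R]_3)
    (eps : R) h : \bar R :=
  (\int[vol]_(x in Omega)
    (w x (h x) + (2 * eps)^-1 * enorm (wcurl Omega h x - j x) ^+ 2)%:E)%E.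

Definition flux_density (w : E -> E -> R) h : E -> E := fun x => grad (w x) (h x).

Definition weak_solution Omega (w : E -> E -> R) (j : E -> 'rV[R]_3) h b : Prop :=
  [/\ curl_eq Omega h j, L2v Omega b,
      b = flux_density w h %[ae vol in Omega]
    & forall phi, H1 Omega phi ->
        \int[vol]_(x in Omega) dot (b x) (wgrad Omega phi x) = 0].

End fields.

(* Main.v *)
Require Import Defs.
From HB Require Import structures.
From mathcomp Require Import all_boot all_order all_algebra.
From mathcomp Require Import all_classical all_reals all_analysis.
From mathcomp Require Import measurable_realfun.
From mathcomp Require Import ring lra zify.

Set Implicit Arguments.
Unset Strict Implicit.
Unset Printing Implicit Defensive.

Import Order.TTheory GRing.Theory Num.Theory.
Import numFieldNormedType.Exports.

Local Open Scope classical_set_scope.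
Local Open Scope ring_scope.

(** The energy is strongly convex with a Lipschitz gradient, so minimizing
    sequences are Cauchy, and beyond existence everything rests on two facts
    about the curl on a bounded Lipschitz domain: a curl-free L^2 field is the
    gradient of an H^1 function if the domain is simply connected, and every
    field v can be replaced by a field v' with the same curl and
    |v'| <= K |curl v|.

    On a domain that is star-shaped with respect to a ball, the averaged
    Poincaré operators, such as
    (P v)(x) = \int eta(y) \int_0^1 (x - y) . v(y + t (x - y)) dt dy,
    are bounded on L^2 and satisfy v = grad (P v) + Q (curl v). A Lipschitz
    domain is covered by finitely many such domains. The local potentials of a
    curl-free field differ by a locally constant cocycle, which is trivial on a
    simply connected domain. For a general field, gluing the local potentials by
    a partition of unity gives a field with the same curl that is bounded by
    curl v and by finitely many means of the local potentials; compactness in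
    the finite-dimensional space of these means replaces Rellich's theorem.

    The penalty estimates come from testing the Euler-Lagrange equation with
    lifts of curl h_eps and of curl h_eps - j, since the flux is orthogonal to
    all curl-free fields. *)

(** * Integrals of functions defined almost everywhere *)

(** Two features of the formulation shape the proof. Elements of L^2 are arbitrary representatives,
    only almost everywhere equal to Borel functions, so integration is first extended to such
    functions ([ae_integrable]). And curls are carried as data: energies are minimized over pairs
    (field, curl), on which the constrained and the penalized problem are one strongly convex
    problem over two different closed convex sets. The Poincaré operators must be averaged over the
    centre [y]: for a fixed centre the substitution in [x] costs [t^-d], too much near [t = 0],
    whereas the average allows a substitution in [y] when [t < 1/2]. The estimates assume that the
    flux vanishes at the zero field: otherwise, for [j = 0], the penalized minimizer need not vanish
    although the right-hand side does. The difference of the two fluxes is weakly divergence free,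
    so its H(div) norm is just its L^2 norm. *)

Section ae_integral.
Context d (T : measurableType d) (R : realType) (mu : {measure set T -> \bar R}).
Import HBNNSimple.

Lemma ge0_integral_sup (f : T -> \bar R) : (forall x, (0 <= f x)%E) ->
  (\int[mu]_x f x = ereal_sup [set sintegral mu h |
    h in [set h : {nnsfun T >-> R} | forall x, ((h x)%:E <= f x)%E]])%E.
Proof. by move=> f0; rewrite ge0_integralTE. Qed.

Lemma ge0_le_integral_gen (f g : T -> \bar R) : (forall x, (0 <= f x)%E) ->
  (forall x, (f x <= g x)%E) -> (\int[mu]_x f x <= \int[mu]_x g x)%E.
Proof.
move=> f0 fg; have g0 x : (0 <= g x)%E by exact: le_trans (fg x).
rewrite (ge0_integral_sup f0) (ge0_integral_sup g0); apply: ge_ereal_sup => _ [h hf <-].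
by apply: ereal_sup_ubound; exists h => // x; exact: le_trans (fg x).
Qed.

(* Neither function need be measurable. *)
Lemma ge0_ae_le_integralT (f g : T -> \bar R) :
  (forall x, (0 <= f x)%E) -> (forall x, (0 <= g x)%E) ->
  ae_eq mu setT f g -> (\int[mu]_x f x <= \int[mu]_x g x)%E.
Proof.
move=> f0 g0 [N [mN N0 subN]].
rewrite (ge0_integral_sup f0); apply: ge_ereal_sup => _ [h hf <-].
have mCN : measurable (~` N) by exact: measurableC.
have -> : sintegral mu h = (\int[mu]_x (h x)%:E)%E.
  by rewrite integral_nnsfun// patch_setT.
rewrite (ge0_negligible_integral mN)//; last 2 first.
  by apply/measurable_EFinP.
  by move=> x _; rewrite lee_fin fun_ge0.
rewrite setTD integral_nnsfun//.
rewrite (ge0_integral_sup g0); apply: ereal_sup_ubound.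
(* Cut off on the null set [N], the simple function [h] lies below [g] and keeps its integral; it is
   measurable even when [f] and [g] are not. *)
exists (proj_nnsfun h mCN); last first.
  by congr (sintegral mu _); apply/funext => x; rewrite /= patchE mindicE/=;
    case: ifP => _; rewrite ?mulr1 ?mulr0.
move=> x /=; rewrite mindicE; case: (boolP (x \in ~` N)) => xN /=; last first.
  by rewrite mulr0.
rewrite mulr1; have <- : f x = g x; last exact: hf.
apply: contrapT => fg; move: xN; rewrite inE; apply.
by apply: subN => /=; tauto.
Qed.

(** Applied to positive and negative parts. Representatives of L^2 classes are not assumed Borel, so
    the integral must be insensitive to null sets without measurability. *)
Lemma ae_eq_integral_gen (D : set T) (f g : T -> \bar R) :
  f = g %[ae mu in D] -> (\int[mu]_(x in D) f x = \int[mu]_(x in D) g x)%E.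
Proof.
move=> fg.
have pos (u v : T -> \bar R) : (forall x, (0 <= u x)%E) ->
    (forall x, (0 <= v x)%E) -> ae_eq mu setT u v ->
    (\int[mu]_x u x = \int[mu]_x v x)%E.
  move=> u0 v0 uv; apply/eqP; rewrite eq_le !ge0_ae_le_integralT//.
  exact: ae_eq_sym.
have {}fg : ae_eq mu setT (f \_ D) (g \_ D).
  move: fg; apply: filterS => x fg _; rewrite !patchE; case: ifPn => //.
  by rewrite inE => /fg.
rewrite integral_mkcond [RHS]integral_mkcond integralE [RHS]integralE.
have /ae_eq_funeposneg[fgp fgn] := fg.
by congr (_ - _)%E; apply: pos.
Qed.

Lemma ae_eq_Rintegral (D : set T) (f g : T -> R) :
  f = g %[ae mu in D] -> \int[mu]_(x in D) f x = \int[mu]_(x in D) g x.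
Proof.
move=> fg; congr fine; apply: ae_eq_integral_gen.
by move: fg; apply: filterS => x fg Dx; rewrite fg.
Qed.

End ae_integral.

(* Integrability up to modification on a null set: f need not be measurable. *)
Definition ae_integrable d (T : measurableType d) (R : realType)
  (mu : {measure set T -> \bar R}) (D : set T) (f : T -> R) :=
  exists2 g, f = g %[ae mu in D] & mu.-integrable D (EFin \o g).

Definition ae_measurable d (T : measurableType d) (R : realType)
  (mu : {measure set T -> \bar R}) (D : set T) (f : T -> R) :=
  exists2 g, f = g %[ae mu in D] & measurable_fun D g.

Section ae_integrable.
Context d (T : measurableType d) (R : realType) (mu : {measure set T -> \bar R}).
Variables (D : set T) (mD : measurable D).
Implicit Types f g h : T -> R.
Local Notation aei := (ae_integrable mu D).
Local Notation aem := (ae_measurable mu D).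
Local Notation "f =ae g" := (f = g %[ae mu in D]) (at level 70).

Lemma ae_integrable_eq f g : f =ae g -> aei g -> aei f.
Proof. by move=> fg [h gh ih]; exists h => //; exact: ae_eq_trans gh. Qed.

Lemma integrable_ae_integrable f : mu.-integrable D (EFin \o f) -> aei f.
Proof. by exists f => //; exact: ae_eq_refl. Qed.

Lemma ae_integrable_measurable f : aei f -> aem f.
Proof.
by move=> [g fg /integrableP[/measurable_EFinP mg _]]; exists g.
Qed.

Lemma measurable_ae_measurable f : measurable_fun D f -> aem f.
Proof. by exists f => //; exact: ae_eq_refl. Qed.

Lemma ae_measurableD f g : aem f -> aem g -> aem (fun x => f x + g x).
Proof.
move=> [f' ff' mf'] [g' gg' mg']; exists (fun x => f' x + g' x).
  by move: ff' gg'; apply: filterS2 => x ff' gg' Dx; rewrite ff'// gg'.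
exact: measurable_funD.
Qed.

Lemma ae_measurableM f g : aem f -> aem g -> aem (fun x => f x * g x).
Proof.
move=> [f' ff' mf'] [g' gg' mg']; exists (fun x => f' x * g' x).
  by move: ff' gg'; apply: filterS2 => x ff' gg' Dx; rewrite ff'// gg'.
exact: measurable_funM.
Qed.

Lemma ae_measurable_norm f : aem f -> aem (fun x => `|f x|).
Proof.
move=> [f' ff' mf']; exists (fun x => `|f' x|).
  by move: ff'; apply: filterS => x ff' Dx; rewrite ff'.
exact: (measurableT_comp (@normr_measurable _ setT)).
Qed.

Lemma ae_measurable_cst r : aem (cst r).
Proof. by apply: measurable_ae_measurable. Qed.

Lemma ae_integrableD f g : aei f -> aei g -> aei (fun x => f x + g x).
Proof.
move=> [f' ff' mf'] [g' gg' mg']; exists (fun x => f' x + g' x).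
  by move: ff' gg'; apply: filterS2 => x ff' gg' Dx; rewrite ff'// gg'.
by have := integrableD mD mf' mg'; apply: eq_integrable => // x _; rewrite /= EFinD.
Qed.

Lemma ae_integrableZ r f : aei f -> aei (fun x => r * f x).
Proof.
move=> [f' ff' mf']; exists (fun x => r * f' x).
  by move: ff'; apply: filterS => x ff' Dx; rewrite ff'.
by have := integrableZl mD r mf'; apply: eq_integrable => // x _; rewrite /= EFinM.
Qed.

Lemma ae_integrableN f : aei f -> aei (fun x => - f x).
Proof.
move=> /(ae_integrableZ (-1)); apply: ae_integrable_eq.
by apply/aeW => x _; rewrite mulN1r.
Qed.

Lemma ae_integrableB f g : aei f -> aei g -> aei (fun x => f x - g x).
Proof. by move=> fi gi; apply: ae_integrableD => //; exact: ae_integrableN. Qed.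

Lemma ae_integrable0 : aei (cst 0).
Proof.
by apply: integrable_ae_integrable; exact: integrable0.
Qed.

Lemma ae_integrable_sum I (s : seq I) (P : pred I) (F : I -> T -> R) :
  (forall i, P i -> aei (F i)) -> aei (fun x => \sum_(i <- s | P i) F i x).
Proof.
move=> h; elim: s => [|i s ih].
  apply: (ae_integrable_eq (g := cst 0)); last exact: ae_integrable0.
  by apply/aeW => x _; rewrite big_nil.
case: (boolP (P i)) => Pi.
  apply: (ae_integrable_eq (g := fun x => F i x + \sum_(i <- s | P i) F i x)).
    by apply/aeW => x _; rewrite big_cons Pi.
  by apply: ae_integrableD => //; exact: h.
apply: ae_integrable_eq ih.
by apply/aeW => x _; rewrite big_cons (negbTE Pi).
Qed.

Lemma ae_integrable_le f g : aem f ->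
  (\forall x \ae mu, D x -> `|f x| <= g x) -> aei g -> aei f.
Proof.
move=> [f' ff' mf'] fg [g' gg' ig']; exists f' => //.
have mg' : measurable_fun D g' by apply/measurable_EFinP; case/integrableP: ig'.
apply/integrableP; split; first exact/measurable_EFinP.
have /integrableP[_] := ig'.
apply: le_lt_trans; apply: ae_ge0_le_integral => //.
- exact/measurableT_comp/measurable_EFinP.
- exact/measurableT_comp/measurable_EFinP.
- move: ff' gg' fg; apply: filterS3 => x ff' gg' fg Dx /=.
  by rewrite lee_fin -ff'// -gg'// (le_trans (fg Dx)) ?ler_norm.
Qed.

Lemma RintD f g : aei f -> aei g -> \int[mu]_(x in D) (f x + g x) =
  \int[mu]_(x in D) f x + \int[mu]_(x in D) g x.
Proof.
move=> [f' ff' mf'] [g' gg' mg'].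
rewrite (ae_eq_Rintegral ff') (ae_eq_Rintegral gg') -RintegralD//.
apply: ae_eq_Rintegral.
by move: ff' gg'; apply: filterS2 => x ff' gg' Dx; rewrite ff'// gg'.
Qed.

Lemma RintZ r f : aei f -> \int[mu]_(x in D) (r * f x) = r * \int[mu]_(x in D) f x.
Proof.
move=> [f' ff' mf']; rewrite (ae_eq_Rintegral ff') -RintegralZl//.
by apply: ae_eq_Rintegral; move: ff'; apply: filterS => x ff' Dx; rewrite ff'.
Qed.

Lemma RintN f : aei f -> \int[mu]_(x in D) (- f x) = - \int[mu]_(x in D) f x.
Proof.
move=> fi; rewrite -mulN1r -RintZ//; congr fine.
by apply: eq_integral => x _; rewrite mulN1r.
Qed.

Lemma RintB f g : aei f -> aei g -> \int[mu]_(x in D) (f x - g x) =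
  \int[mu]_(x in D) f x - \int[mu]_(x in D) g x.
Proof. by move=> fi gi; rewrite RintD ?RintN//; exact: ae_integrableN. Qed.

Lemma Rint0 : \int[mu]_(x in D) (0 : R) = 0.
Proof. by rewrite /Rintegral integral0. Qed.

Lemma Rint_sum I (s : seq I) (P : pred I) (F : I -> T -> R) :
  (forall i, P i -> aei (F i)) ->
  \int[mu]_(x in D) (\sum_(i <- s | P i) F i x) =
  \sum_(i <- s | P i) \int[mu]_(x in D) F i x.
Proof.
move=> h; elim: s => [|i s ih].
  by rewrite big_nil -[RHS]Rint0; apply: eq_Rintegral => x _; rewrite big_nil.
rewrite big_cons; case: (boolP (P i)) => Pi; last first.
  by rewrite -ih; apply: eq_Rintegral => x _; rewrite big_cons (negbTE Pi).
rewrite -ih -RintD//; [|exact: h|exact: ae_integrable_sum].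
by apply: eq_Rintegral => x _; rewrite big_cons Pi.
Qed.

Lemma le_Rint f g : aei f -> aei g -> (\forall x \ae mu, D x -> f x <= g x) ->
  \int[mu]_(x in D) f x <= \int[mu]_(x in D) g x.
Proof.
move=> fi gi fg; rewrite -subr_ge0 -RintB//.
have [h Eh ih] : aei (fun x => g x - f x) by exact: ae_integrableB.
rewrite (ae_eq_Rintegral (g := fun x => `|h x|)).
  by apply: Rintegral_ge0 => x _.
move: Eh fg; apply: filterS2 => x Eh fg Dx.
by rewrite -Eh// ger0_norm// subr_ge0 fg.
Qed.

Lemma ae_integrable_norm f : aei f -> aei (fun x => `|f x|).
Proof.
move=> fi; apply: (ae_integrable_le (g := fun x => `|f x|)).
- exact/ae_measurable_norm/ae_integrable_measurable.
- by apply/aeW => x _; rewrite normr_id.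
case: fi => f' ff' if'; exists (fun x => `|f' x|).
  by move: ff'; apply: filterS => x ff' Dx; rewrite ff'.
exact: integrable_norm.
Qed.

Lemma ae_integrable_fin_EFin f : aei f ->
  (\int[mu]_(x in D) (f x)%:E = (\int[mu]_(x in D) f x)%:E)%E.
Proof.
move=> [g fg ig]; rewrite /Rintegral fineK//.
rewrite (ae_eq_integral_gen (g := EFin \o g)).
  exact: integrable_fin_num.
by move: fg; apply: filterS => x fg Dx; rewrite /= fg.
Qed.

Lemma Rint_eq0_ae f : aei f -> (\forall x \ae mu, D x -> 0 <= f x) ->
  \int[mu]_(x in D) f x = 0 -> f =ae cst 0.
Proof.
move=> fi f0 If; case: (fi) => g fg ig.
have mg : measurable_fun D (EFin \o g) by case/integrableP: ig.
have : ae_eq mu D (EFin \o g) (cst 0%E).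
  apply/ae_eq_integral_abs => //.
  rewrite (ae_eq_integral_gen (g := EFin \o f)).
    by rewrite ae_integrable_fin_EFin// If.
  move: fg f0; apply: filterS2 => x fg f0 Dx /=.
  by congr EFin; rewrite -fg// ger0_norm// f0.
move=> h; move: h fg; apply: filterS2 => x h fg Dx.
by rewrite fg//; case: (h Dx).
Qed.

End ae_integrable.

(** * Lebesgue measure on row vectors *)

Section row_norm.
Context {R : realType} {n : nat}.
Implicit Types x y : 'rV[R]_n.

Lemma coord_le_norm x i : `|x ord0 i| <= `|x|.
Proof.
rewrite [leRHS]/Num.norm /= mx_normrE.
by apply/bigmax_geP; right => /=; exists (ord0, i).
Qed.

Lemma row_norm_le x e : 0 <= e -> (forall i, `|x ord0 i| <= e) -> `|x| <= e.
Proof.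
move=> e0 h; rewrite [leLHS]/Num.norm /= mx_normrE.
by apply/bigmax_leP; split=> // -[i j] _ /=; rewrite ord1.
Qed.

Lemma row_norm_lt x e : 0 < e -> (forall i, `|x ord0 i| < e) -> `|x| < e.
Proof.
move=> e0 h; rewrite [ltLHS]/Num.norm /= mx_normrE.
by apply/bigmax_ltP; split=> // -[i j] _ /=; rewrite ord1.
Qed.

Lemma open_row_ball (U : set 'rV[R]_n) x : open U -> U x ->
  exists2 e, 0 < e & forall y, (forall i, `|x ord0 i - y ord0 i| < e) -> U y.
Proof.
move=> oU Ux; have /nbhs_ballP[e e0 h] := open_nbhs_nbhs (conj oU Ux).
exists e => // y xy; apply: h; rewrite -ball_normE /=.
by apply: row_norm_lt => // i; rewrite !mxE; exact: xy.
Qed.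

End row_norm.

Section row_measure.
Context {R : realType} {n : nat}.
Local Notation E := 'rV[R]_n.

Lemma measurable_row_pi (A : 'I_n -> set R) : (forall i, measurable (A i)) ->
  measurable [set x : E | forall i, A i (x ord0 i)].
Proof.
move=> mA.
have -> : [set x : E | forall i, A i (x ord0 i)] =
    \bigcap_(i in [set: 'I_n]) ((fun x : E => x ord0 i) @^-1` (A i)).
  by apply/seteqP; split => x /= h i; [move=> _|]; exact: h.
apply: fin_bigcap_measurable => //.
by move=> i _; rewrite -[X in measurable X]setTI; exact: (measurable_coord i).
Qed.

Definition row_box (a b : 'I_n -> R) : set E :=
  [set x | forall i, a i < x ord0 i < b i].

Lemma row_boxE a b : row_box a b =
  [set x | forall i, (`]a i, b i[%classic : set R) (x ord0 i)].
Proof. by apply/seteqP; split => x /= h i; move: (h i); rewrite in_itv. Qed.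

Lemma measurable_row_box a b : measurable (row_box a b).
Proof.
rewrite row_boxE.
by apply: (@measurable_row_pi (fun i => `]a i, b i[%classic)) => i; exact: measurable_itv.
Qed.

Definition closed_row_box (a b : 'I_n -> R) : set E :=
  [set x | forall i, a i <= x ord0 i <= b i].

(** The boxes are centred at rational points with half-widths [1/(k+1)], hence countably many.
    Keeping even the closed boxes inside [U] provides compact subsets, for covering arguments and
    for supports of test functions. *)
Lemma open_box_cover (U : set E) : open U ->
  exists (P : set nat) (a b : nat -> 'I_n -> R),
    U = \bigcup_(k in P) row_box (a k) (b k) /\
    forall k, P k -> closed_row_box (a k) (b k) `<=` U.
Proof.
move=> oU.
pose a (p : 'rV[rat]_n * nat) i : R := ratr (p.1 ord0 i) - p.2.+1%:R^-1.
pose b (p : 'rV[rat]_n * nat) i : R := ratr (p.1 ord0 i) + p.2.+1%:R^-1.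
pose p0 : 'rV[rat]_n * nat := (0, 0%N).
(* Codes that decode to nothing give the box of [p0]; the condition that selects the indices keeps
   this harmless. *)
pose p_ k := odflt p0 (unpickle k).
exists [set k | closed_row_box (a (p_ k)) (b (p_ k)) `<=` U],
  (fun k => a (p_ k)), (fun k => b (p_ k)); split => //.
apply/seteqP; split => [x Ux|x [k /= kU]]; last first.
  by move=> h; apply: kU => i; have /andP[/ltW -> /ltW ->] := h i.
have [e e0 h] := open_row_ball oU Ux.
have [k ke] : exists k, k.+1%:R^-1 < e / 2.
  exists (Num.truncn (e / 2)^-1); rewrite invf_plt ?posrE ?divr_gt0//.
  exact: (@truncnS_gt R).
have q i : {q : rat | `|x ord0 i - ratr q| < k.+1%:R^-1}.
  apply: cid; have : x ord0 i - k.+1%:R^-1 < x ord0 i + k.+1%:R^-1.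
    by rewrite ltrD2l gt0_cp.
  move=> /rat_in_itvoo[q]; rewrite in_itv/= => /andP[q1 q2]; exists q.
  by rewrite ltr_distlC q1 q2.
exists (pickle (\row_i sval (q i), k)); rewrite /= /p_ pickleK /=.
  move=> y /= By; apply: h => i; have := By i; rewrite /= /a /b /= mxE.
  case: (q i) => r /= hr /andP[h1 h2].
  have : `|ratr r - y ord0 i| <= k.+1%:R^-1 by rewrite ler_distlC h1 h2.
  move=> h3; rewrite -(subrK (ratr r) (x ord0 i)) -addrA.
  apply: (le_lt_trans (ler_normD _ _)).
  rewrite [e]splitr; apply: ltrD; first exact: lt_trans ke.
  exact: le_lt_trans h3 ke.
move=> i /=; rewrite /a /b /= mxE; case: (q i) => r /= hr.
by move: hr; rewrite ltr_distlC ltrBlDr ltrBlDr andbC.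
Qed.

Lemma open_measurable_row (U : set E) : open U -> measurable U.
Proof.
move=> /open_box_cover[P [a [b [-> _]]]].
by apply: bigcup_measurable => k _; exact: measurable_row_box.
Qed.

Lemma continuous_measurable_row (f : E -> R) : continuous f -> measurable_fun setT f.
Proof.
move=> /continuousP cf; apply: (measurability _ (RGenOpens.measurableE R)).
move=> _ [_ [a [b ->] <-]]; rewrite setTI; apply: open_measurable_row.
by apply: cf; exact: interval_open.
Qed.

Lemma measurable_fun_row d (T : measurableType d) (D : set T) (f : T -> E) :
  measurable D -> (forall i, measurable_fun D (fun t => f t ord0 i)) -> measurable_fun D f.
Proof.
move=> mD mf; apply: (@measurability _ _ _ _ D _ row_cylinder) => //.
move=> _ [_ [i [B [mB ->]]] <-]; exact: mf.
Qed.

(** A half-space [a < x_i] is the union over [k] of the boxes with side []a, k[] in the coordinate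
    [i] and []-k, k[] in the others. *)
Lemma row_box_generate : @measurable _ E = <<s [set A | exists a b, A = row_box a b] >>.
Proof.
apply/seteqP; split; last first.
  apply: smallest_sub; first exact: sigma_algebra_measurable.
  by move=> _ [a [b ->]]; exact: measurable_row_box.
apply: smallest_sub; first exact: smallest_sigma_algebra.
move=> _ [i [B [mB ->]]].
pose G := [set A | exists a b, A = row_box a b].
pose GT := g_sigma_algebraType G.
have : measurable_fun [set: GT] (fun x : GT => (x : E) ord0 i).
  apply: (measurability _ (RGenOInfty.measurableE R)) => //.
  move=> _ [_ [a ->] <-]; rewrite setTI.
  have -> : (fun x : GT => (x : E) ord0 i) @^-1` `]a, +oo[ =
     \bigcup_k row_box (fun j => if j == i then a else - k%:R) (fun j => k%:R).
    apply/seteqP; split => [x /=|x [k _] /(_ i)]; last first.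
      by rewrite eqxx /= in_itv/= andbT => /andP[].
    rewrite in_itv/= andbT => ax.
    exists (Num.truncn `|x : E|).+1 => // j.
    have : `|(x : E) ord0 j| < (Num.truncn `|x : E|).+1%:R.
      by apply: le_lt_trans (coord_le_norm _ _) _; exact: (@truncnS_gt R).
    by rewrite ltr_norml; case: eqP => [->|_] //; rewrite ax => /andP[].
  by apply: bigcupT_measurable => k; apply: sub_sigma_algebra; do 2 eexists.
by move=> /(_ measurableT _ mB); rewrite setTI.
Qed.

(** Boxes generate the sigma-algebra and are stable under intersection, and the cubes []-k, k[^n],
    of finite measure, exhaust the space. *)
Lemma row_measure_unique (m1 m2 : {measure set E -> \bar R}) :
  (forall a b, m1 (row_box a b) = m2 (row_box a b)) ->
  (forall a b, (m1 (row_box a b) < +oo)%E) ->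
  forall A, measurable A -> m1 A = m2 A.
Proof.
move=> m12 m1oo A mA.
apply: (measure_unique [set A | exists a b, A = row_box a b]
  (fun k => row_box (fun=> - k%:R) (fun=> k%:R))) => //.
- exact: row_box_generate.
- move=> _ _ [a [b ->]] [a' [b' ->]].
  exists (fun i => Num.max (a i) (a' i)), (fun i => Num.min (b i) (b' i)).
  apply/seteqP; split => x /=.
    move=> [h1 h2] i; rewrite gt_max lt_min.
    by move: (h1 i) (h2 i) => /andP[-> ->] /andP[-> ->].
  by move=> h; split => i; move: (h i); rewrite gt_max lt_min =>
    /andP[/andP[h1 h2] /andP[h3 h4]]; apply/andP.
- by move=> k; do 2 eexists.
- apply/seteqP; split => // x _; exists (Num.truncn `|x|).+1 => // i.
  rewrite -ltr_norml.
  by apply: le_lt_trans (coord_le_norm _ _) _; exact: (@truncnS_gt R).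
- by move=> _ [a [b ->]]; exact: m12.
Qed.

End row_measure.

Section lebesgue_row_box.
Context {R : realType}.
Local Open Scope ereal_scope.

Lemma lebesgue_row_pi n (A : 'I_n -> set R) : (forall i, measurable (A i)) ->
  lebesgue_row n [set x | forall i, A i (x ord0 i)] =
  \prod_(i < n) lebesgue_measure (A i).
Proof.
elim: n A => [|n IH] A mA.
  rewrite big_ord0 /= diracE mem_set//=.
  by case.
rewrite big_ord_recl -IH//= /lebesgue_row_step /pushforward -product_measure1E//.
  congr (_ _); apply/seteqP; split => [[x y]/= h|[x y]/= [h1 h2] i].
    split; first by have := h ord0; rewrite mxE unlift_none.
    by move=> i; have := h (lift ord0 i); rewrite mxE liftK.
  by rewrite mxE; case: unliftP => [j ->|->]//=.
  exact: mA.
by apply: (@measurable_row_pi _ _ (fun i => A (lift ord0 i))) => i; exact: mA.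
Qed.

Lemma lebesgue_row_boxE n (a b : 'I_n -> R) :
  lebesgue_row n (row_box a b) = (\prod_(i < n) Num.max (b i - a i) 0)%R%:E.
Proof.
rewrite row_boxE (@lebesgue_row_pi n (fun i => `]a i, b i[%classic)); last by move=> i; exact: measurable_itv.
rewrite -prodEFin; apply: eq_bigr => i _.
rewrite lebesgue_measure_itv/= lte_fin; case: ifPn => ab.
  by rewrite -EFinB max_l// subr_ge0 ltW.
by rewrite max_r// subr_le0 leNgt.
Qed.

Lemma lebesgue_row_bounded n (D : set 'rV[R]_n) : measurable D ->
  bounded_set D -> lebesgue_row n D < +oo.
Proof.
move=> mD [M [_ /(_ (M + 1)%R) h]].
have {}h x : D x -> (`|x| <= M + 1)%R by apply: h; rewrite ltrDl.
apply: (@le_lt_trans _ _ (lebesgue_row n (row_box (fun=> - (M + 2))%R (fun=> (M + 2)%R)))).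
  apply: le_measure; rewrite ?inE//; first exact: measurable_row_box.
  move=> x Dx i; rewrite -ltr_norml (le_lt_trans (coord_le_norm _ _))//.
  by rewrite (le_lt_trans (h _ Dx))// ltrD2l ltr1n.
by rewrite lebesgue_row_boxE ltry.
Qed.

End lebesgue_row_box.

Section affine_change.
Context {R : realType} {n : nat}.
Local Notation E := 'rV[R]_n.
Local Notation vol := (@lebesgue_row R n).
Variables (c : R) (a : E).
Hypothesis c0 : 0 < c.

Lemma measurable_affine : measurable_fun setT (fun x : E => c *: x + a).
Proof.
apply: measurable_fun_row => // i.
rewrite (_ : (fun _ => _) = (fun x : E => c * x ord0 i + a ord0 i)); last first.
  by apply/funext => x; rewrite !mxE.
apply: measurable_funD => //; apply: measurable_funM => //.
exact: measurable_coord.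
Qed.

(** Both sides are measures in [A], so boxes suffice. Homotheties and translations are the only
    changes of variables made under the integral. *)
Lemma lebesgue_row_affine (A : set E) : measurable A ->
  vol ((fun x : E => c *: x + a) @^-1` A) = ((c ^- n)%:E * vol A)%E.
Proof.
move=> mA.
have cn0 : 0 <= c ^- n by rewrite invr_ge0 exprn_ge0// ltW.
rewrite -[RHS]/(mscale (NngNum cn0) vol A) -[LHS]/(pushforward vol _ A).
pose m1 := measure_function_pushforward__canonical__measure_function_Measure
   vol measurable_affine.
rewrite -[LHS]/(m1 A).
have boxE (b b' : 'I_n -> R) : (fun x : E => c *: x + a) @^-1` row_box b b' =
    row_box (fun i => (b i - a ord0 i) / c) (fun i => (b' i - a ord0 i) / c).
  apply/seteqP; split => x /= h i; move: (h i); rewrite !mxE;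
    rewrite ltr_pdivrMr// ltr_pdivlMr// [x _ _ * c]mulrC ltrBlDr ltrBrDr//.
apply: row_measure_unique => //.
- move=> b b'; rewrite /m1 /= /pushforward boxE /mscale /= !lebesgue_row_boxE.
  rewrite -EFinM; congr EFin.
  rewrite -exprVn; have -> : c^-1 ^+ n = \prod_(i < n) c^-1 by rewrite prodr_const card_ord.
  rewrite -big_split/=.
  apply: eq_bigr => i _; rewrite -mulrBl opprB addrA subrK.
  rewrite [RHS]maxr_pMr ?invr_ge0 ?(ltW c0)// mulr0.
  by rewrite mulrC.
- by move=> b b'; rewrite /m1 /= /pushforward boxE lebesgue_row_boxE ltry.
Qed.

Lemma ge0_integral_affine (f : E -> \bar R) : measurable_fun setT f ->
  (forall x, (0 <= f x)%E) ->
  (\int[vol]_x f (c *: x + a)%R = (c ^- n)%:E * \int[vol]_x f x)%E.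
Proof.
move=> mf f0.
have cn0 : 0 <= c ^- n by rewrite invr_ge0 exprn_ge0// ltW.
have := @ge0_integral_pushforward _ _ _ _ R _ measurable_affine vol setT f measurableT mf.
rewrite preimage_setT => <- //; rewrite -(ge0_integral_mscale vol measurableT (NngNum cn0))//.
apply: eq_measure_integral => [|maff A mA _]; first exact: measurable_affine.
exact: (lebesgue_row_affine mA).
Qed.

Lemma integrable_affine (f : E -> R) : vol.-integrable setT (EFin \o f) ->
  vol.-integrable setT (fun x => (f (c *: x + a))%:E).
Proof.
move=> /integrableP[mf fi]; apply/integrableP; split.
  exact: (measurableT_comp mf measurable_affine).
rewrite (ge0_integral_affine (f := fun x => `|(f x)%:E|%E))//.
  rewrite lte_mul_pinfty// ?ge0_fin_numE ?ltry// lee_fin.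
  by rewrite invr_ge0 exprn_ge0// ltW.
exact: measurableT_comp.
Qed.

Lemma Rintegral_affine (f : E -> R) : vol.-integrable setT (EFin \o f) ->
  \int[vol]_x f (c *: x + a) = c ^- n * \int[vol]_x f x.
Proof.
move=> fi; have mf := measurable_int vol fi.
have fn := integrable_neg_fin_num measurableT fi.
have fp := integrable_pos_fin_num measurableT fi.
rewrite /Rintegral [in LHS]integralE [in RHS]integralE.
have E1 : ((fun x => (f (c *: x + a))%:E)^\+ = (fun x => ((EFin \o f)^\+ (c *: x + a)%R)))%E.
  by apply/funext => x; rewrite !funeposE.
have E2 : ((fun x => (f (c *: x + a))%:E)^\- = (fun x => ((EFin \o f)^\- (c *: x + a)%R)))%E.
  by apply/funext => x; rewrite !funenegE.
rewrite E1 E2 !ge0_integral_affine//; [|exact: measurable_funeneg|exact: measurable_funepos].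
rewrite -muleBr//; last by rewrite fin_num_adde_defl// fin_numN.
by rewrite fineM// fin_numB fp.
Qed.

End affine_change.

(** * Smooth functions *)

Lemma dist_half2 (R : realFieldType) (a b m e : R) :
  `|a - m| < e / 2 -> `|b - m| < e / 2 -> `|a - b| <= e.
Proof.
move=> H1 H2; rewrite -(subrK m a) -addrA [e]splitr.
by rewrite (le_trans (ler_normD _ _))// lerD// ltW// distrC.
Qed.

Section smooth_functions.
Context {R : realType} {d : nat}.
Local Notation E := 'rV[R]_d.
Implicit Types f g : E -> R.

(** A coinduction principle: the closure properties of smooth functions are proved by exhibiting a
    class that Leibniz' rule or the chain rule maps to itself, instead of by induction over lists of
    indices. *)
Lemma smooth_coind (P : (E -> R) -> Prop) :
  (forall f, P f -> forall x, differentiable f x) ->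
  (forall f i, P f -> P (partial i f)) -> forall f, P f -> smooth f.
Proof.
move=> Pd Pp f Pf s; apply: Pd.
by elim: s => [|i s IH] //=; exact: Pp.
Qed.

Lemma smooth_differentiable f x : smooth f -> differentiable f x.
Proof. by move=> /(_ [::] x). Qed.

Lemma smooth_partial f i : smooth f -> smooth (partial i f).
Proof. by move=> sf s x; have := sf (rcons s i) x; rewrite foldr_rcons. Qed.

Lemma smooth_continuous f : smooth f -> continuous f.
Proof. by move=> sf x; apply/differentiable_continuous/smooth_differentiable. Qed.

Lemma partialD f g i x : differentiable f x -> differentiable g x ->
  partial i (fun y => f y + g y) x = partial i f x + partial i g x.
Proof. by move=> df dg; rewrite /partial deriveD//; exact: diff_derivable. Qed.

Lemma partialM f g i x : differentiable f x -> differentiable g x ->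
  partial i (fun y => f y * g y) x = partial i f x * g x + f x * partial i g x.
Proof.
move=> df dg; rewrite /partial deriveM; [|exact: diff_derivable..].
by rewrite /GRing.scale/= addrC mulrC.
Qed.

Lemma partial_cst (r : R) i x : partial i (cst r : E -> R) x = 0.
Proof. exact: derive_cst. Qed.

Lemma partialZ (r : R) f i x : differentiable f x ->
  partial i (fun y => r * f y) x = r * partial i f x.
Proof.
move=> df; rewrite (partialM i (f := cst r))//.
by rewrite partial_cst mul0r add0r.
Qed.

Lemma derive_row f v x : differentiable f x ->
  'D_v f x = \sum_i v ord0 i * partial i f x.
Proof.
move=> df; rewrite deriveE// {1}(matrix_sum_delta v) big_ord1 linear_sum.
apply: eq_bigr => i _; rewrite /partial deriveE//.
by rewrite linearZ.
Qed.

(** The class handed to [smooth_coind] for sums and products: Leibniz' rule maps it into itself,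
    which fails for single products of smooth functions. *)
Inductive smooth_alg : (E -> R) -> Prop :=
| SAbase f : smooth f -> smooth_alg f
| SAadd f g : smooth_alg f -> smooth_alg g -> smooth_alg (fun x => f x + g x)
| SAmul f g : smooth_alg f -> smooth_alg g -> smooth_alg (fun x => f x * g x).

Lemma smooth_alg_smooth f : smooth_alg f -> smooth f.
Proof.
have ad h : smooth_alg h -> forall x, differentiable h x.
  elim=> {h} [h sh|h g _ dh _ dg|h g _ dh _ dg] x.
  - exact: smooth_differentiable.
  - exact: (@differentiableD _ _ _ h g).
  - exact: (@differentiableM _ _ h g).
move: f; apply: smooth_coind => // f i; elim=> {f}.
- by move=> f sf; apply/SAbase/smooth_partial.
- move=> f g af pf ag pg.
  have -> : partial i (fun x => f x + g x) = fun x => partial i f x + partial i g x.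
    by apply/funext => x; apply: partialD; apply: ad.
  exact: SAadd.
- move=> f g af pf ag pg.
  have -> : partial i (fun x => f x * g x) =
      fun x => partial i f x * g x + f x * partial i g x.
    by apply/funext => x; apply: partialM; apply: ad.
  by apply: SAadd; apply: SAmul.
Qed.

Lemma smoothD f g : smooth f -> smooth g -> smooth (fun x => f x + g x).
Proof. by move=> sf sg; apply/smooth_alg_smooth/SAadd; exact: SAbase. Qed.

Lemma smoothM f g : smooth f -> smooth g -> smooth (fun x => f x * g x).
Proof. by move=> sf sg; apply/smooth_alg_smooth/SAmul; exact: SAbase. Qed.

Lemma smooth_cst (r : R) : smooth (cst r : E -> R).
Proof.
pose P (f : E -> R) := exists r : R, f = cst r.
apply: (@smooth_coind P); last by exists r.
  by move=> _ [q ->] x; exact: differentiable_cst.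
by move=> _ i [q ->]; exists 0; apply/funext => x; rewrite partial_cst.
Qed.

Lemma smoothZ (r : R) f : smooth f -> smooth (fun x => r * f x).
Proof. by apply: (smoothM (f := cst r)); exact: smooth_cst. Qed.

Lemma smoothB f g : smooth f -> smooth g -> smooth (fun x => f x - g x).
Proof.
move=> sf sg; rewrite (_ : (fun _ => _) = fun x => f x + (-1) * g x).
  by apply: smoothD => //; exact: smoothZ.
by apply/funext => x; rewrite mulN1r.
Qed.

Lemma smooth_prod I (s : seq I) (F : I -> E -> R) :
  (forall i, smooth (F i)) -> smooth (fun x => \prod_(i <- s) F i x).
Proof.
move=> sF; elim: s => [|i s IH].
  rewrite (_ : (fun _ => _) = cst 1); first exact: smooth_cst.
  by apply/funext => x; rewrite big_nil.
rewrite (_ : (fun _ => _) = fun x => F i x * \prod_(i <- s) F i x).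
  exact: smoothM.
by apply/funext => x; rewrite big_cons.
Qed.

Lemma line_quotient f x v t :
  (fun h => h^-1 *: ((f \o shift (x + t *: v)) (h *: v) - f (x + t *: v))) =
  (fun h => h^-1 *: (((fun s : R => f (x + s *: v)) \o shift t) (h *: 1) - f (x + t *: v))).
Proof.
apply/funext => h /=; rewrite [h *: 1]mulr1 scalerDl.
by rewrite [h *: v + _]addrC -addrA [t *: v + _]addrC.
Qed.

Lemma derive_line f x v t :
  'D_v f (x + t *: v) = 'D_1 (fun s : R => f (x + s *: v)) t.
Proof. by rewrite /derive line_quotient. Qed.

Lemma is_derive_line f x v t : differentiable f (x + t *: v) ->
  is_derive t 1 (fun s : R => f (x + s *: v)) ('D_v f (x + t *: v)).
Proof.
move=> df; apply: DeriveDef; last by rewrite derive_line.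
by have := @diff_derivable _ _ _ _ _ v df; rewrite /derivable line_quotient.
Qed.

Lemma partial_line f i x : partial i f x =
  'D_1 (fun s : R => f (x + s *: delta_mx ord0 i)) 0.
Proof. by rewrite -derive_line scale0r addr0. Qed.

Lemma coord_line (x : E) (i j : 'I_d) s :
  (x + s *: delta_mx ord0 i : E) ord0 j = x ord0 j + s * (i == j)%:R.
Proof. by rewrite !mxE eqxx/= eq_sym. Qed.

Lemma partial_coord_comp (g : R -> R) (g' a b : R) i j (x : E) :
  is_derive (a * x ord0 j + b) 1 g g' ->
  partial i (fun y : E => g (a * y ord0 j + b)) x = (i == j)%:R * a * g'.
Proof.
move=> dg; rewrite partial_line.
have -> : (fun s : R => g (a * (x + s *: delta_mx ord0 i : E) ord0 j + b)) =
    g \o (fun s : R => (a * (i == j)%:R) * s + (a * x ord0 j + b)).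
  by apply/funext => s /=; rewrite coord_line; congr g; ring.
have dg' : is_derive ((a * (i == j)%:R) * 0 + (a * x ord0 j + b)) 1 g g'.
  by rewrite mulr0 add0r.
have dl : is_derive (0 : R) 1
    (fun s : R => (a * (i == j)%:R) * s + (a * x ord0 j + b)) (a * (i == j)%:R).
  by apply: is_derive_eq; rewrite /GRing.scale/= ?mulr0 ?mulr1 ?addr0 ?add0r.
have [_ ->] := @is_derive1_comp _ g
  (fun s : R => (a * (i == j)%:R) * s + (a * x ord0 j + b)) 0 _ _ dg' dl.
by rewrite mulrC [a * _]mulrC.
Qed.

Lemma differentiable_coord_comp (g : R -> R) (a b : R) j (x : E) :
  derivable g (a * x ord0 j + b) 1 ->
  differentiable (fun y : E => g (a * y ord0 j + b)) x.
Proof.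
move=> /derivable1_diffP dg.
apply: (@differentiable_comp _ _ _ _ (fun y : E => a * y ord0 j + b) g) => //.
apply: differentiableD => //.
apply: (@differentiableM _ _ (cst a) (fun y : E => y ord0 j)) => //.
exact: differentiable_coord.
Qed.

Lemma smooth_coord j : smooth (fun x : E => x ord0 j).
Proof.
pose P (f : E -> R) := f = (fun x => x ord0 j) \/ exists r : R, f = cst r.
apply: (@smooth_coind P); last by left.
  by move=> _ [->|[q ->]] x; [exact: differentiable_coord|exact: differentiable_cst].
move=> _ i [->|[q ->]]; right; last by exists 0; apply/funext => x; rewrite partial_cst.
exists ((i == j)%:R); apply/funext => x.
have -> : (fun x : E => x ord0 j) = (fun x : E => id (1 * x ord0 j + 0)).
  by apply/funext => y; rewrite mul1r addr0.
by rewrite (@partial_coord_comp id 1) ?mulr1.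
Qed.

Lemma partial_coord i j x : partial i (fun y : E => y ord0 j) x = (i == j)%:R.
Proof.
have -> : (fun x : E => x ord0 j) = (fun x : E => id (1 * x ord0 j + 0)).
  by apply/funext => y; rewrite mul1r addr0.
by rewrite (@partial_coord_comp id 1) ?mulr1.
Qed.

Lemma partial_affine f (c : R) (a : E) i x : differentiable f (c *: x + a) ->
  partial i (fun y => f (c *: y + a)) x = c * partial i f (c *: x + a).
Proof.
move=> df; rewrite partial_line.
have -> : (fun s : R => f (c *: (x + s *: delta_mx ord0 i) + a)) =
    (fun s : R => f ((c *: x + a) + s *: (c *: delta_mx ord0 i))).
  apply/funext => s; congr f.
  by rewrite scalerDr !scalerA [s * c]mulrC -!addrA [a + _]addrC.
rewrite -derive_line scale0r addr0 /partial !deriveE//.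
by rewrite linearZ.
Qed.

Lemma smooth_affine f (c : R) (a : E) : smooth f -> smooth (fun x => f (c *: x + a)).
Proof.
pose P (h : E -> R) := exists2 f, smooth f & exists k, h = fun x => k * f (c *: x + a).
have dP g x : smooth g -> differentiable (fun x : E => g (c *: x + a)) x.
  move=> sg; apply: (@differentiable_comp _ _ _ _ (fun x : E => c *: x + a) g).
    by apply: differentiableD => //; exact: (@differentiableZ _ _ _ id).
  exact: smooth_differentiable.
move=> sf; apply: (@smooth_coind P); last first.
  by exists f => //; exists 1; apply/funext => x; rewrite mul1r.
- move=> _ i [g sg [k ->]]; exists (partial i g); first exact: smooth_partial.
  exists (k * c); apply/funext => x; rewrite partialZ; last exact: dP.
  by rewrite partial_affine ?mulrA//; exact: smooth_differentiable.
- move=> _ [g sg [k ->]] x.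
  by apply: (@differentiableM _ _ (cst k) (fun x : E => g (c *: x + a))) => //; exact: dP.
Qed.

Lemma partialV (u : E -> R) i (x : E) : differentiable u x -> u x != 0 ->
  partial i (fun y => (u y)^-1) x = - (u x) ^- 2 * partial i u x.
Proof. by move=> du u0; rewrite /partial deriveV//; exact: diff_derivable. Qed.

Lemma smoothV (u : E -> R) : smooth u -> (forall x, u x != 0) -> smooth (fun x => (u x)^-1).
Proof.
move=> su u0.
(* This class is stable: the derivative of [f u^-n] is [(f' u - n f u') u^-(n+1)]. *)
pose P (h : E -> R) := exists2 f, smooth f & exists n, h = fun x => f x * (u x)^-1 ^+ n.
have dV n x : differentiable (fun x => (u x)^-1 ^+ n) x.
  elim: n => [|n IH]; first exact: (@differentiable_cst _ _ _ (1 : R)).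
  rewrite (_ : (fun _ => _) = (fun y => (u y)^-1 * (u y)^-1 ^+ n)).
    apply: (@differentiableM _ _ (fun y => (u y)^-1)) => //.
    by apply: differentiableV => //; exact: smooth_differentiable.
  by apply/funext => y; rewrite exprS.
have pV n i x : partial i (fun x => (u x)^-1 ^+ n) x =
    - n%:R * (u x)^-1 ^+ n.+1 * partial i u x.
  have dv1 m y : differentiable (fun x => (u x)^-1 ^+ m) y by exact: dV.
  elim: n => [|n IH].
    by rewrite oppr0 !mul0r; exact: (@partial_cst 1).
  have -> : (fun y => (u y)^-1 ^+ n.+1) = (fun y => (u y)^-1 * (u y)^-1 ^+ n).
    by apply/funext => y; rewrite exprS.
  rewrite partialM// ?IH ?partialV//; [|exact: smooth_differentiable|exact: (dV 1%N)].
  rewrite -exprVn -natr1 !exprS; ring.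
apply: (@smooth_coind P); last first.
  exists (cst 1); first exact: smooth_cst.
  by exists 1%N; apply/funext => x; rewrite mul1r expr1.
- move=> _ i [f sf [n ->]]; exists (fun x => partial i f x * u x - n%:R * (f x * partial i u x)).
    apply: smoothB; first by apply: smoothM => //; exact: smooth_partial.
    by apply/smoothZ/smoothM => //; exact: smooth_partial.
  exists n.+1; apply/funext => x.
  rewrite partialM ?pV//; last exact: smooth_differentiable.
  rewrite exprS.
  rewrite {1}(_ : partial i f x = partial i f x * (u x * (u x)^-1)); last by rewrite divff// mulr1.
  by ring.
- move=> _ [f sf [n ->]] x; apply: differentiableM; last exact: dV.
  exact: smooth_differentiable.
Qed.

(** Schwarz's theorem: by two applications of the mean value theorem, the second difference over a
    square of side [h] is [h^2] times either mixed derivative at some point of the square, and both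
    mixed derivatives are continuous. *)
Lemma partialC f i j : smooth f -> partial i (partial j f) = partial j (partial i f).
Proof.
move=> sf; apply/funext => x.
have [->//|ij] := eqVneq i j.
have main (k l : 'I_d) (h : R) : 0 < h -> exists c, [/\ 0 < c.1 < h, 0 < c.2 < h &
   f (x + h *: delta_mx ord0 k + h *: delta_mx ord0 l) - f (x + h *: delta_mx ord0 k)
   - (f (x + h *: delta_mx ord0 l) - f x) =
   h ^+ 2 * partial l (partial k f)
      (x + c.1 *: delta_mx ord0 k + c.2 *: delta_mx ord0 l)].
  move=> h0.
  pose g (s : R) := f (x + h *: delta_mx ord0 l + s *: delta_mx ord0 k) -
                    f (x + s *: delta_mx ord0 k).
  have dg (s : R) : is_derive s 1 g (partial k f (x + h *: delta_mx ord0 l + s *: delta_mx ord0 k) -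
      partial k f (x + s *: delta_mx ord0 k)).
    have d1 := is_derive_line (smooth_differentiable (x + h *: delta_mx ord0 l + s *: delta_mx ord0 k) sf).
    have d2 := is_derive_line (smooth_differentiable (x + s *: delta_mx ord0 k) sf).
    exact: is_deriveB.
  have cg : {within `[0, h], continuous g}.
    by apply: derivable_within_continuous => s _; case: (dg s).
  have [c1] := MVT h0 (fun s _ => dg s) cg.
  rewrite in_itv/= => c1h; rewrite subr0 /g !scale0r !addr0 => E1.
  pose k' (s : R) := partial k f (x + c1 *: delta_mx ord0 k + s *: delta_mx ord0 l).
  have dk (s : R) : is_derive s 1 k' (partial l (partial k f)
       (x + c1 *: delta_mx ord0 k + s *: delta_mx ord0 l)).
    by apply: is_derive_line; apply/smooth_differentiable/smooth_partial.
  have ck : {within `[0, h], continuous k'}.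
    by apply: derivable_within_continuous => s _; case: (dk s).
  have [c2] := MVT h0 (fun s _ => dk s) ck.
  rewrite in_itv/= => c2h; rewrite subr0 /k' scale0r addr0 => E2.
  exists (c1, c2); split => //=.
  rewrite [x + h *: delta_mx ord0 k + _]addrAC E1.
  by rewrite [x + h *: delta_mx ord0 l + _]addrAC E2; ring.
pose A := partial i (partial j f); pose B := partial j (partial i f).
have cA : {for x, continuous A} by apply/smooth_continuous/smooth_partial/smooth_partial.
have cB : {for x, continuous B} by apply/smooth_continuous/smooth_partial/smooth_partial.
apply/eqP; rewrite -subr_eq0 -normr_le0; apply/ler_addgt0Pl => e e0; rewrite addr0.
have /cvgrPdist_lt/(_ (e / 2)) := cA; rewrite divr_gt0// => /(_ isT) /nbhs_ballP[r1 r10 h1].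
have /cvgrPdist_lt/(_ (e / 2)) := cB; rewrite divr_gt0// => /(_ isT) /nbhs_ballP[r2 r20 h2].
pose h := Num.min r1 r2 / 2.
have h0 : 0 < h by rewrite divr_gt0// lt_min r10.
have near_x (k l : 'I_d) (c : R * R) r : k != l -> h < r -> 0 < c.1 < h -> 0 < c.2 < h ->
    ball x r (x + c.1 *: delta_mx ord0 k + c.2 *: delta_mx ord0 l).
  move=> kl hr /andP[a1 b1] /andP[a2 b2].
  rewrite -ball_normE /=; apply: row_norm_lt; first by rewrite (lt_trans _ hr).
  move=> m; rewrite !mxE !eqxx/=.
  have -> : x ord0 m - (x ord0 m + c.1 * (m == k)%:R + c.2 * (m == l)%:R) =
     - (c.1 * (m == k)%:R + c.2 * (m == l)%:R) by ring.
  rewrite normrN; case: eqP => [->|_]; case: eqP => [kl'|_].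
  - by rewrite kl' eqxx in kl.
  - by rewrite mulr1 mulr0 addr0 gtr0_norm// (lt_trans b1).
  - by rewrite mulr1 mulr0 add0r gtr0_norm// (lt_trans b2).
  - by rewrite !mulr0 addr0 normr0 (lt_trans _ hr).
have hr1 : h < r1.
  rewrite /h ltr_pdivrMr// gt_min; apply/orP; left; rewrite mulr_natr mulr2n.
  by rewrite ltrDl.
have hr2 : h < r2.
  rewrite /h ltr_pdivrMr// gt_min; apply/orP; right; rewrite mulr_natr mulr2n.
  by rewrite ltrDl.
have [c [c1 c2 Ec]] := main j i h h0.
have [c' [c1' c2' Ec']] := main i j h h0.
have EA : A (x + c.1 *: delta_mx ord0 j + c.2 *: delta_mx ord0 i) =
          B (x + c'.1 *: delta_mx ord0 i + c'.2 *: delta_mx ord0 j).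
  apply: (@mulfI _ (h ^+ 2)); first by rewrite expf_neq0// gt_eqF.
  rewrite /A /B; move: Ec Ec'.
  have -> : x + h *: delta_mx ord0 i + h *: delta_mx ord0 j =
            x + h *: delta_mx ord0 j + h *: delta_mx ord0 i by rewrite addrAC.
  move: (f _) (f _) (f _) (f _) (partial _ _ _) (partial _ _ _) => a1 a2 a3 a4 p q.
  move=> <- <-; ring.
have ji : j != i by rewrite eq_sym.
apply: (dist_half2 (m := A (x + c.1 *: delta_mx ord0 j + c.2 *: delta_mx ord0 i))).
  exact: (h1 _ (near_x _ _ _ _ ji hr1 c1 c2)).
by rewrite EA; exact: (h2 _ (near_x _ _ _ _ ij hr2 c1' c2')).
Qed.

End smooth_functions.

(** * Bumps and test functions *)

Section flat_function.
Context {R : realType}.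
Implicit Types (p : {poly R}) (t : R).

(** The polynomial makes the family stable under differentiation: the derivative of
    [p(1/t) exp(-1/t)] has the same form, with [X^2 (p - p')]. *)
Definition flat p t : R := if 0 < t then p.[t^-1] * expR (- t^-1) else 0.

(** For [y > 1] it follows from [exp y >= 1 + y^(n+1)/(n+1)!]; up to 1 both factors are at most
    1. *)
Lemma exp_decay n : exists2 C : R, 0 <= C & forall y, 0 <= y -> y ^+ n * expR (- y) <= C.
Proof.
exists n.+1`!%:R => [//|y y0].
have [y1|y1] := leP y 1.
  have : y ^+ n * expR (- y) <= 1 * 1.
    apply: ler_pM; rewrite ?exprn_ge0 ?expR_ge0 ?exprn_ile1//.
    by rewrite -[leRHS](@expR0 R) ler_expR oppr_le0.
  by move/le_trans; apply; rewrite mul1r ler1n fact_gt0.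
rewrite expRN ler_pdivrMr ?expR_gt0//.
have := @expR_ge1Dxn R y n y0; move=> h.
have : y ^+ n <= n.+1`!%:R * (1 + y ^+ n.+1 / n.+1`!%:R).
  rewrite mulrDr mulr1 mulrCA divff ?mulr1; last by rewrite pnatr_eq0 -lt0n fact_gt0.
  rewrite (@le_trans _ _ (y ^+ n.+1))//; first by rewrite ler_eXn2l// leqnSn.
  by rewrite lerDr.
by move/le_trans; apply; rewrite ler_wpM2l.
Qed.

(** The origin is the one point near which [flat p] is not given by a single formula; quadratic
    decay there is what [is_derive_sq] needs for a vanishing derivative. *)
Lemma flat_bound p : exists2 C : R, 0 <= C & forall t, `|flat p t| <= C * t ^+ 2.
Proof.
have /choice[c hc] : forall i : 'I_(size p), exists C : R,
    0 <= C /\ forall y, 0 <= y -> y ^+ i.+2 * expR (- y) <= C.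
  by move=> i; have [C] := exp_decay i.+2; exists C.
exists (\sum_(i < size p) `|p`_i| * c i).
  by apply: sumr_ge0 => i _; rewrite mulr_ge0//; case: (hc i).
move=> t; rewrite /flat; case: ifPn => t0; last first.
  rewrite normr0 mulr_ge0 ?sqr_ge0//.
  by apply: sumr_ge0 => i _; rewrite mulr_ge0//; case: (hc i).
rewrite normrM [`|expR _|]ger0_norm ?expR_ge0// horner_coef.
have ti0 : 0 < t^-1 by rewrite invr_gt0.
rewrite (@le_trans _ _ ((\sum_(i < size p) `|p`_i| * t^-1 ^+ i) * expR (- t^-1)))//.
  rewrite ler_wpM2r ?expR_ge0// (le_trans (ler_norm_sum _ _ _))//.
  by apply: ler_sum => i _; rewrite normrM (ger0_norm (exprn_ge0 _ (ltW ti0))).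
rewrite !mulr_suml; apply: ler_sum => i _; rewrite -!mulrA ler_wpM2l//.
have [_ /(_ _ (ltW ti0)) h] := hc i.
rewrite -ler_pdivrMr ?exprn_gt0//; apply: le_trans h.
by rewrite -exprVn le_eqVlt; apply/orP; left; apply/eqP; rewrite -[in RHS]addn2 exprD; ring.
Qed.

Lemma is_derive_sq (f : R -> R) C : f 0 = 0 -> (forall t, `|f t| <= C * t ^+ 2) ->
  is_derive (0 : R) 1 f 0.
Proof.
move=> f0 fC.
have h : (fun h => h^-1 *: ((f \o shift 0) (h *: 1) - f 0)) @ 0^' --> (0 : R).
  apply/cvgr0Pnorm_le => e e0.
  have C0 : 0 < `|C| + 1 by rewrite ltr_wpDl.
  near=> h; rewrite /= [h *: 1]mulr1 addr0 f0 subr0 normrZ.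
  have h0 : h != 0 by near: h; exact: nbhs_dnbhs_neq.
  have he : `|h| < e / (`|C| + 1).
    near: h; apply: dnbhs0_lt; rewrite divr_gt0//.
  apply: (@le_trans _ _ (`|h^-1| * (C * h ^+ 2))); first by rewrite ler_wpM2l.
  rewrite -(real_normK (num_real h)) mulrCA normfV expr2 mulKf ?normr_eq0//.
  apply: (@le_trans _ _ ((`|C| + 1) * `|h|)).
    by rewrite ler_wpM2r// (le_trans (ler_norm _))// lerDl.
  by rewrite mulrC -ler_pdivlMr// ltW.
apply: DeriveDef; first by rewrite /derivable; apply/cvg_ex; exists 0.
exact: cvg_lim h.
Unshelve. all: by end_near. Qed.

Lemma is_derive_flat p t : is_derive t 1 (flat p) (flat ('X^2 * (p - p^`())) t).
Proof.
have [t0|t0|->] := ltgtP t 0.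
- have -> : flat ('X^2 * (p - p^`())) t = 0 by rewrite /flat ltNge (ltW t0).
  have e : {near t, cst 0 =1 flat p}.
    near=> s; rewrite /flat ltNge ltW//; near: s; exact: lt_nbhsl.
  apply: DeriveDef.
    exact: (near_eq_derivable (f := cst 0)).
  by rewrite -(near_eq_derive _ e) ?derive_cst.
- have e : {near t, (fun s => p.[s^-1] * expR (- s^-1)) =1 flat p}.
    near=> s; rewrite /flat ifT//; near: s; exact: lt_nbhsr.
  apply: near_eq_is_derive e _.
  have tn0 : t != 0 by rewrite gt_eqF.
  have dV : is_derive t 1 (fun s : R => s^-1) (- t ^- 2).
    apply: DeriveDef; first exact: derivableV.
    by rewrite (@deriveV _ _ id)// derive_id /GRing.scale/= mulr1.
  have dN : is_derive t 1 (fun s : R => - s^-1) (t ^- 2).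
    by rewrite -[t ^- 2]opprK; exact: is_deriveN.
  have d1 := @is_derive1_comp _ (horner p) (fun s => s^-1) t _ _ (is_derive_poly p _) dV.
  have d2 := @is_derive1_comp _ expR (fun s => - s^-1) t _ _ (is_derive_expR _) dN.
  have [h1 h2] := is_deriveM d1 d2; apply: DeriveDef; first exact: h1.
  apply: etrans h2 _ => /=.
  rewrite /flat t0 !(hornerM, hornerX, hornerXn, hornerD, hornerN) -!exprVn.
  rewrite [LHS](_ : _ = p.[t^-1] * (expR (- t^-1) * t^-1 ^+ 2) +
    expR (- t^-1) * (p^`().[t^-1] * - t^-1 ^+ 2))//; ring.
- have -> : flat ('X^2 * (p - p^`())) 0 = 0 by rewrite /flat ltxx.
  have [C _ hC] := flat_bound p; apply: (@is_derive_sq _ C) => //.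
  by rewrite /flat ltxx.
Unshelve. all: by end_near. Qed.

(** A smooth step, 0 for [t <= 0] and 1 for [t >= 1]. The denominator is positive because [t] and
    [1 - t] are never both nonpositive. *)
Definition sigmoid (t : R) : R := flat 1 t / (flat 1 t + flat 1 (1 - t)).

Lemma flat1_ge0 t : 0 <= flat 1 t.
Proof. by rewrite /flat; case: ifP => // _; rewrite hornerC mul1r expR_ge0. Qed.

Lemma flat1_gt0 t : 0 < t -> 0 < flat 1 t.
Proof. by move=> t0; rewrite /flat t0 hornerC mul1r expR_gt0. Qed.

Lemma sigmoid_den_gt0 t : 0 < flat 1 t + flat 1 (1 - t).
Proof.
have [t0|t0] := ltP 0 t; first by rewrite ltr_wpDr ?flat1_gt0 ?flat1_ge0.
by rewrite ltr_wpDl ?flat1_ge0// flat1_gt0// subr_gt0 (le_lt_trans t0).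
Qed.

Lemma sigmoid_ge0 t : 0 <= sigmoid t.
Proof. by rewrite divr_ge0 ?flat1_ge0// ltW// sigmoid_den_gt0. Qed.

Lemma sigmoid_le1 t : sigmoid t <= 1.
Proof. by rewrite ler_pdivrMr ?sigmoid_den_gt0// mul1r lerDl flat1_ge0. Qed.

Lemma sigmoid_eq0 t : t <= 0 -> sigmoid t = 0.
Proof. by move=> t0; rewrite /sigmoid {1}/flat ltNge t0 mul0r. Qed.

Lemma sigmoid_eq1 t : 1 <= t -> sigmoid t = 1.
Proof.
move=> t1; rewrite /sigmoid {3}/flat ltNge subr_le0 t1 addr0 divff// gt_eqF//.
by rewrite flat1_gt0// (lt_le_trans ltr01).
Qed.

Lemma sigmoid_neq0 t : sigmoid t != 0 -> 0 < t.
Proof. by apply: contraNT; rewrite -leNgt => /sigmoid_eq0 ->. Qed.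

End flat_function.

Section bumps.
Context {R : realType} {d : nat}.
Local Notation E := 'rV[R]_d.

Lemma smooth_flat (p : {poly R}) (a b : R) (j : 'I_d) :
  smooth (fun x : E => flat p (a * x ord0 j + b)).
Proof.
pose P (h : E -> R) := exists (p : {poly R}) (k : R),
  h = fun x : E => k * flat p (a * x ord0 j + b).
have dP q x : differentiable (fun x : E => flat q (a * x ord0 j + b)) x.
  by apply: differentiable_coord_comp; case: (is_derive_flat q (a * x ord0 j + b)).
apply: (@smooth_coind _ _ P).
- move=> _ [q [k ->]] x.
  by apply: (@differentiableM _ _ (cst k) (fun x : E => flat q (a * x ord0 j + b))).
- move=> _ i [q [k ->]]; exists ('X^2 * (q - q^`())), (k * ((i == j)%:R * a)).
  apply/funext => x; rewrite partialZ//.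
  by rewrite (partial_coord_comp _ (is_derive_flat q _)) !mulrA.
- by exists p, 1; apply/funext => x; rewrite mul1r.
Qed.

Lemma smooth_sigmoid (a b : R) (j : 'I_d) :
  smooth (fun x : E => sigmoid (a * x ord0 j + b)).
Proof.
have s2 : smooth (fun x : E => flat 1 (1 - (a * x ord0 j + b))).
  rewrite (_ : (fun _ => _) = fun x : E => flat 1 ((- a) * x ord0 j + (1 - b))).
    exact: smooth_flat.
  by apply/funext => x; congr flat; ring.
apply: smoothM; first exact: smooth_flat.
apply: smoothV; first by apply: smoothD => //; exact: smooth_flat.
by move=> x; rewrite gt_eqF// sigmoid_den_gt0.
Qed.

(* The indicator function of the box, smoothed on a margin of width e. *)
Definition plateau (a b : 'I_d -> R) (e : R) (x : E) : R :=
  \prod_i (sigmoid (e^-1 * x ord0 i + - (e^-1 * a i)) *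
           sigmoid (- e^-1 * x ord0 i + e^-1 * b i)).

Lemma smooth_plateau a b e : smooth (plateau a b e).
Proof. by apply: smooth_prod => i; apply: smoothM; exact: smooth_sigmoid. Qed.

Lemma plateau_ge0 a b e x : 0 <= plateau a b e x.
Proof. by apply: prodr_ge0 => i _; rewrite mulr_ge0 ?sigmoid_ge0. Qed.

Lemma plateau_le1 a b e x : plateau a b e x <= 1.
Proof.
suff : 0 <= plateau a b e x <= 1 by case/andP.
rewrite /plateau; elim/big_ind : _ => [|u v /andP[u0 u1] /andP[v0 v1]|i _].
- by rewrite ler01 lexx.
- by rewrite mulr_ge0//= mulr_ile1.
- by rewrite mulr_ge0 ?sigmoid_ge0//= mulr_ile1 ?sigmoid_ge0 ?sigmoid_le1.
Qed.

Lemma plateau_neq0 a b e x : 0 < e -> plateau a b e x != 0 -> row_box a b x.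
Proof.
move=> e0; rewrite /plateau prodf_seq_neq0 => /allP h i.
have := h i (mem_index_enum _); rewrite mulf_eq0 negb_or => /andP[/sigmoid_neq0 h1 /sigmoid_neq0 h2].
move: h1 h2; rewrite -mulrBr pmulr_rgt0 ?invr_gt0// subr_gt0 => ->.
by rewrite mulNr addrC -mulrBr pmulr_rgt0 ?invr_gt0// subr_gt0 => ->.
Qed.

Lemma plateau_eq1 a b e (x : E) : 0 < e ->
  (forall i, a i + e <= x ord0 i <= b i - e) -> plateau a b e x = 1.
Proof.
move=> e0 h; rewrite /plateau big1// => i _; have /andP[h1 h2] := h i.
rewrite -mulrBr mulNr [X in _ * sigmoid X]addrC -mulrBr !sigmoid_eq1 ?mulr1//.
  by rewrite -ler_pdivrMl ?invr_gt0// invrK mulr1 lerBrDl -lerBrDr.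
by rewrite -ler_pdivrMl ?invr_gt0// invrK mulr1 lerBrDl.
Qed.

End bumps.

Section test_functions.
Context {R : realType} {d : nat}.
Local Notation E := 'rV[R]_d.
Implicit Types (D : set E) (f g : E -> R).

Lemma compact_support_test D K f : smooth f -> compact K -> K `<=` D ->
  (forall x, ~ K x -> f x = 0) -> test_function D f.
Proof.
move=> sf cK KD f0.
have sub : closure [set x | f x != 0] `<=` K.
  have -> : K = closure K.
    apply/closure_id; apply: (@compact_closed 'rV[R]_d) => //.
  by apply: closure_subset => x /= fx; apply: contrapT => /f0 /eqP; rewrite (negbTE fx).
split => //; last exact: subset_trans KD.
by apply: subclosed_compact sub => //; exact: closed_closure.
Qed.

Lemma test_support D f : test_function D f ->
  exists K, [/\ compact K, K `<=` D & forall x, ~ K x -> f x = 0 /\ forall i, partial i f x = 0].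
Proof.
move=> [sf cf fD]; exists (closure [set x | f x != 0]); split => // x nx.
have n0 : \near x, cst 0 x = f x.
  have : nbhs x (~` closure [set x | f x != 0]).
    by apply: open_nbhs_nbhs; split => //; exact/closed_openC/closed_closure.
  apply: filterS => y ny; apply/esym/eqP/negPn/negP => fy.
  by apply: ny; exact: subset_closure.
split; first by have := nbhs_singleton n0.
by move=> i; rewrite /partial -(near_eq_derive _ n0) derive_cst.
Qed.

Lemma test_smooth D f : test_function D f -> smooth f. Proof. by case. Qed.

Lemma testM D f g : test_function D f -> smooth g -> test_function D (fun x => f x * g x).
Proof.
move=> tf sg; have [K [cK KD h]] := test_support tf.
apply: (compact_support_test _ cK KD); first by apply: smoothM => //; case: tf.
by move=> x /h[-> _]; rewrite mul0r.
Qed.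

Lemma test_partial D f i : test_function D f -> test_function D (partial i f).
Proof.
move=> tf; have [K [cK KD h]] := test_support tf.
apply: (compact_support_test _ cK KD); first by apply: smooth_partial; case: tf.
by move=> x /h[_ ->].
Qed.

Lemma test_sub D D' f : D `<=` D' -> test_function D f -> test_function D' f.
Proof. by move=> DD' [sf cf fD]; split => //; exact: subset_trans DD'. Qed.

Lemma test_affine D D' f c a : 0 < c ->
  (forall x, D (c *: x + a) -> D' x) -> test_function D f ->
  test_function D' (fun x => f (c *: x + a)).
Proof.
move=> c0 DD' tf; have [K [cK KD h]] := test_support tf.
pose g (x : E) : E := c^-1 *: (x - a).
have gK x : c *: g x + a = x by rewrite /g scalerA divff ?gt_eqF// scale1r subrK.
have cg : continuous g.
  move=> x; apply/differentiable_continuous.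
  by apply: (@differentiableZ _ _ _ (fun x => x - a)); apply: differentiableB.
apply: (@compact_support_test _ (g @` K)).
- by apply: smooth_affine; case: tf.
- by apply: continuous_compact => //; exact: continuous_subspaceT.
- by move=> _ [y Ky <-]; apply: DD'; rewrite gK; exact: KD.
- move=> x nx; apply: (h _ _).1 => Kx; apply: nx; exists (c *: x + a) => //.
  by rewrite /g addrK scalerA mulVf ?gt_eqF// scale1r.
Qed.

Lemma test_bounded D f : test_function D f -> exists2 M, 0 <= M & forall x, `|f x| <= M.
Proof.
move=> tf; have [K [cK KD h]] := test_support tf.
have cf : {within K, continuous f}.
  by apply/continuous_subspaceT/smooth_continuous; case: tf.
have : compact (f @` K) by exact: continuous_compact.
move=> /compact_bounded[M [Mr hM]]; exists (`|M| + 1) => // x.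
have [Kx|nKx] := pselect (K x).
  by apply: (hM (`|M| + 1)); [rewrite (le_lt_trans (ler_norm _))// ltrDl|exists x].
by rewrite (h _ nKx).1 normr0 addr_ge0.
Qed.

Lemma test_plateau D (a b : 'I_d -> R) e : 0 < e ->
  [set x : E | forall i, a i <= x ord0 i <= b i] `<=` D ->
  test_function D (plateau a b e).
Proof.
move=> e0 abD; apply: compact_support_test abD _ => //; first exact: smooth_plateau.
  have -> : [set x : E | forall i, a i <= x ord0 i <= b i] =
     [set x : E | forall i, (`[a i, b i]%classic : set R) (x ord0 i)].
    by apply/seteqP; split => x /= h i; move: (h i); rewrite in_itv.
  by apply: (@rV_compact _ _ (fun i => `[a i, b i]%classic)) => i; exact: segment_compact.
move=> x /= nx; apply/eqP; apply: contra_notT nx => /(plateau_neq0 e0) h i.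
by have /andP[/ltW -> /ltW ->] := h i.
Qed.

End test_functions.

(** * Square integrable functions *)

Section scalar_L2.
Context {R : realType} {d : nat}.
Local Notation E := 'rV[R]_d.
Local Notation vol := (@lebesgue_row R d).
Variables (D : set E) (mD : measurable D).
Implicit Types f g : E -> R.
Local Notation aei := (ae_integrable vol D).
Local Notation aem := (ae_measurable vol D).
Local Notation "f =ae g" := (f = g %[ae vol in D]) (at level 70).

Lemma L2_ae f g : f =ae g -> L2 D g -> L2 D f.
Proof. by move=> fg [h [gh mh ih]]; exists h; split => //; exact: ae_eq_trans gh. Qed.

Lemma L2P f : L2 D f <-> aem f /\ aei (fun x => f x ^+ 2).
Proof.
split=> [[g [fg mg ig]]|[[g fg mg] [h fh ih]]].
  split; first by exists g.
  by exists (fun x => g x ^+ 2) => //; move: fg; apply: filterS => x fg Dx; rewrite fg.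
exists g; split => //.
have mg2 : measurable_fun D (fun x => (g x ^+ 2)%:E).
  by apply/measurable_EFinP; exact: measurable_funX.
apply/integrableP; split => //.
have /integrableP[mh] := ih; apply: le_lt_trans.
rewrite le_eqVlt; apply/orP; left; apply/eqP; apply: ae_eq_integral_gen.
have : \forall x \ae vol, D x -> g x ^+ 2 = h x.
  by move: fg fh; apply: filterS2 => x fg fh Dx; rewrite -fh// fg.
by apply: filterS => x gh Dx; rewrite /= gh.
Qed.

Lemma L2_sq f : L2 D f -> aei (fun x => f x ^+ 2). Proof. by move/L2P => []. Qed.

Lemma L2M f g : L2 D f -> L2 D g -> aei (fun x => f x * g x).
Proof.
move=> /L2P[mf If] /L2P[mg Ig].
apply: (@ae_integrable_le _ _ _ _ _ mD _ (fun x => f x ^+ 2 + g x ^+ 2)) => //.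
- exact: ae_measurableM.
- apply/aeW => x Dx; rewrite ler_norml.
  have := sqr_ge0 (f x + g x); have := sqr_ge0 (f x - g x); have := sqr_ge0 (f x); have := sqr_ge0 (g x).
  by move=> h1 h2 h3 h4; apply/andP; split; nra.
- exact: ae_integrableD.
Qed.

Lemma L2_bounded_mul (h f : E -> R) (M : R) : measurable_fun D h -> (forall x, D x -> `|h x| <= M) ->
  L2 D f -> L2 D (fun x => h x * f x).
Proof.
move=> mh hM /L2P[mf If]; apply/L2P; split.
  by apply: ae_measurableM => //; exact: measurable_ae_measurable.
apply: (@ae_integrable_le _ _ _ _ _ mD _ (fun x => M ^+ 2 * f x ^+ 2)) => //.
- have mhf : aem (fun x => h x * f x).
    by apply: ae_measurableM => //; exact: measurable_ae_measurable.
  exact: (ae_measurableM mhf mhf).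
- apply/aeW => x Dx; rewrite ger0_norm ?sqr_ge0// exprMn ler_wpM2r ?sqr_ge0//.
  by rewrite -(real_normK (num_real (h x))) lerXn2r ?nnegrE// ?hM// (le_trans _ (hM x Dx)).
- exact: ae_integrableZ.
Qed.

Lemma L2Z r f : L2 D f -> L2 D (fun x => r * f x).
Proof. by move=> Lf; apply: (L2_bounded_mul (h := cst r) (M := `|r|)). Qed.

Lemma L2D f g : L2 D f -> L2 D g -> L2 D (fun x => f x + g x).
Proof.
move=> Lf Lg; have fg := L2M Lf Lg.
move/L2P: Lf => [mf If]; move/L2P: Lg => [mg Ig]; apply/L2P; split.
  exact: ae_measurableD.
apply: (ae_integrable_eq (g := fun x => (f x ^+ 2 + g x ^+ 2) + 2 * (f x * g x))).
  by apply/aeW => x _; rewrite sqrrD -mulr_natl; ring.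
by apply: ae_integrableD => //; [exact: ae_integrableD|exact: ae_integrableZ].
Qed.

Lemma L2N f : L2 D f -> L2 D (fun x => - f x).
Proof. by move=> /(L2Z (-1)); apply: L2_ae; apply/aeW => x _; rewrite mulN1r. Qed.

Lemma L2B f g : L2 D f -> L2 D g -> L2 D (fun x => f x - g x).
Proof. by move=> Lf Lg; apply: L2D => //; exact: L2N. Qed.

Lemma L20 : L2 D (cst 0).
Proof.
exists (cst 0); split; [exact: ae_eq_refl|exact: measurable_cst|].
rewrite (_ : (fun _ => _) = cst 0%E); first exact: integrable0.
by apply/funext => x; rewrite /= expr0n.
Qed.

Lemma L2_sum I (s : seq I) (F : I -> E -> R) : (forall i, L2 D (F i)) ->
  L2 D (fun x => \sum_(i <- s) F i x).
Proof.
move=> LF; elim: s => [|i s IH].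
  by apply: L2_ae L20; apply/aeW => x _; rewrite big_nil.
apply: (L2_ae (g := fun x => F i x + \sum_(i <- s) F i x)); last exact: L2D.
by apply/aeW => x _; rewrite big_cons.
Qed.

Lemma ae_sub (D' : set E) f g : D' `<=` D -> f =ae g -> f = g %[ae vol in D'].
Proof. by move=> D'D; apply: filterS => x h /D'D. Qed.

Lemma L2_subset D' f : measurable D' -> D' `<=` D -> L2 D f -> L2 D' f.
Proof.
move=> mD' D'D [g [fg mg ig]]; exists g; split.
- exact: ae_sub fg.
- exact: measurable_funS mg.
- exact: integrableS ig.
Qed.

Lemma bounded_aei_L2 f (M : R) : (vol D < +oo)%E -> aem f -> (forall x, D x -> `|f x| <= M) -> L2 D f.
Proof.
move=> volD mf fM; apply/L2P; split => //.
apply: (@ae_integrable_le _ _ _ _ _ mD _ (cst (M ^+ 2))) => //.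
- exact: (ae_measurableM mf mf).
- apply/aeW => x Dx; rewrite ger0_norm ?sqr_ge0//=.
  by rewrite -(real_normK (num_real (f x))) lerXn2r ?nnegrE// ?fM// (le_trans _ (fM x Dx)).
- apply: integrable_ae_integrable; apply: measurable_bounded_integrable => //.
  by exists `|M ^+ 2|; split => // y hy x _; exact: ltW.
Qed.

Lemma L2_aei f : (vol D < +oo)%E -> L2 D f -> aei f.
Proof.
move=> volD Lf.
have L1 : L2 D (cst 1).
  by apply: (@bounded_aei_L2 _ 1) => //; [exact: ae_measurable_cst|move=> x _; rewrite normr1].
have := L2M Lf L1; apply: ae_integrable_eq.
by apply/aeW => x _; rewrite mulr1.
Qed.

Lemma cvg_of_geometric (u : R^nat) (M : R) :
  (forall k, `|u k.+1 - u k| <= M * 4^-1 ^+ k) -> cvgn u.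
Proof.
move=> h.
have : cvgn (series (telescope u)).
  apply: normed_cvg; apply: (@series_le_cvg _ _ (geometric M 4^-1)).
  - by move=> n; rewrite /=.
  - move=> n; rewrite /geometric/= mulr_ge0 ?exprn_ge0 ?invr_ge0//.
    by have := h 0%N; rewrite expr0 mulr1; apply: le_trans.
  - by move=> n; exact: h.
  - by apply: is_cvg_geometric_series; rewrite ger0_norm ?invr_ge0// invf_lt1// ltr1n.
move=> /cvg_ex[l hl]; apply/cvg_ex; exists (u 0%N + l).
have e : (fun n => u 0%N + series (telescope u) n) = u.
  by apply/funext => n; rewrite -eq_sum_telescope.
by rewrite -[X in X @ _]e; apply: cvgD => //; exact: cvg_cst.
Qed.

Lemma L2_fatou (u : nat -> E -> R) f e : (forall n, measurable_fun D (u n)) ->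
  measurable_fun D f ->
  (\forall x \ae vol, D x -> u ^~ x @ \oo --> f x) ->
  (\forall n \near \oo, (\int[vol]_(x in D) (u n x ^+ 2)%:E <= e%:E)%E) ->
  (\int[vol]_(x in D) (f x ^+ 2)%:E <= e%:E)%E.
Proof.
move=> mu mf uf ue.
have mu2 n : measurable_fun D (fun x => (u n x ^+ 2)%:E).
  by apply/measurable_EFinP; exact: measurable_funX.
have := fatou vol mD mu2 (fun n x _ => sqr_ge0 _ : (0 <= (u n x ^+ 2)%:E)%E).
rewrite (ae_eq_integral_gen (g := fun x => (f x ^+ 2)%:E)); last first.
  move: uf; apply: filterS => x uf Dx.
  apply: (@cvg_limn_einf_sup R (fun n => (u n x ^+ 2)%:E) (f x ^+ 2)%:E _).1.
  apply: cvg_EFin; first exact: nearW.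
  have -> : (fine \o (fun n => (u n x ^+ 2)%:E)) = (fun n => u n x * u n x).
    by apply/funext => n /=; rewrite expr2.
  by rewrite expr2; apply: cvgM; exact: uf.
move/le_trans; apply.
rewrite limn_einf_lim; apply: lime_le; first exact: is_cvg_einfs.
move: ue => [N _ ue]; near=> n.
apply: (@le_trans _ _ (\int[vol]_(x in D) (u (maxn n N) x ^+ 2)%:E)%E).
  by apply: ereal_inf_lbound => /=; exists (maxn n N) => //=; rewrite leq_maxl.
by apply: ue; rewrite /= leq_maxr.
Unshelve. all: by end_near. Qed.

(** Riesz-Fischer: a fast subsequence converges almost everywhere, and Fatou's lemma ([L2_fatou])
    turns the Cauchy property into convergence of the whole sequence. *)
Lemma L2_cauchy_measurable (g : nat -> E -> R) :
  (forall n, measurable_fun D (g n)) -> (forall n, L2 D (g n)) ->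
  (forall e, 0 < e -> exists N, forall m n, (N <= m)%N -> (N <= n)%N ->
    \int[vol]_(x in D) (g m x - g n x) ^+ 2 <= e) ->
  exists2 f : E -> R, measurable_fun D f & forall e, 0 < e -> exists N, forall n, (N <= n)%N ->
    (\int[vol]_(x in D) ((g n x - f x) ^+ 2)%:E <= e%:E)%E.
Proof.
move=> mg Lg gC.
(* Squared increments of size [32^-k] stay summable after the weights [16^k]; a finite weighted sum
   at [x] bounds the increments at [x] by a multiple of [4^-k]. *)
have /choice[N hN] : forall k, exists N, forall m n, (N <= m)%N -> (N <= n)%N ->
    \int[vol]_(x in D) (g m x - g n x) ^+ 2 <= 32^-1 ^+ k.
  by move=> k; apply: gC; rewrite exprn_gt0.
pose phi := fix phi k := if k is k'.+1 then (maxn (phi k').+1 (N k'.+1)) else N 0%N.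
have phiN k : (N k <= phi k)%N by case: k => //= k; rewrite leq_maxr.
have phiS k : (phi k < phi k.+1)%N by rewrite /= leq_maxl.
pose u k := g (phi k).
have Lgg m n : ae_integrable vol D (fun x => (g m x - g n x) ^+ 2).
  by apply: L2_sq; exact: L2B.
have mgg m n : measurable_fun D (fun x => (g m x - g n x) ^+ 2).
  by apply: measurable_funX; exact: measurable_funB.
have IE m n : (\int[vol]_(x in D) ((g m x - g n x) ^+ 2)%:E =
    (\int[vol]_(x in D) (g m x - g n x) ^+ 2)%:E)%E by exact: ae_integrable_fin_EFin.
pose s k (x : E) := ((16 ^+ k * (u k.+1 x - u k x) ^+ 2)%:E : \bar R).
have ms k : measurable_fun D (s k).
  by apply/measurable_EFinP; apply: measurable_funM => //; exact: mgg.
have s0 k x : D x -> (0 <= s k x)%E.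
  by move=> _; rewrite lee_fin mulr_ge0 ?sqr_ge0// exprn_ge0.
have Is : (\int[vol]_(x in D) (\sum_(k <oo) s k x) <= 2%:E)%E.
  rewrite integral_nneseries//; apply: lime_le.
    by apply: is_cvg_nneseries => n _ _; apply: integral_ge0; exact: s0.
  near=> n.
  apply: (@le_trans _ _ (\sum_(0 <= k < n) (2^-1 ^+ k)%:E)%E).
    apply: lee_sum => k _; rewrite /s.
    under eq_integral do rewrite EFinM.
    rewrite ge0_integralZl_EFin//;
      try (by move=> x _; rewrite lee_fin sqr_ge0);
      try (by apply/measurable_EFinP; exact: mgg); try exact: exprn_ge0.
    rewrite IE -EFinM lee_fin.
    apply: (@le_trans _ _ (16 ^+ k * 32^-1 ^+ k)).
      rewrite ler_wpM2l ?exprn_ge0// hN// (leq_trans (phiN k))//.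
      exact: ltnW.
    by rewrite -exprMn (_ : 16 * 32^-1 = 2^-1 :> R)//; field.
  rewrite sumEFin lee_fin.
  suff : \sum_(0 <= i < n) 2^-1 ^+ i + 2 * 2^-1 ^+ n = 2 :> R.
    by move=> h; rewrite -[leRHS]h lerDl mulr_ge0// exprn_ge0// invr_ge0.
  elim: (n) => [|k IH]; first by rewrite big_geq// add0r expr0 mulr1.
  by rewrite big_nat_recr//= -[RHS]IH exprS; field.
have is_ : vol.-integrable D (fun x => \sum_(k <oo) s k x)%E.
  apply/integrableP; split; first by apply: ge0_emeasurable_sum => // k x Dx _; exact: s0.
  rewrite (eq_integral (fun x => \sum_(k <oo) s k x)%E).
    by apply: le_lt_trans Is _; rewrite ltry.
  move=> x; rewrite inE => Dx; rewrite gee0_abs//.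
  by apply: nneseries_ge0 => n _ _; exact: s0.
have ucvg : \forall x \ae vol, D x -> cvgn (u ^~ x).
  move: (integrable_ae mD is_); apply: filterS => x fx Dx.
  have {}fx := fx Dx.
  pose M := fine (\sum_(k <oo) s k x)%E.
  have M0 : 0 <= M by apply/fine_ge0/nneseries_ge0 => n _ _; exact: s0.
  apply: (@cvg_of_geometric _ (M + 1)) => k.
  have : 16 ^+ k * (u k.+1 x - u k x) ^+ 2 <= M.
    rewrite -lee_fin /M fineK//.
    apply: le_trans (nneseries_lim_ge k.+1 _); last by move=> n _ _; exact: s0.
    rewrite big_nat_recr//= leeDr// sume_ge0// => i _; exact: s0.
  move=> h; rewrite -(@ler_pXn2r _ 2)// ?nnegrE ?mulr_ge0 ?exprn_ge0 ?addr_ge0//.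
  rewrite real_normK ?num_real// exprMn -exprM mulnC exprM.
  rewrite (_ : 4^-1 ^+ 2 = 16^-1 :> R); last by field.
  rewrite exprVn ler_pdivlMr ?exprn_gt0// mulrC.
  by apply: (le_trans h); nra.
(* The upper limit is measurable without reference to the set of convergence, and it is the limit
   wherever that exists. *)
pose f (x : E) : R := fine (limn_esup (fun k => (u k x)%:E)).
have mf : measurable_fun D f.
  apply: measurableT_comp => //.
  by apply: measurable_fun_limn_esup => n; apply/measurable_EFinP; exact: mg.
have uf : \forall x \ae vol, D x -> u ^~ x @ \oo --> f x.
  move: ucvg; apply: filterS => x cx Dx.
  have /cvg_ex[l hl] := cx Dx.
  rewrite /f (_ : limn_esup _ = l%:E)//.
  apply: (cvg_limn_einf_sup _).2; apply: cvg_EFin => //; exact: nearW.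
exists f => // e e0.
have [N0 hN0] := gC e e0; exists N0 => n nN.
apply: (@L2_fatou (fun k x => g n x - u k x)).
- by move=> k; apply: measurable_funB => //; exact: mg.
- exact: measurable_funB.
- by move: uf; apply: filterS => x ux Dx; apply: cvgB; [exact: cvg_cst|exact: ux].
- near=> k; rewrite IE lee_fin hN0//.
  apply: (@leq_trans k); first by near: k; exact: nbhs_infty_ge.
  elim: (k) => // m IH; exact: leq_ltn_trans IH (phiS m).
Unshelve. all: by end_near. Qed.

Lemma L2_complete (F : nat -> E -> R) : (forall n, L2 D (F n)) ->
  (forall e, 0 < e -> exists N, forall m n, (N <= m)%N -> (N <= n)%N ->
    \int[vol]_(x in D) (F m x - F n x) ^+ 2 <= e) ->
  exists2 f, L2 D f & forall e, 0 < e -> exists N, forall n, (N <= n)%N ->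
    \int[vol]_(x in D) (F n x - f x) ^+ 2 <= e.
Proof.
move=> LF FC; have /choice[g hg] := LF.
have Lg n : L2 D (g n).
  by have [_ mg ig] := hg n; exists (g n); split => //; exact: ae_eq_refl.
have gC e : 0 < e -> exists N, forall m n, (N <= m)%N -> (N <= n)%N ->
    \int[vol]_(x in D) (g m x - g n x) ^+ 2 <= e.
  move=> /FC[N hN]; exists N => m n mN nN; apply: le_trans (hN m n mN nN).
  rewrite le_eqVlt; apply/orP; left; apply/eqP; apply: ae_eq_Rintegral.
  have [Em _ _] := hg m; have [En _ _] := hg n.
  by move: Em En; apply: filterS2 => x Em En Dx; rewrite Em// En.
have mg n : measurable_fun D (g n) by have [] := hg n.
have [f mf hf] := L2_cauchy_measurable mg Lg gC.
have Lf : L2 D f.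
  have [N hN] := hf 1 ltr01.
  have Ld : L2 D (fun x => g N x - f x).
    exists (fun x => g N x - f x); split; [exact: ae_eq_refl|exact: measurable_funB|].
    apply/integrableP; split.
      by apply/measurable_EFinP; apply: measurable_funX; exact: measurable_funB.
    rewrite (eq_integral (fun x => ((g N x - f x) ^+ 2)%:E)).
      by apply: le_lt_trans (hN N (leqnn _)) _; rewrite ltry.
    by move=> x _; rewrite gee0_abs// lee_fin sqr_ge0.
  have := L2B (Lg N) Ld; apply: L2_ae; apply/aeW => x _.
  by rewrite opprB addrCA subrr addr0.
exists f => // e e0; have [N hN] := hf e e0; exists N => n nN.
rewrite (ae_eq_Rintegral (g := fun x => (g n x - f x) ^+ 2)).
  by rewrite -lee_fin -ae_integrable_fin_EFin ?hN//; apply: L2_sq; exact: L2B.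
by have [En _ _] := hg n; move: En; apply: filterS => x En Dx; rewrite En.
Qed.

End scalar_L2.

(** * The fundamental lemma of the calculus of variations *)

Section density.
Context d (T : measurableType d) (R : realType) (mu : {measure set T -> \bar R}).
Variables (f : T -> \bar R) (mf : measurable_fun setT f) (f0 : forall x, (0 <= f x)%E).

(** The hypotheses are arguments so that a term [density mf f0] can carry the canonical structure of
    a measure. *)
Definition density of measurable_fun setT f & (forall x, (0 <= f x)%E) :=
  fun A => (\int[mu]_(x in A) f x)%E.

Let density0 : density mf f0 set0 = 0%E.
Proof. exact: integral_set0. Qed.

Let density_ge0 A : (0 <= density mf f0 A)%E.
Proof. by apply: integral_ge0 => x _. Qed.

Let density_sigma_additive : semi_sigma_additive (density mf f0).
Proof. exact: semi_sigma_additive_nng_induced. Qed.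

HB.instance Definition _ := isMeasure.Build _ _ _ (density mf f0)
  density0 density_ge0 density_sigma_additive.

End density.

Section test_dense.
Context {R : realType} {d : nat}.
Local Notation E := 'rV[R]_d.
Local Notation vol := (@lebesgue_row R d).

(** The positive and the negative part of [h] on the box are densities of two measures that agree on
    all boxes, hence on all measurable sets. On the set [h > 0] the second density vanishes, on its
    complement the first, so both measures are zero. *)
Lemma box_integral0_ae (h : E -> R) (a b : 'I_d -> R) :
  vol.-integrable setT (EFin \o h) ->
  (forall a' b' : 'I_d -> R, row_box a' b' `<=` row_box a b ->
    (forall i, a i <= a' i) -> (forall i, b' i <= b i) ->
    \int[vol]_(x in row_box a' b') h x = 0) ->
  h = cst 0 %[ae vol in row_box a b].
Proof.
move=> ih h0.
have mh : measurable_fun setT h by apply/measurable_EFinP; case/integrableP: ih.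
pose P := row_box a b.
have mP : measurable P by exact: measurable_row_box.
pose f1 x : \bar R := (Num.max (h x) 0 * \1_P x)%:E.
pose f2 x : \bar R := (Num.max (- h x) 0 * \1_P x)%:E.
have m0 r : 0 <= Num.max r (0 : R) by rewrite le_max lexx orbT.
have f10 x : (0 <= f1 x)%E by rewrite lee_fin mulr_ge0.
have f20 x : (0 <= f2 x)%E by rewrite lee_fin mulr_ge0.
have mf1 : measurable_fun setT f1.
  apply/measurable_EFinP; apply: measurable_funM => //.
  by apply: measurable_maxr.
have mf2 : measurable_fun setT f2.
  apply/measurable_EFinP; apply: measurable_funM => //.
  by apply: measurable_maxr => //; exact: measurableT_comp.
have if1 : vol.-integrable setT f1.
  apply: le_integrable ih => // x _ /=; rewrite lee_fin normrM.
  rewrite indicE; case: (x \in P); rewrite ?mulr0 ?mulr1 ?normr0 ?mulr0 ?normr1 ?mulr1//.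
  by rewrite ger0_norm// ge_max normr_ge0 ler_norm.
have if2 : vol.-integrable setT f2.
  apply: le_integrable ih => // x _ /=; rewrite lee_fin normrM.
  rewrite indicE; case: (x \in P); rewrite ?mulr0 ?mulr1 ?normr0 ?mulr0 ?normr1 ?mulr1//.
  by rewrite ger0_norm// ge_max normr_ge0 -normrN ler_norm.
have m12 A : measurable A -> (\int[vol]_(x in A) f1 x = \int[vol]_(x in A) f2 x)%E.
  move=> mA; pose m1 : {measure set E -> \bar R} := density vol mf1 f10.
  pose m2 : {measure set E -> \bar R} := density vol mf2 f20.
  apply: (@row_measure_unique _ _ m1 m2) => //.
  - move=> a' b'; rewrite /m1 /m2 /= /density.
    have mB := @measurable_row_box R d a' b'.
    have i1 : vol.-integrable (row_box a' b') f1 by exact: integrableS if1.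
    have i2 : vol.-integrable (row_box a' b') f2 by exact: integrableS if2.
    pose a'' i := Num.max (a i) (a' i); pose b'' i := Num.min (b i) (b' i).
    have boxI : row_box a'' b'' = row_box a' b' `&` P.
      apply/seteqP; split => x /=.
        by move=> hx; split => i; move: (hx i); rewrite gt_max lt_min =>
          /andP[/andP[h1 h2] /andP[h3 h4]]; apply/andP.
      by move=> [h1 h2] i; rewrite gt_max lt_min; move: (h1 i) (h2 i) =>
        /andP[-> ->] /andP[-> ->].
    have sub : row_box a'' b'' `<=` P by rewrite boxI => x [].
    have a''le i : a i <= a'' i by rewrite le_max lexx.
    have b''ge i : b'' i <= b i by rewrite ge_min lexx.
    have := h0 a'' b'' sub a''le b''ge.
    rewrite boxI Rintegral_mkcondr => I0.
    have ai1 := integrable_ae_integrable i1; have ai2 := integrable_ae_integrable i2.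
    rewrite [LHS](ae_integrable_fin_EFin mB ai1) [RHS](ae_integrable_fin_EFin mB ai2).
    congr EFin; apply/eqP; rewrite -subr_eq0 -RintB//; apply/eqP; rewrite -[RHS]I0.
    apply: eq_Rintegral => x _; rewrite patchE indicE.
    case: (x \in P); rewrite ?mulr0 ?subrr// !mulr1.
    have [hx|/ltW hx] := leP 0 (h x).
      by rewrite max_r ?oppr_le0// subr0.
    by rewrite max_l ?oppr_ge0// opprK add0r.
  - move=> a' b'; rewrite /m1 /= /density.
    have i1 : vol.-integrable (row_box a' b') f1.
      by apply: integrableS if1 => //; exact: measurable_row_box.
    by apply: integrable_lty => //; exact: measurable_row_box.
have mpos : measurable [set x | 0 < h x].
  have -> : [set x | 0 < h x] = h @^-1` `]0, +oo[.
    by apply/seteqP; split => x; rewrite /= in_itv/= andbT.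
  by rewrite -[X in measurable X]setTI; exact: mh.
have f2pos x : 0 < h x -> f2 x = 0%E.
  by move=> hx; rewrite /f2 max_r ?mul0r// oppr_le0 ltW.
have f1neg x : ~ 0 < h x -> f1 x = 0%E.
  by move=> /negP; rewrite -leNgt => hx; rewrite /f1 max_r ?mul0r.
have I1 : (\int[vol]_x f1 x = 0)%E.
  transitivity (\int[vol]_(x in [set x | (0 < h x)%R]) f1 x)%E.
    rewrite [RHS]integral_mkcond; apply: eq_integral => x _.
    by rewrite patchE; case: ifPn => // /negP hx; rewrite f1neg// => h'; apply: hx; rewrite inE.
  by rewrite m12//; apply: integral0_eq => x; exact: f2pos.
have I2 : (\int[vol]_x f2 x = 0)%E by rewrite -m12.
have ae0 f : measurable_fun setT f -> (forall x, (0 <= f x)%E) ->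
    (\int[vol]_x f x = 0)%E -> \forall x \ae vol, f x = 0%E.
  move=> mf f0 If.
  have /ae_eq_integral_abs h1 := mf.
  have := (h1 vol measurableT).1; under eq_integral do rewrite gee0_abs//.
  by move=> /(_ If); apply: filterS => x; exact.
move: (ae0 _ mf1 f10 I1) (ae0 _ mf2 f20 I2); apply: filterS2 => x.
rewrite /f1 /f2 indicE => h1 h2 Px; move: h1 h2; rewrite mem_set// !mulr1 => -[h1] [h2].
have h3 : h x <= 0 by rewrite -h1 le_max lexx.
have h4 : - h x <= 0 by rewrite -h2 le_max lexx.
by apply/eqP; rewrite eq_le h3 -oppr_le0.
Qed.

(** At a point of the open box a margin of width [1/(n+1)] eventually fits; off the box every
    plateau vanishes. *)
Lemma plateau_cvg (a b : 'I_d -> R) (x : E) :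
  plateau a b n.+1%:R^-1 x @[n --> \oo] --> (\1_(row_box a b) x : R).
Proof.
rewrite indicE; have [xB|xB] := boolP (x \in row_box a b); last first.
  rewrite (_ : (fun _ => _) = cst 0); first exact: cvg_cst.
  apply/funext => n; apply/eqP; move: xB; apply: contraNT => px.
  by rewrite inE; apply: plateau_neq0 px; rewrite invr_gt0.
move: xB; rewrite inE => xB.
pose r := \big[Order.min/1]_i Num.min (x ord0 i - a i) (b i - x ord0 i).
have r0 : 0 < r.
  apply/bigmin_gtP; split => // i _; have /andP[h1 h2] := xB i.
  by rewrite lt_min !subr_gt0 h1.
have ri i : r <= x ord0 i - a i /\ r <= b i - x ord0 i.
  have : r <= Num.min (x ord0 i - a i) (b i - x ord0 i) by exact: bigmin_le_cond.
  by rewrite le_min => /andP.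
apply: cvg_near_cst; near=> n.
have nr : n.+1%:R^-1 <= r.
  rewrite invf_ple ?posrE//; apply: le_trans (_ : n%:R <= _); last by rewrite ler_nat.
  by near: n; exact: nbhs_infty_ger.
apply: plateau_eq1; first by rewrite invr_gt0.
move=> i; have [h1 h2] := ri i.
by rewrite -lerBrDl (le_trans nr h1)/= lerBrDr -lerBrDl (le_trans nr h2).
Unshelve. all: by end_near. Qed.

(** Plateaus supported in a closed box inside [D] are test functions; by dominated convergence along
    them the integral of [f] over the open box vanishes, and countably many boxes fill [D]. *)
Lemma test_dense (D : set E) f : open D -> (vol D < +oo)%E -> L2 D f ->
  (forall theta, test_function D theta -> \int[vol]_(x in D) (f x * theta x) = 0) ->
  f = cst 0 %[ae vol in D].
Proof.
move=> oD volD Lf f0; have mD := open_measurable_row oD.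
have [g fg ig] := L2_aei mD volD Lf.
have g0 theta : test_function D theta -> \int[vol]_(x in D) (g x * theta x) = 0.
  move=> tt; rewrite -(f0 _ tt); apply: ae_eq_Rintegral.
  by move: fg; apply: filterS => x fg Dx; rewrite fg.
pose h := g \_ D.
have ih : vol.-integrable setT (EFin \o h).
  by rewrite /h -restrict_EFin; apply/(integrable_mkcond _ mD).
have mg : measurable_fun D g by apply/measurable_EFinP; case/integrableP: ig.
have [P [a [b [DE PD]]]] := open_box_cover oD.
suff h0 k : P k -> h = cst 0 %[ae vol in row_box (a k) (b k)].
  have : \forall x \ae vol, forall k, P k -> row_box (a k) (b k) x -> h x = 0.
    apply/ae_foralln => k; have [Pk|nPk] := pselect (P k); last exact: aeW.
    by move: (h0 k Pk); apply: filterS => x hx _ /hx.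
  move: fg; apply: filterS2 => x fg hx Dx.
  rewrite fg//; move: (Dx); rewrite {1}DE => -[k Pk /(hx k Pk)].
  by rewrite /h patchE mem_set.
move=> Pk; apply: box_integral0_ae => // a' b' sub aa' bb'.
have subD : closed_row_box a' b' `<=` D.
  apply: subset_trans (PD k Pk) => x hx i; have /andP[h1 h2] := hx i.
  by rewrite (le_trans (aa' i))//= (le_trans h2).
have subD' : row_box a' b' `<=` D.
  by apply: subset_trans subD => x hx i; have /andP[/ltW -> /ltW ->] := hx i.
have tp n : test_function D (plateau a' b' n.+1%:R^-1).
  by apply: test_plateau => //; rewrite invr_gt0.
have mp n : measurable_fun D (plateau a' b' n.+1%:R^-1).
  apply: measurable_funTS; apply: continuous_measurable_row.
  exact/smooth_continuous/smooth_plateau.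
have mB := @measurable_row_box R d a' b'.
have [] := @dominated_convergence _ _ _ vol D mD
  (fun n x => (g x * plateau a' b' n.+1%:R^-1 x)%:E) (fun x => (g x * \1_(row_box a' b') x)%:E)
  (fun x => `|g x|%:E).
- by move=> n; apply/measurable_EFinP; apply: measurable_funM.
- by apply/measurable_EFinP; apply: measurable_funM.
- apply/aeW => x Dx; apply: cvg_EFin; first exact: nearW.
  by apply: cvgM; [exact: cvg_cst|exact: plateau_cvg].
- exact: integrable_norm.
- apply/aeW => x n Dx; rewrite lee_fin normrM ler_piMr//.
  by rewrite ger0_norm ?plateau_ge0 ?plateau_le1.
move=> _ _ cvgI.
have I0 : (\int[vol]_(x in D) (g x * \1_(row_box a' b') x)%:E = 0)%E.
  apply: (cvg_unique _ cvgI) => //.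
  rewrite (_ : (fun _ => _) = cst 0%E); first exact: cvg_cst.
  apply/funext => n; rewrite ae_integrable_fin_EFin ?g0//.
  have [M M0 hM] := test_bounded (tp n).
  apply: (@ae_integrable_le _ _ _ _ _ mD _ (fun x => M * `|g x|)).
  - by apply: measurable_ae_measurable; apply: measurable_funM.
  - by apply/aeW => x _; rewrite normrM mulrC ler_wpM2r.
  - apply: ae_integrableZ => //; apply: ae_integrable_norm => //.
    exact: integrable_ae_integrable.
rewrite -(setIidr subD') Rintegral_mkcondr /Rintegral -[RHS](congr1 fine I0).
congr fine; apply: eq_integral => x; rewrite inE => Dx.
rewrite patchE indicE; case: ifP => _; rewrite ?mulr1 ?mulr0//.
by rewrite /h patchE mem_set.
Qed.

End test_dense.

Section dot_product.
Context {R : realType} {n : nat}.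
Implicit Types (u v w : 'rV[R]_n) (r : R).

Lemma dotC u v : dot u v = dot v u.
Proof. by apply: eq_bigr => i _; rewrite mulrC. Qed.

Lemma dotDl u v w : dot (u + v) w = dot u w + dot v w.
Proof. by rewrite -big_split; apply: eq_bigr => i _; rewrite mxE mulrDl. Qed.

Lemma dotZl r u v : dot (r *: u) v = r * dot u v.
Proof. by rewrite mulr_sumr; apply: eq_bigr => i _; rewrite mxE mulrA. Qed.

Lemma dotNl u v : dot (- u) v = - dot u v.
Proof. by rewrite -scaleN1r dotZl mulN1r. Qed.

Lemma dotBl u v w : dot (u - v) w = dot u w - dot v w.
Proof. by rewrite dotDl dotNl. Qed.

Lemma dotDr u v w : dot u (v + w) = dot u v + dot u w.
Proof. by rewrite dotC dotDl !(dotC u). Qed.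

Lemma dotZr r u v : dot u (r *: v) = r * dot u v.
Proof. by rewrite dotC dotZl dotC. Qed.

Lemma dotNr u v : dot u (- v) = - dot u v.
Proof. by rewrite dotC dotNl dotC. Qed.

Lemma dotBr u v w : dot u (v - w) = dot u v - dot u w.
Proof. by rewrite dotDr dotNr. Qed.

Lemma dot0l u : dot 0 u = 0.
Proof. by rewrite -(scale0r u) dotZl mul0r. Qed.

Lemma dot_ge0 u : 0 <= dot u u.
Proof. by apply: sumr_ge0 => i _; rewrite -expr2 sqr_ge0. Qed.

Lemma enorm_ge0 u : 0 <= enorm u. Proof. exact: sqrtr_ge0. Qed.

Lemma enorm_sq u : enorm u ^+ 2 = dot u u.
Proof. by rewrite sqr_sqrtr// dot_ge0. Qed.

Lemma coord_le_enorm u i : `|u ord0 i| <= enorm u.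
Proof.
rewrite -(@ler_pXn2r _ 2)// ?nnegrE ?enorm_ge0// enorm_sq real_normK ?num_real//.
rewrite /dot (bigD1 i)//= expr2 lerDl.
by apply: sumr_ge0 => j _; rewrite -expr2 sqr_ge0.
Qed.

Lemma dot_cauchy u v : `|dot u v| <= enorm u * enorm v.
Proof.
rewrite -(@ler_pXn2r _ 2)// ?nnegrE ?mulr_ge0 ?enorm_ge0//.
rewrite exprMn !enorm_sq real_normK ?num_real//.
have [v0|v0] := leP (dot v v) 0.
  have vv : v = 0.
    apply/rowP => i; rewrite mxE; apply/eqP; rewrite -normr_le0.
    apply: le_trans (coord_le_enorm v i) _; rewrite -(@ler_pXn2r _ 2)// ?nnegrE ?enorm_ge0//.
    by rewrite enorm_sq expr0n.
  by rewrite vv [dot u 0]dotC !dot0l expr0n mulr0.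
have := dot_ge0 (dot v v *: u - dot u v *: v).
rewrite dotBl !dotBr !dotZl !dotZr [dot v u]dotC => h.
have : 0 <= dot v v * (dot u u * dot v v - dot u v ^+ 2).
  by apply: le_trans h _; rewrite le_eqVlt; apply/orP; left; apply/eqP; ring.
by rewrite pmulr_rge0// subr_ge0.
Qed.

Lemma enorm_eq0 u : enorm u = 0 -> u = 0.
Proof.
move=> u0; apply/rowP => i; rewrite mxE; apply/eqP; rewrite -normr_le0 -u0.
exact: coord_le_enorm.
Qed.

Lemma enormZ r u : enorm (r *: u) = `|r| * enorm u.
Proof. by rewrite /enorm dotZl dotZr mulrA -expr2 sqrtrM ?sqr_ge0// sqrtr_sqr. Qed.

End dot_product.

(** * Square integrable fields *)

Section vector_L2.
Context {R : realType} {d : nat}.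
Local Notation E := 'rV[R]_d.
Local Notation vol := (@lebesgue_row R d).
Variables (D : set E) (mD : measurable D).

Definition ip n (F G : E -> 'rV[R]_n) : R := \int[vol]_(x in D) dot (F x) (G x).

Section fixed_dimension.
Variable n : nat.
Implicit Types F G H : E -> 'rV[R]_n.

Lemma L2v_ae F G : F = G %[ae vol in D] -> L2v D G -> L2v D F.
Proof.
move=> FG LG k; apply: L2_ae (LG k).
by move: FG; apply: filterS => x FG Dx; rewrite FG.
Qed.

Lemma L2vD F G : L2v D F -> L2v D G -> L2v D (fun x => F x + G x).
Proof.
move=> LF LG k; apply: (L2_ae (g := fun x => F x ord0 k + G x ord0 k)).
  by apply/aeW => x _; rewrite mxE.
exact: L2D.
Qed.

Lemma L2vZ r F : L2v D F -> L2v D (fun x => r *: F x).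
Proof.
move=> LF k; apply: (L2_ae (g := fun x => r * F x ord0 k)).
  by apply/aeW => x _; rewrite mxE.
exact: L2Z.
Qed.

Lemma L2vB F G : L2v D F -> L2v D G -> L2v D (fun x => F x - G x).
Proof.
move=> LF LG k; apply: (L2_ae (g := fun x => F x ord0 k - G x ord0 k)).
  by apply/aeW => x _; rewrite !mxE.
exact: L2B.
Qed.

Lemma L2v0 : L2v D (fun=> 0 : 'rV[R]_n).
Proof.
by move=> k; apply: L2_ae (L20 _); apply/aeW => x _; rewrite mxE.
Qed.

Lemma L2v_dot F G : L2v D F -> L2v D G -> ae_integrable vol D (fun x => dot (F x) (G x)).
Proof. by move=> LF LG; apply: ae_integrable_sum => // i _; exact: L2M. Qed.

Lemma ip_ae F F' G G' : F = F' %[ae vol in D] -> G = G' %[ae vol in D] ->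
  ip F G = ip F' G'.
Proof.
move=> FF' GG'; apply: ae_eq_Rintegral.
by move: FF' GG'; apply: filterS2 => x FF' GG' Dx; rewrite FF'// GG'.
Qed.

Lemma ipC F G : ip F G = ip G F.
Proof. by apply: eq_Rintegral => x _; rewrite dotC. Qed.

Lemma ipDl F G H : L2v D F -> L2v D G -> L2v D H ->
  ip (fun x => F x + G x) H = ip F H + ip G H.
Proof.
move=> LF LG LH; rewrite /ip -RintD//; [|exact: L2v_dot..].
by apply: eq_Rintegral => x _; rewrite dotDl.
Qed.

Lemma ipZl r F G : L2v D F -> L2v D G -> ip (fun x => r *: F x) G = r * ip F G.
Proof.
move=> LF LG; rewrite /ip -RintZ//; last exact: L2v_dot.
by apply: eq_Rintegral => x _; rewrite dotZl.
Qed.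

Lemma ipBl F G H : L2v D F -> L2v D G -> L2v D H ->
  ip (fun x => F x - G x) H = ip F H - ip G H.
Proof.
move=> LF LG LH; rewrite /ip -RintB//; [|exact: L2v_dot..].
by apply: eq_Rintegral => x _; rewrite dotBl.
Qed.

Lemma ipDr F G H : L2v D F -> L2v D G -> L2v D H ->
  ip F (fun x => G x + H x) = ip F G + ip F H.
Proof. by move=> LF LG LH; rewrite ipC ipDl// ipC [ip H F]ipC. Qed.

Lemma ipZr r F G : L2v D F -> L2v D G -> ip F (fun x => r *: G x) = r * ip F G.
Proof. by move=> LF LG; rewrite ipC ipZl// ipC. Qed.

Lemma ipBr F G H : L2v D F -> L2v D G -> L2v D H ->
  ip F (fun x => G x - H x) = ip F G - ip F H.
Proof. by move=> LF LG LH; rewrite ipC ipBl// ipC [ip H F]ipC. Qed.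

Lemma ip_ge0 F : 0 <= ip F F.
Proof. by apply: Rintegral_ge0 => x _; exact: dot_ge0. Qed.

Lemma L2normE F : L2norm D F = Num.sqrt (ip F F).
Proof. by congr Num.sqrt; apply: eq_Rintegral => x _; rewrite enorm_sq. Qed.

Lemma L2norm_ge0 F : 0 <= L2norm D F.
Proof. exact: sqrtr_ge0. Qed.

Lemma L2norm_sq F : L2norm D F ^+ 2 = ip F F.
Proof. by rewrite L2normE sqr_sqrtr// ip_ge0. Qed.

Lemma L2norm_ae F G : F = G %[ae vol in D] -> L2norm D F = L2norm D G.
Proof. by move=> FG; rewrite !L2normE (ip_ae FG FG). Qed.

Lemma ip_cauchy F G : L2v D F -> L2v D G -> `|ip F G| <= L2norm D F * L2norm D G.
Proof.
move=> LF LG.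
rewrite -(@ler_pXn2r _ 2)// ?nnegrE ?mulr_ge0 ?L2norm_ge0//.
rewrite exprMn !L2norm_sq real_normK ?num_real//.
have key (a b : R) : 0 <= a ^+ 2 * ip F F + 2 * a * b * ip F G + b ^+ 2 * ip G G.
  have := ip_ge0 (fun x => a *: F x + b *: G x).
  have LaF := L2vZ a LF; have LbG := L2vZ b LG.
  rewrite ipDl ?ipDr ?ipZl ?ipZr//; try exact: L2vD.
  by rewrite [ip G F]ipC => /le_trans; apply; rewrite le_eqVlt; apply/orP; left; apply/eqP; ring.
have [g0|g0] := ltP 0 (ip G G).
  have := key (ip G G) (- ip F G).
  have -> : ip G G ^+ 2 * ip F F + 2 * ip G G * - ip F G * ip F G + (- ip F G) ^+ 2 * ip G G
    = ip G G * (ip F F * ip G G - ip F G ^+ 2) by ring.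
  by rewrite pmulr_rge0// subr_ge0.
have {g0}G0 : ip G G = 0 by apply/eqP; rewrite eq_le g0 ip_ge0.
have [f0|f0] := ltP 0 (ip F F).
  have := key (- ip F G) (ip F F).
  have -> : (- ip F G) ^+ 2 * ip F F + 2 * - ip F G * ip F F * ip F G + ip F F ^+ 2 * ip G G
    = ip F F * (ip F F * ip G G - ip F G ^+ 2) by ring.
  by rewrite pmulr_rge0// subr_ge0.
have {f0}F0 : ip F F = 0 by apply/eqP; rewrite eq_le f0 ip_ge0.
(* With both norms zero the form at [(1, - ip F G)] is [- 2 (ip F G)^2], which forces
   [ip F G = 0]. *)
rewrite G0 mulr0; have := key 1 (- ip F G); rewrite F0 G0.
by move=> h; nra.
Qed.

Lemma ip_le F G : L2v D F -> L2v D G -> ip F G <= L2norm D F * L2norm D G.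
Proof. by move=> LF LG; apply: le_trans (ler_norm _) (ip_cauchy LF LG). Qed.

Lemma L2norm_triangle F G : L2v D F -> L2v D G ->
  L2norm D (fun x => F x + G x) <= L2norm D F + L2norm D G.
Proof.
move=> LF LG; rewrite -(@ler_pXn2r _ 2)// ?nnegrE ?addr_ge0 ?L2norm_ge0//.
rewrite L2norm_sq sqrrD !L2norm_sq ipDl ?ipDr//; try exact: L2vD.
rewrite [ip G F]ipC; have := ip_le LF LG; rewrite -mulr_natl; lra.
Qed.

Lemma L2normZ r F : L2v D F -> L2norm D (fun x => r *: F x) = `|r| * L2norm D F.
Proof.
move=> LF; rewrite !L2normE ipZl ?ipZr//; last exact: L2vZ.
by rewrite mulrA -expr2 sqrtrM ?sqr_ge0// sqrtr_sqr.
Qed.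

Lemma L2norm_subC F G : L2norm D (fun x => F x - G x) = L2norm D (fun x => G x - F x).
Proof.
congr Num.sqrt; apply: eq_Rintegral => x _.
by rewrite !enorm_sq -opprB dotNl dotNr opprK.
Qed.

Lemma L2norm_eq0 F : L2v D F -> L2norm D F = 0 -> F = (fun=> 0) %[ae vol in D].
Proof.
move=> LF F0.
have : (fun x => dot (F x) (F x)) = cst 0 %[ae vol in D].
  apply: Rint_eq0_ae => //; first exact: L2v_dot.
    by apply/aeW => x _; exact: dot_ge0.
  by rewrite -[LHS]L2norm_sq F0 expr0n.
apply: filterS => x h /h /=; rewrite -enorm_sq => /eqP; rewrite sqrf_eq0 => /eqP.
exact: enorm_eq0.
Qed.

Lemma ip_sum F G : L2v D F -> L2v D G ->
  ip F G = \sum_k \int[vol]_(x in D) (F x ord0 k * G x ord0 k).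
Proof. by move=> LF LG; rewrite /ip /dot Rint_sum// => i _; exact: L2M. Qed.

Lemma coord_L2norm F k : L2v D F ->
  \int[vol]_(x in D) (F x ord0 k) ^+ 2 <= L2norm D F ^+ 2.
Proof.
move=> LF; rewrite L2norm_sq ip_sum// (bigD1 k)//= -[leLHS]addr0; apply: lerD.
  by under eq_Rintegral do rewrite expr2.
by apply: sumr_ge0 => i _; apply: Rintegral_ge0 => x _; rewrite -expr2 sqr_ge0.
Qed.

Lemma L2v_complete (F : nat -> E -> 'rV[R]_n) : (forall m, L2v D (F m)) ->
  (forall e, 0 < e -> exists N, forall p q, (N <= p)%N -> (N <= q)%N ->
    L2norm D (fun x => F p x - F q x) <= e) ->
  exists2 G, L2v D G & forall e, 0 < e -> exists N, forall p, (N <= p)%N ->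
    L2norm D (fun x => F p x - G x) <= e.
Proof.
move=> LF FC.
have /choice[g hg] k : exists g : E -> R, L2 D g /\ forall e, 0 < e -> exists N, forall p, (N <= p)%N ->
    \int[vol]_(x in D) (F p x ord0 k - g x) ^+ 2 <= e.
  have [//||g Lg hg] := L2_complete mD (F := fun p x => F p x ord0 k).
  - by move=> p; exact: LF.
  - move=> e e0; have se : 0 < Num.sqrt e by rewrite sqrtr_gt0.
    have [N hN] := FC _ se; exists N => p q pN qN.
    rewrite -[leRHS]sqr_sqrtr ?(ltW e0)//; apply: le_trans (_ : L2norm D (fun x => F p x - F q x) ^+ 2 <= _).
      apply: le_trans (coord_L2norm k (L2vB (LF p) (LF q))).
      rewrite le_eqVlt; apply/orP; left; apply/eqP; apply: eq_Rintegral => x _.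
      by rewrite !mxE.
    by rewrite lerXn2r ?nnegrE ?L2norm_ge0 ?(ltW se)// hN.
  - by exists g.
pose G (x : E) : 'rV[R]_n := \row_k g k x.
have LG : L2v D G.
  move=> k; apply: L2_ae (hg k).1; by apply/aeW => x _; rewrite mxE.
exists G => // e e0.
have e'0 : 0 < e ^+ 2 / n.+1%:R by rewrite divr_gt0// exprn_gt0.
have /choice[N hN] k := (hg k).2 _ e'0.
exists (\max_k N k)%N => p pN.
rewrite -(@ler_pXn2r _ 2)// ?nnegrE ?L2norm_ge0 ?(ltW e0)// L2norm_sq ip_sum; try exact: L2vB.
apply: (@le_trans _ _ (\sum_(k < n) e ^+ 2 / n.+1%:R)).
  apply: ler_sum => k _; apply: le_trans (hN k p _); last exact: leq_trans (leq_bigmax k) pN.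
  rewrite le_eqVlt; apply/orP; left; apply/eqP; apply: eq_Rintegral => x _.
  by rewrite !mxE -expr2.
rewrite sumr_const card_ord -[leLHS]mulr_natr -[leLHS]mulrA ler_piMr ?sqr_ge0//.
by rewrite mulrC ler_pdivrMr// mul1r ler_nat.
Qed.

End fixed_dimension.
End vector_L2.

(** * Poincaré homotopy operators on star-shaped domains *)

Section Rint_square.
Context d (T : measurableType d) (R : realType) (mu : {measure set T -> \bar R}).

(** Cauchy-Schwarz against the indicator function of [A], read off from the nonnegative quadratic
    form [key] in [(a, b)]. *)
Lemma Rint_sq_le (A : set T) (f : T -> R) : measurable A -> (mu A < +oo)%E ->
  mu.-integrable setT (EFin \o f) -> mu.-integrable setT (fun x => (f x ^+ 2)%:E) ->
  (forall x, ~ A x -> f x = 0) ->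
  (\int[mu]_x f x) ^+ 2 <= fine (mu A) * \int[mu]_x f x ^+ 2.
Proof.
move=> mA muA if1 if2 fA.
set V := fine (mu A); set m := \int[mu]_x f x; set q := \int[mu]_x f x ^+ 2.
have V0 : 0 <= V by apply: fine_ge0.
have iA : mu.-integrable setT (EFin \o \1_A).
  apply/integrableP; split; first exact/measurable_EFinP.
  under eq_integral do rewrite /= ger0_norm//.
  by rewrite integral_indic// setIT.
have IA : \int[mu]_x \1_A x = V by rewrite /Rintegral integral_indic// setIT.
have key (a b : R) : 0 <= a ^+ 2 * q - 2 * a * b * m + b ^+ 2 * V.
  have a1 := integrable_ae_integrable if1; have a2 := integrable_ae_integrable if2.
  have a3 := integrable_ae_integrable iA.
  have : 0 <= \int[mu]_x (a * f x - b * \1_A x) ^+ 2.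
    by apply: Rintegral_ge0 => x _; exact: sqr_ge0.
  rewrite (@eq_Rintegral _ _ _ _ _ (fun x => a ^+ 2 * f x ^+ 2 + ((- (2 * a * b)) * f x + b ^+ 2 * \1_A x))).
    rewrite RintD//; [|exact: ae_integrableZ|by apply: ae_integrableD => //; exact: ae_integrableZ].
    rewrite RintD//; [|exact: ae_integrableZ..].
    by rewrite !RintZ// IA mulNr addrA.
  move=> x _; rewrite indicE; have [xA|xA] := boolP (x \in A).
    by rewrite /=; ring.
  rewrite fA; first by rewrite /=; ring.
  by move=> /mem_set; rewrite (negbTE xA).
have [V1|V1] := ltP 0 V.
  have := key V m.
  have -> : V ^+ 2 * q - 2 * V * m * m + m ^+ 2 * V = V * (V * q - m ^+ 2) by ring.
  by rewrite pmulr_rge0// subr_ge0.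
have {V1}V1 : V = 0 by apply/eqP; rewrite eq_le V1.
have q0 : 0 <= q by apply: Rintegral_ge0 => x _; exact: sqr_ge0.
have [q1|q1] := ltP 0 q.
  have := key m q; rewrite V1 mulr0 addr0.
  have -> : m ^+ 2 * q - 2 * m * q * m = q * (- m ^+ 2) by ring.
  by rewrite pmulr_rge0// mul0r oppr_ge0.
have {q0 q1}Q0 : q = 0 by apply/eqP; rewrite eq_le q1.
have := key 1 m; have := key 1 (- m); rewrite Q0 V1 => h1 h2; nra.
Qed.

End Rint_square.

Section product_sigma_finite.
Context d1 d2 (T1 : measurableType d1) (T2 : measurableType d2) (R : realType).
Variables (m1 : {sigma_finite_measure set T1 -> \bar R})
          (m2 : {sigma_finite_measure set T2 -> \bar R}).

(* An alias, because the library attaches to the product measure itself only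
   the structures it has for products of finite measures. *)
Definition sf_prod : set (T1 * T2) -> \bar R := (m1 \x m2)%E.

HB.instance Definition _ := Measure.copy sf_prod (m1 \x m2)%E.

Let prod_sigma_finite : sigma_finite setT sf_prod.
Proof.
have /sigma_finiteP[F [FT ndF Foo]] := sigma_finiteT m1.
have /sigma_finiteP[G [GT ndG Goo]] := sigma_finiteT m2.
exists (fun k => F k `*` G k).
  apply/seteqP; split => // -[x y] _.
  have [k _ Fk] : (\bigcup_k F k) x by rewrite -FT.
  have [l _ Gl] : (\bigcup_k G k) y by rewrite -GT.
  exists (maxn k l) => //; split => /=.
    by move: Fk; exact/subsetPset/ndF/leq_maxl.
  by move: Gl; exact/subsetPset/ndG/leq_maxr.
move=> k; have [mF Fk] := Foo k; have [mG Gk] := Goo k.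
split; first exact: measurableX.
by rewrite /sf_prod product_measure1E// lte_mul_pinfty// ge0_fin_numE.
Qed.

HB.instance Definition _ := Measure_isSigmaFinite.Build _ _ _ sf_prod
  prod_sigma_finite.

End product_sigma_finite.

(** * Dilations averaged over the centre and the time *)

Section dilation_operator.
Context {R : realType} {d : nat}.
Local Notation E := 'rV[R]_d.
Local Notation vol := (@lebesgue_row R d).
Local Notation leb := (@lebesgue_measure R).
Local Notation mR := (measurableTypeR R).
Variables (D : set E) (mD : measurable D) (volD : (vol D < +oo)%E).
Local Notation V := (fine (vol D)).

Definition vol_time : {sigma_finite_measure set (E * mR)%type -> \bar R} :=
  @sf_prod _ _ E mR R vol leb.

Definition dil (x : E) (p : E * mR) : E := p.1 + p.2 *: (x - p.1).

(** Restricting [x], the centre and the time through a factor lets all integrals run over the whole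
    space, where Tonelli's theorem applies directly. The time 0, at which the dilation is not
    invertible, is left out. *)
Definition cyl (x : E) (p : E * mR) : R :=
  \1_D x * (\1_D p.1 * \1_(`]0, 1]%classic : set mR) p.2).

Lemma measurable_dil : measurable_fun setT (fun q : E * (E * mR) => dil q.1 q.2).
Proof.
apply: measurable_fun_row => // i.
rewrite (_ : (fun _ => _) = fun q : E * (E * mR) =>
   q.2.1 ord0 i + q.2.2 * (q.1 ord0 i - q.2.1 ord0 i)); last first.
  by apply/funext => q; rewrite !mxE.
have m1 : measurable_fun setT (fun q : E * (E * mR) => q.1 ord0 i).
  exact: (measurableT_comp (measurable_coord i) measurable_fst).
have m21 : measurable_fun setT (fun q : E * (E * mR) => q.2.1 ord0 i).
  apply: (measurableT_comp (measurable_coord i)).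
  exact: (measurableT_comp measurable_fst measurable_snd).
have m22 : measurable_fun setT (fun q : E * (E * mR) => q.2.2 : R).
  exact: (measurableT_comp measurable_snd measurable_snd).
apply: measurable_funD => //; apply: measurable_funM => //.
exact: measurable_funB.
Qed.

Lemma measurable_cyl : measurable_fun setT (fun q : E * (E * mR) => cyl q.1 q.2).
Proof.
apply: measurable_funM.
  exact: (measurableT_comp (measurable_indic mD) measurable_fst).
apply: measurable_funM.
  apply: (measurableT_comp (measurable_indic mD)).
  exact: (measurableT_comp measurable_fst measurable_snd).
apply: (@measurableT_comp _ _ _ _ _ _ (\1_(`]0, 1]%classic : set mR) : mR -> R)).
  by apply: measurable_indic; exact: measurable_itv.
exact: (measurableT_comp measurable_snd measurable_snd).
Qed.

Lemma cyl_ge0 x p : 0 <= cyl x p.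
Proof. by rewrite /cyl !mulr_ge0. Qed.

Lemma dilE x y (t : R) : dil x (y, t) = t *: x + (1 - t) *: y.
Proof. by rewrite /dil/= scalerBr scalerBl scale1r addrCA. Qed.

Section nonneg_bound.
Variable f : E -> \bar R.
Hypotheses (mf : measurable_fun setT f) (f0 : forall x, (0 <= f x)%E).

Lemma dil_slice_bound (t : R) : 0 <= t <= 1 ->
  (\int[vol]_y \int[vol]_x ((\1_D x * \1_D y)%:E * f (dil x (y, t))) <=
   (2 ^+ d * V)%:E * \int[vol]_x f x)%E.
Proof.
move=> /andP[t0 t1].
have I0 : (0 <= \int[vol]_x f x)%E by exact: integral_ge0.
have VE : (V%:E = vol D)%E by rewrite fineK// ge0_fin_numE.
have main (u : R) (g : E -> E) : 2^-1 <= u ->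
   (\int[vol]_y \int[vol]_x ((\1_D x * \1_D y)%:E * f (u *: x + g y)%R) <=
   (2 ^+ d * V)%:E * \int[vol]_x f x)%E.
  move=> u2; have u0 : 0 < u by lra.
  apply: (@le_trans _ _ (\int[vol]_y ((\1_D y)%:E * ((2 ^+ d)%:E * \int[vol]_x f x)))%E).
    apply: ge0_le_integral_gen => y.
      by apply: integral_ge0 => x _; rewrite mule_ge0// lee_fin mulr_ge0.
    rewrite [(\1_D y : R)]indicE; have [yD|yD] := boolP (y \in D); last first.
      rewrite mul0e le_eqVlt; apply/orP; left; apply/eqP.
      by apply: integral0_eq => x _; rewrite mulr0 mul0e.
    rewrite mul1e; apply: (@le_trans _ _ (\int[vol]_x f (u *: x + g y)%R)%E).
      apply: ge0_le_integral_gen => x.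
        by rewrite mule_ge0// lee_fin mulr_ge0.
      rewrite -[leRHS]mul1e; apply: lee_wpmul2r => //.
      by rewrite lee_fin mulr1 indicE; case: (_ \in _).
    rewrite ge0_integral_affine//; apply: lee_wpmul2r => //.
    by rewrite lee_fin -exprVn lerXn2r ?nnegrE ?invr_ge0 ?(ltW u0)// invf_ple// posrE.
  rewrite ge0_integralZr//;
    try (by apply/measurable_EFinP; exact: measurable_indic);
    try (by move=> x _; rewrite lee_fin); try (by rewrite mule_ge0// lee_fin exprn_ge0).
  by rewrite integral_indic// setIT EFinM VE muleA [(vol D * _)%E]muleC.
have [t2|t2] := leP 2^-1 t.
  under eq_integral => y _ do under eq_integral => x _ do rewrite dilE.
  exact: (main t (fun y => (1 - t) *: y)).
have u2 : 2^-1 <= 1 - t by lra.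
pose F (q : E * E) := ((\1_D q.2 * \1_D q.1)%:E * f (dil q.2 (q.1, t)))%E.
have mdilt : measurable_fun setT (fun q : E * E => dil q.2 (q.1, t)).
  apply: measurable_fun_row => // i.
  rewrite (_ : (fun _ => _) = fun q : E * E =>
     q.1 ord0 i + t * (q.2 ord0 i - q.1 ord0 i)); last first.
    by apply/funext => q; rewrite !mxE.
  have m1 : measurable_fun setT (fun q : E * E => q.1 ord0 i).
    exact: (measurableT_comp (measurable_coord i) measurable_fst).
  have m2 : measurable_fun setT (fun q : E * E => q.2 ord0 i).
    exact: (measurableT_comp (measurable_coord i) measurable_snd).
  by apply: measurable_funD => //; apply: measurable_funM => //; exact: measurable_funB.
have mF : measurable_fun setT F.
  apply: emeasurable_funM; last exact: measurableT_comp.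
  apply/measurable_EFinP; apply: measurable_funM.
    exact: (measurableT_comp (measurable_indic mD) measurable_snd).
  exact: (measurableT_comp (measurable_indic mD) measurable_fst).
have F0 q : (0 <= F q)%E by rewrite mule_ge0// lee_fin mulr_ge0.
rewrite (@fubini_tonelli _ _ _ _ _ vol vol F mF F0).
apply: le_trans (main (1 - t) (fun x => t *: x) u2).
apply: ge0_le_integral_gen => x; first by apply: integral_ge0 => y _; exact: F0.
apply: ge0_le_integral_gen => y; first exact: F0.
by rewrite /F/= dilE [t *: _ + _]addrC [(\1_D x : R) * _]mulrC.
Qed.

Lemma dil_bound :
  (\int[vol]_x \int[vol_time]_p ((cyl x p)%:E * f (dil x p)) <=
   (2 ^+ d * V)%:E * \int[vol]_x f x)%E.
Proof.
pose F (q : E * (E * mR)) := ((cyl q.1 q.2)%:E * f (dil q.1 q.2))%E.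
have mF : measurable_fun setT F.
  apply: emeasurable_funM; last exact: (measurableT_comp mf measurable_dil).
  by apply/measurable_EFinP; exact: measurable_cyl.
have F0 q : (0 <= F q)%E by rewrite mule_ge0// lee_fin cyl_ge0.
rewrite (@fubini_tonelli _ _ _ _ _ vol vol_time F mF F0).
pose G p := (\int[vol]_x F (x, p))%E.
have mG : measurable_fun setT G by exact: measurable_fun_fubini_tonelli_G.
have G0 p : (0 <= G p)%E by exact: integral_ge0.
have := @fubini_tonelli2 _ _ _ _ _ vol leb G mG G0; rewrite /G /= => ->.
pose C := ((2 ^+ d * V)%:E * \int[vol]_x f x)%E.
have C0 : (0 <= C)%E.
  by rewrite mule_ge0 ?integral_ge0// lee_fin mulr_ge0 ?exprn_ge0// fine_ge0.
apply: (@le_trans _ _ (\int[leb]_t ((\1_(`]0, 1]%classic : set mR) t)%:E * C))%E).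
  apply: ge0_le_integral_gen => t; first by apply: integral_ge0 => y _; apply: integral_ge0.
  rewrite [X in (X%:E * C)%E]indicE; have [t01|t01] := boolP (t \in (`]0, 1]%classic : set mR)); last first.
    rewrite mul0e le_eqVlt; apply/orP; left; apply/eqP.
    apply: integral0_eq => y _; apply: integral0_eq => x _.
    by rewrite /F /cyl/= [X in _ * (_ * X)]indicE (negbTE t01) !mulr0 mul0e.
  rewrite mul1e; apply: le_trans (dil_slice_bound (t := t) _); last first.
    by move: t01; rewrite inE /= in_itv/= => /andP[/ltW -> ->].
  apply: ge0_le_integral_gen => y; first exact: integral_ge0.
  apply: ge0_le_integral_gen => x; first exact: F0.
  by rewrite /F /cyl/= [X in _ * (_ * X)]indicE t01 mulr1.
rewrite ge0_integralZr//;
  try (by apply/measurable_EFinP; apply: measurable_indic; exact: measurable_itv);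
  try (by move=> x _; rewrite lee_fin).
rewrite integral_indic//= setIT.
by rewrite lebesgue_measure_itv/= lte_fin ltr01 -EFinB subr0 mul1e.
Qed.

End nonneg_bound.
End dilation_operator.

(** * Fubini's theorem for real-valued integrals *)

Section real_fubini.
Context d1 d2 (T1 : measurableType d1) (T2 : measurableType d2) (R : realType).
Variables (m1 : {sigma_finite_measure set T1 -> \bar R})
          (m2 : {sigma_finite_measure set T2 -> \bar R}).
Variable f : T1 * T2 -> R.
Hypothesis fi : (m1 \x m2)%E.-integrable setT (EFin \o f).

Lemma slice1_integrable_ae :
  {ae m1, forall x, m2.-integrable setT (fun y => (f (x, y))%:E)}.
Proof. exact: (ae_integrable1 fi). Qed.

Lemma slice2_integrable_ae :
  {ae m2, forall y, m1.-integrable setT (fun x => (f (x, y))%:E)}.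
Proof. exact: (ae_integrable2 fi). Qed.

Let FE : {ae m1, forall x, (fubini_F m2 (EFin \o f) x = (\int[m2]_y f (x, y))%:E)}.
Proof.
apply: filterS slice1_integrable_ae => x xi.
by rewrite /fubini_F /Rintegral fineK//; exact: integrable_fin_num.
Qed.

Let GE : {ae m2, forall y, (fubini_G m1 (EFin \o f) y = (\int[m1]_x f (x, y))%:E)}.
Proof.
apply: filterS slice2_integrable_ae => x xi.
by rewrite /fubini_G /Rintegral fineK//; exact: integrable_fin_num.
Qed.

Lemma Rint_slice1_integrable : m1.-integrable setT (fun x => (\int[m2]_y f (x, y))%:E).
Proof.
have iF := integrable_fubini_F fi; have /integrableP[mF _] := iF.
apply: le_integrable iF => //.
  exact/measurable_EFinP/(measurableT_comp (fine_measurable measurableT) mF).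
by move=> x _; rewrite /Rintegral -/(fubini_F m2 (EFin \o f) x); case: (fubini_F _ _ x) => //=; rewrite ?normr0 ?leey// lexx.
Qed.

Lemma Rint_slice2_integrable : m2.-integrable setT (fun y => (\int[m1]_x f (x, y))%:E).
Proof.
have [mf _] : measurable_fun setT (EFin \o f) /\ True by case/integrableP: fi.
have mG := measurable_fubini_G fi.
apply/integrableP; split.
  exact/measurable_EFinP/(measurableT_comp (fine_measurable measurableT) mG).
apply: (@le_lt_trans _ _ (\int[m2]_y \int[m1]_x `|(f (x, y))%:E|)%E); last first.
  by have := (@integrable21ltyP _ _ _ _ _ m1 m2 _ mf).1 fi; apply.
apply: ge0_le_integral_gen => y //.
apply: (@le_trans _ _ (`|fubini_G m1 (EFin \o f) y|)%E).
  rewrite /Rintegral -/(fubini_G m1 (EFin \o f) y).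
  by case: (fubini_G _ _ y) => //=; rewrite ?normr0 ?leey// lexx.
by apply: le_abse_integral => //; exact: (measurableT_comp mf (measurable_pair2 y)).
Qed.

Lemma Rint_slice1 : \int[m1]_x \int[m2]_y f (x, y) = \int[(m1 \x m2)%E]_q f q.
Proof.
rewrite [RHS]/Rintegral -(integral12_prod_meas1 fi) [LHS]/Rintegral; congr fine.
apply: ae_eq_integral_gen; apply: filterS FE => x E _.
by rewrite E.
Qed.

Lemma Rint_slice2 : \int[m2]_y \int[m1]_x f (x, y) = \int[(m1 \x m2)%E]_q f q.
Proof.
rewrite [RHS]/Rintegral -(integral21_prod_meas1 fi) [LHS]/Rintegral; congr fine.
apply: ae_eq_integral_gen; apply: filterS GE => x E _.
by rewrite E.
Qed.

End real_fubini.

(** * Integral operators with square integrable kernels *)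

Section square_integrable_kernel.
Context d1 d2 (T1 : measurableType d1) (T2 : measurableType d2) (R : realType).
Variables (m1 : {sigma_finite_measure set T1 -> \bar R})
          (m2 : {sigma_finite_measure set T2 -> \bar R}).
Local Notation mm := (m1 \x m2)%E.
Variables (A : set T1) (B : set T2) (k : T1 -> T2 -> R) (C : R).
Hypotheses (mA : measurable A) (mB : measurable B)
  (m1A : (m1 A < +oo)%E) (m2B : (m2 B < +oo)%E).
Hypothesis mk : measurable_fun setT (fun q : T1 * T2 => k q.1 q.2).
Hypothesis kA : forall x y, ~ (A x /\ B y) -> k x y = 0.
Hypothesis kC : (\int[m1]_x \int[m2]_y (k x y ^+ 2)%:E <= C%:E)%E.

Lemma kernel_sq_integrable : mm.-integrable setT (fun q => (k q.1 q.2 ^+ 2)%:E).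
Proof.
have mk2 : measurable_fun setT (fun q : T1 * T2 => (k q.1 q.2 ^+ 2)%:E).
  by apply/measurable_EFinP; exact: measurable_funX.
apply/(@integrable12ltyP _ _ _ _ _ m1 m2 _ mk2); apply: le_lt_trans (ltry C).
apply: le_trans kC; apply: ge0_le_integral_gen => x; first exact: integral_ge0.
by apply: ge0_le_integral_gen => y //; rewrite /= ger0_norm ?sqr_ge0.
Qed.

(** On the product of [A] and [B], of finite measure, [|k| <= 1 + k^2]; elsewhere the kernel
    vanishes. *)
Lemma kernel_integrable : mm.-integrable setT (fun q => (k q.1 q.2)%:E).
Proof.
have mAB : measurable (A `*` B) by exact: measurableX.
have iAB : mm.-integrable setT (EFin \o \1_(A `*` B)).
  apply/integrableP; split; first exact/measurable_EFinP/measurable_indic.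
  under eq_integral do rewrite /= ger0_norm//.
  rewrite integral_indic// setIT (_ : _ (_ `*` _) = (m1 A * m2 B)%E); last exact: product_measure1E.
  by rewrite lte_mul_pinfty// ge0_fin_numE.
apply: (@le_integrable _ _ _ mm _ measurableT _ (fun q => (\1_(A `*` B) q)%:E + (k q.1 q.2 ^+ 2)%:E)%E).
- exact/measurable_EFinP.
- move=> [x y] _; rewrite -EFinD/= lee_fin [leRHS]ger0_norm ?addr_ge0 ?sqr_ge0//.
  rewrite indicE; case: (boolP (_ \in _)) => [_|/negP AB].
    have := sqr_ge0 (`|k x y| - 1); have := sqr_ge0 (k x y); rewrite sqrrB1 real_normK ?num_real// /=; lra.
  by rewrite kA ?normr0 ?expr0n ?addr0// => ABq; apply: AB; rewrite inE.
- exact: integrableD iAB kernel_sq_integrable.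
Qed.

Lemma measurable_kernel_int : measurable_fun setT (fun x => \int[m2]_y k x y).
Proof. by have /integrableP[/measurable_EFinP] := Rint_slice1_integrable kernel_integrable. Qed.

Lemma kernel_int_sq_le :
  {ae m1, forall x, (\int[m2]_y k x y) ^+ 2 <= fine (m2 B) * \int[m2]_y k x y ^+ 2}.
Proof.
apply: filterS2 (slice1_integrable_ae kernel_integrable) (slice1_integrable_ae kernel_sq_integrable) => x k1 k2.
by apply: Rint_sq_le => // y nB; apply: kA => -[].
Qed.

Let iV : ae_integrable m1 setT (fun x => fine (m2 B) * \int[m2]_y k x y ^+ 2).
Proof.
by apply: ae_integrableZ => //; exact: integrable_ae_integrable (Rint_slice1_integrable kernel_sq_integrable).
Qed.

Lemma kernel_int_sq_integrable : m1.-integrable setT (fun x => ((\int[m2]_y k x y) ^+ 2)%:E).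
Proof.
have m2k : measurable_fun setT (fun x => (\int[m2]_y k x y) ^+ 2).
  by apply: measurable_funX; exact: measurable_kernel_int.
have [h Eh ih] : ae_integrable m1 setT (fun x => (\int[m2]_y k x y) ^+ 2).
  apply: (ae_integrable_le measurableT (measurable_ae_measurable m1 m2k) _ iV).
  apply: filterS kernel_int_sq_le => x xk _; rewrite ger0_norm ?sqr_ge0//.
apply/integrableP; split; first exact/measurable_EFinP.
have /integrableP[_] := ih; suff -> : (\int[m1]_x `|((\int[m2]_y k x y) ^+ 2)%:E| = \int[m1]_x `|(h x)%:E|)%E by [].
by apply: ae_eq_integral_gen; apply: filterS Eh => x E0 _; rewrite E0.
Qed.

Lemma kernel_int_sq_bound : \int[m1]_x (\int[m2]_y k x y) ^+ 2 <= fine (m2 B) * C.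
Proof.
have ik := integrable_ae_integrable (Rint_slice1_integrable kernel_sq_integrable).
apply: (@le_trans _ _ (\int[m1]_x (fine (m2 B) * \int[m2]_y k x y ^+ 2))).
  apply: le_Rint => //; last by apply: filterS kernel_int_sq_le => x xk _.
  exact: integrable_ae_integrable kernel_int_sq_integrable.
rewrite RintZ// ler_wpM2l ?fine_ge0//.
rewrite -lee_fin; apply: le_trans kC.
rewrite -(ae_integrable_fin_EFin measurableT ik).
apply: ge0_le_integral_gen => x; first by rewrite lee_fin Rintegral_ge0// => y _; exact: sqr_ge0.
rewrite /Rintegral; set I := (\int[m2]_y _)%E.
have : (0 <= I)%E by apply: integral_ge0 => y _; rewrite lee_fin sqr_ge0.
by case: I => [r|_|]//; rewrite /= leey.
Qed.

End square_integrable_kernel.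

Section weighted_average.
Context {R : realType} {d : nat}.
Local Notation E := 'rV[R]_d.
Local Notation vol := (@lebesgue_row R d).
Local Notation leb := (@lebesgue_measure R).
Local Notation mR := (measurableTypeR R).
Local Notation volt := (@vol_time R d).
Local Notation mm := (vol \x volt)%E.
Variables (D : set E) (mD : measurable D) (volD : (vol D < +oo)%E).
Local Notation V := (fine (vol D)).

(** The averages over centres and times that occur are all of the form [avg z] for a weight [z];
    multiplication by a test function only changes the weight ([avg_mulr]). *)
Definition kern (z : E -> E * mR -> R) (f : E -> R) (x : E) (p : E * mR) : R :=
  cyl D x p * (z x p * f (dil x p)).

Definition avg z f (x : E) : R := \int[volt]_p kern z f x p.

Let slab : set (E * mR) := D `*` `]0, 1]%classic.

Let mslab : measurable slab.
Proof. by apply: measurableX => //; exact: measurable_itv. Qed.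

Let volt_slab : volt slab = vol D.
Proof.
rewrite [LHS](_ : _ = (vol \x leb)%E slab)// product_measure1E//=.
by rewrite lebesgue_measure_itv/= lte_fin ltr01 -EFinB subr0 mule1.
Qed.

Let cylE x p : cyl D x p = \1_(D `*` slab) (x, p).
Proof.
rewrite /cyl !indicE -!natrM !mulnb; congr (nat_of_bool _)%:R.
apply/and3P/idP; rewrite !inE; first by move=> [xD pD p1]; split => //; split; rewrite ?inE.
by move=> [/= xD [pD p1]]; split.
Qed.

Lemma cyl0 x p : ~ slab p -> cyl D x p = 0.
Proof. by move=> np; rewrite cylE indicE; case: (boolP (_ \in _)) => //; rewrite inE => -[]. Qed.

Lemma avg_out z f x : ~ D x -> avg z f x = 0.
Proof.
move=> nD; rewrite /avg /Rintegral integral0_eq// => p _.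
by rewrite /kern /cyl indicE; case: (boolP (_ \in _)); rewrite ?inE// !mul0r.
Qed.

Section bound.
Variables (z : E -> E * mR -> R) (M : R) (f : E -> R).
Hypotheses (mz : measurable_fun setT (fun q : E * (E * mR) => z q.1 q.2)).
Hypothesis (zM : forall x p, D x -> slab p -> `|z x p| <= M).
Hypotheses (mf : measurable_fun setT f)
           (f2 : vol.-integrable setT (fun x => (f x ^+ 2)%:E)).

Lemma measurable_kern : measurable_fun setT (fun q : E * (E * mR) => kern z f q.1 q.2).
Proof.
apply: measurable_funM; first exact: measurable_cyl.
by apply: measurable_funM => //; exact: (measurableT_comp mf measurable_dil).
Qed.

Lemma kern_sq_le x p : kern z f x p ^+ 2 <= M ^+ 2 * (cyl D x p * f (dil x p) ^+ 2).
Proof.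
rewrite /kern cylE indicE; case: (boolP (_ \in _)); last first.
  by rewrite /= !mul0r mulr0 expr0n.
rewrite inE => -[/= Dx sp]; rewrite !mul1r exprMn ler_wpM2r ?sqr_ge0//.
by rewrite -[leLHS]real_normK ?num_real// lerXn2r ?nnegrE ?zM// (le_trans _ (zM Dx sp)).
Qed.

Let C := M ^+ 2 * (2 ^+ d * V).

Lemma kern_sq_bound : (\int[vol]_x \int[volt]_p (kern z f x p ^+ 2)%:E <=
  C%:E * \int[vol]_x (f x ^+ 2)%:E)%E.
Proof.
have mf2 : measurable_fun setT (fun x => (f x ^+ 2)%:E) by case/integrableP: f2.
apply: (@le_trans _ _ (\int[vol]_x \int[volt]_p ((M ^+ 2)%:E * ((cyl D x p)%:E * (f (dil x p) ^+ 2)%:E)))%E).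
  apply: ge0_le_integral_gen => x; first by apply: integral_ge0 => p _; rewrite lee_fin sqr_ge0.
  apply: ge0_le_integral_gen => p; first by rewrite lee_fin sqr_ge0.
  by rewrite -!EFinM lee_fin kern_sq_le.
have := dil_bound mD volD mf2 (fun x => _ : (0 <= (f x ^+ 2)%:E)%E).
have h x : (0 <= (f x ^+ 2)%:E)%E by rewrite lee_fin sqr_ge0.
move=> /(_ h) {h} db.
have mF : measurable_fun setT (fun q : E * (E * mR) => ((cyl D q.1 q.2)%:E * (f (dil q.1 q.2) ^+ 2)%:E)%E).
  apply: emeasurable_funM; first by apply/measurable_EFinP; exact: measurable_cyl.
  exact: (measurableT_comp mf2 measurable_dil).
have F0 q : (0 <= (cyl D q.1 q.2)%:E * (f (dil q.1 q.2) ^+ 2)%:E)%E.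
  by rewrite mule_ge0// lee_fin ?cyl_ge0 ?sqr_ge0.
rewrite (eq_integral (fun x => (M ^+ 2)%:E * \int[volt]_p ((cyl D x p)%:E * (f (dil x p) ^+ 2)%:E))%E); last first.
  move=> x _; rewrite ge0_integralZl// ?lee_fin ?sqr_ge0//.
    exact: (measurableT_comp mF (measurable_pair1 x)).
  by move=> p _; exact: (F0 (x, p)).
rewrite ge0_integralZl// ?lee_fin ?sqr_ge0//; last first.
- by move=> x _; apply: integral_ge0 => p _; exact: (F0 (x, p)).
- exact: (@measurable_fun_fubini_tonelli_F _ _ _ _ _ volt _ mF F0).
rewrite (_ : C%:E = (M ^+ 2)%:E * (2 ^+ d * V)%:E)%E// -muleA.
by apply: lee_wpmul2l => //; rewrite lee_fin sqr_ge0.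
Qed.

Let kern0 x p : ~ (D x /\ slab p) -> kern z f x p = 0.
Proof.
move=> h; rewrite /kern cylE indicE; case: (boolP (_ \in _)); last by rewrite mul0r.
by rewrite inE => -[? ?]; case: h.
Qed.

Let volt_slab_fin : (volt slab < +oo)%E.
Proof. by rewrite volt_slab. Qed.

Let int_f2 : (\int[vol]_x (f x ^+ 2)%:E)%E = (\int[vol]_x f x ^+ 2)%:E.
Proof. by rewrite /Rintegral fineK//; exact: integrable_fin_num. Qed.

Let kb : (\int[vol]_x \int[volt]_p (kern z f x p ^+ 2)%:E <=
  (C * \int[vol]_x f x ^+ 2)%:E)%E.
Proof. by rewrite EFinM -int_f2; exact: kern_sq_bound. Qed.

Lemma kern_integrable : mm.-integrable setT (fun q => (kern z f q.1 q.2)%:E).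
Proof. exact: (@kernel_integrable _ _ _ _ _ vol volt D slab (kern z f) _ mD mslab volD volt_slab_fin measurable_kern kern0 kb). Qed.

Lemma measurable_avg : measurable_fun setT (avg z f).
Proof. exact: (@measurable_kernel_int _ _ _ _ _ vol volt D slab (kern z f) _ mD mslab volD volt_slab_fin measurable_kern kern0 kb). Qed.

Lemma avg_sq_integrable : vol.-integrable setT (fun x => (avg z f x ^+ 2)%:E).
Proof. exact: (@kernel_int_sq_integrable _ _ _ _ _ vol volt D slab (kern z f) _ mD mslab volD volt_slab_fin measurable_kern kern0 kb). Qed.

Lemma avg_bound : \int[vol]_x avg z f x ^+ 2 <= V * (C * \int[vol]_x f x ^+ 2).
Proof.
have := @kernel_int_sq_bound _ _ _ _ _ vol volt D slab (kern z f) _ mD mslab volD volt_slab_fin measurable_kern kern0 kb.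
by rewrite volt_slab.
Qed.

Lemma Rint_avg : \int[vol]_x avg z f x = \int[volt]_p \int[vol]_x kern z f x p.
Proof. by rewrite (Rint_slice1 kern_integrable) -(Rint_slice2 kern_integrable). Qed.

Lemma avg_integrable : vol.-integrable setT (EFin \o avg z f).
Proof. exact: Rint_slice1_integrable kern_integrable. Qed.

Lemma kern_slice2_integrable : volt.-integrable setT (fun p => (\int[vol]_x kern z f x p)%:E).
Proof. exact: Rint_slice2_integrable kern_integrable. Qed.

End bound.

(** Only almost everywhere: additivity at [x] needs the slices of the kernels at [x] to be
    integrable, which Fubini's theorem gives for almost every [x]. *)
Lemma avg_lin (z : E -> E * mR -> R) (M c : R) (f g : E -> R) :
  measurable_fun setT (fun q : E * (E * mR) => z q.1 q.2) ->
  (forall x p, D x -> slab p -> `|z x p| <= M) ->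
  measurable_fun setT f -> vol.-integrable setT (fun x => (f x ^+ 2)%:E) ->
  measurable_fun setT g -> vol.-integrable setT (fun x => (g x ^+ 2)%:E) ->
  {ae vol, forall x, avg z (fun x => c * f x + g x) x = c * avg z f x + avg z g x}.
Proof.
move=> mz zM mf f2 mg g2.
apply: filterS2 (slice1_integrable_ae (kern_integrable mz zM mf f2))
  (slice1_integrable_ae (kern_integrable mz zM mg g2)) => x.
move=> /integrable_ae_integrable fi /integrable_ae_integrable gi.
rewrite /avg -RintZ// -RintD//; last exact: ae_integrableZ.
by apply: eq_Rintegral => p _; rewrite /kern; ring.
Qed.

Lemma avg_mulr (z : E -> E * mR -> R) (M : R) (f th : E -> R) :
  measurable_fun setT (fun q : E * (E * mR) => z q.1 q.2) ->
  (forall x p, D x -> slab p -> `|z x p| <= M) ->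
  measurable_fun setT f -> vol.-integrable setT (fun x => (f x ^+ 2)%:E) ->
  {ae vol, forall x, avg z f x * th x = avg (fun x p => z x p * th x) f x}.
Proof.
move=> mz zM mf f2.
apply: filterS (slice1_integrable_ae (kern_integrable mz zM mf f2)) => x.
move=> /integrable_ae_integrable fi.
rewrite /avg mulrC -RintZ//.
by apply: eq_Rintegral => p _; rewrite /kern; ring.
Qed.

End weighted_average.

(** * Derivatives along dilations *)

Section dilation_derivative.
Context {R : realType} {d : nat}.
Local Notation E := 'rV[R]_d.
Local Notation leb := (@lebesgue_measure R).
Variables (theta : E -> R) (stheta : smooth theta) (a : nat) (y : E).

Lemma smooth_sum I (s : seq I) (F : I -> E -> R) : (forall i, smooth (F i)) ->
  smooth (fun x => \sum_(i <- s) F i x).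
Proof.
move=> sF; elim: s => [|i s IHs].
  rewrite (_ : (fun _ => _) = cst 0); first exact: smooth_cst.
  by apply/funext => x; rewrite big_nil.
rewrite (_ : (fun _ => _) = fun x => F i x + \sum_(i <- s) F i x); first exact: smoothD.
by apply/funext => x; rewrite big_cons.
Qed.

(** Euler's operator [a + (x - y) . grad], the generator of the dilations centred at [y]; the
    exponent [a] matches the power of [t] in [is_derive_shrink]. *)
Definition euler (x : E) : R :=
  a%:R * theta x + \sum_k (x ord0 k - y ord0 k) * partial k theta x.

(** The inverse of [x |-> dil x (y, t)] for [t != 0]: it appears when a dilation is moved from the
    integrand to the test function. *)
Definition shrink (t : R) (z : E) : E := y + t^-1 *: (z - y).

Lemma continuous_shrink_comp (f : E -> R) (z : E) (t : R) : t != 0 -> continuous f ->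
  {for t, continuous (fun t => f (shrink t z))}.
Proof.
move=> t0 cf; apply: (@continuous_comp _ _ _ (fun t => shrink t z) f); last exact: cf.
apply: cvgD; first exact: cvg_cst.
by apply: cvgZr_tmp; apply: continuousV => //; exact: cvg_id.
Qed.

Lemma is_derive_shrink (z : E) (t : R) : t != 0 ->
  is_derive t 1 (fun t => - (t^-1 ^+ a * theta (shrink t z)))
    (t^-1 ^+ a.+1 * euler (shrink t z)).
Proof.
move=> t0.
have dV : is_derive t 1 (fun t : R => t^-1) (- t ^- 2).
  have := @is_deriveV _ id t 1 1 t0 (is_derive_id _ _).
  by rewrite (_ : (- t ^- 2)%:A = - t ^- 2)//; exact: mulr1.
have dl := @is_derive_line _ _ theta y (z - y) t^-1 (smooth_differentiable _ stheta).
have dc := is_derive1_comp dl dV.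
have dX := is_deriveX a dV.
have := is_deriveN (is_deriveM dX dc).
rewrite derive_row; last exact: smooth_differentiable.
have pw (n : nat) (s : R) : (([eta GRing.inv] : R -> R) ^+ n) s = s^-1 ^+ n.
  by elim: n => [|n IHn]; rewrite ?expr0// !exprS -IHn.
rewrite (_ : - (_ * _) = fun s : R => - (s^-1 ^+ a * theta (shrink s z))); last first.
  by apply/funext => s; rewrite -pw.
move=> h; apply: (is_derive_eq h); rewrite pw /euler /=.
rewrite -[y + _]/(shrink t z).
have -> : \sum_k (shrink t z ord0 k - y ord0 k) * partial k theta (shrink t z) =
    t^-1 * \sum_i (z - y) ord0 i * partial i theta (shrink t z).
  by rewrite mulr_sumr; apply: eq_bigr => k _; rewrite !mxE; ring.
set S := \sum_i _; set th := theta _; rewrite -exprVn; set u := t^-1.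
rewrite -[_ *: (S * _)]/(_ * (S * _)) -[th *: _]/(th * (_ * _)).
by case: a => [|n]; rewrite /= !exprS; ring.
Qed.

Lemma continuous_euler : continuous euler.
Proof.
apply: smooth_continuous; apply: smoothD; first exact: smoothZ.
apply: smooth_sum => k; apply: smoothM; last exact: smooth_partial.
by apply: smoothB; [exact: smooth_coord|exact: smooth_cst].
Qed.

Lemma euler_FTC (z : E) (tau : R) : 0 < tau < 1 ->
  \int[leb]_(t in `[tau, 1]) (t^-1 ^+ a.+1 * euler (shrink t z)) =
  tau^-1 ^+ a * theta (shrink tau z) - theta z.
Proof.
move=> /andP[tau0 tau1].
have nz t : tau <= t -> t != 0 by move=> h; rewrite gt_eqF// (lt_le_trans tau0).
have dF t : tau <= t -> _ := fun h => is_derive_shrink z (nz t h).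
pose F t := - (t^-1 ^+ a * theta (shrink t z)).
have cF t : tau <= t -> {for t, continuous F}.
  by move=> h; apply/differentiable_continuous/derivable1_diffP; have [] := dF t h.
rewrite /Rintegral (@continuous_FTC2 _ _ F)//.
- rewrite /F /= invr1 expr1n mul1r (_ : shrink 1 z = z) ?opprK 1?addrC//.
  by rewrite /shrink invr1 scale1r addrC subrK.
- apply: continuous_in_subspaceT => t; rewrite inE/= in_itv/= => /andP[h _].
  apply: cvgM.
    apply: (@continuous_comp _ _ _ (fun t : R => t^-1) (fun s => s ^+ a.+1)); last exact: exprn_continuous.
    exact: inv_continuous (nz t h).
  by apply: continuous_shrink_comp; [exact: nz|exact: continuous_euler].
- split.
  + by move=> t; rewrite in_itv/= => /andP[/ltW h _]; have [] := dF t h.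
  + by apply: cvg_at_right_filter; exact: cF.
  + by apply: cvg_at_left_filter; apply: cF; exact: ltW.
- move=> t; rewrite in_itv/= => /andP[/ltW h _]; rewrite derive1E.
  by have /@derive_val := dF t h.
Qed.

End dilation_derivative.

Section integrable_products.
Context d (T : measurableType d) (R : realType) (mu : {measure set T -> \bar R}).

Lemma integrable_bounded_mul (f h : T -> R) (M : R) : mu.-integrable setT (EFin \o f) ->
  measurable_fun setT h -> (forall x, `|h x| <= M) ->
  mu.-integrable setT (fun x => (f x * h x)%:E).
Proof.
move=> fi mh hM; have mf : measurable_fun setT f.
  by apply/measurable_EFinP; case/integrableP: fi.
apply: (@le_integrable _ _ _ mu _ measurableT _ (fun x => (M * f x)%:E)).
- by apply/measurable_EFinP; exact: measurable_funM.
- move=> x _; rewrite /= lee_fin !normrM mulrC ler_wpM2r//.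
  by rewrite (le_trans (hM x))// ler_norm.
- under eq_fun do rewrite EFinM.
  exact: integrableZl.
Qed.

Lemma ae_integrable_integrable (D : set T) (f : T -> R) : measurable D ->
  measurable_fun D f -> ae_integrable mu D f -> mu.-integrable D (EFin \o f).
Proof.
move=> mD mf [h Eh ih]; apply/integrableP; split; first exact/measurable_EFinP.
have /integrableP[_] := ih.
suff -> : (\int[mu]_(x in D) `|(EFin \o f) x| = \int[mu]_(x in D) `|(EFin \o h) x|)%E by [].
by apply: ae_eq_integral_gen; apply: filterS Eh => x E0 Dx; rewrite /= E0.
Qed.

Lemma Rint_indic_cvg (G : T -> R) (A : nat -> set T) : mu.-integrable setT (EFin \o G) ->
  (forall n, measurable (A n)) -> (forall x, G x != 0 -> \forall n \near \oo, A n x) ->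
  (\int[mu]_x (G x * \1_(A n) x)) @[n --> \oo] --> \int[mu]_x G x.
Proof.
move=> Gi mA GA; have mG : measurable_fun setT G by apply/measurable_EFinP; case/integrableP: Gi.
pose f_ n x := (G x * \1_(A n) x)%:E.
have mf n : measurable_fun setT (f_ n).
  by apply/measurable_EFinP; apply: measurable_funM => //; exact: measurable_indic.
have aG : mu.-integrable setT (fun x => `|G x|%:E) by exact: (integrable_norm Gi).
have cf : \forall x \ae mu, setT x -> f_ ^~ x @ \oo --> (G x)%:E.
  apply: aeW => x _; have [G0|G0] := eqVneq (G x) 0.
    rewrite (_ : f_ ^~ x = cst 0%E); first by rewrite G0; exact: cvg_cst.
    by apply/funext => n; rewrite /f_ G0 mul0r.
  apply: cvg_near_cst; apply: filterS (GA x G0) => n An.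
  by rewrite /f_ indicE mem_set// mulr1.
have bf : \forall x \ae mu, forall n, setT x -> (`|f_ n x| <= `|G x|%:E)%E.
  apply: aeW => x n _; rewrite /f_ /= lee_fin normrM ler_piMr// indicE.
  by case: (_ \in _); rewrite ?normr1 ?normr0.
have mG' : measurable_fun setT (EFin \o G) by exact/measurable_EFinP.
have [_ _ h] := dominated_convergence measurableT mf mG' cf aG bf.
have fin : (\int[mu]_x (EFin \o G) x)%E \is a fin_num by exact: integrable_fin_num.
by apply: fine_cvg; rewrite /Rintegral fineK.
Qed.

End integrable_products.

Section integrable_product_measure.
Context d1 d2 (T1 : measurableType d1) (T2 : measurableType d2) (R : realType).
Variables (m1 : {sigma_finite_measure set T1 -> \bar R})
          (m2 : {sigma_finite_measure set T2 -> \bar R}).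

Lemma integrable_prod_mul (f : T1 -> R) (g : T2 -> R) :
  m1.-integrable setT (EFin \o f) -> m2.-integrable setT (EFin \o g) ->
  (m1 \x m2)%E.-integrable setT (EFin \o (fun q : T1 * T2 => f q.1 * g q.2)).
Proof.
move=> /integrableP[/measurable_EFinP mf fi] /integrableP[/measurable_EFinP mg gi].
have mfg : measurable_fun setT (EFin \o (fun q : T1 * T2 => f q.1 * g q.2)).
  apply/measurable_EFinP; apply: measurable_funM.
    exact: (measurableT_comp mf measurable_fst).
  exact: (measurableT_comp mg measurable_snd).
apply/(@integrable12ltyP _ _ _ _ _ m1 m2 _ mfg).
have mag : measurable_fun setT (fun y => `|g y|%:E).
  by apply/measurable_EFinP; exact: (measurableT_comp (@normr_measurable _ setT)).
have maf : measurable_fun setT (fun y => `|f y|%:E).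
  by apply/measurable_EFinP; exact: (measurableT_comp (@normr_measurable _ setT)).
rewrite (eq_integral (fun x => `|f x|%:E * \int[m2]_y `|g y|%:E)%E); last first.
  move=> x _; rewrite -ge0_integralZl//; try (by move=> y _; rewrite lee_fin).
  by apply: eq_integral => y _; rewrite /= normrM EFinM.
rewrite ge0_integralZr//; try (by move=> y _; rewrite lee_fin);
  last by apply: integral_ge0 => y _; rewrite lee_fin.
rewrite lte_mul_pinfty//; first by apply: integral_ge0 => y _; rewrite lee_fin.
rewrite ge0_fin_numE//.
by apply: integral_ge0 => y _; rewrite lee_fin.
Qed.

End integrable_product_measure.

Section radial.
Context {R : realType} {d : nat}.
Local Notation E := 'rV[R]_d.
Local Notation vol := (@lebesgue_row R d).
Local Notation leb := (@lebesgue_measure R).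
Local Notation mR := (measurableTypeR R).

Lemma shrink_affine (y z : E) (t : R) : shrink y t z = t^-1 *: z + (y - t^-1 *: y).
Proof. by rewrite /shrink scalerBr addrCA. Qed.

Lemma shrink_dil (y x : E) (t : R) : t != 0 -> shrink y t (dil x (y, t)) = x.
Proof.
move=> t0; rewrite /shrink /dil /= (addrAC y) subrr add0r scalerA mulVf// scale1r.
by rewrite addrC subrK.
Qed.

Lemma dil_shrink (y x : E) (t : R) : t != 0 -> dil (shrink y t x) (y, t) = x.
Proof.
move=> t0; rewrite /shrink /dil /= (addrAC y) subrr add0r scalerA mulfV// scale1r.
by rewrite addrC subrK.
Qed.

Lemma Rint_dil (f h : E -> R) (y : E) (t : R) : 0 < t ->
  vol.-integrable setT (fun z => (f z * h (shrink y t z))%:E) ->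
  \int[vol]_x (f (dil x (y, t)) * h x) =
  t^-1 ^+ d * \int[vol]_z (f z * h (shrink y t z)).
Proof.
move=> t0 fi; rewrite exprVn.
rewrite -(@Rintegral_affine _ _ t ((1 - t) *: y) t0 _ fi).
by apply: eq_Rintegral => x _; rewrite -dilE shrink_dil// gt_eqF.
Qed.

Lemma test_shrink (D : set E) (th : E -> R) (y : E) (t : R) : 0 < t ->
  (forall x, D x -> D (dil x (y, t))) -> test_function D th ->
  test_function D (fun z => th (shrink y t z)).
Proof.
move=> t0 Dt tth; have t'0 : 0 < t^-1 by rewrite invr_gt0.
rewrite (_ : (fun _ => _) = fun z => th (t^-1 *: z + (y - t^-1 *: y))); last first.
  by apply/funext => z; rewrite shrink_affine.
apply: (@test_affine _ _ D D th t^-1 (y - t^-1 *: y) t'0 _ tth) => x; rewrite -shrink_affine => /Dt.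
by rewrite dil_shrink// gt_eqF.
Qed.

Lemma partial_shrink (th : E -> R) (y z : E) (t : R) (i : 'I_d) : smooth th ->
  partial i (fun z => th (shrink y t z)) z = t^-1 * partial i th (shrink y t z).
Proof.
move=> sth; rewrite (_ : (fun _ => _) = fun z => th (t^-1 *: z + (y - t^-1 *: y))); last first.
  by apply/funext => u; rewrite shrink_affine.
by rewrite partial_affine ?shrink_affine//; exact: smooth_differentiable.
Qed.

Definition moment (y : E) (k : 'I_d) (th : E -> R) (z : E) : R := th z * (z ord0 k - y ord0 k).

Lemma smooth_shift (y : E) (k : 'I_d) : smooth (fun z : E => z ord0 k - y ord0 k).
Proof. by apply: smoothB; [exact: smooth_coord|exact: smooth_cst]. Qed.

Lemma test_moment (D : set E) (th : E -> R) (y : E) (k : 'I_d) :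
  test_function D th -> test_function D (moment y k th).
Proof. by move=> tth; apply: testM => //; exact: smooth_shift. Qed.

Lemma partial_moment (th : E -> R) (y z : E) (i k : 'I_d) : smooth th ->
  partial i (moment y k th) z =
  (i == k)%:R * th z + (z ord0 k - y ord0 k) * partial i th z.
Proof.
move=> sth; rewrite /moment partialM; [|exact: smooth_differentiable|exact: smooth_differentiable (smooth_shift _ _)].
rewrite (_ : partial i (fun z : E => z ord0 k - y ord0 k) z = (i == k)%:R); first by ring.
have -> : (fun z : E => z ord0 k - y ord0 k) = fun z : E => z ord0 k + cst (- y ord0 k) z by [].
rewrite partialD ?partial_coord ?partial_cst ?addr0//.
exact: smooth_differentiable (smooth_coord _).
Qed.

(** Puts Euler's operator in divergence form, [div ((x - y) th) + (a - d) th], so that it can be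
    paired with functions that only have weak derivatives. *)
Lemma euler_moment (a : nat) (th : E -> R) (y x : E) : smooth th ->
  euler th a y x = a%:R * th x + \sum_k (partial k (moment y k th) x - th x).
Proof.
move=> sth; congr (_ + _); apply: eq_bigr => k _.
by rewrite partial_moment// eqxx mul1r (addrC (th x)) addrK.
Qed.

Section test_sums.
Variables (D : set E).

Lemma testD (f g : E -> R) : test_function D f -> test_function D g ->
  test_function D (fun x => f x + g x).
Proof.
move=> tf tg.
have [K [cK KD K0]] := test_support tf; have [L [cL LD L0]] := test_support tg.
apply: (compact_support_test (K := K `|` L)).
- by apply: smoothD; [exact: test_smooth tf|exact: test_smooth tg].
- exact: compactU.
- by move=> x [/KD|/LD].
- by move=> x nKL; rewrite (K0 x _).1 ?(L0 x _).1 ?addr0// => h; apply: nKL; [right|left].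
Qed.

Lemma test0 : test_function D (cst 0 : E -> R).
Proof.
apply: (compact_support_test (K := set0)) => //; first exact: smooth_cst.
exact: compact0.
Qed.

Lemma test_sum I (s : seq I) (F : I -> E -> R) : (forall i, test_function D (F i)) ->
  test_function D (fun x => \sum_(i <- s) F i x).
Proof.
move=> tF; elim: s => [|i s IHs].
  rewrite (_ : (fun _ => _) = cst 0); first exact: test0.
  by apply/funext => x; rewrite big_nil.
rewrite (_ : (fun _ => _) = fun x => F i x + \sum_(i <- s) F i x); first exact: testD.
by apply/funext => x; rewrite big_cons.
Qed.

Lemma testZ (r : R) (f : E -> R) : test_function D f -> test_function D (fun x => r * f x).
Proof.
move=> tf; rewrite (_ : (fun _ => _) = fun x => f x * cst r x); last by apply/funext => x; rewrite mulrC.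
by apply: testM => //; exact: smooth_cst.
Qed.

Lemma test_euler (th : E -> R) (a : nat) (y : E) : test_function D th ->
  test_function D (euler th a y).
Proof.
move=> tth; apply: testD; first exact: testZ.
apply: test_sum => k; rewrite (_ : (fun _ => _) = moment y k (partial k th)).
  by apply: test_moment; exact: test_partial.
by apply/funext => x; rewrite /moment mulrC.
Qed.

Lemma test_continuous (th : E -> R) : test_function D th -> continuous th.
Proof. by move=> tth; apply: smooth_continuous; exact: test_smooth tth. Qed.

Lemma test_measurable (th : E -> R) : test_function D th -> measurable_fun setT th.
Proof. by move=> tth; apply: continuous_measurable_row; exact: test_continuous. Qed.

End test_sums.

Lemma measurable_shrink (y : E) (t : R) : 0 < t -> measurable_fun setT (shrink y t).
Proof.
move=> t0; rewrite (_ : shrink y t = fun z => t^-1 *: z + (y - t^-1 *: y)).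
  by apply: measurable_affine; rewrite invr_gt0.
by apply/funext => z; rewrite shrink_affine.
Qed.

Section euler_average.
Variables (f : E -> R) (fi : vol.-integrable setT (EFin \o f)).
Variables (D : set E) (th : E -> R) (tth : test_function D th) (a : nat) (y : E).

Lemma integrable_mul_shrink (h : E -> R) (t : R) : test_function D h -> 0 < t ->
  vol.-integrable setT (fun z => (f z * h (shrink y t z))%:E).
Proof.
move=> thh t0; have [M _ hM] := test_bounded thh.
apply: (integrable_bounded_mul fi (h := fun z => h (shrink y t z)) (M := M)) => //.
exact: (measurableT_comp (test_measurable thh) (measurable_shrink _ t0)).
Qed.

Lemma integrable_mul_dil (h : E -> R) (t : R) : test_function D h -> 0 < t ->
  vol.-integrable setT (fun x => (f (dil x (y, t)) * h x)%:E).
Proof.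
move=> thh t0; have := @integrable_affine _ _ t ((1 - t) *: y) t0 _ (integrable_mul_shrink thh t0).
congr (_.-integrable setT _); apply/funext => x.
by rewrite -dilE shrink_dil// gt_eqF.
Qed.

Lemma ae_integrable_mul_test (h : E -> R) : test_function D h ->
  ae_integrable vol setT (fun z => f z * h z).
Proof.
move=> thh; have [M _ hM] := test_bounded thh; apply: integrable_ae_integrable.
exact: (integrable_bounded_mul fi (test_measurable thh) hM).
Qed.

Lemma Rint_euler_shrink (tau : R) : 0 < tau < 1 ->
  \int[leb]_(t in `[tau, 1])
     (t^-1 ^+ a.+1 * \int[vol]_z (f z * euler th a y (shrink y t z))) =
  \int[vol]_z (f z * (tau^-1 ^+ a * th (shrink y tau z) - th z)).
Proof.
(* Extends [1/t] from [[tau, 1]] to a continuous function on the line bounded by [1/tau]; the kernel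
   [K] is then bounded and Fubini's theorem applies. *)
move=> /andP[tau0 tau1]; pose s (t : R) := (Num.max t tau)^-1.
have s0 t : 0 < s t by rewrite invr_gt0 lt_max tau0 orbT.
have s1 t : s t <= tau^-1 by rewrite lef_pV2 ?posrE ?lt_max ?tau0 ?orbT// le_max lexx orbT.
have [M M0 hM] := test_bounded (test_euler a y tth).
pose I (t : mR) : R := \1_(`[tau, 1]%classic : set mR) t.
pose K (q : E * mR) := s q.2 ^+ a.+1 * euler th a y (y + s q.2 *: (q.1 - y)).
have ms : measurable_fun setT (s : mR -> R).
  apply: continuous_measurable_fun => t.
  apply: (@continuous_comp _ _ _ (fun t : R => Num.max t tau) GRing.inv); last first.
    by apply: inv_continuous; rewrite gt_eqF// lt_max tau0 orbT.
  by apply: continuous_max; [exact: cvg_id|exact: cvg_cst].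
have ms2 : measurable_fun setT (fun q : E * mR => s q.2) by exact: (measurableT_comp ms measurable_snd).
have mK : measurable_fun setT K.
  apply: measurable_funM; first exact: measurable_funX.
  apply: (measurableT_comp (test_measurable (test_euler a y tth))).
  apply: measurable_fun_row => // i.
  rewrite (_ : (fun _ => _) = fun q : E * mR => y ord0 i + s q.2 * (q.1 ord0 i - y ord0 i)); last first.
    by apply/funext => q; rewrite !mxE.
  apply: measurable_funD => //; apply: measurable_funM => //; apply: measurable_funB => //.
  exact: (measurableT_comp (measurable_coord i) measurable_fst).
have KM q : `|K q| <= tau^-1 ^+ a.+1 * M.
  rewrite normrM ler_pM//.
  have sq0 := ltW (s0 q.2).
  rewrite ger0_norm; last exact: exprn_ge0.
  by apply: lerXn2r; rewrite ?nnegrE ?s1// invr_ge0 ltW.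
have Ii : leb.-integrable setT (EFin \o I).
  exact: integrable_indic_itv.
pose F (q : E * mR) := f q.1 * I q.2 * K q.
have iF : (vol \x leb)%E.-integrable setT (EFin \o F).
  by apply: (integrable_bounded_mul (integrable_prod_mul fi Ii)).
transitivity (\int[leb]_t \int[vol]_z F (z, t)).
  rewrite Rintegral_mkcond; apply: eq_Rintegral => t _.
  rewrite patchE /F /= /I indicE; case: ifPn => [|_]; last first.
    by rewrite /Rintegral integral0_eq// => z _; rewrite mulr0 mul0r.
  rewrite inE/= in_itv/= => /andP[tt _].
  have E1 : s t = t^-1 by rewrite /s max_l.
  have t0 : 0 < t by exact: lt_le_trans tau0 tt.
  have E2 : \int[vol]_z (t^-1 ^+ a.+1 * (f z * euler th a y (shrink y t z))) =
      t^-1 ^+ a.+1 * \int[vol]_z (f z * euler th a y (shrink y t z)).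
    by apply: RintZ => //; apply: integrable_ae_integrable; exact: integrable_mul_shrink (test_euler a y tth) t0.
  by rewrite -E2; apply: eq_Rintegral => z _; rewrite /K /= E1 mulr1 mulrCA.
rewrite (Rint_slice2 iF) -(Rint_slice1 iF); apply: eq_Rintegral => z _.
rewrite -(euler_FTC (test_smooth tth) a y z); last by rewrite tau0.
rewrite (@eq_Rintegral _ _ _ _ _ (fun t => f z * (I t * K (z, t)))); last by move=> t _; rewrite /F mulrA.
rewrite RintZ//; last first.
  apply: integrable_ae_integrable.
  by apply: (integrable_bounded_mul Ii (h := fun t => K (z, t))) => //; exact: (measurableT_comp mK (measurable_pair1 z)).
congr (_ * _); rewrite [RHS]Rintegral_mkcond; apply: eq_Rintegral => t _.
rewrite patchE /I indicE; case: ifPn => [|_]; last by rewrite mul0r.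
by rewrite inE/= in_itv/= mul1r /K /s => /andP[tt _]; rewrite max_l.
Qed.

End euler_average.

Lemma L2_rep (D : set E) (f : E -> R) : measurable D -> (vol D < +oo)%E -> L2 D f ->
  exists g, [/\ f = g %[ae vol in D], forall x, ~ D x -> g x = 0, measurable_fun setT g,
    vol.-integrable setT (EFin \o g) & vol.-integrable setT (fun x => (g x ^+ 2)%:E)].
Proof.
move=> mD volD [g [fg mg ig]]; exists (g \_ D).
have mgD : measurable_fun setT (g \_ D) by apply/(measurable_restrictT g mD).
split=> //.
- by move: fg; apply: filterS => x fg Dx; rewrite patchE mem_set// fg.
- by move=> x nD; rewrite patchE; case: ifPn => //; rewrite inE.
- rewrite (_ : EFin \o _ = (EFin \o g) \_ D); last by apply/funext => x; rewrite /= !patchE; case: ifP.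
  apply/(integrable_mkcond _ mD); apply: ae_integrable_integrable => //.
  by apply: (L2_aei mD volD); exists g; split => //; exact: aeW.
- rewrite (_ : (fun _ => _) = (fun x => (g x ^+ 2)%:E) \_ D).
    exact/(integrable_mkcond _ mD).
  by apply/funext => x; rewrite /= !patchE; case: ifP => //; rewrite expr0n.
Qed.

Lemma Rint_rep (D : set E) (f g h : E -> R) : f = g %[ae vol in D] ->
  (forall x, ~ D x -> g x = 0) ->
  \int[vol]_(x in D) (f x * h x) = \int[vol]_x (g x * h x).
Proof.
move=> fg g0; rewrite (@ae_eq_Rintegral _ _ _ vol D _ (fun x => g x * h x)).
  rewrite Rintegral_mkcond; apply: eq_Rintegral => x _.
  by rewrite patchE; case: ifPn => //; rewrite notin_setE => /g0 ->; rewrite mul0r.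
by move: fg; apply: filterS => x fg Dx; rewrite fg.
Qed.

Lemma test_integrable (D : set E) (h : E -> R) : test_function D h ->
  vol.-integrable setT (EFin \o h).
Proof.
move=> th; have [K [cK _ K0]] := test_support th; have [M _ hM] := test_bounded th.
have clK : closed K by apply: compact_closed => //; exact: norm_hausdorff.
have mK : measurable K.
  by rewrite -[K]setCK; apply: measurableC; apply: open_measurable_row; exact: closed_openC.
have iK : vol.-integrable setT (EFin \o \1_K).
  apply/integrableP; split; first exact/measurable_EFinP/measurable_indic.
  under eq_integral do rewrite /= ger0_norm//.
  by rewrite integral_indic// setIT lebesgue_row_bounded//; exact: compact_bounded.
rewrite (_ : EFin \o h = fun x => (\1_K x * h x)%:E).
  exact: (integrable_bounded_mul iK (test_measurable th) hM).
apply/funext => x; rewrite indicE /=; have [xK|xK] := boolP (x \in K); first by rewrite mul1r.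
by rewrite (K0 x _).1 ?mulr0// => /mem_set; rewrite (negbTE xK).
Qed.

Lemma test_out (D : set E) (h : E -> R) x : test_function D h -> ~ D x -> h x = 0.
Proof.
by move=> thh nD; have [K [_ KD K0]] := test_support thh; apply: (K0 x _).1 => /KD.
Qed.

Lemma Rint_test (D : set E) (h : E -> R) : test_function D h ->
  \int[vol]_(x in D) h x = \int[vol]_x h x.
Proof.
move=> th; rewrite Rintegral_mkcond; apply: eq_Rintegral => x _; rewrite patchE.
by case: ifPn => //; rewrite notin_setE => /(test_out th).
Qed.

Lemma L2_test (D : set E) (h : E -> R) : measurable D -> (vol D < +oo)%E ->
  test_function D h -> L2 D h.
Proof.
move=> mD volD th; have [M _ hM] := test_bounded th.
apply: (@bounded_aei_L2 _ _ D mD _ M) => // .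
apply: measurable_ae_measurable; exact: measurable_funTS (test_measurable th).
Qed.

Lemma bump_exists (B : set E) : open B -> B !=set0 ->
  exists eta : E -> R, [/\ test_function B eta, forall x, 0 <= eta x & \int[vol]_x eta x = 1].
Proof.
move=> oB [p Bp].
have /nbhs_ballP[r /= r0 rB] := open_nbhs_nbhs (conj oB Bp).
pose a i := p ord0 i - r / 2; pose b i := p ord0 i + r / 2.
have r4 : 0 < r / 8 by lra.
have tp : test_function B (plateau a b (r / 8)).
  apply: test_plateau => // x /= ab; apply: rB; rewrite -ball_normE /ball_/=.
  apply: row_norm_lt => // i; have := ab i; rewrite !mxE /a /b => /andP[h1 h2].
  by rewrite ltr_norml; apply/andP; split; lra.
have ip := integrable_ae_integrable (test_integrable tp).
pose A := row_box (fun i => p ord0 i - r / 4) (fun i => p ord0 i + r / 4).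
have mA : measurable A by exact: measurable_row_box.
have volA : vol A = (\prod_(i < d) (r / 2))%:E.
  rewrite lebesgue_row_boxE; congr EFin; apply: eq_bigr => i _.
  by rewrite max_l; lra.
have IA : (\int[vol]_x (\1_A x)%:E = vol A)%E by rewrite integral_indic// setIT.
have iA : vol.-integrable setT (EFin \o \1_A).
  apply/integrableP; split; first exact/measurable_EFinP/measurable_indic.
  by under eq_integral do rewrite /= ger0_norm//; rewrite IA volA ltry.
have c0 : 0 < \int[vol]_x plateau a b (r / 8) x.
  apply: (@lt_le_trans _ _ (\int[vol]_x \1_A x)).
    rewrite /Rintegral IA volA /=.
    by apply: prodr_gt0 => i _; lra.
  apply: le_Rint => //; first exact: integrable_ae_integrable.
  apply: aeW => x _; rewrite indicE; case: (boolP (_ \in _)) => [|_]; last exact: plateau_ge0.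
  rewrite inE /A row_boxE /= => Ax; rewrite plateau_eq1// => i.
  by have := Ax i; rewrite in_itv/= /a /b => /andP[h1 h2]; apply/andP; split; lra.
exists (fun x => (\int[vol]_x plateau a b (r / 8) x)^-1 * plateau a b (r / 8) x); split.
- exact: testZ.
- by move=> x; rewrite mulr_ge0 ?plateau_ge0// invr_ge0 ltW.
- by rewrite RintZ// mulVf// gt_eqF.
Qed.

Section dil_pair.
Variables (D : set E) (mD : measurable D) (volD : (vol D < +oo)%E).
Variables (g : E -> R) (mg : measurable_fun setT g) (gi : vol.-integrable setT (EFin \o g)).
Variables (th eta : E -> R) (tth : test_function D th) (teta : test_function D eta).

Let F t (q : E * E) := g (dil q.1 (q.2, t)) * th q.1 * eta q.2.

Let measurable_dil_pair t : measurable_fun setT (F t).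
Proof.
have mdil : measurable_fun setT (fun q : E * E => dil q.1 (q.2, t)).
  apply: measurable_fun_row => // i.
  rewrite (_ : (fun _ => _) = fun q : E * E => q.2 ord0 i + t * (q.1 ord0 i - q.2 ord0 i)); last first.
    by apply/funext => q; rewrite !mxE.
  have m1 : measurable_fun setT (fun q : E * E => q.1 ord0 i).
  exact: (measurableT_comp (measurable_coord i) measurable_fst).
  have m2 : measurable_fun setT (fun q : E * E => q.2 ord0 i).
  exact: (measurableT_comp (measurable_coord i) measurable_snd).
  by apply: measurable_funD => //; apply: measurable_funM => //; exact: measurable_funB.
apply: measurable_funM; last exact: (measurableT_comp (test_measurable teta) measurable_snd).
apply: measurable_funM; first exact: (measurableT_comp mg mdil).
  exact: (measurableT_comp (test_measurable tth) measurable_fst).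
Qed.

Let dil_pair_bound0 : exists2 M, 0 <= M & forall t, 0 <= t <= 1 ->
  (\int[vol]_y \int[vol]_x `|(F t (x, y))%:E| <= M%:E)%E.
Proof.
have out := @test_out D.
have [M1 M10 hM1] := test_bounded tth; have [M2 M20 hM2] := test_bounded teta.
have mag : measurable_fun setT (fun x => `|g x|%:E).
  by apply/measurable_EFinP; exact: (measurableT_comp (@normr_measurable _ setT)).
exists (2 ^+ d * fine (vol D) * (M1 * M2 * \int[vol]_x `|g x|)).
  rewrite mulr_ge0// ?mulr_ge0 ?exprn_ge0 ?fine_ge0//.
  by apply: integral_ge0 => x _; rewrite lee_fin.
move=> t t01.
  apply: (@le_trans _ _ (\int[vol]_y \int[vol]_x ((\1_D x * \1_D y)%:E * (M1 * M2 * `|g (dil x (y, t))|)%:E))%E).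
    apply: ge0_le_integral_gen => y; first exact: integral_ge0.
    apply: ge0_le_integral_gen => x //=; rewrite -EFinM lee_fin !indicE /F /= !normrM.
    have [xD|xD] := boolP (x \in D); last first.
      by rewrite (out _ _ tth) ?normr0 ?mulr0 ?mul0r// => /mem_set; rewrite (negbTE xD).
    have [yD|yD] := boolP (y \in D); last first.
      by rewrite (out _ _ teta) ?normr0 ?mulr0 ?mul0r// => /mem_set; rewrite (negbTE yD).
    rewrite !mul1r -mulrA [leRHS]mulrC ler_wpM2l//.
    by rewrite ler_pM.
  apply: (@le_trans _ _ ((2 ^+ d * fine (vol D))%:E * \int[vol]_x (M1 * M2 * `|g x|)%:E)%E).
    apply: (@dil_slice_bound _ _ D mD volD (fun x => (M1 * M2 * `|g x|)%:E)).
    - under eq_fun do rewrite EFinM.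
      by apply: emeasurable_funM.
    - by move=> x; rewrite lee_fin !mulr_ge0.
    - by [].
  under eq_integral do rewrite EFinM.
  rewrite ge0_integralZl//; try (by move=> x _; rewrite lee_fin); try (by rewrite lee_fin mulr_ge0).
  have /integrableP[_ gfin] := gi.
have gfn : (\int[vol]_x `|g x|%:E)%E \is a fin_num.
  by rewrite ge0_fin_numE//; apply: integral_ge0 => x _; rewrite lee_fin.
by rewrite [leRHS]EFinM lee_wpmul2l// ?lee_fin ?mulr_ge0 ?exprn_ge0 ?fine_ge0// [leRHS]EFinM [X in (_ <= _ * X)%E]fineK.
Qed.

Lemma dil_pair_integrable t : 0 <= t <= 1 ->
  (vol \x vol)%E.-integrable setT (EFin \o F t).
Proof.
move=> t01; have [M _ hM] := dil_pair_bound0.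
have mF' : measurable_fun setT (EFin \o F t) by exact/measurable_EFinP.
apply/(@integrable21ltyP _ _ _ _ _ vol vol _ mF').
exact: le_lt_trans (hM t t01) (ltry _).
Qed.

(** The bound is uniform down to [t = 0], which makes the boundary term of [radial_average] vanish
    in the limit. *)
Lemma dil_pair_bound : exists M, forall t, 0 <= t <= 1 ->
  `|\int[vol]_y \int[vol]_x F t (x, y)| <= M.
Proof.
have [M _ hM] := dil_pair_bound0; exists M => t t01.
have iF := dil_pair_integrable t01.
have mF' : measurable_fun setT (EFin \o F t) by exact/measurable_EFinP.
rewrite (Rint_slice2 iF) -lee_fin; apply: le_trans (hM t t01).
have fn : (\int[(vol \x vol)%E]_q (F t q)%:E)%E \is a fin_num by exact: integrable_fin_num.
rewrite -abse_EFin /Rintegral fineK//.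
have := @fubini_tonelli2 _ _ _ _ _ vol vol (fun q => `|(F t q)%:E|%E).
rewrite /fubini_G /= => <- //.
- by apply: le_abse_integral.
- apply/measurable_EFinP.
  exact: (measurableT_comp (@normr_measurable _ setT) (measurable_dil_pair t)).
Qed.

End dil_pair.

(** * Weakly constant functions on convex sets *)

Section convex_constant.
Variables (D : set E) (oD : open D) (volD : (vol D < +oo)%E).
Hypothesis cD : forall x y t, D x -> D y -> 0 <= t <= 1 -> D (dil x (y, t)).
Let mD : measurable D. Proof. exact: open_measurable_row. Qed.

Section representative.
Variables (g : E -> R) (g0 : forall x, ~ D x -> g x = 0) (mg : measurable_fun setT g)
  (gi : vol.-integrable setT (EFin \o g)).
Hypothesis wg : forall xi k, test_function D xi -> \int[vol]_x (g x * partial k xi x) = 0.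

(** With the exponent [a = d] Euler's operator is a pure divergence, hence annihilated by [g]. So
    the pairing of the dilated [g] with [th] does not change in [t], and its values at the times 1/2
    and 1 agree. *)
Lemma Rint_midpoint (th : E -> R) (y : E) : test_function D th -> D y ->
  \int[vol]_x (g (dil x (y, 2^-1)) * th x) = \int[vol]_x (g x * th x).
Proof.
move=> tth Dy; have h01 : 0 < (2^-1 : R) < 1 by lra.
have [h0 h1] := andP h01.
have ai (h : E -> R) t : test_function D h -> 0 < t -> ae_integrable vol setT (fun z => g z * h (shrink y t z)).
  by move=> th_ t0; apply: integrable_ae_integrable; exact: integrable_mul_shrink th_ t0.
have tM k t : 0 < t -> t <= 1 -> test_function D (fun z => moment y k th (shrink y t z)).
  move=> t0 t1; apply: test_shrink => //; last exact: test_moment.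
  by move=> x Dx; apply: cD => //; rewrite (ltW t0) t1.
have E0 t : 0 < t -> t <= 1 -> \int[vol]_z (g z * euler th d y (shrink y t z)) = 0.
  move=> t0 t1; rewrite (@eq_Rintegral _ _ _ _ _ (fun z => \sum_k t * (g z * partial k (fun z => moment y k th (shrink y t z)) z))).
    rewrite Rint_sum//.
      apply: big1 => k _; rewrite RintZ//; first by rewrite wg ?mulr0//; exact: tM.
      by apply: (ae_integrable_mul_test gi (D := D)); apply: test_partial; exact: tM.
    move=> k _; apply: ae_integrableZ => //; apply: (ae_integrable_mul_test gi (D := D)).
    by apply: test_partial; exact: tM.
  move=> z _; rewrite euler_moment; last exact: test_smooth tth.
  rewrite sumrB sumr_const card_ord mulr_natl addrC subrK mulr_sumr; apply: eq_bigr => k _.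
  have -> : partial k (fun z => moment y k th (shrink y t z)) z =
      t^-1 * partial k (moment y k th) (shrink y t z).
    by apply: partial_shrink; exact: test_smooth (test_moment y k tth).
  by rewrite mulrCA mulVKf// gt_eqF.
have := @Rint_euler_shrink g gi D th tth d y 2^-1 h01.
rewrite (@eq_Rintegral _ _ _ _ _ (fun=> 0)); last first.
  move=> t; rewrite inE/= in_itv/= => /andP[t2 t1]; rewrite E0 ?mulr0//.
  exact: lt_le_trans t2.
rewrite {1}/Rintegral integral0 /=.
have it : ae_integrable vol setT (fun z => g z * th z) by exact: (ae_integrable_mul_test gi tth).
have isd : ae_integrable vol setT (fun z => g z * th (shrink y 2^-1 z)) by exact: ai.
rewrite (@eq_Rintegral _ _ _ _ _ (fun z => 2^-1^-1 ^+ d * (g z * th (shrink y 2^-1 z)) - g z * th z)); last first.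
  by move=> z _; rewrite mulrBr mulrCA.
rewrite RintB//; last exact: ae_integrableZ.
rewrite RintZ// -Rint_dil//; last exact: integrable_mul_shrink tth h0.
by move/esym/eqP; rewrite subr_eq0 => /eqP.
Qed.

(* Testing g at the midpoint of x and y against th(x) eta(y) gives both sides,
   because a weakly constant g is unchanged in the mean by a dilation. *)
Lemma Rint_mul_test_symmetric (th eta : E -> R) : test_function D th -> test_function D eta ->
  (\int[vol]_x (g x * th x)) * \int[vol]_x eta x = (\int[vol]_x (g x * eta x)) * \int[vol]_x th x.
Proof.
move=> tth teta.
have h0 : 0 < (2^-1 : R) by lra.
pose F (q : E * E) := g (dil q.1 (q.2, 2^-1)) * th q.1 * eta q.2.
have it h : test_function D h -> ae_integrable vol setT h.
  by move=> thh; apply: integrable_ae_integrable; exact: test_integrable thh.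
have out := @test_out D.
have iF : (vol \x vol)%E.-integrable setT (EFin \o F).
  by apply: (dil_pair_integrable mD volD mg gi tth teta); apply/andP; split; lra.
(* The midpoint is symmetric in the two points, which is why the time 1/2 is singled out. *)
have dilC x y : dil x (y, 2^-1) = dil y (x, 2^-1) :> E.
  rewrite !dilE [RHS]addrC; congr (_ *: _ + _ *: _); lra.
have E1 : \int[(vol \x vol)%E]_q F q = (\int[vol]_x (g x * th x)) * \int[vol]_x eta x.
  rewrite -(Rint_slice2 iF) -RintZ//; last exact: it.
  apply: eq_Rintegral => y _; have [Dy|nDy] := pselect (D y); last first.
    rewrite (out _ _ teta)// mulr0 /Rintegral integral0_eq// => x _.
    by rewrite /F /= (out _ _ teta)// mulr0.
  rewrite -(Rint_midpoint tth Dy) mulrC -RintZ//; last first.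
    apply: integrable_ae_integrable.
    exact: integrable_mul_dil tth h0.
  by apply: eq_Rintegral => x _; rewrite /F mulrC.
have E2 : \int[(vol \x vol)%E]_q F q = (\int[vol]_x (g x * eta x)) * \int[vol]_x th x.
  rewrite -(Rint_slice1 iF) -RintZ//; last exact: it.
  apply: eq_Rintegral => x _; have [Dx|nDx] := pselect (D x); last first.
    rewrite (out _ _ tth)// mulr0 /Rintegral integral0_eq// => y _.
    by rewrite /F /= (out _ _ tth)// mulr0 mul0r.
  rewrite -(Rint_midpoint teta Dx) mulrC -RintZ//; last first.
    apply: integrable_ae_integrable; exact: integrable_mul_dil teta h0.
  by apply: eq_Rintegral => y _; rewrite /F/= dilC; ring.
by rewrite -E1.
Qed.

End representative.

(** With [eta] of integral one, [Rint_mul_test_symmetric] says that [f] pairs with every [th] like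
    the constant [c], the integral of [f eta]; [test_dense] concludes. *)
Lemma weak_grad0_cst (f : E -> R) : L2 D f -> is_weak_grad D f (fun=> 0) ->
  exists c, f = cst c %[ae vol in D].
Proof.
move=> Lf wf; have [->|Dn0] := eqVneq D set0; first by exists 0; apply: aeW.
have [eta [teta eta0 eta1]] : exists eta : E -> R, [/\ test_function D eta, forall x, 0 <= eta x & \int[vol]_x eta x = 1].
  by apply: bump_exists => //; exact/set0P.
have [g [fg g0 mg gi g2]] := L2_rep mD volD Lf.
have wg xi k : test_function D xi -> \int[vol]_x (g x * partial k xi x) = 0.
  move=> txi; rewrite -(Rint_rep (f := f) (D := D))//; apply/eqP.
  rewrite -oppr_eq0 -(wf xi txi k); apply/eqP.
  by rewrite /Rintegral integral0_eq// => x _; rewrite mxE mul0r.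
exists (\int[vol]_x (g x * eta x)); set c := \int[vol]_x _.
have : (fun x => f x - c) = cst 0 %[ae vol in D].
  have Lc : L2 D (cst c).
    apply: (@bounded_aei_L2 _ _ D mD _ `|c|) => //; exact: ae_measurable_cst.
  apply: test_dense => //; first exact: L2B.
  move=> th tth.
  have Lth := L2_test mD volD tth.
  have ig : ae_integrable vol D (fun x => f x * th x) by exact: L2M.
  rewrite (@eq_Rintegral _ _ _ _ _ (fun x => f x * th x - c * th x)); last by move=> x _; rewrite mulrBl.
  have it := L2_aei mD volD Lth.
  rewrite RintB//; last exact: ae_integrableZ.
  rewrite (Rint_rep th fg g0) RintZ// (Rint_test tth).
  have := Rint_mul_test_symmetric mg gi wg tth teta; rewrite eta1 mulr1 => ->.
  by rewrite subrr.
by apply: filterS => x h Dx; apply/eqP; rewrite -subr_eq0; apply/eqP; exact: h.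
Qed.

End convex_constant.

(** * The weak homotopy formula on a star-shaped domain *)

Section star_shaped.
Variables (D : set E) (oD : open D) (bD : bounded_set D).
Variables (eta : E -> R) (teta : test_function D eta).
Hypothesis eta1 : \int[vol]_x eta x = 1.
Hypothesis star : forall x y t, D x -> eta y != 0 -> 0 <= t <= 1 -> D (dil x (y, t)).
Hypothesis d_gt0 : (0 < d)%N.
Let mD : measurable D. Proof. exact: open_measurable_row. Qed.
Let volD : (vol D < +oo)%E. Proof. exact: lebesgue_row_bounded. Qed.

Let slab : set (E * mR) := D `*` `]0, 1]%classic.

(** For a fixed centre and time, the change of variables moves the dilation from [f], which need not
    have derivatives, to the test function. *)
Lemma kern_slice (z : E -> E * mR -> R) (f h : E -> R) (y : E) (t c : R) :
  vol.-integrable setT (EFin \o f) -> D y -> 0 < t -> t <= 1 -> test_function D h ->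
  (forall x, z x (y, t) = c * h x) ->
  \int[vol]_x kern D z f x (y, t) =
  c * (t^-1 ^+ d * \int[vol]_x (f x * h (shrink y t x))).
Proof.
move=> fi Dy t0 t1 thh zE.
rewrite -Rint_dil//; last exact: integrable_mul_shrink thh t0.
rewrite -RintZ//; last by apply: integrable_ae_integrable; exact: integrable_mul_dil thh t0.
apply: eq_Rintegral => x _; rewrite /kern /cyl zE !indicE /= (mem_set Dy).
rewrite [(t \in _)]mem_set ?mulr1; last by rewrite /= in_itv/= t0.
have [xD|xD] := boolP (x \in D); first by rewrite mul1r; ring.
by rewrite (test_out thh) ?mulr0 ?mul0r ?mulr0// => /mem_set; rewrite (negbTE xD).
Qed.

Lemma kern_slice0 (z : E -> E * mR -> R) (f : E -> R) (y : E) (t : R) :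
  (D y -> 0 < t -> t <= 1 -> forall x, z x (y, t) = 0) ->
  \int[vol]_x kern D z f x (y, t) = 0.
Proof.
move=> h; rewrite /Rintegral integral0_eq// => x _; rewrite /kern.
have [[Dy /=]|nh] := pselect (slab (y, t)).
  by rewrite in_itv/= => /andP[t0 t1]; rewrite h// mul0r mulr0.
by rewrite cyl0// mul0r.
Qed.

Lemma slab_bound : exists2 M : R, 0 <= M &
  forall x p k, D x -> slab p -> `|x ord0 k - p.1 ord0 k| <= M.
Proof.
have [N [_ /(_ (N + 1))]] := bD; rewrite ltrDl ltr01 => /(_ isT) hN.
have [x0|] := pselect (exists x, D x); last first.
  by move=> nD; exists 0 => // x p k Dx; exfalso; apply: nD; exists x.
have N0 : 0 <= N + 1 by case: x0 => x Dx; exact: le_trans (hN x Dx).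
exists (N + 1 + (N + 1)) => [|x p k Dx [Dp _]]; first by rewrite addr_ge0.
rewrite (le_trans (ler_normB _ _))// lerD// (le_trans (coord_le_norm _ _))//; exact: hN.
Qed.

Lemma measurable_shift k : measurable_fun setT (fun q : E * (E * mR) => q.1 ord0 k - q.2.1 ord0 k).
Proof.
apply: measurable_funB; first exact: (measurableT_comp (measurable_coord k) measurable_fst).
apply: (measurableT_comp (measurable_coord k)).
exact: (measurableT_comp measurable_fst measurable_snd).
Qed.

Lemma measurable_eta : measurable_fun setT (fun q : E * (E * mR) => eta q.2.1).
Proof.
apply: (measurableT_comp (test_measurable teta)).
exact: (measurableT_comp measurable_fst measurable_snd).
Qed.

Definition radial_weight (th : E -> R) (x : E) (p : E * mR) := eta p.1 * euler th d.-1 p.1 x.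

Lemma measurable_radial_weight (th : E -> R) : test_function D th ->
  measurable_fun setT (fun q : E * (E * mR) => radial_weight th q.1 q.2).
Proof.
move=> tth; apply: measurable_funM; first exact: measurable_eta.
apply: measurable_funD.
  apply: measurable_funM => //; exact: (measurableT_comp (test_measurable tth) measurable_fst).
apply: measurable_sum => k; apply: measurable_funM; first exact: measurable_shift.
by apply: (measurableT_comp _ measurable_fst); apply: (@test_measurable D); exact: test_partial.
Qed.

Lemma radial_weight_bound (th : E -> R) : test_function D th ->
  exists M, forall x p, D x -> slab p -> `|radial_weight th x p| <= M.
Proof.
move=> tth; have [M1 M10 hM1] := test_bounded teta; have [M2 M20 hM2] := test_bounded tth.
have [M3 M30 hM3] := slab_bound.
have [M4 hM4] := choice (fun k => let: ex_intro2 M _ hM := test_bounded (test_partial k tth) in ex_intro _ M hM).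
exists (M1 * (d.-1%:R * M2 + \sum_k (M3 * M4 k))) => x p Dx sp.
rewrite normrM ler_pM// (le_trans (ler_normD _ _))// lerD//.
  by rewrite normrM ger0_norm// ler_wpM2l.
rewrite (le_trans (ler_norm_sum _ _ _))//; apply: ler_sum => k _.
by rewrite normrM ler_pM// hM3.
Qed.

(** The fundamental theorem of calculus in [t] with exponent [d - 1], averaged over the centres.
    Time 1 contributes [- f th] because [eta] has integral one; the term at time [tau] is [tau]
    times a bounded quantity and disappears as [tau] tends to 0. *)
Lemma radial_average (f th : E -> R) : measurable_fun setT f ->
  vol.-integrable setT (EFin \o f) -> vol.-integrable setT (fun x => (f x ^+ 2)%:E) ->
  test_function D th ->
  \int[@vol_time R d]_p \int[vol]_x kern D (radial_weight th) f x p = - \int[vol]_x (f x * th x).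
Proof.
move=> mf fi f2 tth.
have mz := measurable_radial_weight tth; have [M zM] := radial_weight_bound tth.
pose G p := \int[vol]_x kern D (radial_weight th) f x p.
have iG : (@vol_time R d).-integrable setT (EFin \o G) by exact: (kern_slice2_integrable mD volD mz zM mf f2).
(* The offset keeps [tau n] strictly below 1 from [n = 0] on, as [Rint_euler_shrink] requires. *)
pose tau n : R := n.+2%:R^-1.
have tau0 n : 0 < tau n by rewrite invr_gt0.
have tau1 n : tau n < 1 by rewrite invf_lt1 ?ltr1n.
pose A n : set (E * mR) := setT `*` `[tau n, 1]%classic.
have mA n : measurable (A n) by apply: measurableX => //; exact: measurable_itv.
have GA p : G p != 0 -> \forall n \near \oo, A n p.
  case: p => y t G0.
  have [t0 t1] : 0 < t /\ t <= 1.
    apply/andP/negPn/negP => /andP h; case/eqP: G0; apply: kern_slice0 => _ t0 t1.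
    by exfalso; apply: h.
  apply: filterS (near_infty_natSinv_lt (PosNum t0)) => n nt; split => //=.
  rewrite in_itv/= t1 andbT ltW//; apply: le_lt_trans nt.
  by rewrite lef_pV2 ?posrE// ler_nat.
have GE y t : 0 < t -> t <= 1 -> G (y, t) =
    eta y * (t^-1 ^+ d * \int[vol]_x (f x * euler th d.-1 y (shrink y t x))).
  move=> t0 t1; have [Dy|nDy] := pselect (D y); last first.
    by rewrite (test_out teta)// mul0r; apply: kern_slice0.
  apply: kern_slice => //; exact: test_euler.
pose I := \int[vol]_x (f x * th x).
pose c n := \int[vol]_y \int[vol]_x (f (dil x (y, tau n)) * th x * eta y).
have key n : \int[@vol_time R d]_p (G p * \1_(A n) p) = tau n * c n - I.
  have iGA : (@vol_time R d).-integrable setT (EFin \o (fun p => G p * \1_(A n) p)).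
    apply: (integrable_bounded_mul iG (M := 1)); first exact: measurable_indic.
    by move=> p; rewrite indicE; case: (_ \in _); rewrite ?normr1 ?normr0.
  have := @Rint_slice1 _ _ _ _ _ vol leb (fun p => G p * \1_(A n) p) iGA.
  move=> E1; rewrite [LHS](_ : _ = \int[vol]_y \int[leb]_t (G (y, t) * \1_(A n) (y, t))); last first.
    by rewrite E1.
  have t01 : 0 <= tau n <= 1 by rewrite !ltW.
  have iP := dil_pair_integrable mD volD mf fi tth teta t01.
  rewrite (@eq_Rintegral _ _ _ _ _ (fun y => tau n * (\int[vol]_x (f (dil x (y, tau n)) * th x * eta y)) - I * eta y)).
    have a1 : ae_integrable vol setT (fun y => \int[vol]_x (f (dil x (y, tau n)) * th x * eta y)).
      exact: integrable_ae_integrable (Rint_slice2_integrable iP).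
    have a2 : ae_integrable vol setT eta by exact: integrable_ae_integrable (test_integrable teta).
    by rewrite RintB//; [rewrite !RintZ// eta1 mulr1|exact: ae_integrableZ..].
  move=> y _.
  rewrite [LHS](_ : _ = \int[leb]_(t in `[tau n, 1]) G (y, t)); last first.
    rewrite [RHS]Rintegral_mkcond; apply: eq_Rintegral => t _; rewrite patchE indicE.
    rewrite (_ : ((y, t) \in A n) = (t \in (`[tau n, 1]%classic : set R))); last first.
      by apply/idP/idP; rewrite !inE; [move=> []|move=> h; split].
    by case: ifP => _; rewrite ?mulr1 ?mulr0.
  transitivity (\int[leb]_(t in `[tau n, 1]) (eta y * (t^-1 ^+ d * \int[vol]_x (f x * euler th d.-1 y (shrink y t x))))).
    apply: eq_Rintegral => t; rewrite inE/= in_itv/= => /andP[tt t1]; apply: GE => //; exact: lt_le_trans tt.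
  have iyf : vol.-integrable setT (EFin \o (fun z => eta y * f z)).
    by rewrite /comp; under eq_fun do rewrite EFinM; exact: integrableZl.
  have tau01 : 0 < tau n < 1 by rewrite tau0 tau1.
  have := @Rint_euler_shrink _ iyf D th tth d.-1 y _ tau01.
  rewrite (prednK d_gt0).
  rewrite [X in X = _ -> _](_ : _ = \int[leb]_(t in `[tau n, 1]) (eta y * (t^-1 ^+ d * \int[vol]_x (f x * euler th d.-1 y (shrink y t x))))).
    move=> ->.
    have i1 : ae_integrable vol setT (fun z => f z * th (shrink y (tau n) z)).
      by apply: integrable_ae_integrable; exact: integrable_mul_shrink tth (tau0 n).
    have i2 : ae_integrable vol setT (fun z => f z * th z) by exact: (ae_integrable_mul_test fi tth).
    rewrite (@eq_Rintegral _ _ _ _ _ (fun z => eta y * (tau n)^-1 ^+ d.-1 * (f z * th (shrink y (tau n) z)) - eta y * (f z * th z))); last first.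
      by move=> z _; ring.
    rewrite RintB//; [|exact: ae_integrableZ..].
    rewrite !RintZ//.
    rewrite [in RHS](@eq_Rintegral _ _ _ _ _ (fun x => eta y * (f (dil x (y, tau n)) * th x))); last first.
      by move=> x _; ring.
    rewrite RintZ//; last by apply: integrable_ae_integrable; exact: integrable_mul_dil tth (tau0 n).
    rewrite Rint_dil//; last exact: integrable_mul_shrink tth (tau0 n).
    have ed : tau n * (tau n)^-1 ^+ d.-1.+1 = (tau n)^-1 ^+ d.-1.
      by rewrite exprS mulrA mulfV ?mul1r// gt_eqF.
    by rewrite -ed (prednK d_gt0) /I; ring.
  apply: eq_Rintegral => t; rewrite inE/= in_itv/= => /andP[tt t1]; have t0 : 0 < t by exact: lt_le_trans tt.
  rewrite [RHS]mulrCA; congr (_ * _); rewrite -RintZ//.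
    by apply: eq_Rintegral => z _; rewrite mulrA.
  apply: integrable_ae_integrable; exact: integrable_mul_shrink (test_euler d.-1 y tth) t0.
have [C hC] := dil_pair_bound mD volD mf fi tth teta.
have cG := Rint_indic_cvg iG mA GA.
have ctau : tau n @[n --> \oo] --> (0 : R) by have := @cvg_harmonic R; rewrite -cvg_shiftS.
have cC : (tau n * C) @[n --> \oo] --> (0 : R).
  by rewrite -[X in _ --> X](mul0r C); apply: cvgM; [exact: ctau|exact: cvg_cst].
have cc : (tau n * c n) @[n --> \oo] --> (0 : R).
  apply: (@squeeze_cvgr _ _ _ _ (fun n => - (tau n * C)) (fun n => tau n * C)).
  - apply: nearW => n; rewrite -ler_norml normrM (ger0_norm (ltW (tau0 n))) ler_wpM2l ?(ltW (tau0 n))//.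
    by apply: hC; rewrite (ltW (tau0 n)) (ltW (tau1 n)).
  - by rewrite -[X in _ --> X]oppr0; exact: cvgN.
  - exact: cC.
have c2 : (tau n * c n - I) @[n --> \oo] --> 0 - I by apply: cvgB => //; exact: cvg_cst.
rewrite -sub0r; apply: (cvg_unique _ _ c2) => //.
by rewrite /= (_ : (fun n => _) = fun n => \int[@vol_time R d]_p (G p * \1_(A n) p))//; apply/funext => n.
Qed.

(** The weights of the averaged Poincaré homotopies on 1-forms and, below, on 2-forms; in degree [p]
    the homotopy carries [t^(p-1)], whence the extra factor [t] in [fld_weight]. *)
Definition pot_weight (k : 'I_d) (x : E) (p : E * mR) : R := eta p.1 * (x ord0 k - p.1 ord0 k).
Definition fld_weight (k : 'I_d) (x : E) (p : E * mR) : R := eta p.1 * ((p.2 : R) * (x ord0 k - p.1 ord0 k)).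

Lemma measurable_pot_weight k : measurable_fun setT (fun q : E * (E * mR) => pot_weight k q.1 q.2).
Proof. apply: measurable_funM; [exact: measurable_eta|exact: measurable_shift]. Qed.

Lemma measurable_fld_weight k : measurable_fun setT (fun q : E * (E * mR) => fld_weight k q.1 q.2).
Proof.
apply: measurable_funM; first exact: measurable_eta.
apply: measurable_funM; last exact: measurable_shift.
exact: (measurableT_comp measurable_snd measurable_snd).
Qed.

Lemma weights_bound : exists2 M, 0 <= M & forall k x p, D x -> slab p ->
  `|pot_weight k x p| <= M /\ `|fld_weight k x p| <= M.
Proof.
have [M1 M10 hM1] := test_bounded teta; have [M3 M30 hM3] := slab_bound.
exists (M1 * M3) => [|k x p Dx sp]; first exact: mulr_ge0.
have h := hM3 x p k Dx sp.
split; first by rewrite normrM ler_pM.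
rewrite !normrM ler_pM//; case: sp => _ /=; rewrite in_itv/= => /andP[p0 p1].
by rewrite -[leRHS]mul1r ler_pM// ger0_norm// ltW.
Qed.

Definition potential (v : 'I_d -> E -> R) (x : E) : R := \sum_k avg D (pot_weight k) (v k) x.
Definition correction (w : 'I_d -> E -> R) (x : E) : R := \sum_k avg D (fld_weight k) (w k) x.

Lemma sub_eq_opp (a b c : R) : a - b = - c -> b = a + c.
Proof. by move=> h; lra. Qed.

Lemma kernel_algebra (e p t dl A B W U : R) : A = B + W ->
  e * (p * (t * A - dl * U)) - e * t * (p * W) = e * p * (t * B - dl * U).
Proof. by move=> ->; ring. Qed.

Definition good (f : E -> R) := [/\ forall x, ~ D x -> f x = 0, measurable_fun setT f,
  vol.-integrable setT (EFin \o f) & vol.-integrable setT (fun x => (f x ^+ 2)%:E)].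

Lemma Rint_avg_test (z : E -> E * mR -> R) (M : R) (f th : E -> R) :
  measurable_fun setT (fun q : E * (E * mR) => z q.1 q.2) ->
  (forall x p, D x -> slab p -> `|z x p| <= M) -> good f -> test_function D th ->
  [/\ ae_integrable vol setT (fun x => avg D z f x * th x),
    (@vol_time R d).-integrable setT (fun p => (\int[vol]_x kern D (fun x p => z x p * th x) f x p)%:E) &
   \int[vol]_x (avg D z f x * th x) =
   \int[@vol_time R d]_p \int[vol]_x kern D (fun x p => z x p * th x) f x p].
Proof.
move=> mz zM [_ mf fi f2] tth; have [N N0 hN] := test_bounded tth.
have mz' : measurable_fun setT (fun q : E * (E * mR) => z q.1 q.2 * th q.1).
  by apply: measurable_funM => //; exact: (measurableT_comp (test_measurable tth) measurable_fst).
have zM' x p : D x -> slab p -> `|z x p * th x| <= M * N.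
  by move=> Dx sp; rewrite normrM ler_pM// zM.
split.
- apply: integrable_ae_integrable.
  by apply: (integrable_bounded_mul (avg_integrable mD volD mz zM mf f2) (M := N)) => //; exact: test_measurable tth.
- exact: (kern_slice2_integrable mD volD mz' zM' mf f2).
- rewrite -(Rint_avg mD volD mz' zM' mf f2); apply: ae_eq_Rintegral.
  by apply: filterS (avg_mulr mD volD th mz zM mf f2) => x ->.
Qed.

(** Works for each centre and time separately. Once the dilation sits on the test function, the curl
    relation tested with [S k] trades the derivative of index [i] paired with [v k] for the
    derivative of index [k] paired with [v i]; the sum over [k] is a radial derivative of [v i],
    which [radial_average] integrates to [- v i]. *)
Lemma potential_weak (v : 'I_d -> E -> R) (w : 'I_d -> E -> R) (i : 'I_d) (th : E -> R) :
  (forall k, good (v k)) -> (forall k, good (w k)) ->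
  (forall xi k, test_function D xi ->
    \int[vol]_x (v i x * partial k xi x) - \int[vol]_x (v k x * partial i xi x) =
    - \int[vol]_x (w k x * xi x)) ->
  test_function D th ->
  \int[vol]_x (potential v x * partial i th x) =
  \int[vol]_x (correction w x * th x) - \int[vol]_x (v i x * th x).
Proof.
move=> gv gw vw tth; have [M M0 hM] := weights_bound.
have tth' := test_partial i tth.
have P k := Rint_avg_test (measurable_pot_weight k) (fun x p Dx sp => (hM k x p Dx sp).1) (gv k) tth'.
have Q k := Rint_avg_test (measurable_fld_weight k) (fun x p Dx sp => (hM k x p Dx sp).2) (gw k) tth.
rewrite (@eq_Rintegral _ _ _ _ _ (fun x => \sum_k avg D (pot_weight k) (v k) x * partial i th x)); last first.
  by move=> x _; rewrite mulr_suml.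
rewrite [in RHS](@eq_Rintegral _ _ _ _ _ (fun x => \sum_k avg D (fld_weight k) (w k) x * th x)); last first.
  by move=> x _; rewrite mulr_suml.
rewrite Rint_sum//; last by move=> k _; case: (P k).
rewrite Rint_sum//; last by move=> k _; case: (Q k).
have [_ mvi vii vi2] := gv i.
rewrite -(radial_average mvi vii vi2 tth); apply/eqP; rewrite -subr_eq0 opprD addrA.
rewrite subr_eq0 -sumrB; apply/eqP.
transitivity (\sum_k (\int[@vol_time R d]_p (\int[vol]_x kern D (fun x p => pot_weight k x p * partial i th x) (v k) x p -
   \int[vol]_x kern D (fun x p => fld_weight k x p * th x) (w k) x p))).
  apply: eq_bigr => k _; have [_ ip ->] := P k; have [_ iq ->] := Q k.
  by rewrite RintB//; exact: integrable_ae_integrable.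
rewrite -Rint_sum//; last first.
  move=> k _; have [_ ip _] := P k; have [_ iq _] := Q k.
  by apply: ae_integrableB => //; exact: integrable_ae_integrable.
apply: eq_Rintegral => -[y t] _.
have [[[Dy t0] t1]|h] := pselect ((D y /\ 0 < t) /\ t <= 1); last first.
  rewrite kern_slice0; last by move=> Dy t0 t1; exfalso; apply: h.
  by apply: big1 => k _; rewrite !kern_slice0 ?subrr// => Dy t0 t1; exfalso; apply: h.
have [e0|e0] := eqVneq (eta y) 0.
  rewrite kern_slice0; last by move=> _ _ _ x; rewrite /radial_weight e0 mul0r.
  by apply: big1 => k _; rewrite !kern_slice0 ?subrr// => _ _ _ x; rewrite /pot_weight /fld_weight /= e0 !mul0r.
have sth := test_smooth tth.
have inv_t : t * t^-1 = 1 by rewrite mulfV// gt_eqF.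
pose m k := moment y k th; have tm k : test_function D (m k) by exact: test_moment.
have tmp k : test_function D (fun x => partial i (m k) x - (i == k)%:R * th x).
  rewrite (_ : (fun _ => _) = fun x => partial i (m k) x + - (i == k)%:R * th x); last first.
    by apply/funext => x; rewrite mulNr.
  by apply: testD; [exact: test_partial|exact: testZ].
have E1 k : \int[vol]_x kern D (fun x p => pot_weight k x p * partial i th x) (v k) x (y, t) =
   eta y * (t^-1 ^+ d * \int[vol]_x (v k x * (partial i (m k) (shrink y t x) - (i == k)%:R * th (shrink y t x)))).
  have [_ _ vki _] := gv k.
  apply: (kern_slice vki Dy t0 t1 (tmp k)) => x.
  by rewrite /pot_weight /m partial_moment//=; ring.
pose S k := fun z => m k (shrink y t z).
have E2 k : \int[vol]_x kern D (fun x p => fld_weight k x p * th x) (w k) x (y, t) =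
   eta y * t * (t^-1 ^+ d * \int[vol]_x (w k x * S k x)).
  have [_ _ wki _] := gw k.
  apply: (kern_slice wki Dy t0 t1 (tm k)) => x.
  by rewrite /fld_weight /m /moment /=; ring.
have E3 : \int[vol]_x kern D (radial_weight th) (v i) x (y, t) =
   eta y * (t^-1 ^+ d * \int[vol]_x (v i x * euler th d.-1 y (shrink y t x))).
  by apply: (kern_slice vii Dy t0 t1 _ _) => //; exact: test_euler.
rewrite E3; under eq_bigr do rewrite E1 E2.
(* Star-shapedness enters here: contracting towards a centre maps [D] into itself, so the
   transported test function is still supported in [D]. *)
have tS k : test_function D (S k).
  by apply: test_shrink => // x Dx; apply: star => //; rewrite ltW.
have pS k j z : partial j (m k) (shrink y t z) = t * partial j (S k) z.
  rewrite (_ : partial j (S k) z = t^-1 * partial j (m k) (shrink y t z)) ?mulrA ?inv_t ?mul1r//.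
  by apply: partial_shrink; exact: test_smooth (tm k).
pose T z := th (shrink y t z).
have tT : test_function D T.
  by apply: test_shrink => // x Dx; apply: star => //; rewrite ltW.
have F1 k : \int[vol]_x (v k x * (partial i (m k) (shrink y t x) - (i == k)%:R * th (shrink y t x))) =
   t * \int[vol]_x (v k x * partial i (S k) x) - (i == k)%:R * \int[vol]_x (v k x * T x).
  have [_ _ vki _] := gv k.
  have i1 := ae_integrable_mul_test vki (test_partial i (tS k)).
  have i2 := ae_integrable_mul_test vki tT.
  rewrite -!RintZ// -RintB//; [|exact: ae_integrableZ..].
  by apply: eq_Rintegral => z _; rewrite pS /T; ring.
have F3 : \int[vol]_x (v i x * euler th d.-1 y (shrink y t x)) =
  t * \sum_k \int[vol]_x (v i x * partial k (S k) x) - \int[vol]_x (v i x * T x).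
  have i1 k := ae_integrable_mul_test vii (test_partial k (tS k)).
  have i2 := ae_integrable_mul_test vii tT.
  rewrite -Rint_sum// -RintZ//; last by apply: ae_integrable_sum.
  rewrite -RintB//; last by apply: ae_integrableZ => //; apply: ae_integrable_sum.
  apply: eq_Rintegral => z _; rewrite euler_moment// sumrB sumr_const card_ord.
  under eq_bigr => k _ do rewrite -/(m k) pS.
  rewrite -mulr_sumr -mulr_sumr -/(T z) -[in T z *+ d](prednK d_gt0) mulrS mulr_natl; ring.
rewrite F3.
transitivity (eta y * t^-1 ^+ d * \sum_k (t * \int[vol]_x (v i x * partial k (S k) x) -
    (i == k)%:R * \int[vol]_x (v k x * T x))).
  rewrite mulr_sumr; apply: eq_bigr => k _; rewrite F1.
  exact: kernel_algebra (sub_eq_opp (vw (S k) k (tS k))).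
rewrite sumrB -mulr_sumr [X in _ - X](bigD1 i)//= eqxx mul1r [X in _ - (_ + X)]big1 ?addr0 -?mulrA//.
by move=> k ki; rewrite eq_sym (negbTE ki) mul0r.
Qed.

End star_shaped.
End radial.

(** * The homotopy operators on square integrable fields *)

Section L2_operators.
Context {R : realType} {d : nat}.
Local Notation E := 'rV[R]_d.
Local Notation vol := (@lebesgue_row R d).
Local Notation mR := (measurableTypeR R).

Definition star_domain (D : set E) := [/\ open D, bounded_set D &
  exists B, [/\ open B, B !=set0, B `<=` D &
    forall x y (t : R), D x -> B y -> 0 <= t <= 1 -> D (dil x (y, t))]].

(** Linearity is asked almost everywhere only, because the operators act through chosen
    representatives and their integrals split only for almost every [x]. *)
Definition L2_operator (D : set E) (C : R) (P : ('I_d -> E -> R) -> E -> R) : Prop :=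
  (forall v, (forall k, L2 D (v k)) -> L2 D (P v) /\
     \int[vol]_(x in D) P v x ^+ 2 <= C * \sum_k \int[vol]_(x in D) v k x ^+ 2) /\
  (forall (c : R) v v', (forall k, L2 D (v k)) -> (forall k, L2 D (v' k)) ->
     P (fun k x => c * v k x + v' k x) = (fun x => c * P v x + P v' x) %[ae vol in D]).

Lemma sqr_sum_le (a : 'I_d -> R) : (\sum_k a k) ^+ 2 <= d%:R * \sum_k a k ^+ 2.
Proof.
pose u : 'rV[R]_d := \row_k 1; pose v : 'rV[R]_d := \row_k a k.
have E1 : dot u v = \sum_k a k by apply: eq_bigr => k _; rewrite !mxE mul1r.
have E2 : dot u u = d%:R.
  by rewrite /dot (eq_bigr (fun=> 1)) ?sumr_const ?card_ord// => k _; rewrite !mxE mul1r.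
have E3 : dot v v = \sum_k a k ^+ 2 by apply: eq_bigr => k _; rewrite !mxE.
rewrite -E1 -E2 -E3 -!enorm_sq -exprMn -real_normK ?num_real// lerXn2r ?nnegrE ?mulr_ge0 ?enorm_ge0//.
exact: dot_cauchy.
Qed.

Section avg_operator.
Variables (D : set E) (mD : measurable D) (volD : (vol D < +oo)%E).
Let slab : set (E * mR) := D `*` `]0, 1]%classic.

Lemma goodP (f : E -> R) : exists g, good D g /\ (L2 D f -> f = g %[ae vol in D]).
Proof.
have [Lf|nLf] := pselect (L2 D f).
  have [g [fg g0 mg gi g2]] := L2_rep mD volD Lf.
  by exists g.
exists (cst 0); split=> //; split=> //; first exact: integrable0.
by rewrite (_ : (fun _ => _) = cst 0%E); [exact: integrable0|apply/funext => x; rewrite /= expr0n].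
Qed.

(** Chosen for each function separately, so [rep] of a sum and the sum of the representatives agree
    only almost everywhere; outside [L2] the value is just some good function. *)
Definition rep (f : E -> R) : E -> R := sval (cid (goodP f)).

Lemma rep_good f : good D (rep f).
Proof. by rewrite /rep; case: cid => g []. Qed.

Lemma rep_ae f : L2 D f -> f = rep f %[ae vol in D].
Proof. by rewrite /rep; case: cid => g []. Qed.

Lemma good_L2 (D' : set E) g : measurable D' -> good D g -> L2 D' g.
Proof.
move=> mD' [_ mg _ g2]; exists g; split; [exact: aeW|exact: measurable_funTS|].
exact: (integrableS measurableT mD' (@subsetT _ _) g2).
Qed.

Lemma good_lin (c : R) f g : good D f -> good D g -> good D (fun x => c * f x + g x).
Proof.
move=> gf gg; have [f0 mf fi f2] := gf; have [g0 mg gi g2] := gg.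
have mh : measurable_fun setT (fun x => c * f x + g x).
  by apply: measurable_funD => //; exact: measurable_funM.
split=> //.
- by move=> x nD; rewrite f0// g0// mulr0 addr0.
- apply: ae_integrable_integrable => //; apply: ae_integrableD => //.
    by apply: ae_integrableZ => //; exact: integrable_ae_integrable.
  exact: integrable_ae_integrable.
- apply: (@ae_integrable_integrable _ _ _ vol setT (fun x => (c * f x + g x) ^+ 2)) => //.
    exact: measurable_funX.
  apply: L2_sq; apply: L2D => //; last exact: good_L2.
  by apply: L2Z => //; exact: good_L2.
Qed.

Lemma Rint_good f : good D f -> \int[vol]_(x in D) f x ^+ 2 = \int[vol]_x f x ^+ 2.
Proof.
move=> [f0 _ _ _]; rewrite Rintegral_mkcond; apply: eq_Rintegral => x _; rewrite patchE.
by case: ifPn => //; rewrite notin_setE => /f0 ->; rewrite expr0n.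
Qed.

Variables (z : 'I_d -> E -> E * mR -> R) (M : R).
Hypotheses (mz : forall k, measurable_fun setT (fun q : E * (E * mR) => z k q.1 q.2)).
Hypothesis (zM : forall k x p, D x -> slab p -> `|z k x p| <= M).

Let V := fine (vol D).
Let C0 := V * (M ^+ 2 * (2 ^+ d * V)).

Let good_avg k f : good D f -> good D (avg D (z k) f).
Proof.
move=> [f0 mf fi f2]; split.
- by move=> x nD; exact: avg_out.
- exact: (measurable_avg mD volD (mz k) (@zM k) mf f2).
- exact: (avg_integrable mD volD (mz k) (@zM k) mf f2).
- exact: (avg_sq_integrable mD volD (mz k) (@zM k) mf f2).
Qed.

(** Equality almost everywhere is not visibly preserved by [avg], which evaluates its argument along
    segments; the L^2 bound applied to the difference settles it. *)
Let avg_ae k f g : good D f -> good D g -> f = g %[ae vol in D] ->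
  {ae vol, forall x, avg D (z k) f x = avg D (z k) g x}.
Proof.
move=> gf gg fg.
have [f0 mf fi f2] := gf; have [g0 mg gi g2] := gg.
have gh := good_lin (-1) gf gg; have [h0 mh hi h2] := gh.
have b := avg_bound mD volD (mz k) (@zM k) mh h2.
have I0 : \int[vol]_x (-1 * f x + g x) ^+ 2 = 0.
  rewrite -Rint_good// (@ae_eq_Rintegral _ _ _ vol D _ (fun=> 0)); first by rewrite /Rintegral integral0.
  by apply: filterS fg => x fg Dx; rewrite fg// mulN1r addNr expr0n.
rewrite I0 !mulr0 in b.
have [_ _ _ a2] := good_avg k gh.
have : (fun x => avg D (z k) (fun x => -1 * f x + g x) x ^+ 2) = cst 0 %[ae vol in setT].
  apply: Rint_eq0_ae => //; first exact: integrable_ae_integrable.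
    by apply: aeW => x _; exact: sqr_ge0.
  by apply/eqP; rewrite eq_le b /=; apply: Rintegral_ge0 => x _; exact: sqr_ge0.
apply: filterS2 (avg_lin mD volD (-1) (mz k) (@zM k) mf f2 mg g2) => x -> /(_ I) /eqP.
by rewrite sqrf_eq0 mulN1r addrC subr_eq0 => /eqP ->.
Qed.

Lemma avg_L2_operator :
  L2_operator D (d%:R * C0) (fun v x => \sum_k avg D (z k) (rep (v k)) x).
Proof.
split=> [v Lv|c v v' Lv Lv'].
  have gk k := good_avg k (rep_good (v k)).
  have Lk k : L2 D (avg D (z k) (rep (v k))) by exact: good_L2.
  split; first exact: L2_sum.
  have ik k : ae_integrable vol D (fun x => avg D (z k) (rep (v k)) x ^+ 2).
    exact: L2_sq (Lk k).
  have is2 : ae_integrable vol D (fun x => (\sum_k avg D (z k) (rep (v k)) x) ^+ 2).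
    apply: L2_sq; exact: L2_sum.
  apply: (@le_trans _ _ (\int[vol]_(x in D) (d%:R * \sum_k avg D (z k) (rep (v k)) x ^+ 2))).
    apply: le_Rint => //; first by apply: ae_integrableZ => //; exact: ae_integrable_sum.
    by apply: aeW => x _; exact: sqr_sum_le.
  rewrite RintZ//; last exact: ae_integrable_sum.
  rewrite Rint_sum// -mulrA ler_wpM2l// mulr_sumr; apply: ler_sum => k _.
  rewrite Rint_good//; have [r0 mr ri r2] := rep_good (v k).
  apply: le_trans (avg_bound mD volD (mz k) (@zM k) mr r2) _.
  rewrite -Rint_good; last exact: rep_good.
  rewrite (@ae_eq_Rintegral _ _ _ vol D (rep (v k) ^+ 2) (fun x => v k x ^+ 2)).
    by rewrite mulrA.
  by apply: filterS (rep_ae (Lv k)) => x E0 Dx; rewrite E0.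
have h k : {ae vol, forall x, avg D (z k) (rep (fun x => c * v k x + v' k x)) x =
    c * avg D (z k) (rep (v k)) x + avg D (z k) (rep (v' k)) x}.
  have [r0 mr ri r2] := rep_good (v k); have [r0' mr' ri' r2'] := rep_good (v' k).
  apply: filterS2 (avg_lin mD volD c (mz k) (@zM k) mr r2 mr' r2')
    (avg_ae k (rep_good (fun x => c * v k x + v' k x)) (good_lin c (rep_good (v k)) (rep_good (v' k))) _) => [x <- ->//|].
  have Ll : L2 D (fun x => c * v k x + v' k x) by apply: L2D => //; exact: L2Z.
  apply: filterS3 (rep_ae Ll) (rep_ae (Lv k)) (rep_ae (Lv' k)) => x e1 e2 e3 Dx.
  by rewrite -e1// -e2// -e3.
have : {ae vol, forall x k, avg D (z k) (rep (fun x => c * v k x + v' k x)) x =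
    c * avg D (z k) (rep (v k)) x + avg D (z k) (rep (v' k)) x}.
  exact: filter_forall.
apply: filterS => x hx Dx.
rewrite mulr_sumr -big_split/=; apply: eq_bigr => k _; exact: hx.
Qed.

End avg_operator.

(** In the weak sense, [w] is a row of the curl, [w k = d_k v_i - d_i v_k], and the identity
    obtained is [d_i (P v) = v_i - Q w]. The centres are averaged by a bump supported in the set
    with respect to which [D] is star-shaped. *)
Lemma poincare_operators (D : set E) : (0 < d)%N -> star_domain D ->
  exists (P Q : ('I_d -> E -> R) -> E -> R) (C : R),
   [/\ 0 <= C, L2_operator D C P, L2_operator D C Q &
    forall v w i, (forall k, L2 D (v k)) -> (forall k, L2 D (w k)) ->
    (forall xi k, test_function D xi ->
    \int[vol]_(x in D) (v i x * partial k xi x) - \int[vol]_(x in D) (v k x * partial i xi x) =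
    - \int[vol]_(x in D) (w k x * xi x)) ->
    forall th, test_function D th ->
    \int[vol]_(x in D) (P v x * partial i th x) =
    \int[vol]_(x in D) (Q w x * th x) - \int[vol]_(x in D) (v i x * th x)].
Proof.
move=> d0 [oD bD [B [oB B0 BD starB]]].
have mD : measurable D by exact: open_measurable_row.
have volD : (vol D < +oo)%E by exact: lebesgue_row_bounded.
have [eta [tB eta0 eta1]] := bump_exists oB B0.
have teta : test_function D eta by exact: test_sub tB.
have star x y (t : R) : D x -> eta y != 0 -> 0 <= t <= 1 -> D (dil x (y, t)).
  by move=> Dx ey t01; apply: starB => //; apply: contrapT => nB; case/eqP: ey; exact: test_out tB nB.
have [M M0 hM] := weights_bound bD teta.
pose P v x := \sum_k avg D (pot_weight eta k) (rep mD volD (v k)) x.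
pose Q w x := \sum_k avg D (fld_weight eta k) (rep mD volD (w k)) x.
have oP := avg_L2_operator mD volD (measurable_pot_weight teta) (fun k x p Dx sp => (hM k x p Dx sp).1).
have oQ := avg_L2_operator mD volD (measurable_fld_weight teta) (fun k x p Dx sp => (hM k x p Dx sp).2).
exists P, Q; eexists; split; [|exact: oP|exact: oQ|].
  by rewrite !mulr_ge0 ?sqr_ge0 ?exprn_ge0 ?fine_ge0.
move=> v w i Lv Lw vw th tth.
have Pout (u : 'I_d -> E -> R) (zz : 'I_d -> E -> E * mR -> R) x : ~ D x -> \sum_k avg D (zz k) (rep mD volD (u k)) x = 0.
  by move=> nD; apply: big1 => k _; exact: avg_out.
have gv k := rep_good mD volD (v k); have gw k := rep_good mD volD (w k).
have r0 f : forall x, ~ D x -> rep mD volD f x = 0 by have [] := rep_good mD volD f.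
rewrite (Rint_rep _ (rep_ae mD volD (Lv i)))//.
have Pae (f : E -> R) : f = f %[ae vol in D] by exact: aeW.
rewrite (Rint_rep _ (Pae (P v)) (Pout v _)) (Rint_rep _ (Pae (Q w)) (Pout w _)).
apply: (potential_weak oD bD teta eta1 star d0 (v := fun k => rep mD volD (v k)) (w := fun k => rep mD volD (w k)) (i := i)) => //.
move=> xi k txi.
by rewrite -!(Rint_rep _ (rep_ae mD volD _) (r0 _))//; exact: vw.
exact: r0.
Qed.

End L2_operators.

(** * Lipschitz domains are locally star-shaped *)

Section geometry.
Context {R : realType} {d : nat}.
Local Notation E := 'rV[R]_d.

Lemma compact_finite_cover (K : set E) (W : E -> set E) : compact K ->
  (forall p, K p -> nbhs p (W p)) ->
  exists s : seq E, (forall p, p \in s -> K p) /\ forall x, K x -> exists2 p, p \in s & W p x.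
Proof.
rewrite compact_cover => cK nW.
have [||D DK KD] := cK E K (fun p => interior (W p)).
- by move=> p _; exact: open_interior.
- by move=> x Kx; exists x => //; exact: nW.
exists (finmap.enum_fset D); split=> [p pD|x /KD[p /= pD px]]; first by have := DK p pD; rewrite inE.
by exists p => //; exact: (@interior_subset _ (W p)).
Qed.

Lemma mulmx_bound (M : 'M[R]_d) : exists2 K : R, 0 < K & forall z : E, `|z *m M| <= K * `|z|.
Proof.
exists (1 + \sum_j \sum_k `|M k j|) => [|z].
  by rewrite ltr_pwDl// sumr_ge0// => j _; rewrite sumr_ge0.
apply: row_norm_le => [|j]; first by rewrite mulr_ge0// addr_ge0// sumr_ge0// => j _; rewrite sumr_ge0.
rewrite mxE (le_trans (ler_norm_sum _ _ _))//.
apply: (@le_trans _ _ (\sum_k `|M k j| * `|z|)).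
  by apply: ler_sum => k _; rewrite normrM mulrC ler_wpM2l// coord_le_norm.
rewrite -mulr_suml ler_wpM2r// [X in _ <= _ + X](bigD1 j)//= addrCA lerDl addr_ge0// sumr_ge0// => i _.
by rewrite sumr_ge0.
Qed.

Lemma continuous_mulmx (M : 'M[R]_d) : continuous (fun x : E => x *m M).
Proof.
have [K K0 hK] := mulmx_bound M => x A /nbhs_ballP[e /= e0 eA].
apply/nbhs_ballP; exists (e / K) => [|y xy]; first exact: divr_gt0.
apply: eA; move: xy; rewrite -!ball_normE /ball_/= -mulmxBl => xy.
by rewrite (le_lt_trans (hK _))// mulrC -ltr_pdivlMr.
Qed.

Definition qbox (Q : 'M[R]_d) (c r : 'I_d -> R) : set E :=
  [set x | forall k, `|(x *m Q) ord0 k - c k| < r k].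

Lemma open_qbox Q c r : open (qbox Q c r).
Proof.
rewrite openE => x xB.
suff h k : \forall y \near x, `|(y *m Q) ord0 k - c k| < r k by exact: filter_forall h.
have cF : continuous (fun y : E => (y *m Q) ord0 k).
  move=> y; apply: (@continuous_comp _ _ _ (fun y : E => y *m Q) (fun M : E => M ord0 k)).
    exact: continuous_mulmx.
  exact: coord_continuous.
have /continuousP/(_ (ball (c k) (r k)) (ball_open _ _)) oB := cF.
have : nbhs x ((fun y : E => (y *m Q) ord0 k) @^-1` ball (c k) (r k)).
  by apply: open_nbhs_nbhs; split => //; rewrite /ball /= distrC; exact: xB.
by apply: filterS => y; rewrite /ball /= distrC.
Qed.

Lemma convex_comb_lt (a b e t : R) : a < e -> b < e -> 0 <= t -> t <= 1 ->
  t * a + (1 - t) * b < e.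
Proof.
move=> ae be t0 t1; have [->|tn0] := eqVneq t 0; first by rewrite mul0r add0r subr0 mul1r.
have tp : 0 < t by rewrite lt_neqAle eq_sym tn0.
have h1 : 0 < t * (e - a) by rewrite mulr_gt0// subr_gt0.
have h2 : 0 <= (1 - t) * (e - b) by rewrite mulr_ge0// subr_ge0// ltW.
by nra.
Qed.

Lemma ball_convex (p x y : E) (r t : R) : ball p r x -> ball p r y -> 0 <= t <= 1 ->
  ball p r (dil x (y, t)).
Proof.
rewrite -!ball_normE /ball_/= => px py /andP[t0 t1].
have -> : p - dil x (y, t) = t *: (p - x) + (1 - t) *: (p - y).
  by rewrite dilE; apply/rowP => j; rewrite !mxE; ring.
apply: (le_lt_trans (ler_normD _ _)); rewrite !normrZ !ger0_norm ?subr_ge0//.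
exact: convex_comb_lt.
Qed.

Lemma ball_star_domain (p : E) (r : R) : 0 < r -> star_domain (ball p r).
Proof.
move=> r0; split; first exact: ball_open.
- exists (`|p| + r); split; first exact: num_real.
  move=> M hM x /=; rewrite -ball_normE /ball_/= => px; apply: le_trans (ltW hM).
  rewrite -[x](subrK p) addrC (le_trans (ler_normD _ _))// lerD2l distrC ltW//.
- exists (ball p r); split => //; first exact: ball_open.
    by exists p; exact: ballxx.
  by move=> x y t; exact: ball_convex.
Qed.

(** At a boundary point, take a box whose height exceeds its width in proportion to the Lipschitz
    constant, and a small box [B] deep below the graph. A segment towards [B] descends at least as
    fast as the graph can, so it stays below the graph. *)
Lemma lipschitz_star (Omega : set E) (p : E) (U : set E) : lipschitz_domain Omega ->
  bounded_set Omega -> closure Omega p -> nbhs p U ->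
  exists V, [/\ V `<=` U, open V, V p & star_domain (V `&` Omega)].
Proof.
move=> [oO cO O0 lipO] bO cOp Up.
have [Op|nOp] := pselect (Omega p).
  have : nbhs p (U `&` Omega) by apply: filterI => //; exact: open_nbhs_nbhs.
  move=> /nbhs_ballP[r /= r0 rU]; exists (ball p r); split.
  - by move=> x /rU[].
  - exact: ball_open.
  - exact: ballxx.
  - rewrite (_ : _ `&` _ = ball p r); first exact: ball_star_domain.
    by apply/seteqP; split => [x []//|x xr]; split => //; have [] := rU x xr.
have [Q [i [g [V0 [QQ lg V0p hV0]]]]] := lipO p (conj cOp nOp).
have [Lam Lam0 hL] : exists2 Lam, 0 <= Lam & forall x y, `|g x - g y| <= Lam * `|x - y|.
  move: lg => [M [_ /(_ (`|M| + 1))]].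
  have -> : M < `|M| + 1 by rewrite (le_lt_trans (ler_norm _))// ltrDl.
  move=> /(_ isT) h; exists (`|M| + 1) => [|x y]; first by rewrite addr_ge0.
  by exact: (h (x, y)).
have QtQ : Q^T *m Q = 1%:M by exact: mulmx1C.
pose q := p *m Q.
have [del del0 hdel] : exists2 del, 0 < del & forall x : E, `|x *m Q - q| < del -> (U `&` V0) x.
  have [K K0 hK] := mulmx_bound Q^T.
  have : nbhs p (U `&` V0) by exact: filterI.
  move=> /nbhs_ballP[r /= r0 rU]; exists (r / K) => [|x xq]; first exact: divr_gt0.
  apply: rU; rewrite -ball_normE /ball_/= distrC.
  have -> : x - p = (x *m Q - q) *m Q^T by rewrite mulmxBl -!mulmxA QQ !mulmx1.
  by rewrite (le_lt_trans (hK _))// mulrC -ltr_pdivlMr.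
(* Depths below [p] in units of the half-width [rho]: deeper than [T2] a point of the box is below
   the graph whatever its other coordinates are; [B] occupies the depths between [T1] and
   [T1 + 1 = T]; and [T1 - T2 = 2 Lam] covers the variation of the graph over a distance [2 rho]. *)
pose T2 := 2 * Lam + 1; pose T1 := 4 * Lam + 1; pose T := 4 * Lam + 2.
pose rho := del / (T + 1).
have T0 : 0 < T by rewrite /T; lra.
have rho0 : 0 < rho by rewrite divr_gt0// /T; lra.
have Trho : T * rho + rho = del by rewrite -{2}[rho]mul1r -mulrDl mulrC /rho divfK// gt_eqF// /T; lra.
pose V := qbox Q (fun k => q ord0 k) (fun k => if k == i then T * rho else rho).
pose B := qbox Q (fun k => if k == i then q ord0 k - (T1 + 2^-1) * rho else q ord0 k)
                 (fun k => if k == i then rho / 2 else rho).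
have VU x : V x -> (U `&` V0) x.
  move=> Vx; apply: hdel; apply: row_norm_lt => // k.
  rewrite [X in `|X|](_ : _ = (x *m Q) ord0 k - q ord0 k); last by rewrite !mxE.
  apply: lt_le_trans (Vx k) _; case: ifP => _; rewrite -Trho; first by rewrite lerDl ltW.
  by rewrite lerDr mulr_ge0// ltW.
have Vp : V p by move=> k; rewrite subrr normr0; case: ifP => _ //; rewrite mulr_gt0.
have colE (x y : E) (e : R) : 0 <= e -> (forall k, k != i -> `|x ord0 k - y ord0 k| <= e) ->
    `|col' i x - col' i y| <= e.
  move=> e0 h; apply: row_norm_le => // j; rewrite !mxE; apply: h.
  by rewrite eq_sym neq_lift.
pose y (x : E) : E := x *m Q.
have yi x : V x -> `|y x ord0 i - q ord0 i| < T * rho by move=> Vx; have := Vx i; rewrite eqxx.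
have yk x k : V x -> k != i -> `|y x ord0 k - q ord0 k| < rho.
  by move=> Vx ki; have := Vx k; rewrite (negbTE ki).
have gq x : V x -> `|g (col' i (y x)) - g (col' i q)| <= Lam * rho.
  move=> Vx; apply: le_trans (hL _ _) _; rewrite ler_wpM2l//; apply: colE; first exact: ltW.
  by move=> k ki; exact/ltW/yk.
(* [p] is a limit of points of [Omega], so it cannot lie far above the graph; a point of [Omega]
   within [rho] of it gives the bound. *)
have qg : q ord0 i <= g (col' i q) + (Lam + 1) * rho.
  have : nbhs p (qbox Q (fun k => q ord0 k) (fun=> rho)).
    by apply: open_nbhs_nbhs; split; [exact: open_qbox|move=> k; rewrite subrr normr0].
  move=> /(cOp _)[x [Ox xq]].
  have Vx : V x.
    move=> k; have := xq k; case: ifP => // _ h; rewrite (lt_le_trans h)//.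
    by rewrite -[leLHS]mul1r ler_wpM2r ?ltW// /T; lra.
  have [_ V0x] := VU x Vx.
  have /(hV0 x V0x) := Ox => h1.
  have := gq x Vx; have := xq i; rewrite -/(y x) ler_norml ltr_norml => /andP[h2 h3] /andP[h4 h5].
  move: h1; rewrite -/(y x); lra.
have BV x : B x -> V x.
  move=> Bx k; have := Bx k; case: ifP => [/eqP ->|//]; rewrite !ltr_norml => /andP[h1 h2].
  by apply/andP; split; rewrite /T /T1 in h1 h2 *; nra.
have Bi x : B x -> y x ord0 i < q ord0 i - T1 * rho.
  by move=> Bx; have := Bx i; rewrite eqxx ltr_norml => /andP[_ h]; rewrite /y; nra.
have low x : V x -> y x ord0 i < q ord0 i - T2 * rho -> Omega x.
  move=> Vx h; have [_ V0x] := VU x Vx; apply/(hV0 x V0x); rewrite -/(y x).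
  have := gq x Vx; rewrite ler_norml => /andP[h1 h2].
  by rewrite /T2 in h; nra.
have BO x : B x -> Omega x.
  move=> Bx; apply: low; first exact: BV.
  apply: lt_le_trans (Bi x Bx) _; have := mulr_ge0 Lam0 (ltW rho0); rewrite /T1 /T2; lra.
exists V; split=> //; first by move=> x /VU[].
  exact: open_qbox.
split; first by apply: openI => //; exact: open_qbox.
  by have [M [Mr hM]] := bO; exists M; split => // N /hM hN x [_ Ox]; exact: hN.
exists B; split; first exact: open_qbox.
- exists ((q - (T1 + 2^-1) * rho *: delta_mx ord0 i) *m Q^T) => k.
  rewrite -mulmxA QtQ mulmx1 !mxE eqxx /=; case: ifP => [/eqP ->|ki].
    by rewrite mulr1 subrr normr0 divr_gt0.
  by rewrite mulr0 subr0 subrr normr0.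
- by move=> x Bx; split; [exact: BV|exact: BO].
move=> x b t [Vx Ox] Bb /andP[t0 t1].
pose zz := dil x (b, t).
have yz k : y zz ord0 k = t * y x ord0 k + (1 - t) * y b ord0 k.
  by rewrite /y /zz dilE mulmxDl -!scalemxAl !mxE.
have Vb := BV b Bb.
have Vz : V zz.
  move=> k; rewrite -/(y zz) yz; have := Vx k; have := Vb k; rewrite -/(y x) -/(y b).
  move=> h1 h2; rewrite (_ : _ - _ = t * (y x ord0 k - q ord0 k) + (1 - t) * (y b ord0 k - q ord0 k)); last by ring.
  apply: (le_lt_trans (ler_normD _ _)); rewrite !normrM (ger0_norm t0) (@ger0_norm _ (1 - t)) ?subr_ge0//.
  exact: convex_comb_lt.
split=> //.
(* If [x] is deep as well, so is the whole segment; otherwise [B] is lower than [x] by at least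
   [2 Lam rho]. *)
have [h|h] := ltP (y x ord0 i) (q ord0 i - T2 * rho).
  apply: low => //; rewrite yz.
  apply: convex_comb_lt => //; apply: lt_le_trans (Bi b Bb) _.
  by have := mulr_ge0 Lam0 (ltW rho0); rewrite /T1 /T2; lra.
have [_ V0z] := VU zz Vz; have [_ V0x] := VU x Vx.
apply/(hV0 zz V0z); have := (hV0 x V0x).1 Ox; rewrite -/(y zz) -/(y x) yz => gx.
have : `|g (col' i (y x)) - g (col' i (y zz))| <= Lam * ((1 - t) * (2 * rho)).
  apply: le_trans (hL _ _) _; rewrite ler_wpM2l//; apply: colE.
    by rewrite mulr_ge0 ?subr_ge0// mulr_ge0// ltW.
  move=> k ki; rewrite yz.
  rewrite (_ : _ - _ = (1 - t) * ((y x ord0 k - q ord0 k) - (y b ord0 k - q ord0 k))); last by ring.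
  rewrite normrM ger0_norm ?subr_ge0// ler_wpM2l ?subr_ge0//.
  rewrite (le_trans (ler_normB _ _))// mulr_natl mulr2n lerD// ltW//; exact: yk.
rewrite ler_norml => /andP[h1 h2].
have := Bi b Bb => h3.
have [t1'|t1'] := eqVneq t 1.
  by rewrite t1' in h1 h2 *; lra.
have h4 : 0 < 1 - t by rewrite subr_gt0 lt_neqAle t1' t1.
have h5 : y b ord0 i <= y x ord0 i - 2 * Lam * rho by rewrite /T1 in h3; rewrite /T2 in h; lra.
have h6 : (1 - t) * y b ord0 i <= (1 - t) * (y x ord0 i - 2 * Lam * rho) by rewrite ler_wpM2l// ltW.
by move: h1 h2 h6 gx; nra.
Qed.

End geometry.

(** * Locally constant cocycles on simply connected domains *)

Section monodromy.
Context {R : realType} {d : nat}.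
Local Notation E := 'rV[R]_d.

Lemma lebesgue_number (T : pseudoMetricType R) (K : set T) (W : T -> set T) : compact K ->
  (forall s, K s -> nbhs s (W s)) ->
  exists2 e : R, 0 < e & forall s, K s -> exists2 p, K p & ball s e `<=` W p.
Proof.
move=> /compact_near_coveringP cK nW.
have := cK R (0 : R)^'+ (fun e s => exists2 p, K p & ball s e `<=` W p) _.
move=> /(_ _)[].
- move=> x Kx; have /nbhs_ballP[e /= e0 eW] := nW x Kx.
  exists (ball x (e / 2), [set r | 0 < r < e / 2]) => /=.
    split; first by apply: nbhsx_ballx; rewrite divr_gt0.
    by near=> r; apply/andP; split; near: r; [exact: nbhs_right_gt|apply: nbhs_right_lt; rewrite divr_gt0].
  move=> [s r] /= [xs /andP[r0 re]]; exists x => // q sq; apply: eW.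
  rewrite [e]splitr; apply: ball_triangle xs _; exact: (le_ball (ltW re)).
move=> e /= e0 he; exists (e / 2); first exact: divr_gt0.
apply: he; last exact: divr_gt0.
by rewrite /= sub0r normrN ger0_norm ?divr_ge0 ?ltW// ltr_pdivrMr// ltr_pMr// ltr1n.
Unshelve. all: by end_near. Qed.

(** Restricted to the segment, parametrized over the whole line by clamping the time, the function
    has derivative zero. *)
Lemma locally_constant_star (f : E -> R) (S : set E) (b x : E) :
  (forall t : R, 0 <= t <= 1 -> S (dil x (b, t))) ->
  (forall y, S y -> \forall z \near y, f z = f y) -> f x = f b.
Proof.
move=> starS lf.
pose cl (t : R) := Num.max 0 (Num.min 1 t).
have cl01 t : 0 <= cl t <= 1 by rewrite /cl le_max lexx ge_max ler01 ge_min lexx.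
pose G (t : R) := f (dil x (b, cl t)).
have cG : continuous (fun t : R => dil x (b, cl t)).
  move=> t; rewrite /dil /=; apply: cvgD; first exact: cvg_cst.
  apply: cvgZr_tmp.
  by apply: continuous_max; [exact: cvg_cst|apply: continuous_min; [exact: cvg_cst|exact: cvg_id]].
have dG t : is_derive t (1 : R) G 0.
  apply: (@near_eq_is_derive _ _ _ (cst (G t)) G) => //.
  near=> s; rewrite /G /=; apply/esym; near: s.
  exact: cG t _ (lf _ (starS _ (cl01 t))).
have := @is_derive_0_is_cst _ G 0 1 dG.
rewrite /G /cl minxx (max_r ler01) (min_r ler01) maxxx !dilE.
by rewrite scale0r add0r subr0 scale1r scale1r subrr scale0r addr0 => ->.
Unshelve. all: by end_near. Qed.

Section chains.
Variables (Omega : set E) (c : E -> E -> R) (r : E -> R).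
Hypothesis r0 : forall p, Omega p -> 0 < r p.
Hypothesis rO : forall p, Omega p -> ball p (r p) `<=` Omega.
Hypothesis cc : forall p x y z : E, Omega p -> ball p (r p) x -> ball p (r p) y -> ball p (r p) z ->
  c x y + c y z = c x z.

Definition linked (x y : E) := exists p, [/\ Omega p, ball p (r p) x & ball p (r p) y].

Lemma c_refl p : Omega p -> c p p = 0.
Proof.
move=> Op; have pp : ball p (r p) p by apply: ballxx; exact: r0.
by have /eqP := cc Op pp pp pp; rewrite -[X in _ == X]addr0 (inj_eq (addrI _)) => /eqP.
Qed.

Lemma c_anti x y : linked x y -> c x y = - c y x.
Proof.
move=> [p [Op px py]].
have xx : c x x = 0.
  by have /eqP := cc Op px px px; rewrite -[X in _ == X]addr0 (inj_eq (addrI _)) => /eqP.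
by apply/eqP; rewrite -addr_eq0 (cc Op px py px) xx.
Qed.

Lemma c_telescope p (u : nat -> E) (a n : nat) : Omega p ->
  (forall j, (a <= j <= a + n)%N -> ball p (r p) (u j)) ->
  \sum_(a <= j < a + n) c (u j) (u j.+1) = c (u a) (u (a + n)%N).
Proof.
move=> Op; elim: n => [|n IHn] h.
  have pa : ball p (r p) (u a) by apply: h; rewrite leqnn leq_addr.
  rewrite addn0 big_geq//.
  by have /eqP := cc Op pa pa pa; rewrite -[X in _ == X]addr0 (inj_eq (addrI _)) => /eqP ->.
rewrite addnS big_nat_recr ?leq_addr//= IHn; last by move=> j /andP[h1 h2]; apply: h; rewrite h1 addnS leqW.
by apply: (cc Op); apply: h; lia.
Qed.

Section closed_chain.
Hypothesis sc : forall gamma : R -> E,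
    {within `[0, 1], continuous gamma} -> gamma @` `[0, 1] `<=` Omega ->
    gamma 0 = gamma 1 ->
    exists H : R * R -> E,
      [/\ {within `[0, 1] `*` `[0, 1], continuous H},
          H @` (`[0, 1] `*` `[0, 1]) `<=` Omega,
          forall t, t \in `[0, 1] -> H (0, t) = gamma t /\ H (1, t) = gamma 0
        & forall s, s \in `[0, 1] -> H (s, 0) = gamma 0 /\ H (s, 1) = gamma 0].

Let clamp (s : R) : R := Num.max 0 (Num.min 1 s).

Let continuous_clamp : continuous clamp.
Proof.
by move=> t; apply: continuous_max; [exact: cvg_cst|apply: continuous_min; [exact: cvg_cst|exact: cvg_id]].
Qed.

(** A sum of clamped increments is continuous term by term, without matching linear pieces at the
    vertices. *)
Definition polygon (n : nat) (u : nat -> E) (t : R) : E :=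
  u 0%N + \sum_(0 <= j < n) clamp (n%:R * t - j%:R) *: (u j.+1 - u j).

Lemma continuous_polygon n u : continuous (polygon n u).
Proof.
suff gen k m : continuous (fun t : R => u 0%N + \sum_(0 <= j < m) clamp (k%:R * t - j%:R) *: (u j.+1 - u j)).
  exact: gen.
elim: m => [|m IHm] t.
  rewrite (_ : (fun _ => _) = cst (u 0%N)); first exact: cvg_cst.
  by apply/funext => s; rewrite big_geq// addr0.
rewrite (_ : (fun _ => _) = fun s => (u 0%N + \sum_(0 <= j < m) clamp (k%:R * s - j%:R) *: (u j.+1 - u j)) +
   clamp (k%:R * s - m%:R) *: (u m.+1 - u m)); last first.
  by apply/funext => s; rewrite big_nat_recr//= addrA.
apply: cvgD; first exact: IHm.
apply: cvgZr_tmp.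
apply: (@continuous_comp _ _ _ (fun s : R => k%:R * s - m%:R) clamp); last exact: continuous_clamp.
by apply: cvgB; [apply: cvgM; [exact: cvg_cst|exact: cvg_id]|exact: cvg_cst].
Qed.

Lemma polygonE n u i t : (i < n)%N -> i%:R <= n%:R * t <= i.+1%:R ->
  polygon n u t = u i + (n%:R * t - i%:R) *: (u i.+1 - u i).
Proof.
move=> ni /andP[ti ti1]; rewrite /polygon.
rewrite (@big_cat_nat _ _ _ i.+1)//= big_nat_recr//=.
rewrite (@eq_big_nat _ _ _ 0 i _ (fun j => u j.+1 - u j)); last first.
  move=> j /andP[_ ji]; rewrite /clamp min_l ?max_r ?scale1r//.
  rewrite lerBrDr; apply: le_trans ti; by rewrite addrC natr1 ler_nat.
rewrite telescope_sumr// [X in _ + (_ + X)]big_nat_cond [X in _ + (_ + X)]big1 => [|j /andP[/andP[ij jn] _]].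
  rewrite addr0 addrA [u 0%N + _]addrC subrK /clamp min_r; last by rewrite lerBlDr addrC natr1.
  by rewrite max_r// subr_ge0.
rewrite /clamp [Num.min _ _]min_r; last first.
  rewrite lerBlDr; apply: le_trans ti1 _; rewrite -(ler_nat R) in ij; lra.
by rewrite max_l ?scale0r// subr_le0 (le_trans ti1)// ler_nat.
Qed.

(* A contraction of the polygon through the chain is subdivided so finely that
   each cell lies in a single ball; the sums around the cells cancel. *)
Lemma closed_chain_sum (n : nat) (u : nat -> E) : (0 < n)%N -> u n = u 0%N ->
  (forall i, (i < n)%N -> linked (u i) (u i.+1)) ->
  \sum_(0 <= i < n) c (u i) (u i.+1) = 0.
Proof.
move=> n0 un lu; pose g := polygon n u.
have nR0 : 0 < n%:R :> R by rewrite ltr0n.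
have cvx p x y (s : R) : ball p (r p) x -> ball p (r p) y -> 0 <= s <= 1 -> ball p (r p) (x + s *: (y - x)).
  by move=> px py; exact: ball_convex py px.
have gseg i (t : R) p : (i < n)%N -> ball p (r p) (u i) -> ball p (r p) (u i.+1) ->
    i%:R <= n%:R * t <= i.+1%:R -> ball p (r p) (g t).
  move=> ni pi pi1 ti; rewrite /g (polygonE u ni ti); apply: cvx => //.
  by move: ti; rewrite -natr1 => /andP[h1 h2]; apply/andP; split; lra.
have seg (t : R) : 0 <= t <= 1 -> exists2 i, (i < n)%N & i%:R <= n%:R * t <= i.+1%:R.
  move=> /andP[t0 t1]; have nt0 : 0 <= n%:R * t by rewrite mulr_ge0.
  have [tn1|tn1] := eqVneq t 1.
    exists n.-1; first by rewrite prednK.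
    by rewrite tn1 mulr1 prednK// !ler_nat leqnn leq_pred.
  have /andP[h1 h2] := truncn_itv nt0.
  exists (Num.truncn (n%:R * t)); last by rewrite h1 ltW.
  rewrite -(ltr_nat R); apply: le_lt_trans h1 _.
  by rewrite -[ltRHS]mulr1 ltr_pM2l// lt_neqAle tn1.
have gi i : (i <= n)%N -> g (i%:R / n%:R) = u i.
  move=> i_n; have ni : n%:R * (i%:R / n%:R) = i%:R :> R by rewrite mulrC divfK// gt_eqF.
  have [in'|] := ltnP i n.
    by rewrite /g (polygonE u in') ni ?lexx ?ler_nat//= subrr scale0r addr0.
  move=> ni'; have -> : i = n by apply/eqP; rewrite eqn_leq i_n.
  have nn : (n.-1 < n)%N by rewrite prednK.
  rewrite /g (polygonE u nn) divff ?gt_eqF// mulr1; last by rewrite prednK// !ler_nat leqnn leq_pred.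
  have e1 : n%:R - n.-1%:R = 1 :> R by rewrite -{1}(prednK n0) -natr1 addrAC subrr add0r.
  by rewrite prednK// e1 scale1r addrC subrK.
have gO : g @` `[0, 1] `<=` Omega.
  move=> _ [t /= t01 <-]; rewrite in_itv/= in t01; have [i ni ti] := seg t t01.
  by have [p [Op pi pi1]] := lu i ni; apply: (rO Op); exact: gseg ti.
have g01 : g 0 = g 1.
  have := gi n (leqnn n); have := gi 0%N (leq0n n).
  by rewrite mul0r divff ?gt_eqF// => -> ->.
have gc : {within `[0, 1], continuous g} by apply: continuous_subspaceT; exact: continuous_polygon.
have [H [cH HO H0 H1]] := sc gc gO g01.
pose K : set (R * R) := `[0, 1] `*` `[0, 1].
have cK : compact K by apply: compact_setX; exact: segment_compact.
pose W (s : R * R) : set (R * R) := [set q | K q -> ball (H s) (r (H s)) (H q)].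
have HOs s : K s -> Omega (H s) by move=> Ks; apply: HO; exists s.
have nW s : K s -> nbhs s (W s).
  move=> Ks; move/subspace_continuousP: cH => /(_ s Ks) /(_ (ball (H s) (r (H s)))).
  by apply; apply: nbhsx_ballx; exact/r0/HOs.
have [e e0 he] := lebesgue_number cK nW.
(* The number of subdivisions is a multiple of [n], so that the vertices of the polygon, at the
   times [i/n], are grid points. *)
have [m m0 me] : exists2 m, (0 < m)%N & (n * m)%:R^-1 < e.
  exists (Num.truncn e^-1).+1 => //.
  rewrite invf_plt ?posrE ?ltr0n ?muln_gt0 ?n0//.
  apply: (lt_le_trans (@truncnS_gt R _)); rewrite ler_nat leq_pmull//.
pose M := (n * m)%N; have M0 : (0 < M)%N by rewrite muln_gt0 n0.
have MR0 : 0 < M%:R :> R by rewrite ltr0n.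
pose h i j := H (i%:R / M%:R, j%:R / M%:R).
have K01 (i : nat) : (i <= M)%N -> 0 <= (i%:R / M%:R : R) <= 1.
  by move=> iM; rewrite divr_ge0//= ler_pdivrMr// mul1r ler_nat.
have sq i j : (i < M)%N -> (j < M)%N -> exists p, Omega p /\
    forall a b, (a <= 1)%N -> (b <= 1)%N -> ball p (r p) (h (i + a)%N (j + b)%N).
  move=> iM jM; have Kij : K (i%:R / M%:R, j%:R / M%:R) by split; rewrite /= in_itv /=; apply: K01; exact: ltnW.
  have [s Ks sW] := he _ Kij; exists (H s); split; first exact: HOs.
  move=> a b a1 b1; apply: sW; last by split; rewrite /= in_itv/=; apply: K01; lia.
  have near1 k a' : (a' <= 1)%N -> ball (k%:R / M%:R : R) e ((k + a')%:R / M%:R).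
    move=> a1'; rewrite /ball /= -mulrBl natrD opprD addrA subrr sub0r mulNr normrN ger0_norm ?divr_ge0//.
    by apply: le_lt_trans me; rewrite ler_piMl ?invr_ge0// lern1.
  by split; exact: near1.
pose S i := \sum_(0 <= j < M) c (h i j) (h i j.+1).
have g0O : Omega (g 0) by apply: gO; exists 0 => //=; rewrite in_itv/= lexx ler01.
have hl i : (i <= M)%N -> h i 0%N = g 0 /\ h i M = g 0.
  move=> iM; rewrite /h mul0r divff ?gt_eqF//.
  by apply: H1; rewrite in_itv/=; exact: K01.
(* In each cell the two ways around give the same sum; the transversal steps telescope to those on
   the two lateral sides, where the homotopy stays at [g 0]. *)
have Sstep i : (i < M)%N -> S i = S i.+1.
  move=> iM.
  suff : S i + \sum_(0 <= j < M) (c (h i j.+1) (h i.+1 j.+1) - c (h i j) (h i.+1 j)) = S i.+1.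
    rewrite (telescope_sumr (fun j => c (h i j) (h i.+1 j)))//.
    have [-> ->] := hl i (ltnW iM); have [-> ->] := hl i.+1 iM.
    by rewrite subrr addr0.
  rewrite /S -big_split/=; apply: eq_big_nat => j /andP[_ jM].
  have [p [Op hp]] := sq i j iM jM.
  have := hp 0%N 0%N isT isT; have := hp 0%N 1%N isT isT; have := hp 1%N 0%N isT isT; have := hp 1%N 1%N isT isT.
  rewrite !addn0 !addn1 => p11 p10 p01 p00.
  by have := cc Op p00 p01 p11; have := cc Op p00 p10 p11; lra.
have SM : S 0%N = S M.
  have : forall i, (i <= M)%N -> S 0%N = S i.
    by elim=> [//|i IHi] iM; rewrite -Sstep//; apply: IHi; exact: ltnW.
  by apply.
have H0' (i : nat) : (i <= M)%N -> H (0, i%:R / M%:R) = g (i%:R / M%:R) /\ H (1, i%:R / M%:R) = g 0.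
  by move=> iM; apply: H0; rewrite in_itv/=; exact: K01.
have SM0 : S M = 0.
  rewrite /S big_nat big1// => j /andP[_ jM]; rewrite /h divff ?gt_eqF//.
  have [_ ->] := H0' j (ltnW jM); have [_ ->] := H0' j.+1 jM.
  exact: c_refl.
transitivity (S 0%N); last by rewrite SM SM0.
rewrite /S.
have -> : \sum_(0 <= j < M) c (h 0%N j) (h 0%N j.+1) = \sum_(0 <= j < M) c (g (j%:R / M%:R)) (g (j.+1%:R / M%:R)).
  apply: eq_big_nat => j /andP[_ jM]; rewrite /h mul0r.
  by have [-> _] := H0' j (ltnW jM); have [-> _] := H0' j.+1 jM.
(* The initial row regroups into blocks of [m] steps, each along one edge of the polygon and hence
   inside one ball. *)
rewrite /M big_nat_mul /=.
have mR0 : 0 < m%:R :> R by rewrite ltr0n.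
have jm (j : nat) : n%:R * (j%:R / M%:R) = j%:R / m%:R :> R.
  by rewrite /M natrM invfM mulrCA mulVKf// gt_eqF.
apply: eq_big_nat => i /andP[_ ni].
have [p [Op pi pi1]] := lu i ni.
have e1 : (i.+1 * m = i * m + m)%N by rewrite mulSn addnC.
have hb j : (i * m <= j <= i * m + m)%N -> ball p (r p) (g (j%:R / M%:R)).
  move=> /andP[h1 h2]; apply: (gseg i) => //.
  rewrite jm; apply/andP; split; first by rewrite ler_pdivlMr// -natrM ler_nat.
  by rewrite ler_pdivrMr// -natrM ler_nat e1.
rewrite e1 (c_telescope Op hb) -e1.
have gu l : (l <= n)%N -> g ((l * m)%N%:R / M%:R) = u l.
  move=> ln; rewrite -gi//; congr (g _).
  by rewrite /M !natrM -mulf_div divff ?mulr1// gt_eqF.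
by rewrite !gu// ltnW.
Qed.

Hypothesis (oO : open Omega) (cO : connected Omega) (O0 : Omega !=set0).

Let e (x y : E) : bool := `[< linked x y >].

Let e_sym x y : e x y = e y x.
Proof. by apply/asboolP/asboolP => -[p [? ? ?]]; exists p; split. Qed.

(** The set of points reachable from [x0] is open and closed in [Omega], since every point of a ball
    is linked to its centre. *)
Lemma chain_connected (x0 x : E) : Omega x0 -> Omega x -> exists2 s, path e x0 s & last x0 s = x.
Proof.
move=> O0' Ox; pose A : set E := [set x | Omega x /\ exists2 s, path e x0 s & last x0 s = x].
suff OA : Omega = A by rewrite OA in Ox; case: Ox.
have step y z : A y -> Omega z -> e y z -> A z.
  move=> [Oy [s ps ls]] Oz yz; split=> //; exists (rcons s z); last by rewrite last_rcons.
  by rewrite rcons_path ps ls.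
have bb p : Omega p -> ball p (r p) p by move=> Op; apply: ballxx; exact: r0.
apply/esym; apply: cO.
- by exists x0; split => //; exists [::].
- exists (\bigcup_(y in A) ball y (r y)); first by apply: bigcup_open => y _; exact: ball_open.
  apply/seteqP; split=> [y Ay|y [Oy [z Az zy]]].
    by split; [case: Ay|exists y => //; apply: bb; case: Ay].
  apply: (step z) => //; apply/asboolP; exists z; split=> //; [by case: Az|apply: bb; by case: Az].
- exists (~` \bigcup_(y in Omega `\` A) ball y (r y)).
    by apply: open_closedC; apply: bigcup_open => y _; exact: ball_open.
  apply/seteqP; split=> [y Ay|y [Oy nz]].
    split; first by case: Ay.
    move=> [z [Oz nAz] zy]; apply: nAz; apply: (step y) => //; apply/asboolP.
    by exists z; split => //; exact: bb.
  by apply: contrapT => nAy; apply: nz; exists y => //; exact: bb.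
Qed.

Fixpoint csum (x : E) (s : seq E) : R := if s is y :: s' then c x y + csum y s' else 0.

Let csum_cat x s1 s2 : csum x (s1 ++ s2) = csum x s1 + csum (last x s1) s2.
Proof. by elim: s1 x => [|y s IHs] x /=; rewrite ?add0r// IHs addrA. Qed.

Let csum_rev x s : path e x s -> csum (last x s) (rev (belast x s)) = - csum x s.
Proof.
elim: s x => [|y s IHs] x /=; first by rewrite oppr0.
move=> /andP[/asboolP xy ps]; rewrite rev_cons -cats1 csum_cat IHs//=.
have -> : last (last y s) (rev (belast y s)) = y.
  by case: s {IHs ps} => // z s; rewrite /= rev_cons last_rcons.
by rewrite addr0 (c_anti xy) opprD opprK addrC.
Qed.

Let csum_closed x s : path e x s -> last x s = x -> csum x s = 0.
Proof.
move=> ps ls; pose u i := nth x (x :: s) i.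
have -> : csum x s = \sum_(0 <= i < size s) c (u i) (u i.+1).
  rewrite /u; elim: s {ps ls u} (x) => [|y s IHs] z; first by rewrite big_geq.
  rewrite big_nat_recl//= IHs; congr (_ + _); apply: eq_big_nat => i /andP[_ si].
  by rewrite (set_nth_default z y)//= ?(set_nth_default z y)// ltnW.
have [->|s0] := posnP (size s); first by rewrite big_geq.
apply: closed_chain_sum => //.
  by rewrite /u -[LHS]/(nth x (x :: s) (size s)) -last_nth ls.
by move=> i si; move/(pathP x): ps => /(_ i si) /asboolP; rewrite /u.
Qed.

(** [a x] is the sum of [c] along a chosen chain from [x0] to [x]. For linked points the two chains
    and the link form a closed chain, whose sum vanishes. *)
Lemma primitive_exists : exists a : E -> R, forall x y, linked x y -> c x y = a y - a x.
Proof.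
have [x0 Ox0] := O0.
have lO x y : linked x y -> Omega x /\ Omega y.
  by move=> [p [Op px py]]; split; exact: (rO Op).
have ch x : exists s, Omega x -> path e x0 s /\ last x0 s = x.
  have [Ox|nO] := pselect (Omega x); last by exists [::].
  by have [s ps ls] := chain_connected Ox0 Ox; exists s.
have [s hs] := choice ch.
exists (fun x => csum x0 (s x)) => x y lxy.
have [Ox Oy] := lO x y lxy; have [px lx] := hs x Ox; have [py ly] := hs y Oy.
have pr : path e y (rev (belast x0 (s y))).
  by rewrite -{1}ly rev_path; under eq_path do rewrite e_sym.
have lr : last y (rev (belast x0 (s y))) = x0.
  by rewrite -{1}ly; case: (s y) => // z t; rewrite /= rev_cons last_rcons.
have := @csum_closed x0 (s x ++ y :: rev (belast x0 (s y))).
rewrite cat_path px lx /= pr last_cat /= lr csum_cat lx /=.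
have -> : e x y by apply/asboolP.
move=> /(_ isT erefl).
rewrite -{2}ly csum_rev// => h.
by apply/eqP; rewrite eq_sym subr_eq -subr_eq0; apply/eqP; move: h; lra.
Qed.

End closed_chain.
End chains.

(** The cocycle becomes a function of two nearby points: with an index [kk x] chosen at each point,
    [c x y] compares [delta (kk _) k] at [x] and at [y], with the same result for all [k] available
    nearby. Its primitive [a], supplied by simple connectedness, makes [delta (kk x) k x + a x]
    constant on [D k], and this constant is [- lam k]. *)
Lemma cocycle_trivial (Omega : set E) (N : nat) (D : 'I_N -> set E) (delta : 'I_N -> 'I_N -> E -> R) :
  simply_connected Omega -> open Omega -> Omega !=set0 ->
  (forall k, open (D k) /\ D k `<=` Omega) ->
  (forall k, exists b, forall x (t : R), D k x -> 0 <= t <= 1 -> D k (dil x (b, t))) ->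
  (forall x, Omega x -> exists k, D k x) ->
  (forall k l x, D k x -> D l x -> \forall y \near x, delta k l y = delta k l x) ->
  (forall k l m x, D k x -> D l x -> D m x -> delta k l x + delta l m x = delta k m x) ->
  exists lam : 'I_N -> R, forall k l x, D k x -> D l x -> delta k l x = lam k - lam l.
Proof.
move=> [cO sc] oO O0 hD starD cov lc coc.
have rex p : exists rr : R, Omega p -> [/\ 0 < rr, ball p rr `<=` Omega &
   forall k l y, D k p -> D l p -> ball p rr y -> [/\ D k y, D l y & delta k l y = delta k l p]].
  have [Op|nO] := pselect (Omega p); last by exists 0.
  have n3 : nbhs p Omega by exact: open_nbhs_nbhs.
  have h k l : \forall y \near p, D k p -> D l p -> [/\ D k y, D l y & delta k l y = delta k l p].
    have [Dk|nD] := pselect (D k p); last by apply: filterS n3 => y _ /nD.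
    have [Dl|nD] := pselect (D l p); last by apply: filterS n3 => y _ _ /nD.
    have n1 : nbhs p (D k) by apply: open_nbhs_nbhs; split => //; case: (hD k).
    have n2 : nbhs p (D l) by apply: open_nbhs_nbhs; split => //; case: (hD l).
    by apply: filterS3 n1 n2 (lc k l p Dk Dl).
  have h1 : \forall y \near p, forall k l, D k p -> D l p -> [/\ D k y, D l y & delta k l y = delta k l p].
    have h2 k : \forall y \near p, forall l, D k p -> D l p -> [/\ D k y, D l y & delta k l y = delta k l p].
      by have := @filter_forall _ _ (fun l y => D k p -> D l p -> [/\ D k y, D l y & delta k l y = delta k l p]) _ (nbhs_filter p) (h k).
    by have := @filter_forall _ _ (fun k y => forall l, D k p -> D l p -> [/\ D k y, D l y & delta k l y = delta k l p]) _ (nbhs_filter p) h2.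
  have h4 : nbhs p ([set y | forall k l, D k p -> D l p -> [/\ D k y, D l y & delta k l y = delta k l p]] `&` Omega).
    exact: filterI h1 n3.
  have /nbhs_ballP[rr /= rr0 hr] := h4.
  by exists rr => _; split=> // [y /hr[]//|k l y Dk Dl /hr[+ _]]; exact.
have [r hr] := choice rex.
have kex p : exists k, Omega p -> D k p.
  have [Op|nO] := pselect (Omega p); first by have [k Dk] := cov p Op; exists k.
  have [x Ox] := O0; have [k _] := cov x Ox; by exists k.
have [kk hk] := choice kex.
have [z Oz] := O0.
have dkk k x : D k x -> delta k k x = 0.
  by move=> Dk; have /eqP := coc k k k x Dk Dk Dk; rewrite -[X in _ == X]addr0 (inj_eq (addrI _)) => /eqP.
have danti k l x : D k x -> D l x -> delta k l x = - delta l k x.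
  by move=> Dk Dl; apply/eqP; rewrite -addr_eq0 (coc k l k x)// dkk.
pose cp p x y := delta (kk x) (kk p) x - delta (kk y) (kk p) y.
have inD p x : Omega p -> ball p (r p) x -> D (kk p) x /\ Omega x.
  move=> Op px; have [_ rO h] := hr p Op.
  by have [] := h (kk p) (kk p) x (hk p Op) (hk p Op) px; split => //; exact: rO.
have shift p x y k : Omega p -> ball p (r p) x -> ball p (r p) y -> D k p ->
    delta (kk x) k x - delta (kk y) k y = cp p x y.
  move=> Op px py Dk; have [_ _ h] := hr p Op; have Dp := hk p Op.
  have [Dkx Dpx E1] := h k (kk p) x Dk Dp px; have [Dky Dpy E2] := h k (kk p) y Dk Dp py.
  have Ox := (inD p x Op px).2; have Oy := (inD p y Op py).2.
  rewrite /cp -(coc (kk x) k (kk p) x)//; last exact: hk.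
  rewrite -(coc (kk y) k (kk p) y)//; last exact: hk.
  by rewrite E1 E2; ring.
(* Two balls may carry different indices; the discrepancy is [delta (kk q) (kk p)], locally constant
   on the intersection of the balls, which is convex. *)
have indep p q x y : Omega p -> Omega q -> ball p (r p) x -> ball p (r p) y ->
    ball q (r q) x -> ball q (r q) y -> cp p x y = cp q x y.
  move=> Op Oq px py qx qy; rewrite /cp.
  have [Dpx Ox] := inD p x Op px; have [Dpy Oy] := inD p y Op py.
  have [Dqx _] := inD q x Oq qx; have [Dqy _] := inD q y Oq qy.
  rewrite -(coc (kk x) (kk q) (kk p) x)//; last exact: hk.
  rewrite -(coc (kk y) (kk q) (kk p) y)//; last exact: hk.
  suff -> : delta (kk q) (kk p) x = delta (kk q) (kk p) y by ring.
  apply: (@locally_constant_star _ (ball p (r p) `&` ball q (r q))); last first.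
    move=> u [pu qu]; apply: lc; first exact: (inD q u Oq qu).1.
    exact: (inD p u Op pu).1.
  by move=> t t01; split; exact: ball_convex.
pose lk x y := exists p, [/\ Omega p, ball p (r p) x & ball p (r p) y].
have cex x y : exists v : R, forall p, Omega p -> ball p (r p) x -> ball p (r p) y -> v = cp p x y.
  have [[p [Op px py]]|nl] := pselect (lk x y); last first.
    by exists 0 => p Op px py; exfalso; apply: nl; exists p.
  by exists (cp p x y) => q Oq qx qy; exact: indep.
have [c0 hc0] := choice (fun q : E * E => cex q.1 q.2); pose c x y := c0 (x, y).
have hc p x y : Omega p -> ball p (r p) x -> ball p (r p) y -> c x y = cp p x y := hc0 (x, y) p.
have [a ha] : exists a : E -> R, forall x y, linked Omega r x y -> c x y = a y - a x.
  apply: primitive_exists => //.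
  - by move=> p Op; have [] := hr p Op.
  - by move=> p Op; have [] := hr p Op.
  - move=> p x y w Op px py pw; rewrite !(hc p)//; rewrite /cp; ring.
have mu k : exists m : R, forall x, D k x -> delta (kk x) k x + a x = m.
  have [b hb] := starD k; exists (delta (kk b) k b + a b) => x Dx.
  apply: (@locally_constant_star (fun x => delta (kk x) k x + a x) (D k)); first by move=> t t01; exact: hb.
  move=> y Dy; have Oy : Omega y by apply: (hD k).2.
  have [r0 _ _] := hr y Oy.
  have : nbhs y (ball y (r y)) by exact: nbhsx_ballx.
  apply: filterS => x' yx'; have yy : ball y (r y) y by exact: ballxx.
  have := shift y x' y k Oy yx' yy Dy; rewrite -hc// ha; last by exists y.
  by move=> h; lra.
have [m hm] := choice mu.
exists (fun k => - m k) => k l x Dk Dl.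
have Ox : Omega x by apply: (hD k).2.
have := hm k x Dk; have := hm l x Dl.
rewrite -(coc k (kk x) l x) ?(danti k (kk x) x)//; try exact: hk.
by move=> <- <-; ring.
Qed.

End monodromy.

(** * Weak derivatives: localization and gluing *)

Section localization.
Context {R : realType} {d : nat}.
Local Notation E := 'rV[R]_d.
Local Notation vol := (@lebesgue_row R d).

Lemma closed_row_box_compact (a b : 'I_d -> R) : compact (closed_row_box a b).
Proof.
have -> : closed_row_box a b = [set x : E | forall i, (`[a i, b i]%classic : set R) (x ord0 i)].
  by apply/seteqP; split => x /= h i; move: (h i); rewrite in_itv.
by apply: (@rV_compact _ _ (fun i => `[a i, b i]%classic)) => i; exact: segment_compact.
Qed.

(** Compactness of the closed boxes reduces the local exceptional null sets to countably many. *)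
Lemma ae_local (U : set E) (P : E -> Prop) : open U ->
  (forall x, U x -> exists2 r : R, 0 < r & \forall y \ae vol, ball x r y -> P y) ->
  \forall y \ae vol, U y -> P y.
Proof.
move=> oU locP; have [S [a [b [UE ab]]]] := open_box_cover oU.
have box k : S k -> \forall y \ae vol, closed_row_box (a k) (b k) y -> P y.
  move=> Sk.
  have rex x : exists r : R, U x -> 0 < r /\ \forall y \ae vol, ball x r y -> P y.
    have [Ux|nU] := pselect (U x); last by exists 0.
    by have [r r0 h] := locP x Ux; exists r.
  have [r hr] := choice rex.
  have [|s [sU cov]] := @compact_finite_cover _ _ _ (fun x => ball x (r x)) (@closed_row_box_compact (a k) (b k)).
    by move=> x /(ab k Sk) Ux; apply: nbhsx_ballx; case: (hr x Ux).
  have : \forall y \ae vol, forall x, x \in s -> ball x (r x) y -> P y.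
    elim: s sU {cov} => [|x s IHs] sU; first by apply: aeW.
    have h1 : \forall y \ae vol, ball x (r x) y -> P y.
      by apply: (hr x _).2; apply: (ab k Sk); apply: sU; rewrite mem_head.
    apply: filterS2 h1 (IHs _) => [y p1 p2 z|z zs]; last by apply: sU; rewrite inE zs orbT.
    by rewrite inE => /predU1P[->//|]; exact: p2.
  by apply: filterS => y h /cov[x xs xy]; exact: (h x xs xy).
have box' k : \forall y \ae vol, S k -> closed_row_box (a k) (b k) y -> P y.
  have [Sk|nS] := pselect (S k); last by apply: aeW => y /nS.
  by apply: filterS (box k Sk) => y h _.
apply: filterS (ae_foralln box') => y h.
rewrite UE => -[k Sk yk]; apply: (h k Sk) => i.
by have /andP[/ltW -> /ltW ->] := yk i.
Qed.

Lemma vol_ball_gt0 (x : E) (r : R) : 0 < r -> (0 < vol (ball x r))%E.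
Proof.
move=> r0; apply: (@lt_le_trans _ _ (vol (row_box (fun i => x ord0 i - r / 2) (fun i => x ord0 i + r / 2)))).
  rewrite lebesgue_row_boxE lte_fin; apply: prodr_gt0 => i _; rewrite lt_max; apply/orP; left; lra.
apply: le_measure; rewrite ?inE.
- exact: measurable_row_box.
- by apply: open_measurable_row; exact: ball_open.
- rewrite row_boxE => y /= h; rewrite -ball_normE /ball_/=; apply: row_norm_lt => // i; rewrite !mxE.
  by have := h i; rewrite in_itv/= ltr_norml => /andP[h1 h2]; apply/andP; split; lra.
Qed.

Lemma ae_ball_ex (x : E) (r : R) (P : E -> Prop) : 0 < r ->
  (\forall y \ae vol, ball x r y -> P y) -> exists2 y, ball x r y & P y.
Proof.
move=> r0 [N [mN N0 h]]; apply: contrapT => nP.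
have : (vol (ball x r) <= vol N)%E.
  apply: le_measure; rewrite ?inE//; first by apply: open_measurable_row; exact: ball_open.
  by move=> y xy; apply: h => /= hy; apply: nP; exists y => //; exact: hy.
by rewrite N0 leNgt vol_ball_gt0.
Qed.

Lemma L2_extend (D Omega : set E) f : measurable D -> measurable Omega -> D `<=` Omega -> L2 D f ->
  (forall x, Omega x -> ~ D x -> f x = 0) -> L2 Omega f.
Proof.
move=> mD mO DO [g [fg mg ig]] f0; exists (g \_ D); split.
- apply: filterS fg => x fg Ox; rewrite patchE; case: ifPn; first by rewrite inE.
  by rewrite notin_setE => /(f0 x Ox).
- by apply: measurable_funTS; apply/(measurable_restrictT g mD).
- apply: (integrableS measurableT mO) => //.
  rewrite (_ : (fun _ => _) = (fun x => (g x ^+ 2)%:E) \_ D); first exact/(integrable_mkcond _ mD).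
  by apply/funext => x; rewrite /= !patchE; case: ifP => //; rewrite expr0n.
Qed.

Lemma Rint_sub (D Omega : set E) (f : E -> R) : D `<=` Omega ->
  (forall x, Omega x -> ~ D x -> f x = 0) ->
  \int[vol]_(x in Omega) f x = \int[vol]_(x in D) f x.
Proof.
move=> DO f0; rewrite Rintegral_mkcond [RHS]Rintegral_mkcond; apply: eq_Rintegral => x _.
rewrite !patchE; case: ifPn => xO; case: ifPn => xD //.
  by apply: f0; [move: xO; rewrite inE|move: xD; rewrite notin_setE].
by exfalso; move: xO xD; rewrite notin_setE inE => nO /DO.
Qed.

Lemma cutoff_exists (V : set E) p : open V -> V p ->
  exists2 beta : E -> R, test_function V beta & \forall x \near p, beta x = 1.
Proof.
move=> oV Vp; have /nbhs_ballP[r /= r0 rV] := open_nbhs_nbhs (conj oV Vp).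
pose a i := p ord0 i - r / 2; pose b i := p ord0 i + r / 2.
have r8 : 0 < r / 8 by rewrite divr_gt0.
exists (plateau a b (r / 8)).
  apply: test_plateau => // x /= ab; apply: rV; rewrite -ball_normE /ball_/=.
  apply: row_norm_lt => // i; have := ab i; rewrite !mxE /a /b => /andP[h1 h2].
  by rewrite ltr_norml; apply/andP; split; lra.
apply/nbhs_ballP; exists (r / 4) => [|x]; first by rewrite /= divr_gt0.
rewrite -ball_normE /ball_/= => px; apply: plateau_eq1 => // i.
have := le_lt_trans (coord_le_norm (p - x) i) px; rewrite !mxE ltr_norml /a /b => /andP[h1 h2].
by apply/andP; split; lra.
Qed.

Lemma star_cover (Omega : set E) (U : E -> set E) : lipschitz_domain Omega -> bounded_set Omega ->
  (forall p, closure Omega p -> nbhs p (U p)) ->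
  exists N (V : 'I_N -> set E) (beta : 'I_N -> E -> R) (p : 'I_N -> E),
    (forall k, [/\ closure Omega (p k), open (V k), star_domain (V k `&` Omega), V k `<=` U (p k) &
       test_function (V k) (beta k)]) /\
    forall x, closure Omega x -> exists k, beta k x = 1.
Proof.
move=> lO bO nU.
have cK : compact (closure Omega).
  apply: bounded_closed_compact; last exact: closed_closure.
  have [M [Mr hM]] := bO; exists (M + 1); split; first exact: num_real.
  move=> x Mx y cy /=.
  have : nbhs y (ball y 1) by exact: nbhsx_ballx.
  move=> /(cy _)[z [Oz]]; rewrite -ball_normE /ball_/= => yz.
  rewrite -(subrK z y) (le_trans (ler_normD _ _))//.
  have h1 : `|z| <= x - 1 by apply: hM => //; lra.
  by lra.
have ex p : exists V : set E, exists beta : E -> R, closure Omega p ->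
  [/\ open V, star_domain (V `&` Omega), V `<=` U p, test_function V beta & \forall x \near p, beta x = 1].
  have [cp|ncp] := pselect (closure Omega p); last by exists set0, (cst 0).
  have [V [VU oV Vp sV]] := lipschitz_star lO bO cp (nU p cp).
  by have [beta tb b1] := cutoff_exists oV Vp; exists V, beta.
have [V hV] := choice ex; have [beta hb] := choice hV.
have [|s [sO cov]] := @compact_finite_cover _ _ _ (fun p => [set x | beta p x = 1]) cK.
  by move=> p cp; have [] := hb p cp.
exists (size s), (fun k => V (tnth (in_tuple s) k)), (fun k => beta (tnth (in_tuple s) k)), (tnth (in_tuple s)).
have inO k : closure Omega (tnth (in_tuple s) k) by apply: sO; exact: mem_tnth.
split=> [k|x cx].
  by have [] := hb _ (inO k).
have [p ps px] := cov x cx; have ips : (index p s < size s)%N by rewrite index_mem.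
by exists (Ordinal ips); rewrite (tnth_nth p) /= nth_index.
Qed.

Section partition.
Variables (N : nat) (beta : 'I_N -> E -> R).

(** One minus the sum of the first [m] functions is the product of [1 - beta l] for [l < m], so the
    sum reaches 1 as soon as one [beta l] does. *)
Definition bpart (k : 'I_N) (x : E) : R := beta k x * \prod_(l < N | (l < k)%N) (1 - beta l x).

Lemma bpart_sum x : (exists k, beta k x = 1) -> \sum_k bpart k x = 1.
Proof.
move=> [k0 bk].
have key m : (m <= N)%N -> \sum_(k < N | (k < m)%N) bpart k x = 1 - \prod_(l < N | (l < m)%N) (1 - beta l x).
  elim: m => [|m IHm] mN.
    by rewrite !big_pred0 ?subrr// => l.
  have eqm (l : 'I_N) : (l < m.+1)%N = (l == Ordinal mN) || (l < m)%N by rewrite ltnS leq_eqVlt.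
  rewrite (bigD1 (Ordinal mN))//= [in RHS](bigD1 (Ordinal mN))//=.
  have e2 (l : 'I_N) : (l < m.+1)%N && (l != Ordinal mN) = (l < m)%N.
    by rewrite eqm; case: eqVneq => [->|] /=; rewrite ?ltnn ?andbT ?andbF.
  rewrite !(eq_bigl _ _ e2) IHm ?(ltnW mN)// /bpart /=; ring.
have := key N (leqnn N); rewrite (eq_bigl xpredT) => [->|l]; last by rewrite ltn_ord.
by rewrite (bigD1 k0) ?ltn_ord//= bk subrr mul0r subr0.
Qed.

End partition.
End localization.

(** * The curl as an antisymmetric matrix *)

Section curl_algebra.
Context {R : realType} {d : nat}.
Local Notation E := 'rV[R]_d.
Local Notation vol := (@lebesgue_row R d).
Hypothesis hd : (d <= 3)%N.

Lemma dot_pad3 (u v : E) : dot (pad3 u) (pad3 v) = dot u v.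
Proof.
pose F (k : nat) := oapp (fun i : 'I_d => u ord0 i * v ord0 i) 0 (insub k).
transitivity (\sum_(k < 3) F k).
  apply: eq_bigr => k _; rewrite !mxE /F; case: (insub (k : nat)) => [i|] //=; exact: mulr0.
rewrite -(big_mkord xpredT F) (big_cat_nat (n := d))//= big_mkord.
rewrite [X in _ + X]big_nat_cond [X in _ + X]big1 ?addr0; last first.
  by move=> k /andP[/andP[dk _] _]; rewrite /F insubF// ltnNge dk.
by apply: eq_bigr => i _; rewrite /F valK.
Qed.

Lemma dot_cross (a b u v : 'rV[R]_3) :
  dot (cross a b) (cross u v) = dot a u * dot b v - dot a v * dot b u.
Proof.
have e1 : (ord0 : 'I_3) + 1 = 1 by apply: val_inj.
have e2 : (ord0 : 'I_3) + 2 = 2 by apply: val_inj.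
have e3 : (1 : 'I_3) + 1 = 2 by apply: val_inj.
have e4 : (1 : 'I_3) + 2 = ord0 by apply: val_inj.
have e5 : (2 : 'I_3) + 1 = ord0 by apply: val_inj.
have e6 : (2 : 'I_3) + 2 = 1 by apply: val_inj.
have l1 : lift ord0 ord0 = 1 :> 'I_3 by apply: val_inj.
have l2 : lift ord0 (lift ord0 ord0) = 2 :> 'I_3 by apply: val_inj.
rewrite /dot !big_ord_recl !big_ord0 !l2 !l1 !mxE !(e1, e2, e3, e4, e5, e6).
ring.
Qed.

Lemma dot_delta_pad (i : 'I_d) (u : E) : dot (pad3 (delta_mx ord0 i)) (pad3 u) = u ord0 i.
Proof.
rewrite dot_pad3 /dot (bigD1 i)//= mxE !eqxx mul1r big1 ?addr0// => j ji.
by rewrite mxE (negbTE ji) andbF mul0r.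
Qed.

(** On a curl, the entry [d_k h_i - d_i h_k] of the associated antisymmetric matrix. Defined through
    [cross] and padding, it treats two and three dimensions alike; in the plane it reads off the
    third component of [c]. *)
Definition curl_comp (i k : 'I_d) (c : 'rV[R]_3) : R :=
  - dot (cross (pad3 (delta_mx ord0 i)) (pad3 (delta_mx ord0 k))) c.

Lemma curl_compE (i k : 'I_d) (u v : E) :
  curl_comp i k (cross (pad3 u) (pad3 v)) = - (u ord0 i * v ord0 k - u ord0 k * v ord0 i).
Proof. by rewrite /curl_comp dot_cross !dot_delta_pad; congr (- (_ - _)); rewrite mulrC. Qed.

Lemma curl_comp_sum (i k : 'I_d) : exists a : 'I_3 -> R,
  forall c, curl_comp i k c = \sum_l a l * c ord0 l.
Proof.
exists (fun l => - cross (pad3 (delta_mx ord0 i)) (pad3 (delta_mx ord0 k)) ord0 l) => c'.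
by rewrite /curl_comp /dot -sumrN; apply: eq_bigr => l _; rewrite mulNr.
Qed.
End curl_algebra.

Section weak_calculus.
Context {R : realType} {d : nat}.
Local Notation E := 'rV[R]_d.
Local Notation vol := (@lebesgue_row R d).
Variables (D : set E) (oD : open D) (volD : (vol D < +oo)%E).
Let mD : measurable D. Proof. exact: open_measurable_row. Qed.

Lemma pad3D (u v : E) : pad3 (u + v) = pad3 u + pad3 v.
Proof. by apply/rowP => k; rewrite !mxE; case: insub => [i|] /=; rewrite ?mxE ?addr0. Qed.

Lemma pad3Z (r : R) (u : E) : pad3 (r *: u) = r *: pad3 u.
Proof. by apply/rowP => k; rewrite !mxE; case: insub => [i|] /=; rewrite ?mxE ?mulr0. Qed.

Lemma L2v_pad3 (h : E -> E) : L2v D h -> L2v D (fun x => pad3 (h x)).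
Proof.
move=> hL k; rewrite (_ : (fun _ => _) = fun x => oapp (fun i : 'I_d => h x ord0 i) 0 (insub (k : nat))).
  by case: insub => [i|] /=; [exact: hL|exact: L20].
by apply/funext => x; rewrite mxE.
Qed.

Lemma L2v_grad_test phi : test_function D phi -> L2v D (grad phi).
Proof.
move=> tp i; rewrite (_ : (fun _ => _) = partial i phi); last by apply/funext => x; rewrite mxE.
by apply: (L2_test mD volD); exact: test_partial.
Qed.

Lemma pad_mul_aei (h : E -> E) phi a b : L2v D h -> test_function D phi ->
  ae_integrable vol D (fun x => pad3 (h x) ord0 a * pad3 (grad phi x) ord0 b).
Proof.
move=> hL tp; apply: (L2M mD); first exact: (L2v_pad3 hL).
exact: (L2v_pad3 (L2v_grad_test tp)).
Qed.

Lemma cross_aei (h : E -> E) phi k : L2v D h -> test_function D phi ->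
  ae_integrable vol D (fun x => cross (pad3 (h x)) (pad3 (grad phi x)) ord0 k).
Proof.
move=> hL tp.
rewrite (_ : (fun _ => _) = fun x => pad3 (h x) ord0 (k + 1) * pad3 (grad phi x) ord0 (k + 2)
  - pad3 (h x) ord0 (k + 2) * pad3 (grad phi x) ord0 (k + 1)); last by apply/funext => x; rewrite [LHS]mxE.
by apply: (ae_integrableB mD); exact: pad_mul_aei.
Qed.

Lemma mul_test_aei f phi : L2 D f -> test_function D phi -> ae_integrable vol D (fun x => f x * phi x).
Proof. by move=> fL tp; apply: (L2M mD) => //; exact: (L2_test mD volD). Qed.

Lemma weak_curl_lin (r : R) (h h' : E -> E) (c c' : E -> 'rV[R]_3) :
  L2v D h -> L2v D h' -> L2v D c -> L2v D c' -> is_weak_curl D h c -> is_weak_curl D h' c' ->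
  is_weak_curl D (fun x => r *: h x + h' x) (fun x => r *: c x + c' x).
Proof.
move=> hL hL' cL cL' H H' phi tp k.
transitivity (\int[vol]_(x in D) (r * (c x ord0 k * phi x) + c' x ord0 k * phi x)).
  by apply: eq_Rintegral => x _; rewrite !mxE mulrDl mulrA.
have i1 := mul_test_aei (cL k) tp; have i2 := mul_test_aei (cL' k) tp.
rewrite RintD//; last exact: ae_integrableZ.
have -> : \int[vol]_(x in D) (r * (c x ord0 k * phi x)) = r * \int[vol]_(x in D) (c x ord0 k * phi x).
  by apply: RintZ.
rewrite H// H'//.
have j1 := cross_aei k hL tp; have j2 := cross_aei k hL' tp.
have <- : \int[vol]_(x in D) (r * cross (pad3 (h x)) (pad3 (grad phi x)) ord0 k) =
  r * \int[vol]_(x in D) cross (pad3 (h x)) (pad3 (grad phi x)) ord0 k by apply: RintZ.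
rewrite -RintD//; last exact: ae_integrableZ.
apply: eq_Rintegral => x _; rewrite pad3D pad3Z.
set p := pad3 (grad phi x); set a := pad3 (h x); set b := pad3 (h' x).
rewrite !mxE; ring.
Qed.

Lemma weak_grad_lin (r : R) f f' (g g' : E -> E) : L2 D f -> L2 D f' -> L2v D g -> L2v D g' ->
  is_weak_grad D f g -> is_weak_grad D f' g' ->
  is_weak_grad D (fun x => r * f x + f' x) (fun x => r *: g x + g' x).
Proof.
move=> fL fL' gL gL' H H' phi tp i.
transitivity (\int[vol]_(x in D) (r * (g x ord0 i * phi x) + g' x ord0 i * phi x)).
  by apply: eq_Rintegral => x _; rewrite !mxE mulrDl mulrA.
have i1 := mul_test_aei (gL i) tp; have i2 := mul_test_aei (gL' i) tp.
rewrite RintD//; last exact: ae_integrableZ.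
have -> : \int[vol]_(x in D) (r * (g x ord0 i * phi x)) = r * \int[vol]_(x in D) (g x ord0 i * phi x).
  by apply: RintZ.
rewrite H// H'//.
have tp' : test_function D (partial i phi) by exact: test_partial.
have j1 := mul_test_aei fL tp'; have j2 := mul_test_aei fL' tp'.
transitivity (- \int[vol]_(x in D) (r * (f x * partial i phi x) + f' x * partial i phi x)).
  rewrite RintD//; last exact: ae_integrableZ.
  have -> : \int[vol]_(x in D) (r * (f x * partial i phi x)) = r * \int[vol]_(x in D) (f x * partial i phi x).
    by apply: RintZ.
  by rewrite opprD mulrN.
by congr (- _); apply: eq_Rintegral => x _; rewrite mulrDl mulrA.
Qed.

Lemma weak_grad_ae f f' (g g' : E -> E) : f = f' %[ae vol in D] -> g = g' %[ae vol in D] ->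
  is_weak_grad D f' g' -> is_weak_grad D f g.
Proof.
move=> ff gg H phi tp i.
rewrite (@ae_eq_Rintegral _ _ _ _ D _ (fun x => g' x ord0 i * phi x)); last first.
  by apply: filterS gg => x h Dx; rewrite h.
rewrite H//; congr (- _); apply/esym/ae_eq_Rintegral.
by apply: filterS ff => x h Dx; rewrite h.
Qed.

Lemma weak_curl_ae (h h' : E -> E) (c c' : E -> 'rV[R]_3) : h = h' %[ae vol in D] ->
  c = c' %[ae vol in D] -> is_weak_curl D h' c' -> is_weak_curl D h c.
Proof.
move=> hh cc H phi tp k.
rewrite (@ae_eq_Rintegral _ _ _ _ D _ (fun x => c' x ord0 k * phi x)); last first.
  by apply: filterS cc => x e Dx; rewrite e.
rewrite H//; apply/esym/ae_eq_Rintegral.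
by apply: filterS hh => x e Dx; rewrite e.
Qed.

Lemma weak_curl_grad f (g : E -> E) : L2 D f -> L2v D g -> is_weak_grad D f g ->
  is_weak_curl D g (fun=> 0).
Proof.
move=> fL gL H phi tp k.
transitivity (0 : R).
  transitivity (\int[vol]_(x in D) (0 : R)); last by rewrite /Rintegral integral0.
  by apply: eq_Rintegral => x _; rewrite mxE mul0r.
pose G a b := \int[vol]_(x in D) (pad3 (g x) ord0 a * pad3 (grad phi x) ord0 b).
(* After integration by parts both sides are the integral of [f] against the same mixed second
   derivative of [phi]; padded indices contribute 0. *)
have sym a b : G a b = G b a.
  pose pd (o : option 'I_d) := oapp (fun i => partial i phi) (fun=> 0) o.
  have GE a' b' : G a' b' = oapp (fun i => \int[vol]_(x in D) (g x ord0 i * pd (insub (b' : nat)) x)) 0 (insub (a' : nat)).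
    rewrite /G; case ia : (insub (a' : nat)) => [i|] /=; last first.
      transitivity (\int[vol]_(x in D) (0 : R)); last by rewrite /Rintegral integral0.
      by apply: eq_Rintegral => x _; rewrite !mxE ia/= mul0r.
    by apply: eq_Rintegral => x _; rewrite !mxE ia/=; case: insub => [j|] //=; rewrite mxE.
  rewrite (GE a b) (GE b a).
  clear GE.
  rewrite /pd.
  move: (insub (a : nat)) (insub (b : nat)) => [i|] [j|] /=; last by [].
  - rewrite !H; try exact: test_partial.
    rewrite (partialC i j (test_smooth tp)).
    exact: erefl.
  - transitivity (\int[vol]_(x in D) (0 : R)); last by rewrite /Rintegral integral0.
    by apply: eq_Rintegral => x _; rewrite mulr0.
  - symmetry; transitivity (\int[vol]_(x in D) (0 : R)); last by rewrite /Rintegral integral0.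
    by apply: eq_Rintegral => x _; rewrite mulr0.
symmetry; transitivity (G (k + 1) (k + 2) - G (k + 2) (k + 1)); last by rewrite sym subrr.
rewrite /G -RintB//; try exact: pad_mul_aei.
by apply: eq_Rintegral => x _; rewrite [LHS]mxE.
Qed.

Lemma L2v_rot (i k : 'I_d) (c : E -> 'rV[R]_3) : L2v D c -> L2 D (fun x => curl_comp i k (c x)).
Proof.
move=> cL; have [a ha] := @curl_comp_sum R d i k.
rewrite (_ : (fun _ => _) = fun x => \sum_l a l * c x ord0 l); last by apply/funext => x; rewrite ha.
by apply: (L2_sum mD) => l; apply: (L2Z mD).
Qed.

(** Contracting the vector identity with the cross product of two unit vectors gives the scalar
    relations that the Poincaré operators take as hypothesis. *)
Lemma weak_curl_rot (v : E -> E) (c : E -> 'rV[R]_3) (i k : 'I_d) xi : (d <= 3)%N ->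
  L2v D v -> L2v D c -> is_weak_curl D v c -> test_function D xi ->
  \int[vol]_(x in D) (v x ord0 i * partial k xi x) - \int[vol]_(x in D) (v x ord0 k * partial i xi x) =
  - \int[vol]_(x in D) (curl_comp i k (c x) * xi x).
Proof.
move=> d3 vL cL H tx; have [a ha] := @curl_comp_sum R d i k.
have -> : \int[vol]_(x in D) (curl_comp i k (c x) * xi x) =
    \int[vol]_(x in D) curl_comp i k (cross (pad3 (v x)) (pad3 (grad xi x))).
  transitivity (\int[vol]_(x in D) \sum_l a l * (c x ord0 l * xi x)).
    by apply: eq_Rintegral => x _; rewrite ha mulr_suml; apply: eq_bigr => l _; rewrite mulrA.
  rewrite (Rint_sum mD); last by move=> l _; apply: (ae_integrableZ mD); exact: mul_test_aei.
  transitivity (\int[vol]_(x in D) \sum_l a l * cross (pad3 (v x)) (pad3 (grad xi x)) ord0 l); last first.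
    by apply: eq_Rintegral => x _; rewrite ha.
  rewrite (Rint_sum mD); last by move=> l _; apply: (ae_integrableZ mD); exact: cross_aei.
  apply: eq_bigr => l _.
  have -> : \int[vol]_(x in D) (a l * (c x ord0 l * xi x)) = a l * \int[vol]_(x in D) (c x ord0 l * xi x).
    by apply: (RintZ mD); exact: mul_test_aei.
  rewrite H//; symmetry.
  by apply: (RintZ mD); exact: cross_aei.
have ti j := test_partial j tx.
have ai j j' : ae_integrable vol D (fun x => v x ord0 j * partial j' xi x).
  exact: (mul_test_aei (vL j)).
rewrite -RintB//.
transitivity (- \int[vol]_(x in D) - (v x ord0 i * partial k xi x - v x ord0 k * partial i xi x)).
  by rewrite RintN ?opprK//; exact: ae_integrableB.
congr (- _); apply: eq_Rintegral => x _; rewrite (curl_compE d3) !mxE; congr (- (_ - _)).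
Qed.

End weak_calculus.

Section weak_restriction.
Context {R : realType} {d : nat}.
Local Notation E := 'rV[R]_d.
Local Notation vol := (@lebesgue_row R d).

Lemma test_partial_out (D : set E) phi i x : test_function D phi -> ~ D x -> partial i phi x = 0.
Proof. by move=> tp; apply: test_out; exact: test_partial. Qed.

Lemma weak_grad_restrict (D Omega : set E) f (g : E -> E) : D `<=` Omega ->
  is_weak_grad Omega f g -> is_weak_grad D f g.
Proof.
move=> DO H phi tp i; have := H phi (test_sub DO tp) i.
rewrite (Rint_sub DO) => [|x _ nD]; last by rewrite (test_out tp nD) mulr0.
by rewrite [in RHS](Rint_sub DO) => [|x _ nD]; last by rewrite (test_partial_out i tp nD) mulr0.
Qed.

Lemma weak_curl_restrict (D Omega : set E) (h : E -> E) (c : E -> 'rV[R]_3) : D `<=` Omega ->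
  is_weak_curl Omega h c -> is_weak_curl D h c.
Proof.
move=> DO H phi tp k; have := H phi (test_sub DO tp) k.
rewrite (Rint_sub DO) => [|x _ nD]; last by rewrite (test_out tp nD) mulr0.
rewrite [in RHS](Rint_sub DO) => [->//|x _ nD].
have -> : grad phi x = 0 by apply/rowP => i; rewrite !mxE (test_partial_out i tp nD).
have p0 : pad3 (0 : E) = 0 by apply/rowP => j; rewrite !mxE; case: insub => //= i; rewrite mxE.
by rewrite p0 !mxE !mulr0 subrr.
Qed.

Lemma test_inter (D D' : set E) f : test_function D f -> test_function D' f -> test_function (D `&` D') f.
Proof. by move=> [sf cf fD] [_ _ fD']; split=> // x fx; split; [exact: fD|exact: fD']. Qed.

(* The gradient of [chi * f] for a cut-off chi supported in V and a function f
   on V `&` Omega is the weak gradient on all of Omega, by extension by zero. *)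
Lemma weak_grad_cutoff (V Omega : set E) chi f (g : E -> E) : open V -> open Omega ->
  (vol Omega < +oo)%E -> test_function V chi -> L2 (V `&` Omega) f -> L2v (V `&` Omega) g ->
  is_weak_grad (V `&` Omega) f g ->
  is_weak_grad Omega (fun x => chi x * (f \_ (V `&` Omega)) x)
    (fun x => \row_i (chi x * ((fun y => g y ord0 i) \_ (V `&` Omega)) x + (f \_ (V `&` Omega)) x * partial i chi x)).
Proof.
move=> oV oO vO tc fL gL H th tt i; set D := V `&` Omega.
have oD : open D by exact: openI.
have mD := open_measurable_row oD.
have DO : D `<=` Omega by move=> x [].
have vD : (vol D < +oo)%E.
  by apply: le_lt_trans vO; apply: le_measure; rewrite ?inE//; exact: open_measurable_row.
have sc := test_smooth tc; have st := test_smooth tt.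
have tct : test_function D (fun x => chi x * th x).
  apply: test_inter; first exact: testM.
  by rewrite (_ : (fun _ => _) = fun x => th x * chi x); [exact: testM|apply/funext => x; rewrite mulrC].
have tdt j : test_function D (fun x => partial j chi x * th x).
  apply: test_inter; first by apply: testM => //; exact: test_partial.
  rewrite (_ : (fun _ => _) = fun x => th x * partial j chi x); last by apply/funext => x; rewrite mulrC.
  by apply: testM => //; exact: smooth_partial.
have tcd j : test_function D (fun x => chi x * partial j th x).
  apply: test_inter; first by apply: testM => //; exact: smooth_partial.
  rewrite (_ : (fun _ => _) = fun x => partial j th x * chi x); last by apply/funext => x; rewrite mulrC.
  by apply: testM => //; exact: test_partial.
rewrite (Rint_sub DO) => [|x _ nD]; last by rewrite !mxE !patchE !memNset// mulr0 mul0r add0r mul0r.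
rewrite [in RHS](Rint_sub DO) => [|x _ nD]; last by rewrite !patchE !memNset// mulr0 mul0r.
transitivity (\int[vol]_(x in D) (g x ord0 i * (chi x * th x) + f x * (partial i chi x * th x))).
  apply: eq_Rintegral => x Dx; rewrite !mxE !patchE Dx; ring.
have i1 := mul_test_aei oD vD (gL i) tct.
have i2 := mul_test_aei oD vD fL (tdt i).
have i3 := mul_test_aei oD vD fL (tcd i).
rewrite RintD// H// (_ : \int[vol]_(x in D) (f x * partial i (fun y => chi y * th y) x) =
  \int[vol]_(x in D) (f x * (partial i chi x * th x)) + \int[vol]_(x in D) (f x * (chi x * partial i th x))); last first.
  rewrite -RintD//; apply: eq_Rintegral => x _; rewrite partialM; [ring|exact: smooth_differentiable|exact: smooth_differentiable].
rewrite opprD addrAC addNr add0r; congr (- _); apply: eq_Rintegral => x Dx; rewrite !patchE Dx; ring.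
Qed.

Lemma weak_grad_sum (D : set E) N (f : 'I_N -> E -> R) (g : 'I_N -> E -> E) : open D ->
  (vol D < +oo)%E -> (forall k, L2 D (f k)) -> (forall k, L2v D (g k)) ->
  (forall k, is_weak_grad D (f k) (g k)) ->
  is_weak_grad D (fun x => \sum_k f k x) (fun x => \sum_k g k x).
Proof.
move=> oD vD fL gL H; have mD := open_measurable_row oD.
move=> phi tp i.
transitivity (\int[vol]_(x in D) \sum_k (g k x ord0 i * phi x)).
  by apply: eq_Rintegral => x _; rewrite summxE mulr_suml.
rewrite (Rint_sum mD); last by move=> k _; exact: (mul_test_aei oD vD (gL k i)).
transitivity (- \int[vol]_(x in D) \sum_k (f k x * partial i phi x)); last first.
  by congr (- _); apply: eq_Rintegral => x _; rewrite mulr_suml.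
rewrite (Rint_sum mD); last by move=> k _; apply: (mul_test_aei oD vD (fL k)); exact: test_partial.
by rewrite -sumrN; apply: eq_bigr => k _; exact: H.
Qed.

End weak_restriction.

(** * Vanishing weak gradients and the Poincaré-Wirtinger inequality *)

Section constants.
Context {R : realType} {d : nat}.
Local Notation E := 'rV[R]_d.
Local Notation vol := (@lebesgue_row R d).

Definition locally_constant (D : set E) (c : E -> R) :=
  forall x, D x -> \forall y \near x, c y = c x.

Lemma vol_sub_lty (D Omega : set E) : open D -> open Omega -> D `<=` Omega ->
  (vol Omega < +oo)%E -> (vol D < +oo)%E.
Proof.
by move=> oD oO DO; apply: le_lt_trans; apply: le_measure; rewrite ?inE//; exact: open_measurable_row.
Qed.

Lemma vol_ball_lty (x : E) (r : R) : (vol (ball x r) < +oo)%E.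
Proof.
apply: lebesgue_row_bounded; first by apply: open_measurable_row; exact: ball_open.
exists (`|x| + r); split; first exact: num_real.
move=> M hM y; rewrite -ball_normE /ball_/= => xy.
rewrite -(subrK x y) (le_trans (ler_normD _ _))// distrC; lra.
Qed.

Lemma ae_near_locally_constant (c1 c2 : E -> R) (x : E) (r : R) : 0 < r ->
  (\forall y \near x, c1 y = c1 x) -> (\forall y \near x, c2 y = c2 x) ->
  (\forall y \ae vol, ball x r y -> c1 y = c2 y) -> c1 x = c2 x.
Proof.
move=> r0 h1 h2 ae.
have /nbhs_ballP[e /= e0 he] : \forall y \near x, c1 y = c1 x /\ c2 y = c2 x.
  by apply: filterS2 h1 h2.
have m0 : 0 < Num.min e r by rewrite lt_min e0.
have [|y xy hy] := @ae_ball_ex R d x _ (fun y => c1 y = c2 y) m0.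
  apply: filterS ae => y hy xy; apply: hy; apply: le_ball xy; by rewrite ge_min lexx orbT.
have [<- <-] : c1 y = c1 x /\ c2 y = c2 x by apply: he; apply: le_ball xy; by rewrite ge_min lexx.
exact: hy.
Qed.

(** On each ball [f] is almost everywhere constant. Since balls have positive volume, the constant
    does not depend on the ball around a given point, which defines [c] pointwise. *)
Lemma weak_grad0_locally_constant (D : set E) f : open D -> L2 D f -> is_weak_grad D f (fun=> 0) ->
  exists2 c, locally_constant D c & f = c %[ae vol in D].
Proof.
move=> oD fL H; have mD := open_measurable_row oD.
pose good x (r c : R) := [/\ 0 < r, ball x r `<=` D & \forall y \ae vol, ball x r y -> f y = c].
have ex x : exists c, D x -> exists r, good x r c.
  have [Dx|nD] := pselect (D x); last by exists 0.
  have /nbhs_ballP[r /= r0 rD] := open_nbhs_nbhs (conj oD Dx).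
  have [|||c hc] := @weak_grad0_cst R d (ball x r) (ball_open x r) (vol_ball_lty x r) _ f.
  - by move=> y z t xy xz t01; exact: ball_convex.
  - by apply: (L2_subset mD) => //; apply: open_measurable_row; exact: ball_open.
  - exact: weak_grad_restrict H.
  - by exists c => _; exists r; split.
have uniq x c c' r r' : good x r c -> good x r' c' -> c = c'.
  move=> [r0 _ h] [r'0 _ h'].
  apply: (@ae_near_locally_constant (cst c) (cst c') x (Num.min r r')).
  - by rewrite lt_min r0.
  - exact: filterE.
  - exact: filterE.
  - apply: filterS2 h h' => y h h' xy.
    rewrite /= -(h (le_ball _ xy)) ?ge_min ?lexx// (h' (le_ball _ xy))//; by rewrite ge_min lexx orbT.
have [c hc] := choice ex.
have key x : D x -> exists r, good x r (c x) /\ forall y, ball x r y -> c y = c x.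
  move=> Dx; have [r [r0 rD h]] := hc x Dx; exists r; split=> // y xy.
  have [s gy] := hc y (rD y xy).
  have /nbhs_ballP[t /= t0 ty] : nbhs y (ball x r) by apply: open_nbhs_nbhs; split=> //; exact: ball_open.
  apply: (uniq y _ _ s t gy); split=> // [z /ty /rD//|].
  by apply: filterS h => z h /ty.
exists c.
- move=> x Dx; have [r [[r0 _ _] h]] := key x Dx.
  by apply/nbhs_ballP; exists r.
- apply: (@ae_local R d D (fun y => f y = c y) oD) => x Dx.
  have [r [[r0 rD h] hr]] := key x Dx; exists r => //.
  by apply: filterS h => y h xy; rewrite (h xy) hr.
Qed.

Lemma locally_constant_connected (D : set E) c : open D -> connected D -> locally_constant D c ->
  forall x y, D x -> D y -> c x = c y.
Proof.
move=> oD cD lc x y Dx Dy.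
have h : [set z | D z /\ c z = c x] = D.
  apply: cD; first by exists x.
  - exists ([set z | D z /\ c z = c x]); last by apply/seteqP; split => z /=; tauto.
    rewrite openE => z /= [Dz cz]; rewrite /interior/=.
    apply: filterS2 (lc z Dz) (open_nbhs_nbhs (conj oD Dz)) => t h Dt; split=> //=.
    by rewrite h.
  - exists (~` [set z | D z /\ c z != c x]).
      apply: open_closedC; rewrite openE => z /= [Dz cz]; rewrite /interior/=.
      apply: filterS2 (lc z Dz) (open_nbhs_nbhs (conj oD Dz)) => t h Dt; split=> //=.
      by rewrite h.
    apply/seteqP; split => z /=; first by move=> [Dz ->]; split=> // -[_]; rewrite eqxx.
    by move=> [Dz h]; split=> //; apply/eqP/negPn/negP => ne; apply: h.
by have [_ ->] : [set z | D z /\ c z = c x] y by rewrite h.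
Qed.

Lemma weak_grad0_connected (D : set E) f : open D -> connected D -> L2 D f ->
  is_weak_grad D f (fun=> 0) -> exists c, f = cst c %[ae vol in D].
Proof.
move=> oD cD fL H; have [c lc fc] := weak_grad0_locally_constant oD fL H.
have [->|/set0P[x Dx]] := eqVneq D set0; first by exists 0; apply: aeW => x.
exists (c x); apply: filterS fc => y h Dy; rewrite (h Dy).
exact: (locally_constant_connected oD cD lc).
Qed.

Lemma weak_grad0_star (D : set E) f : star_domain D -> L2 D f ->
  is_weak_grad D f (fun=> 0) -> exists c, f = cst c %[ae vol in D].
Proof.
move=> [oD _ [B [_ [b Bb] _ st]]] fL H; have [c lc fc] := weak_grad0_locally_constant oD fL H.
exists (c b); apply: filterS fc => y h Dy; rewrite (h Dy).
by apply: (@locally_constant_star R d c D) lc => t t01; exact: st.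
Qed.

Lemma star_vol (D : set E) : star_domain D -> (vol D < +oo)%E.
Proof. by move=> [oD bD _]; apply: lebesgue_row_bounded => //; exact: open_measurable_row. Qed.

Lemma star_vol_gt0 (D : set E) : star_domain D -> 0 < fine (vol D).
Proof.
move=> sD; have [oD bD [B [oB [b Bb] BD st]]] := sD.
have mD := open_measurable_row oD.
rewrite fine_gt0// star_vol// andbT.
have /nbhs_ballP[r /= r0 rD] := open_nbhs_nbhs (conj oD (BD b Bb)).
apply: lt_le_trans (vol_ball_gt0 b r0) _; apply: le_measure; rewrite ?inE//.
by apply: open_measurable_row; exact: ball_open.
Qed.

Lemma potential_of_closed (D : set E) (g : E -> E) (P Q : ('I_d -> E -> R) -> E -> R) C :
  open D -> (vol D < +oo)%E ->
  0 <= C -> L2_operator D C P -> L2_operator D C Q ->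
  (forall v w i, (forall k, L2 D (v k)) -> (forall k, L2 D (w k)) ->
    (forall xi k, test_function D xi ->
    \int[vol]_(x in D) (v i x * partial k xi x) - \int[vol]_(x in D) (v k x * partial i xi x) =
    - \int[vol]_(x in D) (w k x * xi x)) ->
    forall th, test_function D th ->
    \int[vol]_(x in D) (P v x * partial i th x) =
    \int[vol]_(x in D) (Q w x * th x) - \int[vol]_(x in D) (v i x * th x)) ->
  L2v D g -> (forall i k xi, test_function D xi ->
    \int[vol]_(x in D) (g x ord0 i * partial k xi x) - \int[vol]_(x in D) (g x ord0 k * partial i xi x) = 0) ->
  is_weak_grad D (P (fun i x => g x ord0 i)) g.
Proof.
move=> oD vD C0 PO QO PQ gL H th tt i.
have mD := open_measurable_row oD.
(* Linearity with coefficient [-1] at the zero family gives [Q 0 = - Q 0 + Q 0]. *)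
have Q0 : Q (fun _ _ => 0) = (fun=> 0) %[ae vol in D].
  have [_ lin] := QO; have := lin (-1) (fun _ _ => 0) (fun _ _ => 0) (fun=> L20 D) (fun=> L20 D).
  apply: filterS => x h Dx; have := h Dx.
  have -> : (fun (k : 'I_d) (y : E) => -1 * 0 + 0) = (fun (_ : 'I_d) (_ : E) => 0) :> ('I_d -> E -> R).
    by apply/funext => k; apply/funext => z; rewrite mulr0 addr0.
  by move=> ->; rewrite mulN1r addNr.
rewrite (PQ _ (fun _ _ => 0) i)//; last 1 first.
- move=> xi k tx.
  have -> : \int[vol]_(x in D) (0 * xi x) = 0.
    transitivity (\int[vol]_(x in D) (0 : R)); last by rewrite /Rintegral integral0.
    by apply: eq_Rintegral => x _; rewrite mul0r.
  by rewrite oppr0 H.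
- have -> : \int[vol]_(x in D) (Q (fun _ _ => 0) x * th x) = 0.
    transitivity (\int[vol]_(x in D) (0 : R)); last by rewrite /Rintegral integral0.
    by apply: ae_eq_Rintegral; apply: filterS Q0 => x h Dx; rewrite h// mul0r.
  by rewrite sub0r opprK.
by move=> k; exact: L20.
Qed.

Lemma ae_cst_int (D : set E) (a : R) : measurable D -> (vol D < +oo)%E ->
  ae_integrable vol D (cst a) /\ \int[vol]_(x in D) a = a * fine (vol D).
Proof.
move=> mD vD; split; last exact: Rintegral_cst.
apply: integrable_ae_integrable.
apply/integrableP; split; first by apply/measurable_EFinP; exact: measurable_cst.
by rewrite (_ : (fun _ => _) = cst `|a|%:E)// integral_cst// lte_mul_pinfty.
Qed.

Lemma L2_Rint_sq_le (D : set E) f : measurable D -> (vol D < +oo)%E -> 0 < fine (vol D) -> L2 D f ->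
  (\int[vol]_(x in D) f x) ^+ 2 <= fine (vol D) * \int[vol]_(x in D) f x ^+ 2.
Proof.
move=> mD vD V0 fL; have fi := L2_aei mD vD fL.
set V := fine (vol D) in V0 *; set s := \int[vol]_(x in D) f x; pose a := s / V.
have [ai aE] := ae_cst_int (a ^+ 2) mD vD.
rewrite -ler_pdivrMl//.
have -> : V^-1 * s ^+ 2 = \int[vol]_(x in D) (2 * a * f x - a ^+ 2).
  rewrite RintB//; last exact: ae_integrableZ.
  have -> : \int[vol]_(x in D) (2 * a * f x) = 2 * a * s by apply: RintZ.
  by rewrite aE -/V /a; field; rewrite gt_eqF.
apply: (le_Rint mD); [apply: ae_integrableB => //; exact: ae_integrableZ|exact: L2_sq|].
by apply: aeW => x _; have := sqr_ge0 (f x - a); nra.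
Qed.

Lemma sq_decompose (f p V m s : R) : 0 < V -> (f - p) * V = m - s ->
  f ^+ 2 <= 2 * p ^+ 2 + 4 / V ^+ 2 * (m ^+ 2 + s ^+ 2).
Proof.
move=> V0 h; have fE : f = p + (m - s) / V by rewrite -h mulfK ?gt_eqF// addrC subrK.
have h1 : ((m - s) / V) ^+ 2 <= 2 / V ^+ 2 * (m ^+ 2 + s ^+ 2).
  rewrite exprMn exprVn [leRHS]mulrAC ler_wpM2r ?invr_ge0 ?exprn_ge0// ?(ltW V0)//.
  by rewrite -subr_ge0 (_ : _ - _ = (m + s) ^+ 2) ?sqr_ge0//; ring.
rewrite fE; set q := (m - s) / V in h1 *.
have -> : 4 / V ^+ 2 = 2 * (2 / V ^+ 2) by ring.
rewrite -mulrA; set z := 2 / V ^+ 2 * _ in h1 *.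
have := sqr_ge0 (p - q); nra.
Qed.

(** [P] applied to the gradient of [f] has the same weak gradient as [f] and is bounded by it in
    L^2. The two functions differ by a constant, which their integrals over [D] control. *)
Lemma poincare_wirtinger (D : set E) : (0 < d)%N -> star_domain D -> exists2 C : R, 0 <= C &
  forall f (g : E -> E), L2 D f -> L2v D g -> is_weak_grad D f g ->
  \int[vol]_(x in D) f x ^+ 2 <=
  C * (\sum_i \int[vol]_(x in D) g x ord0 i ^+ 2 + (\int[vol]_(x in D) f x) ^+ 2).
Proof.
move=> d0 sD; have [P [Q [C [C0 PO QO PQ]]]] := poincare_operators d0 sD.
have oD : open D by case: sD.
have mD := open_measurable_row oD; have vD := star_vol sD; have V0 := star_vol_gt0 sD.
set V := fine (vol D) in V0.
exists (2 * C + 4 / V ^+ 2 * V * (1 + V * C)) => [|f g fL gL H].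
  have ? := ltW V0.
  have q0 : 0 <= 4 / V ^+ 2 by rewrite divr_ge0// exprn_ge0.
  by apply: addr_ge0; [exact: mulr_ge0|apply: mulr_ge0; [exact: mulr_ge0|apply: addr_ge0 => //; exact: mulr_ge0]].
have HP : is_weak_grad D (P (fun i x => g x ord0 i)) g.
  apply: (potential_of_closed oD vD C0 PO QO PQ gL) => i k xi tx.
  rewrite !H; try exact: test_partial.
  by rewrite (partialC i k (test_smooth tx)) subrr.
set p := P _ in HP.
have [pL pb] : L2 D p /\ \int[vol]_(x in D) p x ^+ 2 <= C * \sum_i \int[vol]_(x in D) g x ord0 i ^+ 2.
  by have [PO1 _] := PO; exact: (PO1 (fun i x => g x ord0 i)).
have Hd : is_weak_grad D (fun x => (-1) * p x + f x) (fun=> 0).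
  have := weak_grad_lin oD vD (-1) pL fL gL gL HP H.
  by apply: weak_grad_ae; apply: aeW => x _; [by []|rewrite scaleN1r addNr].
have [|c hc] := weak_grad0_star sD _ Hd.
  by apply: (L2D mD) => //; exact: L2Z.
have fi := L2_aei mD vD fL; have pi := L2_aei mD vD pL.
have [ci cE] := ae_cst_int c mD vD.
set m := \int[vol]_(x in D) f x; set s := \int[vol]_(x in D) p x.
have cV : c * V = m - s.
  rewrite -cE -RintB//; apply/esym/ae_eq_Rintegral.
  by apply: filterS hc => x h Dx; have := h Dx; rewrite /cst => <-; ring.
have sb : s ^+ 2 <= V * \int[vol]_(x in D) p x ^+ 2.
  exact: L2_Rint_sq_le.
set S := \sum_i _ in pb *.
have S0 : 0 <= S by apply: sumr_ge0 => i _; apply: Rintegral_ge0 => x _; exact: sqr_ge0.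
apply: (@le_trans _ _ (\int[vol]_(x in D) (2 * p x ^+ 2 + 4 / V ^+ 2 * (m ^+ 2 + s ^+ 2)))).
  have [ki kE] := ae_cst_int (4 / V ^+ 2 * (m ^+ 2 + s ^+ 2)) mD vD.
  apply: (le_Rint mD); [exact: L2_sq|apply: (ae_integrableD mD) => //; apply: (ae_integrableZ mD); exact: L2_sq|].
  apply: filterS hc => x h Dx; apply: sq_decompose => //.
  by rewrite -cV; have := h Dx; rewrite /cst => <-; congr (_ * _); ring.
have [ki kE] := ae_cst_int (4 / V ^+ 2 * (m ^+ 2 + s ^+ 2)) mD vD.
rewrite (RintD mD)//; last by apply: (ae_integrableZ mD); exact: L2_sq.
have -> : \int[vol]_(x in D) (2 * p x ^+ 2) = 2 * \int[vol]_(x in D) p x ^+ 2.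
  by apply: (RintZ mD); exact: L2_sq.
rewrite kE -/V; set I := \int[vol]_(x in D) p x ^+ 2 in pb sb *.
have q0 : 0 <= 4 / V ^+ 2 * V by rewrite mulr_ge0 ?divr_ge0 ?exprn_ge0 ?ltW.
rewrite [4 / _ * _ * V]mulrAC; set q := 4 / V ^+ 2 * V in q0 *.
have h1 : q * s ^+ 2 <= q * (V * (C * S)).
  by rewrite ler_wpM2l// (le_trans sb)// ler_wpM2l// ltW.
have h2 : 0 <= C * m ^+ 2 by rewrite mulr_ge0// sqr_ge0.
have h3 : 0 <= q * S by rewrite mulr_ge0.
have h4 := mulr_ge0 q0 (mulr_ge0 (ltW V0) h2).
rewrite (_ : (_ + _) * _ = 2 * (C * S) + 2 * (C * m ^+ 2) + q * S + q * m ^+ 2 + q * (V * (C * S)) + q * (V * (C * m ^+ 2))); last by ring.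
by rewrite mulrDr; lra.
Qed.

End constants.

(** * Gluing by a partition of unity *)

Section gluing.
Context {R : realType} {d : nat}.
Local Notation E := 'rV[R]_d.
Local Notation vol := (@lebesgue_row R d).
Local Notation leb := (@lebesgue_measure R).

Lemma Rint_test_shrink (h : E -> R) (D : set E) y (t : R) : 0 < t -> test_function D h ->
  \int[vol]_z h (shrink y t z) = t ^+ d * \int[vol]_z h z.
Proof.
move=> t0 th; have ti : 0 < t^-1 by rewrite invr_gt0.
rewrite (_ : (fun z => h (shrink y t z)) = fun z => h (t^-1 *: z + (y - t^-1 *: y))); last first.
  by apply/funext => z; rewrite shrink_affine.
by rewrite (Rintegral_affine _ ti (test_integrable th)) exprVn invrK.
Qed.

(* Euler's vector field centred at y has divergence d, whatever y is; comparing
   two centres isolates a single partial derivative. *)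
Lemma Rint_euler_test (D : set E) th y : (0 < d)%N -> test_function D th ->
  \int[vol]_x euler th d.-1 y x = - \int[vol]_x th x.
Proof.
move=> d0 tt; have [K [cK KD Kth]] := test_support tt.
have [M [Mr hM]] := compact_bounded cK.
(* The ball must contain both the support of [th] and the centre [y], so that it contains the
   segments between them. *)
pose r := Num.max (`|M| + 2) (`|y| + 1).
have Kr x : K x -> ball 0 r x.
  move=> Kx; rewrite -ball_normE /ball_/= sub0r normrN lt_max; apply/orP; left.
  have : `|x| <= `|M| + 1 by apply: hM => //; have := ler_norm M; lra.
  lra.
have yr : ball 0 r y.
  by rewrite -ball_normE /ball_/= sub0r normrN lt_max; apply/orP; right; lra.
pose B := ball (0 : E) r.
have mB : measurable B by apply: open_measurable_row; exact: ball_open.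
have Bi : vol.-integrable setT (EFin \o (\1_B : E -> R)).
  apply/integrableP; split; first by apply/measurable_EFinP; exact: measurable_indic.
  rewrite (eq_integral (fun x => (\1_B x)%:E)) => [|x _]; last by rewrite /= ger0_norm.
  by rewrite integral_indic// setIT; exact: vol_ball_lty.
have eK x : euler th d.-1 y x != 0 -> K x.
  move=> e0; apply: contrapT => nK; case/eqP: e0; rewrite /euler (Kth x nK).1 mulr0 add0r.
  by rewrite big1// => k _; rewrite (Kth x nK).2 mulr0.
have one (h : E -> R) t z : 0 < t -> t <= 1 -> (forall x, h x != 0 -> K x) ->
    \1_B z * h (shrink y t z) = h (shrink y t z).
  move=> t0 t1 hK; have [->|h0] := eqVneq (h (shrink y t z)) 0; first by rewrite mulr0.
  rewrite indicE mem_set ?mul1r// /B -(@dil_shrink R d y z t) ?gt_eqF//.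
  by apply: ball_convex; [exact/Kr/hK|exact: yr|rewrite ltW].
have h12 : 0 < (2^-1 : R) < 1 by lra.
(* With the indicator function of the ball for [f] and [tau = 1/2], the left side is [e / 2], since
   dilation by [t] scales integrals by [t^d], and the right side is [m / 2 - m]. *)
have := Rint_euler_shrink Bi tt d.-1 y h12.
have te := test_euler d.-1 y tt.
set e := \int[vol]_x euler th d.-1 y x; set m := \int[vol]_x th x.
have i1 : ae_integrable vol setT th by apply: integrable_ae_integrable; exact: test_integrable tt.
have -> : \int[vol]_z (\1_B z * (2^-1^-1 ^+ d.-1 * th (shrink y 2^-1 z) - th z)) = - (2^-1 * m).
  have thK x : th x != 0 -> K x.
    by move=> t0; apply: contrapT => nK; case/eqP: t0; case: (Kth x nK).
  have sh1 z : shrink y 1 z = z by rewrite /shrink invr1 scale1r addrC subrK.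
  transitivity (\int[vol]_z (2 ^+ d.-1 * th (shrink y 2^-1 z) - th z)).
    apply: eq_Rintegral => z _; rewrite mulrBr mulrCA.
    have -> : \1_B z * th (shrink y 2^-1 z) = th (shrink y 2^-1 z) by apply: one => //; lra.
    have -> : \1_B z * th z = th z by have := one th 1 z ltr01 (lexx _) thK; rewrite sh1.
    by rewrite invrK.
  have i2 : ae_integrable vol setT (fun z => th (shrink y 2^-1 z)).
    have := integrable_ae_integrable (@integrable_affine R d (2^-1)^-1 (y - (2^-1)^-1 *: y) _ th (test_integrable tt)).
    rewrite (_ : (fun z => th (shrink y 2^-1 z)) = fun z => th ((2^-1)^-1 *: z + (y - (2^-1)^-1 *: y))); last first.
      by apply/funext => z; rewrite shrink_affine.
    by apply; rewrite invrK.
  rewrite RintB//; last exact: ae_integrableZ.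
  have -> : \int[vol]_z (2 ^+ d.-1 * th (shrink y 2^-1 z)) = 2 ^+ d.-1 * \int[vol]_z th (shrink y 2^-1 z).
    by apply: RintZ.
  rewrite (Rint_test_shrink y _ tt); last lra.
  rewrite -[in 2^-1 ^+ d](prednK d0) exprS mulrA mulrCA.
  rewrite -exprMn mulfV ?pnatr_eq0// expr1n mulr1 -/m; lra.
have -> : \int[leb]_(t in `[2^-1, 1]) (t^-1 ^+ d.-1.+1 * \int[vol]_z (\1_B z * euler th d.-1 y (shrink y t z))) =
  \int[leb]_(t in `[2^-1, 1]) e.
  apply: eq_Rintegral => t; rewrite inE/= in_itv/= => /andP[t12 t1].
  have t0 : 0 < t by apply: lt_le_trans t12; lra.
  rewrite (_ : \int[vol]_z _ = \int[vol]_z euler th d.-1 y (shrink y t z)); last first.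
    by apply: eq_Rintegral => z _; exact: one.
  by rewrite (Rint_test_shrink y t0 te) prednK// mulrA -exprMn mulVf ?gt_eqF// expr1n mul1r.
rewrite Rintegral_cst//= lebesgue_measure_itv/= lte_fin ifT; last by lra.
rewrite -EFinB/= => h; lra.
Qed.

Lemma Rint_partial_test (D : set E) th i : (0 < d)%N -> test_function D th ->
  \int[vol]_x partial i th x = 0.
Proof.
move=> d0 tt.
have ai y : ae_integrable vol setT (euler th d.-1 y).
  by apply: integrable_ae_integrable; apply: test_integrable; exact: test_euler tt.
transitivity (\int[vol]_x (euler th d.-1 0 x - euler th d.-1 (delta_mx ord0 i) x)).
  apply: eq_Rintegral => x _; rewrite /euler opprD addrACA subrr add0r.
  rewrite -sumrB (bigD1 i)//= big1 ?addr0 => [|k ki]; last first.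
    by rewrite !mxE eqxx (negbTE ki) !subr0 subrr.
  have -> : (0 : E) ord0 i = 0 by rewrite mxE.
  have -> : (delta_mx ord0 i : E) ord0 i = 1 by rewrite mxE !eqxx.
  by ring.
by rewrite RintB// !(Rint_euler_test _ d0 tt) subrr.
Qed.

Lemma weak_grad_cst (D : set E) (a : R) : (0 < d)%N -> is_weak_grad D (cst a) (fun=> 0).
Proof.
move=> d0 th tt i; have tp := test_partial i tt.
transitivity (0 : R).
  transitivity (\int[vol]_(x in D) (0 : R)); last by rewrite /Rintegral integral0.
  by apply: eq_Rintegral => x _; rewrite mxE mul0r.
have -> : \int[vol]_(x in D) (cst a x * partial i th x) = \int[vol]_(x in D) (a * partial i th x) by [].
rewrite (Rint_test (testZ a tp)).
have -> : \int[vol]_x (a * partial i th x) = a * \int[vol]_x partial i th x.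
  by apply: RintZ => //; apply: integrable_ae_integrable; exact: test_integrable tp.
by rewrite (Rint_partial_test i d0 tt) mulr0 oppr0.
Qed.

Lemma partial_sum N (f : 'I_N -> E -> R) i x : (forall k, smooth (f k)) ->
  partial i (fun y => \sum_k f k y) x = \sum_k partial i (f k) x.
Proof.
move=> sf; suff h (s : seq 'I_N) : partial i (fun y => \sum_(k <- s) f k y) x = \sum_(k <- s) partial i (f k) x.
  exact: h.
elim: s => [|k s IHs].
  rewrite big_nil (_ : (fun _ => _) = cst 0) ?partial_cst//.
  by apply/funext => y; rewrite big_nil.
rewrite big_cons -IHs -partialD.
- by congr (partial _ _ _); apply/funext => y; rewrite big_cons.
- exact: smooth_differentiable.
- by apply: smooth_differentiable; exact: smooth_sum.
Qed.

Lemma partition_partial (Omega : set E) N (chi : 'I_N -> E -> R) i x : open Omega ->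
  (forall k, smooth (chi k)) -> (forall y, Omega y -> \sum_k chi k y = 1) -> Omega x ->
  \sum_k partial i (chi k) x = 0.
Proof.
move=> oO sc c1 Ox; rewrite -partial_sum// -[RHS](partial_cst 1 i x).
by apply: near_eq_derive; apply: filterS (open_nbhs_nbhs (conj oO Ox)).
Qed.

Lemma L2_patch (D Omega : set E) f : open D -> open Omega -> D `<=` Omega -> L2 D f ->
  L2 Omega (f \_ D).
Proof.
move=> oD oO DO fL; have mD := open_measurable_row oD.
apply: (L2_extend mD (open_measurable_row oO) DO).
  apply: L2_ae fL; apply: aeW => x Dx; by rewrite patchE mem_set.
by move=> x _ nD; rewrite patchE memNset.
Qed.

Lemma L2_mul_test (V Omega : set E) chi f : open Omega -> test_function V chi -> L2 Omega f ->
  L2 Omega (fun x => chi x * f x).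
Proof.
move=> oO tc; have [M _ hM] := test_bounded tc.
apply: (@L2_bounded_mul _ _ _ (open_measurable_row oO) _ _ M) => //.
by apply: measurable_funTS; exact: test_measurable tc.
Qed.

Lemma weak_grad_glue (Omega : set E) N (V : 'I_N -> set E) chi f (g : 'I_N -> E -> E) :
  open Omega -> (vol Omega < +oo)%E -> (forall k, open (V k)) ->
  (forall k, test_function (V k) (chi k)) -> (forall k, L2 (V k `&` Omega) (f k)) ->
  (forall k, L2v (V k `&` Omega) (g k)) -> (forall k, is_weak_grad (V k `&` Omega) (f k) (g k)) ->
  let psi x := \sum_k chi k x * (f k \_ (V k `&` Omega)) x in
  let G x := \sum_k \row_i (chi k x * ((fun y => g k y ord0 i) \_ (V k `&` Omega)) x
      + (f k \_ (V k `&` Omega)) x * partial i (chi k) x) in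
  [/\ L2 Omega psi, L2v Omega G & is_weak_grad Omega psi G].
Proof.
move=> oO vO oV tc fL gL H psi G; have mO := open_measurable_row oO.
have oD k : open (V k `&` Omega) by exact: openI.
have DO k : V k `&` Omega `<=` Omega by move=> x [].
have pL k : L2 Omega (fun x => chi k x * (f k \_ (V k `&` Omega)) x).
  by apply: L2_mul_test (tc k) _ => //; exact: L2_patch.
have GL k : L2v Omega (fun x => \row_i (chi k x * ((fun y => g k y ord0 i) \_ (V k `&` Omega)) x
      + (f k \_ (V k `&` Omega)) x * partial i (chi k) x)).
  move=> i; apply: (@L2_ae _ _ _ _ (fun x => chi k x * ((fun y => g k y ord0 i) \_ (V k `&` Omega)) x
      + partial i (chi k) x * (f k \_ (V k `&` Omega)) x)).
    by apply: aeW => x _; rewrite mxE [partial _ _ _ * _]mulrC.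
  apply: (L2D mO); first by apply: L2_mul_test (tc k) _ => //; apply: L2_patch => //; exact: gL.
  by apply: L2_mul_test (test_partial i (tc k)) _ => //; exact: L2_patch.
split.
- exact: (L2_sum mO).
- move=> i; apply: (@L2_ae _ _ _ _ (fun x => \sum_k (\row_i (chi k x * ((fun y => g k y ord0 i) \_ (V k `&` Omega)) x
      + (f k \_ (V k `&` Omega)) x * partial i (chi k) x)) ord0 i)).
    by apply: aeW => x _; rewrite summxE.
  by apply: (L2_sum mO) => k; exact: GL.
- apply: weak_grad_sum => // k.
  by apply: weak_grad_cutoff.
Qed.

Lemma star_partition (Omega : set E) (U : E -> set E) : lipschitz_domain Omega -> bounded_set Omega ->
  (forall p, closure Omega p -> nbhs p (U p)) ->
  exists N (V : 'I_N -> set E) (chi : 'I_N -> E -> R) (p : 'I_N -> E),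
    [/\ forall k, [/\ closure Omega (p k), open (V k), star_domain (V k `&` Omega), V k `<=` U (p k) &
       test_function (V k) (chi k)],
      forall x, closure Omega x -> exists k, V k x &
      forall x, closure Omega x -> \sum_k chi k x = 1].
Proof.
move=> lO bO nU; have [N [V [beta [p [hk cov]]]]] := star_cover lO bO nU.
exists N, V, (bpart beta), p; split.
- move=> k; have [h1 h2 h3 h4 h5] := hk k; split=> //.
  apply: testM => //.
  rewrite (_ : (fun _ => _) = fun x => \prod_(l < N) (if (l < k)%N then 1 - beta l x else 1)); last first.
    by apply/funext => x; rewrite big_mkcond.
  apply: smooth_prod => l; case: (ltnP l k) => _; last exact: smooth_cst.
  by apply: smoothB; [exact: smooth_cst|have [_ _ _ _ /test_smooth] := hk l].
- move=> x cx; have [k bk] := cov x cx; exists k; apply: contrapT => nV.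
  have [_ _ _ _ t] := hk k; have := test_out t nV; rewrite bk => /eqP; by rewrite oner_eq0.
- move=> x cx; exact/bpart_sum/cov.
Qed.

End gluing.

(** * Scalar potentials of curl-free fields *)

Section potentials.
Context {R : realType} {d : nat}.
Local Notation E := 'rV[R]_d.
Local Notation vol := (@lebesgue_row R d).
Hypotheses (d0 : (0 < d)%N) (d3 : (d <= 3)%N).

Lemma curl_comp0 (i k : 'I_d) : curl_comp i k (0 : 'rV[R]_3) = 0.
Proof. by have [a ->] := @curl_comp_sum R d i k; rewrite big1// => l _; rewrite mxE mulr0. Qed.

Lemma weak_curl0_closed (D : set E) (v : E -> E) i k xi : open D -> (vol D < +oo)%E ->
  L2v D v -> is_weak_curl D v (fun=> 0) -> test_function D xi ->
  \int[vol]_(x in D) (v x ord0 i * partial k xi x) - \int[vol]_(x in D) (v x ord0 k * partial i xi x) = 0.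
Proof.
move=> oD vD vL H tx; rewrite (weak_curl_rot oD vD i k d3 vL _ H tx); last exact: L2v0.
rewrite (_ : \int[vol]_(x in D) _ = 0) ?oppr0//.
transitivity (\int[vol]_(x in D) (0 : R)); last by rewrite /Rintegral integral0.
by apply: eq_Rintegral => x _; rewrite curl_comp0 mul0r.
Qed.

Lemma star_potential (D : set E) (v : E -> E) : star_domain D -> L2v D v ->
  is_weak_curl D v (fun=> 0) -> exists2 f, L2 D f & is_weak_grad D f v.
Proof.
move=> sD vL H; have [P [Q [C [C0 PO QO PQ]]]] := poincare_operators d0 sD.
have oD : open D by case: sD.
have vD := star_vol sD.
exists (P (fun i x => v x ord0 i)); first by have [PO1 _] := PO; case: (PO1 (fun i x => v x ord0 i) vL).
by apply: (potential_of_closed oD vD C0 PO QO PQ vL) => i k xi; exact: weak_curl0_closed.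
Qed.

Lemma weak_grad_diff0 (D : set E) f f' (g : E -> E) : open D -> (vol D < +oo)%E ->
  L2 D f -> L2 D f' -> L2v D g -> is_weak_grad D f g -> is_weak_grad D f' g ->
  is_weak_grad D (fun x => -1 * f' x + f x) (fun=> 0).
Proof.
move=> oD vD fL fL' gL H H'; have := weak_grad_lin oD vD (-1) fL' fL gL gL H' H.
by apply: weak_grad_ae; apply: aeW => x _; [by []|rewrite scaleN1r addNr].
Qed.

Lemma curl_free_potential (Omega : set E) (h : E -> E) : simply_connected Omega ->
  lipschitz_domain Omega -> bounded_set Omega -> L2v Omega h -> is_weak_curl Omega h (fun=> 0) ->
  exists2 psi, L2 Omega psi & is_weak_grad Omega psi h.
Proof.
move=> scO lO bO hL H; have [oO cO O0 _] := lO.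
have mO := open_measurable_row oO.
have vO : (vol Omega < +oo)%E by exact: lebesgue_row_bounded.
have [N [V [chi [p [hV cov c1]]]]] := star_partition lO bO (fun p _ => (filterT : nbhs p setT)).
have oV k : open (V k) by case: (hV k).
have tc k : test_function (V k) (chi k) by case: (hV k).
pose D k := V k `&` Omega.
have sD k : star_domain (D k) by case: (hV k).
have oD k : open (D k) by case: (sD k).
have DO k : D k `<=` Omega by move=> x [].
have mD k := open_measurable_row (oD k).
have vD k := star_vol (sD k).
have hLD k : L2v (D k) h by move=> i; exact: (L2_subset mO (mD k) (DO k) (hL i)).
have ex k : exists f, L2 (D k) f /\ is_weak_grad (D k) f h.
  by have [f fL fH] := star_potential (sD k) (hLD k) (weak_curl_restrict (DO k) H); exists f.
have [f hf] := choice ex.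
have fL k : L2 (D k) (f k) by case: (hf k).
have fH k : is_weak_grad (D k) (f k) h by case: (hf k).
have oI k l : open (D k `&` D l) by exact: openI.
have vI k l : (vol (D k `&` D l) < +oo)%E.
  by apply: (vol_sub_lty (oI k l) (oD k) _ (vD k)) => x [].
have exd (kl : 'I_N * 'I_N) : exists c, locally_constant (D kl.1 `&` D kl.2) c /\
    (fun x => -1 * f kl.2 x + f kl.1 x) = c %[ae vol in D kl.1 `&` D kl.2].
  case: kl => k l /=.
  have mI := open_measurable_row (oI k l).
  have L1 : L2 (D k `&` D l) (f k) by apply: (L2_subset (mD k) mI) => // x [].
  have L2' : L2 (D k `&` D l) (f l) by apply: (L2_subset (mD l) mI) => // x [].
  have hL' : L2v (D k `&` D l) h by move=> i; apply: (L2_subset (mD k) mI) => [x []//|]; exact: hLD.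
  have [||c lc fc] := @weak_grad0_locally_constant R d (D k `&` D l) (fun x => -1 * f l x + f k x) (oI k l).
  - by apply: (L2D mI) => //; exact: L2Z.
  - apply: (weak_grad_diff0 (oI k l) (vI k l) L1 L2' hL').
      by apply: weak_grad_restrict (fH k) => x [].
    by apply: weak_grad_restrict (fH l) => x [].
  - by exists c.
have [delta hdelta] := choice exd.
have [|||||lam hlam] := @cocycle_trivial R d Omega N D (fun k l => delta (k, l)) scO oO O0.
- by move=> k; split; [exact: oD|exact: DO].
- move=> k; have [_ _ [B [_ [b Bb] _ st]]] := sD k; exists b => x t Dx t01; exact: st.
- by move=> x Ox; have [k Vk] := cov x (subset_closure Ox); exists k.
- by move=> k l x Dk Dl; have [lc _] := hdelta (k, l); exact: (lc x).
- move=> k l m x Dk Dl Dm.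
  have /nbhs_ballP[r /= r0 hr] := open_nbhs_nbhs (conj (openI (oI k l) (oD m)) (conj (conj Dk Dl) Dm)).
  have [lc1 e1] := hdelta (k, l); have [lc2 e2] := hdelta (l, m); have [lc3 e3] := hdelta (k, m).
  (* The cocycle identity holds almost everywhere, by the definition of the jumps, and then
     everywhere because both sides are locally constant. *)
  apply: (@ae_near_locally_constant R d (fun y => delta (k, l) y + delta (l, m) y) (delta (k, m)) x r r0).
  + by apply: filterS2 (lc1 x (conj Dk Dl)) (lc2 x (conj Dl Dm)) => y /= -> ->.
  + exact: (lc3 x (conj Dk Dm)).
  + apply: filterS3 e1 e2 e3 => y /= e1 e2 e3 xy.
    have [[yk yl] ym] := hr y xy.
    by rewrite -e1// -e2// -e3//; ring.
(* Shifted by [lam k], the local potentials agree almost everywhere on overlaps. The factor 1 fits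
   the form of [weak_grad_lin]. *)
pose F k (x : E) := 1 * f k x + cst (- lam k) x.
have cL k : L2 (D k) (cst (- lam k)).
  apply: (@bounded_aei_L2 _ _ _ (mD k) _ `|lam k| (vD k)).
    exact: ae_measurable_cst.
  by move=> x _; rewrite /cst normrN.
have FL k : L2 (D k) (F k) by apply: (L2D (mD k)) => //; exact: (L2Z (mD k)).
have FH k : is_weak_grad (D k) (F k) h.
  have := weak_grad_lin (oD k) (vD k) 1 (fL k) (cL k) (hLD k) (@L2v0 _ _ _ _) (fH k) (@weak_grad_cst R d (D k) (- lam k) d0).
  by apply: weak_grad_ae; apply: aeW => x _; [by []|rewrite scale1r addr0].
have [pL GL gH] := weak_grad_glue oO vO oV tc FL hLD FH.
set psi := (X in is_weak_grad _ X _) in gH pL; set G := (X in is_weak_grad _ _ X) in gH GL.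
exists psi; first exact: pL.
apply: weak_grad_ae gH; first exact: aeW.
have agree : \forall x \ae vol, forall kl : 'I_N * 'I_N, D kl.1 x -> D kl.2 x -> F kl.1 x = F kl.2 x.
  apply: filter_forall => -[k l]; have [_] := hdelta (k, l); apply: filterS => x /= e Dk Dl.
  have := e (conj Dk Dl); rewrite (hlam k l x Dk Dl) /F /cst => e'.
  have -> : f k x = f l x + (lam k - lam l) by rewrite -e'; ring.
  by ring.
apply: filterS agree => x agree Ox; have [m Vm] := cov x (subset_closure Ox).
have Dm : D m x by [].
have sc k : smooth (chi k) := test_smooth (tc k).
rewrite /G; apply/rowP => i; rewrite summxE.
(* Every potential can be replaced by [F m] at [x]; the derivatives of the partition of unity then
   sum to zero and only [h] remains. *)
transitivity (\sum_k (h x ord0 i * chi k x + F m x * partial i (chi k) x)).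
  rewrite big_split/= -!mulr_sumr (c1 _ (subset_closure Ox)) mulr1.
  rewrite (partition_partial i oO sc _ Ox) ?mulr0 ?addr0// => y Oy.
  by apply: c1; exact: subset_closure.
apply: eq_bigr => k _; rewrite mxE.
have [Vk|nV] := pselect (V k x).
  by rewrite !patchE !mem_set// (agree (k, m))//= [h x _ _ * _]mulrC.
by rewrite (test_out (tc k) nV) (test_partial_out i (tc k) nV) !(mul0r, mulr0).
Qed.

End potentials.

(** * A bounded right inverse of the curl *)

Section domination.
Context {R : realType} (T : Type) (A : set T) (G : T -> R).
Hypothesis G0 : forall x, A x -> 0 <= G x.

(** Bounds up to an unnamed constant, uniform over [A], so that estimates can be combined without
    tracking constants. *)
Definition dominated (F : T -> R) := exists2 C : R, 0 <= C & forall x, A x -> F x <= C * G x.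

Lemma dominated_self : dominated G.
Proof. by exists 1 => // x _; rewrite mul1r. Qed.

Lemma dominated_le F F' : (forall x, A x -> F x <= F' x) -> dominated F' -> dominated F.
Proof. by move=> FF [C C0 h]; exists C => // x Ax; rewrite (le_trans (FF x Ax))// h. Qed.

Lemma dominatedD F F' : dominated F -> dominated F' -> dominated (fun x => F x + F' x).
Proof.
move=> [C C0 h] [C' C'0 h']; exists (C + C'); first exact: addr_ge0.
by move=> x Ax; rewrite mulrDl lerD ?h ?h'.
Qed.

Lemma dominatedZ c F : 0 <= c -> dominated F -> dominated (fun x => c * F x).
Proof.
move=> c0 [C C0 h]; exists (c * C); first exact: mulr_ge0.
by move=> x Ax; rewrite -mulrA ler_wpM2l// h.
Qed.

Lemma dominated0 : dominated (fun=> 0).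
Proof. by exists 0 => // x _; rewrite mul0r. Qed.

Lemma dominated_sum (I : finType) (F : I -> T -> R) : (forall i, dominated (F i)) ->
  dominated (fun x => \sum_i F i x).
Proof.
move=> h; have /choice[C hC] i : exists C : R, 0 <= C /\ forall x, A x -> F i x <= C * G x.
  by have [C C0 hC] := h i; exists C.
exists (\sum_i C i); first by apply: sumr_ge0 => i _; case: (hC i).
by move=> x Ax; rewrite mulr_suml; apply: ler_sum => i _; case: (hC i) => _; exact.
Qed.

End domination.

Section cover_estimates.
Context {R : realType} {d : nat}.
Local Notation E := 'rV[R]_d.
Local Notation vol := (@lebesgue_row R d).

Lemma Rint_cover (Omega : set E) M (D : 'I_M -> set E) f : open Omega ->
  (forall m, D m `<=` Omega) -> (forall m, open (D m)) -> (forall x, Omega x -> exists m, D m x) ->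
  (forall x, 0 <= f x) -> ae_integrable vol Omega f ->
  \int[vol]_(x in Omega) f x <= \sum_m \int[vol]_(x in D m) f x.
Proof.
move=> oO DO oD cov f0 fi; have mO := open_measurable_row oO.
have pi m : ae_integrable vol Omega (f \_ (D m)).
  have [g fg gi] := fi; exists (g \_ (D m)).
    by apply: filterS fg => x h Ox; rewrite !patchE; case: ifP => // _; exact: h.
  have mD := open_measurable_row (oD m).
  apply: (integrableS measurableT mO) => //.
  rewrite (_ : EFin \o _ = (EFin \o g) \_ (D m)); last by apply/funext => x; rewrite /= !patchE; case: ifP.
  by apply/(integrable_mkcond _ mD); apply: (integrableS mO mD).
apply: (@le_trans _ _ (\int[vol]_(x in Omega) \sum_m (f \_ (D m)) x)).
  apply: (le_Rint mO) => //; first exact: (ae_integrable_sum mO).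
  apply: aeW => x Ox; have [m Dm] := cov x Ox.
  rewrite (bigD1 m)//= patchE mem_set// lerDl; apply: sumr_ge0 => l _.
  by rewrite patchE; case: ifP.
rewrite (Rint_sum mO)//; apply: ler_sum => m _.
rewrite (Rint_sub (DO m)) => [|x _ nD]; last by rewrite patchE memNset.
rewrite le_eqVlt; apply/orP; left; apply/eqP; apply: eq_Rintegral => x Dx; by rewrite patchE Dx.
Qed.

Lemma Rint_mono_set (D Omega : set E) f : open D -> open Omega -> D `<=` Omega ->
  (forall x, 0 <= f x) -> ae_integrable vol Omega f ->
  \int[vol]_(x in D) f x <= \int[vol]_(x in Omega) f x.
Proof.
move=> oD oO DO f0 fi; have mO := open_measurable_row oO; have mD := open_measurable_row oD.
have -> : \int[vol]_(x in D) f x = \int[vol]_(x in Omega) (f \_ D) x.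
  rewrite (Rint_sub DO) => [|x _ nD]; last by rewrite patchE memNset.
  by apply: eq_Rintegral => x Dx; rewrite patchE Dx.
apply: (le_Rint mO) => //; last first.
  by apply: aeW => x _; rewrite patchE; case: ifP.
have [g fg gi] := fi; exists (g \_ D).
  by apply: filterS fg => x h Ox; rewrite !patchE; case: ifP => // _; exact: h.
apply: (integrableS measurableT mO) => //.
rewrite (_ : EFin \o _ = (EFin \o g) \_ D); last by apply/funext => x; rewrite /= !patchE; case: ifP.
by apply/(integrable_mkcond _ mD); apply: (integrableS mO mD).
Qed.

Lemma Rint_sq_mono (D Omega : set E) f : open D -> open Omega -> D `<=` Omega -> L2 Omega f ->
  \int[vol]_(x in D) f x ^+ 2 <= \int[vol]_(x in Omega) f x ^+ 2.
Proof.
move=> oD oO DO fL; apply: (Rint_mono_set oD oO DO) => [x|]; first exact: sqr_ge0.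
exact: L2_sq.
Qed.

End cover_estimates.

(** * A normalized field with the same curl *)

Section curl_decomposition.
Context {R : realType} {d : nat}.
Local Notation E := 'rV[R]_d.
Local Notation vol := (@lebesgue_row R d).
Hypotheses (d0 : (0 < d)%N) (d3 : (d <= 3)%N).
Variables (Omega : set E) (oO : open Omega) (bO : bounded_set Omega).
Variables (N : nat) (V : 'I_N -> set E) (chi : 'I_N -> E -> R).
Hypotheses (oV : forall k, open (V k)) (sD : forall k, star_domain (V k `&` Omega)).
Hypotheses (tc : forall k, test_function (V k) (chi k)).
Hypothesis c1 : forall x, Omega x -> \sum_k chi k x = 1.
Variables (P Q : 'I_N -> ('I_d -> E -> R) -> E -> R) (C : 'I_N -> R).
Hypotheses (C0 : forall k, 0 <= C k) (PO : forall k, L2_operator (V k `&` Omega) (C k) (P k))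
  (QO : forall k, L2_operator (V k `&` Omega) (C k) (Q k)).
Hypothesis PQ : forall k v w i, (forall j, L2 (V k `&` Omega) (v j)) -> (forall j, L2 (V k `&` Omega) (w j)) ->
    (forall xi j, test_function (V k `&` Omega) xi ->
    \int[vol]_(x in V k `&` Omega) (v i x * partial j xi x) - \int[vol]_(x in V k `&` Omega) (v j x * partial i xi x) =
    - \int[vol]_(x in V k `&` Omega) (w j x * xi x)) ->
    forall th, test_function (V k `&` Omega) th ->
    \int[vol]_(x in V k `&` Omega) (P k v x * partial i th x) =
    \int[vol]_(x in V k `&` Omega) (Q k w x * th x) - \int[vol]_(x in V k `&` Omega) (v i x * th x).
(* A finer cover, on whose members the jumps between the local potentials
   satisfy a Poincaré-Wirtinger inequality. *)
Variables (M : nat) (W : 'I_M -> set E) (S : 'I_M -> pred 'I_N) (l : 'I_M -> 'I_N).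
Hypotheses (oW : forall m, open (W m)) (sW : forall m, star_domain (W m `&` Omega)).
Hypotheses (covW : forall x, Omega x -> exists m, W m x) (Sl : forall m, S m (l m)).
Hypotheses (WV : forall m k, S m k -> W m `<=` V k)
  (W0 : forall m k, ~~ S m k -> forall x, W m x -> chi k x = 0 /\ forall i, partial i (chi k) x = 0).

Let D k := V k `&` Omega.
Let Dm m := W m `&` Omega.
Let mO : measurable Omega. Proof. exact: open_measurable_row. Qed.
Let vO : (vol Omega < +oo)%E. Proof. exact: lebesgue_row_bounded. Qed.
Let oD k : open (D k). Proof. exact: openI. Qed.
Let mD k : measurable (D k). Proof. exact: open_measurable_row. Qed.
Let vD k : (vol (D k) < +oo)%E. Proof. exact: star_vol (sD k). Qed.
Let DO k : D k `<=` Omega. Proof. by move=> x []. Qed.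
Let oDm m : open (Dm m). Proof. exact: openI. Qed.
Let mDm m : measurable (Dm m). Proof. exact: open_measurable_row. Qed.
Let vDm m : (vol (Dm m) < +oo)%E. Proof. exact: star_vol (sW m). Qed.
Let DmO m : Dm m `<=` Omega. Proof. by move=> x []. Qed.
Arguments DO : clear implicits.
Arguments DmO : clear implicits.
Arguments oD : clear implicits.
Arguments oDm : clear implicits.
Let DmD m k : S m k -> Dm m `<=` D k.
Proof. by move=> Smk x [Wx Ox]; split=> //; exact: (WV Smk). Qed.

(** The curl is carried along as data, so that linear combinations of pairs are admissible without
    recourse to the chosen [wcurl]. *)
Definition admissible (p : (E -> E) * (E -> 'rV[R]_3)) :=
  [/\ L2v Omega p.1, L2v Omega p.2 & is_weak_curl Omega p.1 p.2].

Definition comps (v : E -> E) : 'I_d -> E -> R := fun i x => v x ord0 i.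
Definition curls i (c : E -> 'rV[R]_3) : 'I_d -> E -> R := fun j x => curl_comp i j (c x).

Definition local_pot k (v : E -> E) := P k (comps v).
Definition local_cor k i (c : E -> 'rV[R]_3) := Q k (curls i c).
Definition local_grad k (p : (E -> E) * (E -> 'rV[R]_3)) : E -> E :=
  fun x => \row_i (p.1 x ord0 i - local_cor k i p.2 x).

(* p.1 minus the gradient of the local potentials glued by the partition of
   unity: it has the same curl, and depends on p.1 only through the local
   corrections and the jumps of the potentials. *)
Definition normalize (p : (E -> E) * (E -> 'rV[R]_3)) : E -> E :=
  fun x => \row_i \sum_k (chi k x * (local_cor k i p.2 \_ (D k)) x
    - (local_pot k p.1 \_ (D k)) x * partial i (chi k) x).

(** The finitely many numbers through which, besides its curl, a field enters the bounds. They are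
    integrals, not divided by the volume; 0 is a default when the piece is not assigned to the
    domain of the potential. *)
Definition mean (mk : 'I_M * 'I_N) (v : E -> E) : R :=
  if S mk.1 mk.2 then \int[vol]_(x in Dm mk.1) local_pot mk.2 v x else 0.

Let compsL k v : L2v Omega v -> forall j, L2 (D k) (comps v j).
Proof. by move=> vL j; exact: (L2_subset mO (mD k) (DO k) (vL j)). Qed.

Let curlsL k i c : L2v Omega c -> forall j, L2 (D k) (curls i c j).
Proof. by move=> cL j; apply: (L2_subset mO (mD k) (DO k)); exact: L2v_rot. Qed.

Lemma local_pot_L2 k v : L2v Omega v -> L2 (D k) (local_pot k v).
Proof. by move=> vL; have [PO1 _] := PO k; case: (PO1 _ (compsL k vL)). Qed.

Lemma local_cor_L2 k i c : L2v Omega c -> L2 (D k) (local_cor k i c).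
Proof. by move=> cL; have [QO1 _] := QO k; case: (QO1 _ (curlsL k i cL)). Qed.

Lemma local_grad_L2 k p : admissible p -> L2v (D k) (local_grad k p).
Proof.
move=> [vL cL _] i; apply: (@L2_ae _ _ _ _ (fun x => p.1 x ord0 i - local_cor k i p.2 x)).
  by apply: aeW => x _; rewrite mxE.
by apply: (L2B (mD k)); [exact: (compsL k vL)|exact: local_cor_L2].
Qed.

Lemma local_grad_weak k p : admissible p -> is_weak_grad (D k) (local_pot k p.1) (local_grad k p).
Proof.
move=> [vL cL H] th tt i.
rewrite (PQ (w := curls i p.2) (compsL k vL) (curlsL k i cL))//; last first.
  have cLk : L2v (D k) p.2 by move=> a; exact: (L2_subset mO (mD k) (DO k) (cL a)).
  move=> xi j tx.
  have vLk : L2v (D k) p.1 by exact: compsL.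
  have := weak_curl_rot (oD k) (vD k) i j d3 vLk cLk (weak_curl_restrict (DO k) H) tx.
  by rewrite /comps /curls.
rewrite opprB -(RintB (mD k))//; last 2 first.
- exact: (mul_test_aei (oD k) (vD k) (compsL k vL i) tt).
- exact: (mul_test_aei (oD k) (vD k) (local_cor_L2 k i cL) tt).
apply: eq_Rintegral => x _; by rewrite mxE mulrBl.
Qed.

Lemma normalize_curl p : admissible p ->
  L2v Omega (normalize p) /\ is_weak_curl Omega (normalize p) p.2.
Proof.
move=> pa; have [vL cL H] := pa.
have pL k : L2 (D k) (local_pot k p.1) by exact: local_pot_L2.
have gL k : L2v (D k) (local_grad k p) by exact: local_grad_L2.
have wg k : is_weak_grad (D k) (local_pot k p.1) (local_grad k p) by exact: local_grad_weak.
have [psiL GL gH] := weak_grad_glue oO vO oV tc pL gL wg.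
set psi := (X in is_weak_grad _ X _) in gH psiL; set G := (X in is_weak_grad _ _ X) in gH GL.
have G0 := weak_curl_grad oO vO psiL GL gH.
(* Since the [chi k] sum to 1, [p.1] is the sum of the [chi k p.1], which cancels the field part of
   [local_grad]. *)
have e : normalize p = (fun x => -1 *: G x + p.1 x) %[ae vol in Omega].
  apply: aeW => x Ox; apply/rowP => i; rewrite !mxE summxE.
  transitivity (- (\sum_k (chi k x * (local_grad k p x ord0 i) + (local_pot k p.1 \_ (D k)) x * partial i (chi k) x))
     + \sum_k chi k x * p.1 x ord0 i).
    rewrite -sumrN -big_split/=; apply: eq_bigr => k _; rewrite mxE.
    have [Vk|nV] := pselect (V k x).
      by rewrite !patchE !mem_set//; ring.
    by rewrite (test_out (tc k) nV) (test_partial_out i (tc k) nV) !(mul0r, mulr0); ring.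
  rewrite -mulr_suml (c1 Ox) mul1r mulN1r; congr (- _ + _); apply: eq_bigr => k _; rewrite mxE.
  have [Vk|nV] := pselect (V k x); first by rewrite mxE !patchE !mem_set// mxE.
  by rewrite mxE (test_out (tc k) nV) (test_partial_out i (tc k) nV) !(mul0r, mulr0).
split.
  apply: (L2v_ae e); apply: (L2vD mO) => //; exact: L2vZ.
apply: (weak_curl_ae e) (weak_curl_lin oO vO (-1) GL vL (@L2v0 _ _ _ _) cL G0 H).
by apply: aeW => x _; rewrite scaler0 add0r.
Qed.

Definition pair_sub (p q : (E -> E) * (E -> 'rV[R]_3)) : (E -> E) * (E -> 'rV[R]_3) :=
  (fun x => -1 *: q.1 x + p.1 x, fun x => -1 *: q.2 x + p.2 x).

Lemma admissible_diff p q : admissible p -> admissible q -> admissible (pair_sub p q).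
Proof.
move=> [vL cL H] [vL' cL' H']; split.
- by apply: (L2vD mO) => //; exact: L2vZ.
- by apply: (L2vD mO) => //; exact: L2vZ.
- exact: (weak_curl_lin oO vO (-1) vL' vL cL' cL H' H).
Qed.

Lemma local_pot_diff k p q : admissible p -> admissible q ->
  local_pot k (pair_sub p q).1 = (fun x => -1 * local_pot k q.1 x + local_pot k p.1 x) %[ae vol in D k].
Proof.
move=> [vL _ _] [vL' _ _]; have [_ lin] := PO k.
have := lin (-1) _ _ (compsL k vL') (compsL k vL).
apply: filterS => x h Dx; rewrite -(h Dx) /local_pot; congr (P k _ x).
by apply/funext => i; apply/funext => y; rewrite /comps !mxE.
Qed.

Lemma local_cor_diff k i p q : admissible p -> admissible q ->
  local_cor k i (pair_sub p q).2 = (fun x => -1 * local_cor k i q.2 x + local_cor k i p.2 x) %[ae vol in D k].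
Proof.
move=> [_ cL _] [_ cL' _]; have [_ lin] := QO k.
have := lin (-1) _ _ (curlsL k i cL') (curlsL k i cL).
apply: filterS => x h Dx; rewrite -(h Dx) /local_cor; congr (Q k _ x).
apply/funext => j; apply/funext => y; rewrite /curls; have [a ha] := @curl_comp_sum R d i j.
by rewrite !ha mulr_sumr -big_split/=; apply: eq_bigr => b _; rewrite !mxE; ring.
Qed.

Lemma normalize_diff p q : admissible p -> admissible q ->
  normalize (pair_sub p q) = (fun x => normalize p x - normalize q x) %[ae vol in Omega].
Proof.
move=> pa qa.
have h1 : \forall x \ae vol, forall k, D k x -> local_pot k (pair_sub p q).1 x = -1 * local_pot k q.1 x + local_pot k p.1 x.
  by apply: filter_forall => k; exact: local_pot_diff.
have h2 : \forall x \ae vol, forall ki : 'I_N * 'I_d, D ki.1 x ->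
    local_cor ki.1 ki.2 (pair_sub p q).2 x = -1 * local_cor ki.1 ki.2 q.2 x + local_cor ki.1 ki.2 p.2 x.
  by apply: filter_forall => -[k i]; exact: local_cor_diff.
apply: filterS2 h1 h2 => x h1 h2 Ox; apply/rowP => i; rewrite !mxE -sumrB; apply: eq_bigr => k _.
have [Vk|nV] := pselect (V k x).
  by rewrite !patchE !mem_set// h1// (h2 (k, i))//=; ring.
by rewrite (test_out (tc k) nV) (test_partial_out i (tc k) nV) !(mul0r, mulr0) !subr0.
Qed.

Lemma mean_diff mk p q : admissible p -> admissible q ->
  mean mk (pair_sub p q).1 = mean mk p.1 - mean mk q.1.
Proof.
case: mk => m k pa qa; rewrite /mean /=; case: ifP => [Smk|_]; last by rewrite subrr.
have [vL _ _] := pa; have [vL' _ _] := qa.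
have i1 : ae_integrable vol (Dm m) (local_pot k p.1).
  apply: (L2_aei (mDm m) (vDm m)); apply: (L2_subset (mD k) (mDm m) (DmD Smk)); exact: local_pot_L2.
have i2 : ae_integrable vol (Dm m) (local_pot k q.1).
  apply: (L2_aei (mDm m) (vDm m)); apply: (L2_subset (mD k) (mDm m) (DmD Smk)); exact: local_pot_L2.
rewrite -RintB//; apply: ae_eq_Rintegral.
apply: filterS (local_pot_diff k pa qa) => x h Dx; rewrite h ?mulN1r 1?addrC//.
exact: (DmD Smk).
Qed.

Lemma mean_bound : exists2 K : R, 0 <= K & forall mk v, L2v Omega v ->
  mean mk v ^+ 2 <= K * L2norm Omega v ^+ 2.
Proof.
have [K K0 hK] : dominated (fun v => L2v Omega v) (fun v => L2norm Omega v ^+ 2)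
    (fun v => \sum_mk mean mk v ^+ 2).
  apply: dominated_sum => -[m k]; have [Smk|nS] := boolP (S m k); last first.
    by apply: dominated_le (@dominated0 _ _ _ _) => v _; rewrite /mean/= (negbTE nS) expr0n.
  apply: (@dominated_le _ _ _ _ _ (fun v => fine (vol (Dm m)) * (C k * (d%:R * L2norm Omega v ^+ 2)))).
    move=> v vL; rewrite /mean/= Smk; apply: le_trans (L2_Rint_sq_le (mDm m) (vDm m) (star_vol_gt0 (sW m)) _) _.
      by apply: (L2_subset (mD k) (mDm m) (DmD Smk)); exact: local_pot_L2.
    rewrite ler_wpM2l ?fine_ge0//.
    have [PO1 _] := PO k; have [pL pb] := PO1 _ (compsL k vL).
    apply: le_trans (Rint_sq_mono (oDm m) (oD k) (DmD Smk) (local_pot_L2 k vL)) _.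
    apply: le_trans pb _; rewrite ler_wpM2l//.
    apply: (@le_trans _ _ (\sum_(j < d) L2norm Omega v ^+ 2)); last by rewrite sumr_const card_ord mulr_natl.
    apply: ler_sum => j _; apply: le_trans (coord_L2norm mO j vL).
    exact: (Rint_sq_mono (oD k) oO (DO k) (vL j)).
  have w0 : 0 <= fine (vol (Dm m)) by rewrite fine_ge0.
  by apply: dominatedZ => //; apply: dominatedZ => //; apply: dominatedZ => //; exact: dominated_self.
exists K => // mk v vL; apply: le_trans (hK v vL).
by rewrite (bigD1 mk)//= lerDl; apply: sumr_ge0 => i _; exact: sqr_ge0.
Qed.

(** The reference quantity of all the bounds up to [normalize_bound]. *)
Let G (p : (E -> E) * (E -> 'rV[R]_3)) := L2norm Omega p.2 ^+ 2 + \sum_mk mean mk p.1 ^+ 2.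

Let G0 p : admissible p -> 0 <= G p.
Proof. by move=> _; rewrite addr_ge0 ?sqr_ge0// sumr_ge0// => i _; exact: sqr_ge0. Qed.

Let dom_curl : dominated admissible G (fun p => L2norm Omega p.2 ^+ 2).
Proof.
apply: dominated_le (dominated_self _ _) => p _.
by rewrite lerDl sumr_ge0// => i _; exact: sqr_ge0.
Qed.

Let dom_mean mk : dominated admissible G (fun p => mean mk p.1 ^+ 2).
Proof.
apply: dominated_le (dominated_self _ _) => p _.
rewrite /G (bigD1 mk)//= addrCA lerDl addr_ge0 ?sqr_ge0// sumr_ge0// => i _; exact: sqr_ge0.
Qed.

Let dom_curls i j : dominated admissible G (fun p => \int[vol]_(x in Omega) curls i p.2 j x ^+ 2).
Proof.
have [a ha] := @curl_comp_sum R d i j.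
apply: (@dominated_le _ _ _ _ _ (fun p => 3 * \sum_b a b ^+ 2 * L2norm Omega p.2 ^+ 2)); last first.
  by apply: dominatedZ => //; apply: dominated_sum => b; apply: dominatedZ => //; exact: sqr_ge0.
move=> p [_ cL _].
apply: (@le_trans _ _ (\int[vol]_(x in Omega) (3 * \sum_b a b ^+ 2 * p.2 x ord0 b ^+ 2))).
  apply: (le_Rint mO).
  - by apply: (L2_sq (D := Omega)); exact: L2v_rot.
  - apply: (ae_integrableZ mO); apply: (ae_integrable_sum mO) => b _; apply: (ae_integrableZ mO); exact: L2_sq.
  - apply: aeW => x _; rewrite /curls ha; apply: le_trans (@sqr_sum_le R 3 _) _.
    by rewrite ler_wpM2l//; apply: ler_sum => b _; rewrite exprMn.
have ai b : ae_integrable vol Omega (fun x => a b ^+ 2 * p.2 x ord0 b ^+ 2).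
  by apply: (ae_integrableZ mO); exact: L2_sq.
have -> : \int[vol]_(x in Omega) (3 * \sum_b a b ^+ 2 * p.2 x ord0 b ^+ 2) =
   3 * \int[vol]_(x in Omega) \sum_b a b ^+ 2 * p.2 x ord0 b ^+ 2.
  by apply: (RintZ mO); exact: (ae_integrable_sum mO).
rewrite (Rint_sum mO)// ler_wpM2l//; apply: ler_sum => b _.
have -> : \int[vol]_(x in Omega) (a b ^+ 2 * p.2 x ord0 b ^+ 2) = a b ^+ 2 * \int[vol]_(x in Omega) (p.2 x ord0 b ^+ 2).
  by apply: (RintZ mO); exact: L2_sq.
by rewrite ler_wpM2l ?sqr_ge0// coord_L2norm.
Qed.

Let dom_cor k i : dominated admissible G (fun p => \int[vol]_(x in D k) local_cor k i p.2 x ^+ 2).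
Proof.
apply: (@dominated_le _ _ _ _ _ (fun p => C k * \sum_j \int[vol]_(x in Omega) curls i p.2 j x ^+ 2)); last first.
  by apply: dominatedZ => //; apply: dominated_sum => j; exact: dom_curls.
move=> p [_ cL _]; have [QO1 _] := QO k; have [_ qb] := QO1 _ (curlsL k i cL).
apply: le_trans qb _; rewrite ler_wpM2l//; apply: ler_sum => j _.
have cjL : L2 Omega (curls i p.2 j) by exact: L2v_rot.
exact: (Rint_sq_mono (oD k) oO (DO k) cjL).
Qed.

(** In the difference of two local potentials the field itself cancels: the gradient is a difference
    of corrections, and the Poincaré-Wirtinger inequality bounds the jump by these and by the
    means. *)
Let dom_jump m k k' : S m k -> S m k' -> dominated admissible G
  (fun p => \int[vol]_(x in Dm m) (local_pot k p.1 x - local_pot k' p.1 x) ^+ 2).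
Proof.
move=> Sk Sk'; have [K K0 hK] := poincare_wirtinger d0 (sW m).
apply: (@dominated_le _ _ _ _ _ (fun p => K * (\sum_i (2 * (\int[vol]_(x in D k) local_cor k i p.2 x ^+ 2 +
   \int[vol]_(x in D k') local_cor k' i p.2 x ^+ 2)) +
   2 * (mean (m, k) p.1 ^+ 2 + mean (m, k') p.1 ^+ 2)))); last first.
  apply: dominatedZ => //; apply: dominatedD.
    by apply: dominated_sum => i; apply: dominatedZ => //; exact: (dominatedD (dom_cor k i) (dom_cor k' i)).
  by apply: dominatedZ => //; exact: (dominatedD (dom_mean (m, k)) (dom_mean (m, k'))).
move=> p pa; have [vL cL _] := pa.
have fL k0 : S m k0 -> L2 (Dm m) (local_pot k0 p.1).
  by move=> S0; apply: (L2_subset (mD k0) (mDm m) (DmD S0)); exact: local_pot_L2.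
have cL' k0 i : S m k0 -> L2 (Dm m) (local_cor k0 i p.2).
  by move=> S0; apply: (L2_subset (mD k0) (mDm m) (DmD S0)); exact: local_cor_L2.
have gL k0 : S m k0 -> L2v (Dm m) (local_grad k0 p).
  by move=> S0 i; apply: (L2_subset (mD k0) (mDm m) (DmD S0)); exact: local_grad_L2.
have H k0 : S m k0 -> is_weak_grad (Dm m) (local_pot k0 p.1) (local_grad k0 p).
  by move=> S0; apply: (weak_grad_restrict (DmD S0)) (@local_grad_weak k0 p pa).
have := hK _ _ _ _ (weak_grad_lin (oDm m) (vDm m) (-1) (fL k' Sk') (fL k Sk) (gL k' Sk') (gL k Sk) (H k' Sk') (H k Sk)).
rewrite (_ : \int[vol]_(x in Dm m) (-1 * local_pot k' p.1 x + local_pot k p.1 x) ^+ 2 =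
   \int[vol]_(x in Dm m) (local_pot k p.1 x - local_pot k' p.1 x) ^+ 2); last first.
  by apply: eq_Rintegral => x _; rewrite mulN1r addrC.
move=> h; apply: le_trans (h _ _) _.
- by apply: (L2D (mDm m)); [apply: (L2Z (mDm m)); exact: fL|exact: fL].
- by apply: (L2vD (mDm m)); [apply: (L2vZ (mDm m)); exact: gL|exact: gL].
rewrite ler_wpM2l//; apply: lerD.
  apply: ler_sum => i _.
  apply: (@le_trans _ _ (\int[vol]_(x in Dm m) (2 * (local_cor k i p.2 x ^+ 2 + local_cor k' i p.2 x ^+ 2)))).
    apply: (le_Rint (mDm m)).
    + apply: L2_sq; apply: (L2_ae (g := fun x => -1 * local_grad k' p x ord0 i + local_grad k p x ord0 i)).
        by apply: aeW => x _; rewrite !mxE.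
      by apply: (L2D (mDm m)); [apply: (L2Z (mDm m)); exact: gL|exact: gL].
    + by apply: (ae_integrableZ (mDm m)); apply: (ae_integrableD (mDm m)); apply: L2_sq; exact: cL'.
    + apply: aeW => x _; rewrite !mxE; set a := local_cor k i p.2 x; set b := local_cor k' i p.2 x.
      rewrite (_ : -1 * _ + _ = b - a); last by ring.
      by have := sqr_ge0 (a + b); nra.
  have s0 k0 : S m k0 -> ae_integrable vol (Dm m) (fun x => local_cor k0 i p.2 x ^+ 2).
    by move=> S0; apply: L2_sq; exact: cL'.
  have -> : \int[vol]_(x in Dm m) (2 * (local_cor k i p.2 x ^+ 2 + local_cor k' i p.2 x ^+ 2)) =
    2 * \int[vol]_(x in Dm m) (local_cor k i p.2 x ^+ 2 + local_cor k' i p.2 x ^+ 2).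
    by apply: (RintZ (mDm m)); apply: (ae_integrableD (mDm m)); exact: s0.
  rewrite (RintD (mDm m)); [|exact: s0|exact: s0].
  rewrite ler_wpM2l//; apply: lerD.
    by apply: (Rint_sq_mono (oDm m) (oD k) (DmD Sk)); exact: local_cor_L2.
  by apply: (Rint_sq_mono (oDm m) (oD k') (DmD Sk')); exact: local_cor_L2.
rewrite /mean /= Sk Sk'.
rewrite (RintD (mDm m)); last 2 first.
- by apply: (ae_integrableZ (mDm m)); apply: (L2_aei (mDm m) (vDm m)); exact: fL.
- by apply: (L2_aei (mDm m) (vDm m)); exact: fL.
have -> : \int[vol]_(x in Dm m) (-1 * local_pot k' p.1 x) = -1 * \int[vol]_(x in Dm m) local_pot k' p.1 x.
  by apply: (RintZ (mDm m)); apply: (L2_aei (mDm m) (vDm m)); exact: fL.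
set a := \int[vol]_(x in Dm m) local_pot k p.1 x; set b := \int[vol]_(x in Dm m) local_pot k' p.1 x.
by have := sqr_ge0 (a + b); nra.
Qed.

(** The derivatives of the partition of unity sum to zero, so on a fine piece the local potentials
    may be replaced by their jumps relative to the reference potential [l m]. The potentials alone
    are bounded by the field, but the jumps by [G]. *)
Lemma normalize_bound : dominated admissible G (fun p => L2norm Omega (normalize p) ^+ 2).
Proof.
have [B B0 hB] : exists2 B : R, 0 <= B & forall k i x, chi k x ^+ 2 <= B /\ partial i (chi k) x ^+ 2 <= B.
  have /choice[b hb] (ki : 'I_N * 'I_d) : exists b : R, 0 <= b /\ forall x, chi ki.1 x ^+ 2 <= b /\ partial ki.2 (chi ki.1) x ^+ 2 <= b.
    case: ki => k i /=; have [b1 b10 h1] := test_bounded (tc k).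
    have [b2 b20 h2] := test_bounded (test_partial i (tc k)).
    exists (b1 ^+ 2 + b2 ^+ 2); split=> [|x]; first by rewrite addr_ge0 ?sqr_ge0.
    have g1 := sqr_ge0 b1; have g2 := sqr_ge0 b2.
    have e1 : chi k x ^+ 2 <= b1 ^+ 2 by rewrite -[leLHS]real_normK ?num_real// ler_pXn2r// nnegrE.
    have e2 : partial i (chi k) x ^+ 2 <= b2 ^+ 2 by rewrite -[leLHS]real_normK ?num_real// ler_pXn2r// nnegrE.
    by split; lra.
  exists (\sum_ki b ki); first by apply: sumr_ge0 => ki _; case: (hb ki).
  move=> k i x; have [_ h] := hb (k, i); have [/= h1 h2] := h x.
  have le : b (k, i) <= \sum_ki b ki by rewrite (bigD1 (k, i))//= lerDl sumr_ge0// => ki _; case: (hb ki).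
  by split; [exact: le_trans h1 le|exact: le_trans h2 le].
apply: (@dominated_le _ _ _ _ _ (fun p => \sum_(i < d) \sum_(m < M) N%:R * \sum_(k < N) (2 * B) *
   (\int[vol]_(x in D k) local_cor k i p.2 x ^+ 2 +
    if S m k then \int[vol]_(x in Dm m) (local_pot k p.1 x - local_pot (l m) p.1 x) ^+ 2 else 0))); last first.
  apply: dominated_sum => i; apply: dominated_sum => m; apply: dominatedZ => //.
  apply: dominated_sum => k; apply: dominatedZ; first by rewrite mulr_ge0.
  apply: (dominatedD (dom_cor k i)); have [Smk|_] := boolP (S m k); last exact: dominated0.
  exact: (dom_jump Smk (Sl m)).
move=> p pa; have [vL cL _] := pa; have [nL _] := normalize_curl pa.
rewrite L2norm_sq (ip_sum mO nL nL); apply: ler_sum => i _.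
rewrite (_ : \int[vol]_(x in Omega) _ = \int[vol]_(x in Omega) (normalize p x ord0 i) ^+ 2); last first.
  by apply: eq_Rintegral => x _; rewrite expr2.
apply: le_trans (Rint_cover oO DmO oDm _ (fun x => sqr_ge0 _) (L2_sq (nL i))) _.
  by move=> x Ox; have [m Wm] := covW Ox; exists m.
apply: ler_sum => m _.
pose cor k x := (local_cor k i p.2 \_ (D k)) x ^+ 2.
pose jump k x := if S m k then (local_pot k p.1 x - local_pot (l m) p.1 x) ^+ 2 else 0.
have corL k : L2 Omega (local_cor k i p.2 \_ (D k)) by apply: L2_patch => //; exact: local_cor_L2.
have corI k : ae_integrable vol (Dm m) (cor k).
  by apply: (L2_sq (D := Dm m)); apply: (L2_subset mO (mDm m) (DmO m)); exact: corL.
have jumpI k : ae_integrable vol (Dm m) (jump k).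
  have [Smk|nS] := boolP (S m k); last first.
    by rewrite (_ : jump k = cst 0); [exact: ae_integrable0|apply/funext => x; rewrite /jump (negbTE nS)].
  rewrite (_ : jump k = fun x => (local_pot k p.1 x - local_pot (l m) p.1 x) ^+ 2); last first.
    by apply/funext => x; rewrite /jump Smk.
  apply: L2_sq; apply: (L2B (mDm m)).
    by apply: (L2_subset (mD k) (mDm m) (DmD Smk)); exact: local_pot_L2.
  by apply: (L2_subset (mD (l m)) (mDm m) (DmD (Sl m))); exact: local_pot_L2.
apply: (@le_trans _ _ (\int[vol]_(x in Dm m) (N%:R * \sum_k (2 * B) * (cor k x + jump k x)))).
  apply: (le_Rint (mDm m)).
  - by apply: L2_sq; apply: (L2_subset mO (mDm m) (DmO m)); exact: nL.
  - apply: (ae_integrableZ (mDm m)); apply: (ae_integrable_sum (mDm m)) => k _.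
    by apply: (ae_integrableZ (mDm m)); apply: (ae_integrableD (mDm m)).
  - apply: aeW => x Dx; have [Wx Ox] := Dx.
    have sc k : smooth (chi k) := test_smooth (tc k).
    pose b k := if S m k then (local_pot k p.1 x - local_pot (l m) p.1 x) * partial i (chi k) x else 0.
    have -> : normalize p x ord0 i = \sum_k (chi k x * (local_cor k i p.2 \_ (D k)) x - b k).
      rewrite mxE; transitivity (\sum_k (chi k x * (local_cor k i p.2 \_ (D k)) x
        - (local_pot k p.1 \_ (D k)) x * partial i (chi k) x + local_pot (l m) p.1 x * partial i (chi k) x)).
        by rewrite [RHS]big_split/= -mulr_sumr (partition_partial i oO sc c1 Ox) mulr0 addr0.
      apply: eq_bigr => k _; rewrite -addrA; congr (_ + _).
      rewrite /b; case: ifPn => Smk.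
        have [Vk _] := DmD Smk Dx; rewrite [(local_pot _ _ \_ _) x]patchE mem_set//; ring.
      by have [_ ->] := W0 Smk Wx; ring.
    apply: le_trans (@sqr_sum_le R N _) _; rewrite ler_wpM2l//; apply: ler_sum => k _.
    have [h1 h2] := hB k i x; rewrite /cor /jump.
    set u := (local_cor k i p.2 \_ (D k)) x.
    have hu : (chi k x * u) ^+ 2 <= B * u ^+ 2 by rewrite exprMn ler_wpM2r ?sqr_ge0.
    have hb : b k ^+ 2 <= B * (if S m k then (local_pot k p.1 x - local_pot (l m) p.1 x) ^+ 2 else 0).
      rewrite /b; case: ifP => _; last by rewrite mulr0 expr0n.
      by rewrite exprMn mulrC ler_wpM2r ?sqr_ge0.
    have := sqr_ge0 (chi k x * u + b k).
    set z := (if _ then _ else _) in hb *; set y := chi k x * u in hu *; nra.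
have -> : \int[vol]_(x in Dm m) (N%:R * \sum_k (2 * B) * (cor k x + jump k x)) =
  N%:R * \int[vol]_(x in Dm m) \sum_k (2 * B) * (cor k x + jump k x).
  apply: (RintZ (mDm m)); apply: (ae_integrable_sum (mDm m)) => k _.
  by apply: (ae_integrableZ (mDm m)); exact: ae_integrableD.
rewrite ler_wpM2l// (Rint_sum (mDm m)); last first.
  by move=> k _; apply: (ae_integrableZ (mDm m)); exact: ae_integrableD.
apply: ler_sum => k _.
have -> : \int[vol]_(x in Dm m) (2 * B * (cor k x + jump k x)) = 2 * B * \int[vol]_(x in Dm m) (cor k x + jump k x).
  by apply: (RintZ (mDm m)); exact: ae_integrableD.
rewrite ler_wpM2l ?mulr_ge0// (RintD (mDm m))//; apply: lerD.
  apply: le_trans (Rint_sq_mono (oDm m) oO (DmO m) (corL k)) _.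
  rewrite (Rint_sub (DO k)) => [|x _ nD]; last by rewrite patchE memNset// expr0n.
  rewrite le_eqVlt; apply/orP; left; apply/eqP; apply: eq_Rintegral => x Dx; by rewrite patchE Dx.
by rewrite /jump; have [_|_] := boolP (S m k); rewrite // /Rintegral integral0.
Qed.

End curl_decomposition.

(** * The compactness argument *)

Section curl_lifting.
Context {R : realType} {d : nat}.
Local Notation E := 'rV[R]_d.
Local Notation vol := (@lebesgue_row R d).

Lemma cross_pad3_sum (h : E) (p : 'rV[R]_3) k :
  cross (pad3 h) p ord0 k = \sum_i h ord0 i * cross (pad3 (delta_mx ord0 i)) p ord0 k.
Proof.
have pE a : pad3 h ord0 a = \sum_i h ord0 i * pad3 (delta_mx ord0 i : E) ord0 a.
  rewrite mxE; under eq_bigr do rewrite mxE; case: insub => [j|] /=; last first.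
    by rewrite big1// => i _; rewrite mulr0.
  rewrite (bigD1 j)//= mxE !eqxx mulr1 big1 ?addr0// => i ij.
  by rewrite mxE eq_sym (negbTE ij) andbF mulr0.
rewrite mxE !pE !mulr_suml -sumrB; apply: eq_bigr => i _.
by rewrite [in RHS]mxE; ring.
Qed.

Section weak_curl_pairing.
Variables (D : set E) (oD : open D) (vD : (vol D < +oo)%E).
Let mD : measurable D. Proof. exact: open_measurable_row. Qed.

(** Writes both sides of the curl relation as inner products with fixed square integrable fields;
    they are then continuous in L^2, which is how [weak_curl_closed] passes to the limit. *)
Lemma weak_curl_pairing phi k : test_function D phi ->
  exists (A : E -> 'rV[R]_3) (B : E -> E), [/\ L2v D A, L2v D B,
    forall c : E -> 'rV[R]_3, \int[vol]_(x in D) (c x ord0 k * phi x) = ip D c A &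
    forall h : E -> E, \int[vol]_(x in D) (cross (pad3 (h x)) (pad3 (grad phi x))) ord0 k = ip D h B].
Proof.
move=> tp.
exists (fun x => \row_l (phi x * (l == k)%:R)), (fun x => \row_i cross (pad3 (delta_mx ord0 i)) (pad3 (grad phi x)) ord0 k); split.
- move=> l; apply: (@L2_ae _ _ _ _ (fun x => (l == k)%:R * phi x)).
    by apply: aeW => x _; rewrite mxE mulrC.
  by apply: (L2Z mD); exact: (L2_test mD vD).
- move=> i; have gL := L2v_pad3 (L2v_grad_test oD vD tp).
  apply: (@L2_ae _ _ _ _ (fun x => pad3 (delta_mx ord0 i : E) ord0 (k + 1) * pad3 (grad phi x) ord0 (k + 2) -
    pad3 (delta_mx ord0 i : E) ord0 (k + 2) * pad3 (grad phi x) ord0 (k + 1))).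
    by apply: aeW => x _; rewrite mxE [LHS]mxE.
  by apply: (L2B mD); apply: (L2Z mD).
- move=> c; apply: eq_Rintegral => x _; rewrite /dot (bigD1 k)//= mxE eqxx mulr1 big1 ?addr0// => l lk.
  by rewrite mxE (negbTE lk) !mulr0.
- move=> h; apply: eq_Rintegral => x _; rewrite cross_pad3_sum; apply: eq_bigr => i _.
  by rewrite [in RHS]mxE.
Qed.

Lemma weak_curl_closed (h : E -> E) (c : E -> 'rV[R]_3) : L2v D h -> L2v D c ->
  (forall e, 0 < e -> exists (h' : E -> E) (c' : E -> 'rV[R]_3), [/\ L2v D h', L2v D c', is_weak_curl D h' c',
    L2norm D (fun x => h x - h' x) <= e & L2norm D (fun x => c x - c' x) <= e]) ->
  is_weak_curl D h c.
Proof.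
move=> hL cL H phi tp k; have [A [B [AL BL AE BE]]] := weak_curl_pairing k tp.
rewrite AE BE; apply/eqP; rewrite -subr_eq0 -normr_eq0 eq_le normr_ge0 andbT.
apply/ler_addgt0Pr => e e0; rewrite add0r.
pose M := L2norm D A + L2norm D B + 1.
have M0 : 0 < M by rewrite ltr_wpDl// addr_ge0// L2norm_ge0.
have [|h' [c' [hL' cL' H' hh cc]]] := H (e / M); first by rewrite divr_gt0.
have e1 := H' phi tp k; rewrite AE BE in e1.
have -> : ip D c A - ip D h B = ip D (fun x => c x - c' x) A - ip D (fun x => h x - h' x) B.
  rewrite !ipBl// e1; ring.
apply: (@le_trans _ _ (e / M * L2norm D A + e / M * L2norm D B)).
  rewrite (le_trans (ler_normB _ _))// lerD//.
  - apply: le_trans (ip_cauchy mD _ AL) _; first exact: L2vB.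
    by rewrite ler_wpM2r// L2norm_ge0.
  - apply: le_trans (ip_cauchy mD _ BL) _; first exact: L2vB.
    by rewrite ler_wpM2r// L2norm_ge0.
rewrite -mulrDr mulrAC ler_pdivrMr// ler_wpM2l ?(ltW e0)// /M lerDl; exact: ler01.
Qed.

End weak_curl_pairing.

Hypotheses (d0 : (0 < d)%N) (d3 : (d <= 3)%N).
Variables (Omega : set E) (lO : lipschitz_domain Omega) (bO : bounded_set Omega).
Let oO : open Omega. Proof. by case: lO. Qed.
Let mO : measurable Omega. Proof. exact: open_measurable_row. Qed.
Let vO : (vol Omega < +oo)%E. Proof. exact: lebesgue_row_bounded. Qed.

Lemma curl_normalization : exists (I : finType) (T : (E -> E) * (E -> 'rV[R]_3) -> E -> E)
    (m : I -> (E -> E) -> R) (K : R),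
  [/\ 0 <= K, forall p, admissible Omega p -> L2v Omega (T p) /\ is_weak_curl Omega (T p) p.2,
    forall i v, L2v Omega v -> m i v ^+ 2 <= K * L2norm Omega v ^+ 2 &
    forall p q, admissible Omega p -> admissible Omega q ->
      L2norm Omega (fun x => T p x - T q x) ^+ 2 <=
      K * (L2norm Omega (fun x => p.2 x - q.2 x) ^+ 2 + \sum_i (m i p.1 - m i q.1) ^+ 2)].
Proof.
have [N [V [chi [p [hV cov c1]]]]] := star_partition lO bO (fun p _ => (filterT : nbhs p setT)).
have oV k : open (V k) by case: (hV k).
have tc k : test_function (V k) (chi k) by case: (hV k).
have sD k : star_domain (V k `&` Omega) by case: (hV k).
have /choice[P] k := poincare_operators d0 (sD k).
move=> /choice[Q] /choice[C] hPQ.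
have /choice[L hL] k := test_support (tc k).
(* Near [q], every [V k] that contains [q] is kept and the support of every other [chi k] is
   avoided. Members of a cover subordinate to these neighbourhoods are thus either inside [V k] or
   off the support of [chi k]. *)
pose U q := [set y | forall k, (V k q -> V k y) /\ (~ V k q -> ~ L k y)].
have nU q : closure Omega q -> nbhs q (U q).
  move=> _; apply: (@filter_forall _ _ (fun k y => (V k q -> V k y) /\ (~ V k q -> ~ L k y)) _ (nbhs_filter q)) => k.
  have [cL LV _] := hL k.
  have [Vk|nV] := pselect (V k q).
    by apply: filterS (open_nbhs_nbhs (conj (oV k) Vk)) => y Vy; split.
  have clL : closed (L k) by apply: compact_closed => //; exact: norm_hausdorff.
  have nL : (~` L k) q by move=> /LV.
  by apply: filterS (open_nbhs_nbhs (conj (closed_openC clL) nL)) => y Ly; split.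
have [M [W [omega [p' [hW covW _]]]]] := star_partition lO bO nU.
pose S m : pred 'I_N := fun k => `[< V k (p' m) >].
have /choice[l Sl] m : exists k, S m k.
  have [cp _ _ _ _] := hW m; have [k Vk] := cov _ cp; exists k; exact/asboolP.
have WV m k : S m k -> W m `<=` V k.
  by move=> /asboolP Vk x; have [_ _ _ WU _] := hW m; move=> /WU /(_ k)[+ _]; exact.
have W0 m k : ~~ S m k -> forall x, W m x -> chi k x = 0 /\ forall i, partial i (chi k) x = 0.
  move=> /asboolPn nV x; have [_ _ _ WU _] := hW m; move=> /WU /(_ k)[_ /(_ nV) nL].
  by have [_ _ h] := hL k; exact: h.
have sW m : star_domain (W m `&` Omega) by case: (hW m).
have covW' x : Omega x -> exists m, W m x by move=> Ox; apply: covW; exact: subset_closure.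
have c1' x : Omega x -> \sum_k chi k x = 1 by move=> Ox; apply: c1; exact: subset_closure.
have C0 k : 0 <= C k by case: (hPQ k).
have PO k : L2_operator (V k `&` Omega) (C k) (P k) by case: (hPQ k).
have QO k : L2_operator (V k `&` Omega) (C k) (Q k) by case: (hPQ k).
have PQ k := let: And4 _ _ _ h := hPQ k in h.
have oW m : open (W m) by case: (hW m).
have [K1 K10 hK1] := normalize_bound d0 d3 oO bO oV sD tc c1' C0 PO QO PQ oW sW covW' Sl WV W0.
have [K2 K20 hK2] := mean_bound oO oV C0 PO oW sW WV.
exists ('I_M * 'I_N)%type, (normalize Omega V chi P Q), (mean Omega P W S), (K1 + K2); split.
- exact: addr_ge0.
- move=> q qa; exact: (normalize_curl d3 oO bO oV sD tc c1' PO QO PQ qa).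
- move=> i v vL; apply: le_trans (hK2 i v vL) _; rewrite ler_wpM2r ?sqr_ge0//; lra.
- move=> q r qa ra.
  have da := admissible_diff oO bO qa ra.
  have e1 := normalize_diff oO oV tc PO QO qa ra.
  rewrite -(L2norm_ae e1).
  apply: le_trans (hK1 _ da) _.
  have -> : L2norm Omega (pair_sub q r).2 = L2norm Omega (fun x => q.2 x - r.2 x).
    by apply: L2norm_ae; apply: aeW => x _; rewrite /= scaleN1r addrC.
  have -> : \sum_mk mean Omega P W S mk (pair_sub q r).1 ^+ 2 = \sum_mk (mean Omega P W S mk q.1 - mean Omega P W S mk r.1) ^+ 2.
    by apply: eq_bigr => mk _; rewrite (mean_diff oO oV PO oW sW WV mk qa ra).
  rewrite ler_wpM2r//; last lra.
  by rewrite addr_ge0 ?sqr_ge0// sumr_ge0// => i _; exact: sqr_ge0.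
Qed.

(** Bolzano-Weierstrass through compactness of a box in finite dimension. The indices need not
    increase; [k <= s k] is enough to make the curls tend to 0. *)
Lemma cluster_seq (J : finType) (y : nat -> J -> R) (B : R) : (forall n j, `|y n j| <= B) ->
  exists (a : J -> R) (s : nat -> nat), forall k, (k <= s k)%N /\ forall j, `|y (s k) j - a j| <= k.+1%:R^-1.
Proof.
move=> yB; pose Y n : 'rV[R]_#|J| := \row_j y n (enum_val j).
have cK := @closed_row_box_compact R #|J| (fun=> - B) (fun=> B).
have [|b [_ cb]] := cK (Y @ \oo) _.
  by exists 0%N => // n _ j; rewrite mxE -ler_norml.
have /choice[s hs] k : exists n, (k <= n)%N /\ forall j, `|Y n ord0 j - b ord0 j| <= k.+1%:R^-1.
  have h1 : (Y @ \oo) [set Y n | n in [set n | (k <= n)%N]].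
    by exists k => // n kn; exists n.
  have h2 : nbhs b (ball b (k.+1%:R^-1 : R)) by apply: nbhsx_ballx; rewrite invr_gt0.
  have [z [[n kn <-]]] := cb _ _ h1 h2.
  rewrite -ball_normE /ball_/= => bz; exists n; split=> // j.
  by apply: ltW; rewrite distrC; apply: le_lt_trans bz; have := coord_le_norm (b - Y n) j; rewrite !mxE.
exists (fun j => b ord0 (enum_rank j)), s => k; have [h1 h2] := hs k; split=> // j.
by have := h2 (enum_rank j); rewrite mxE enum_rankK.
Qed.

(** Take a field with the given curl whose norm is less than twice the infimum [s] of the norms of
    such fields, and divide by [s]; the hypothesis makes [s] at least [n + 1] times the norm of the
    curl. *)
Lemma weak_curl_minimal (n : nat) p : admissible Omega p ->
  (forall v, L2v Omega v -> is_weak_curl Omega v p.2 -> n.+1%:R * L2norm Omega p.2 < L2norm Omega v) ->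
  exists q, [/\ admissible Omega q, L2norm Omega q.1 <= 2, L2norm Omega q.2 <= n.+1%:R^-1 &
    forall v, L2v Omega v -> is_weak_curl Omega v q.2 -> 1 <= L2norm Omega v].
Proof.
move=> [vL cL H] big.
pose A : set R := [set a | exists v : E -> E, [/\ L2v Omega v, is_weak_curl Omega v p.2 & a = L2norm Omega v]].
have A0 : A !=set0 by exists (L2norm Omega p.1), p.1.
have lbA : lbound A (n.+1%:R * L2norm Omega p.2).
  by move=> _ [v [vL' H' ->]]; apply: ltW; exact: big.
have hi : has_inf A by split=> //; exists (n.+1%:R * L2norm Omega p.2); exact: lbA.
pose s := inf A.
have s1 : n.+1%:R * L2norm Omega p.2 <= s by apply: lb_le_inf => //; exact: lbA.
(* If the curl had norm 0, the zero field would be a competitor of norm 0, against the strict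
   inequality [big]. *)
have s0 : 0 < s.
  have c0 := L2norm_ge0 Omega p.2.
  have [c00|cn0] := eqVneq (L2norm Omega p.2) 0; last first.
    by apply: lt_le_trans s1; rewrite mulr_gt0// lt_def cn0.
  have cz := L2norm_eq0 mO cL c00.
  exfalso; have := big (fun=> 0) (@L2v0 _ _ _ _).
  have z : L2norm Omega (fun=> 0 : E) = 0.
    have := L2normZ mO 0 vL; rewrite normr0 mul0r => <-.
    by apply: L2norm_ae; apply: aeW => x _; rewrite scale0r.
  rewrite c00 mulr0 z ltxx => h; have // : false; apply: h.
  apply: (weak_curl_ae (h' := fun x => 0 *: p.1 x) (c' := fun=> 0)) => //.
    by apply: aeW => x _; rewrite scale0r.
  have := weak_curl_lin oO vO (-1) vL vL cL cL H H.
  by apply: weak_curl_ae; apply: aeW => x _; rewrite ?scale0r scaleN1r addNr.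
have [_ [v [vL' H' ->]] vs] := inf_adherent s0 hi.
have z0 : L2v Omega (fun=> 0 : E) := @L2v0 _ _ _ _.
have z03 : L2v Omega (fun=> 0 : 'rV[R]_3) := @L2v0 _ _ _ _.
have si0 : 0 < s^-1 by rewrite invr_gt0.
have w0 : is_weak_curl Omega (fun=> 0) (fun=> 0).
  have := weak_curl_lin oO vO (-1) vL' vL' cL cL H' H'.
  by apply: weak_curl_ae; apply: aeW => x _; rewrite scaleN1r addNr.
have scale (a : R) (u : E -> E) (c : E -> 'rV[R]_3) : L2v Omega u -> L2v Omega c -> is_weak_curl Omega u c ->
    is_weak_curl Omega (fun x => a *: u x) (fun x => a *: c x).
  move=> uL cL' Hu; have := weak_curl_lin oO vO a uL z0 cL' z03 Hu w0.
  by apply: weak_curl_ae; apply: aeW => x _; rewrite addr0.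
exists (fun x => s^-1 *: v x, fun x => s^-1 *: p.2 x); split => /=.
- split; [exact: L2vZ|exact: L2vZ|exact: scale].
- rewrite L2normZ// gtr0_norm// mulrC ler_pdivrMr//; lra.
- rewrite L2normZ// gtr0_norm// mulrC ler_pdivrMr// ler_pdivlMl//.
- move=> u uL Hu; have Hsu : is_weak_curl Omega (fun x => s *: u x) p.2.
    apply: weak_curl_ae (scale s u _ uL (L2vZ mO s^-1 cL) Hu); apply: aeW => x _ //.
    by rewrite scalerA mulfV ?scale1r// gt_eqF.
  have : s <= L2norm Omega (fun x => s *: u x).
    by apply: ge_inf; [case: hi|exists (fun x => s *: u x); split=> //; exact: L2vZ].
  by rewrite L2normZ// gtr0_norm// ler_pMr.
Qed.

(* Otherwise there are v_n of norm at most 2, nearly minimal among the fields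
   with the same curl, whose curls tend to 0. The finitely many means of v_n
   converge along a subsequence, so that the normalized fields converge to a
   curl-free field; subtracting it contradicts minimality. *)
Lemma curl_lifting : exists2 K : R, 0 <= K & forall (v : E -> E) c, L2v Omega v -> L2v Omega c ->
  is_weak_curl Omega v c -> exists v' : E -> E,
  [/\ L2v Omega v', is_weak_curl Omega v' c & L2norm Omega v' <= K * L2norm Omega c].
Proof.
have [I [T [m [K [K0 TL mb Td]]]]] := curl_normalization.
apply: contrapT => nK.
have /choice[q hq] n : exists q, [/\ admissible Omega q, L2norm Omega q.1 <= 2, L2norm Omega q.2 <= n.+1%:R^-1 &
    forall v, L2v Omega v -> is_weak_curl Omega v q.2 -> 1 <= L2norm Omega v].
  apply: contrapT => nq; apply: nK; exists n.+1%:R => // v c vL cL H; apply: contrapT => nv; apply: nq.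
  apply: (@weak_curl_minimal n (v, c)) => //= u uL Hu; rewrite ltNge; apply/negP => le.
  by apply: nv; exists u.
have qa n : admissible Omega (q n) by case: (hq n).
have yb n i : `|m i (q n).1| <= Num.sqrt (K * 4).
  have [[vL _ _] q2 _ _] := hq n.
  rewrite -[leLHS]sqrtr_sqr ler_wsqrtr// (le_trans (mb i _ vL))// ler_wpM2l//.
  by have := L2norm_ge0 Omega (q n).1; nra.
have [a [s hs]] := @cluster_seq I (fun n i => m i (q n).1) (Num.sqrt (K * 4)) yb.
pose z j := T (q (s j)).
have zL j : L2v Omega (z j) by case: (TL _ (qa (s j))).
have zH j : is_weak_curl Omega (z j) (q (s j)).2 by case: (TL _ (qa (s j))).
have cL n : L2v Omega (q n).2 by case: (qa n).
have cs j : L2norm Omega (q (s j)).2 <= j.+1%:R^-1.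
  have [_ _ h _] := hq (s j); apply: le_trans h _.
  by rewrite lef_pV2 ?posrE// ler_nat ltnS; case: (hs j).
pose B := K * (1 + #|I|%:R).
have B0 : 0 <= B by rewrite mulr_ge0// addr_ge0.
have zz j k : L2norm Omega (fun x => z j x - z k x) ^+ 2 <= B * (j.+1%:R^-1 + k.+1%:R^-1) ^+ 2.
  apply: le_trans (Td _ _ (qa (s j)) (qa (s k))) _; rewrite /B -mulrA ler_wpM2l//.
  set r := _ + k.+1%:R^-1.
  have r0 : 0 <= r by rewrite addr_ge0.
  rewrite mulrDl mul1r lerD//.
    rewrite ler_pXn2r ?nnegrE ?L2norm_ge0//.
    have z3 : L2v Omega (fun x => -1 *: (q (s k)).2 x) by exact: L2vZ.
    apply: (@le_trans _ _ (L2norm Omega (q (s j)).2 + L2norm Omega (fun x => -1 *: (q (s k)).2 x))).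
      apply: le_trans (L2norm_triangle mO (cL _) z3).
      rewrite le_eqVlt; apply/orP; left; apply/eqP; apply: L2norm_ae; apply: aeW => x _.
      by rewrite scaleN1r.
    by rewrite L2normZ// normrN1 mul1r lerD.
  apply: (@le_trans _ _ (\sum_(i : I) r ^+ 2)); last by rewrite sumr_const mulr_natl.
  apply: ler_sum => i _; rewrite -[leLHS]real_normK ?num_real// ler_pXn2r ?nnegrE//.
  have [_ h1] := hs j; have [_ h2] := hs k.
  rewrite (_ : _ - _ = (m i (q (s j)).1 - a i) - (m i (q (s k)).1 - a i)); last by ring.
  by rewrite (le_trans (ler_normB _ _))// lerD.
have [|w wL hw] := L2v_complete mO zL.
  move=> e e0.
  have e1 : 0 < e / (2 * (Num.sqrt B + 1)) by rewrite divr_gt0// mulr_gt0// ltr_wpDl// sqrtr_ge0.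
  have [N _ hN] := near_infty_natSinv_lt (PosNum e1).
  exists N => j k Nj Nk; have := hN j Nj; have := hN k Nk => /= hk hj.
  have sB := sqrtr_ge0 B.
  rewrite -(@ler_pXn2r _ 2)// ?nnegrE ?L2norm_ge0 ?(ltW e0)//.
  apply: le_trans (zz j k) _; rewrite -[B]sqr_sqrtr// -exprMn ler_pXn2r ?nnegrE ?mulr_ge0 ?addr_ge0 ?(ltW e0)//.
  apply: (@le_trans _ _ (Num.sqrt B * (e / (2 * (Num.sqrt B + 1)) + e / (2 * (Num.sqrt B + 1))))).
    by rewrite ler_wpM2l// lerD// ltW.
  rewrite (_ : Num.sqrt B * _ = e * (Num.sqrt B / (Num.sqrt B + 1))); last by field; rewrite gt_eqF// ltr_wpDl.
  rewrite ler_piMr ?(ltW e0)// ler_pdivrMr ?mul1r ?ltr_wpDl//; lra.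
have wH : is_weak_curl Omega w (fun=> 0).
  apply: weak_curl_closed => // [|e e0]; first exact: L2v0.
  have [N1 h1] := hw e e0.
  have [N2 _ h2] := near_infty_natSinv_lt (PosNum e0).
  pose j := maxn N1 N2; exists (z j), (q (s j)).2; split=> //.
    by rewrite L2norm_subC h1// leq_maxl.
  rewrite L2norm_subC; have := h2 j (leq_maxr _ _) => /= /ltW; apply: le_trans.
  rewrite (L2norm_ae (G := (q (s j)).2)) //; apply: aeW => x _; by rewrite subr0.
(* Subtracting the curl-free limit [w] leaves a field of norm at most 1/2 with the curl of
   [q (s N)], whereas all such fields have norm at least 1. *)
have [N hN] := hw 2^-1 ltac:(lra).
have [_ _ _ big] := hq (s N).
have dH : is_weak_curl Omega (fun x => z N x - w x) (q (s N)).2.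
  have := weak_curl_lin oO vO (-1) wL (zL N) (@L2v0 _ _ _ _) (cL (s N)) wH (zH N).
  apply: weak_curl_ae; apply: aeW => x _; first by rewrite scaleN1r addrC.
  by rewrite scaler0 add0r.
have := big _ (L2vB mO (zL N) wL) dH; have := hN N (leqnn N); lra.
Qed.

End curl_lifting.

(** * The coenergy functional *)

Section caratheodory.
Context {R : realType} {d : nat}.
Local Notation E := 'rV[R]_d.
Local Notation vol := (@lebesgue_row R d).

(* The argument is rounded down to a lattice of mesh 1/n, on which only
   countably many sections are involved. *)
Lemma caratheodory_measurable (D : set E) (F : E -> E -> R) (g : E -> E) : measurable D ->
  (forall u, measurable_fun D (F ^~ u)) -> (forall x, D x -> continuous (F x)) ->
  (forall i, measurable_fun D (fun x => g x ord0 i)) -> measurable_fun D (fun x => F x (g x)).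
Proof.
move=> mD mF cF mg.
pose c n (z : {ffun 'I_d -> int}) : E := \row_i ((z i)%:~R / n.+1%:R).
pose z n x : {ffun 'I_d -> int} := [ffun i => Num.floor (n.+1%:R * g x ord0 i)].
apply: (@measurable_fun_cvg _ _ R D (fun n x => F x (c n (z n x)))).
- move=> n _ B mB.
  pose A k := if unpickle k is Some y then D `&` [set x | z n x = y] `&` (D `&` (F ^~ (c n y)) @^-1` B) else set0.
  have -> : D `&` (fun x => F x (c n (z n x))) @^-1` B = \bigcup_k A k.
    apply/seteqP; split => x.
      by move=> [Dx Bx]; exists (pickle (z n x)) => //; rewrite /A pickleK; split.
    by move=> [k _]; rewrite /A; case: unpickle => [y|] // [[Dx /= zy] [_ /= By]]; split=> //=; rewrite zy.
  apply: bigcupT_measurable => k; rewrite /A; case: unpickle => [y|] //.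
  apply: measurableI; last exact: mF.
  pose I i : set R := [set r | (y i)%:~R <= n.+1%:R * r < (y i + 1)%:~R].
  have mI i : measurable (I i).
    have -> : I i = `[(y i)%:~R / n.+1%:R, (y i + 1)%:~R / n.+1%:R[%classic.
      apply/seteqP; split => r /=; rewrite in_itv/= ler_pdivrMr// ltr_pdivlMr// mulrC//.
    exact: measurable_itv.
  have -> : D `&` [set x | z n x = y] = D `&` g @^-1` [set u | forall i, I i (u ord0 i)].
    apply/seteqP; split => x [Dx h]; split=> //=.
      by move=> i; rewrite /I/= -h ffunE floor_itv.
    by apply/ffunP => i; rewrite ffunE; apply/eqP; rewrite floor_eq; exact: h.
  by apply: (measurable_fun_row mD mg) => //; exact: measurable_row_pi.
- move=> x Dx; apply/cvgrPdist_lt => e e0.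
  have /nbhs_ballP[r /= r0 hr] : \forall u \near g x, `|F x (g x) - F x u| < e.
    by have /cvgrPdist_lt /(_ _ e0) := cF x Dx (g x).
  apply: filterS (near_infty_natSinv_lt (PosNum r0)) => n /= nr; apply: hr.
  rewrite -ball_normE /ball_/=; apply: row_norm_lt => // i; apply: le_lt_trans nr.
  rewrite !mxE ffunE.
  have n0 : 0 < n.+1%:R :> R by [].
  have := floor_itv (n.+1%:R * g x ord0 i); set f := Num.floor _.
  rewrite intrD => /andP[h1 h2].
  rewrite (_ : g x ord0 i - _ = (n.+1%:R * g x ord0 i - f%:~R) / n.+1%:R); last by field; rewrite nat1r.
  rewrite normrM normfV (gtr0_norm n0) ler_pdivrMr// mulVf ?gt_eqF//.
  by rewrite ler_norml; apply/andP; split; lra.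
Qed.

End caratheodory.

Section convexity_bounds.
Context {R : realType} {d : nat}.
Local Notation E := 'rV[R]_d.

Lemma derive_dot (F : E -> R) (u v : E) : differentiable F u -> 'D_v F u = dot (grad F u) v.
Proof. by move=> dF; rewrite derive_row//; apply: eq_bigr => i _; rewrite mxE mulrC. Qed.

(** The mean value theorem along the segment for [F] minus its quadratic model of curvature [k];
    [k = gamma] and [k = L] give the two sides of [smooth_convex_bounds]. *)
Lemma second_order_mean (F : E -> R) (u v : E) (k : R) : smooth F ->
  exists2 t : R, 0 < t < 1 & F (u + v) - F u - dot (grad F u) v - k / 2 * dot v v =
    dot (grad F (u + t *: v) - grad F u) v - k * t * dot v v.
Proof.
move=> sF; set a := dot (grad F u) v; set q := dot v v.
pose f (s : R) := F (u + s *: v) - (a * s + (k / 2 * q) * s ^+ 2).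
have df (t : R) : is_derive t 1 f (dot (grad F (u + t *: v)) v - (a + k * q * t)).
  have dF : differentiable F (u + t *: v) by exact: smooth_differentiable.
  have h1 := is_derive_line dF; rewrite (derive_dot v dF) in h1.
  have h2 : is_derive t 1 (fun s : R => a * s + (k / 2 * q) * s ^+ 2) (a + k * q * t).
    have i1 : is_derive t 1 (id : R -> R) 1 := is_derive_id t 1.
    have := is_deriveD (is_deriveZ a i1) (is_deriveZ (k / 2 * q) (is_deriveX 2 i1)).
    have -> : (a \*: id + (k / 2 * q) \*: id ^+ 2 : R -> R) = (fun s : R => a * s + (k / 2 * q) * s ^+ 2).
      by apply: boolp.funext => s; rewrite /= !fctE.
    have -> : a%:A + (k / 2 * q) *: (2 * t ^+ 2.-1)%:A = a + k * q * t :> R.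
      by rewrite /GRing.scale /= !mulr1; field.
    by [].
  exact: is_deriveB.
have cf : {within `[0 : R, 1], continuous f}.
  apply: derivable_within_continuous => t _; exact: (ex_derive (is_derive := df t)).
have [t t01 ft] := MVT ltr01 (fun t _ => df t) cf.
exists t; first by move: t01; rewrite in_itv.
move: ft; rewrite /f !scale1r scale0r addr0 subr0 mulr1 expr1n mulr0 expr0n/= mulr0 => ft.
by rewrite dotBl -/a; move: ft; lra.
Qed.

Lemma smooth_convex_bounds (F : E -> R) (gamma L : R) : smooth F ->
  (forall u v, gamma * enorm (u - v) ^+ 2 <= dot (grad F u - grad F v) (u - v)) ->
  (forall u v, enorm (grad F u - grad F v) <= L * enorm (u - v)) ->
  forall u v, F u + dot (grad F u) v + gamma / 2 * dot v v <= F (u + v) /\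
    F (u + v) <= F u + dot (grad F u) v + L / 2 * dot v v.
Proof.
move=> sF mono lip u v; split.
- have [t /andP[t0 t1] e] := second_order_mean u v gamma sF.
  have := mono (u + t *: v) u; rewrite addrC addKr enorm_sq dotZr dotZl dotZr.
  set q := dot v v in e *; set p := dot _ v in e *.
  have -> : gamma * (t * (t * q)) = t * (gamma * t * q) by ring.
  rewrite ler_pM2l// => h; move: e; lra.
- have [t /andP[t0 t1] e] := second_order_mean u v L sF.
  have h1 := dot_cauchy (grad F (u + t *: v) - grad F u) v.
  have e2 : u + t *: v - u = t *: v by rewrite addrC addKr.
  have h2 := lip (u + t *: v) u; rewrite e2 enormZ gtr0_norm// in h2.
  have h3 : enorm (grad F (u + t *: v) - grad F u) * enorm v <= L * t * dot v v.
    apply: (@le_trans _ _ (L * (t * enorm v) * enorm v)); first by rewrite ler_wpM2r// enorm_ge0.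
    by rewrite -enorm_sq expr2 !mulrA.
  have h4 := ler_norm (dot (grad F (u + t *: v) - grad F u) v).
  move: e h1 h3 h4; set q := dot v v; set p := dot _ v; lra.
Qed.

End convexity_bounds.

Section coenergy_density.
Context {R : realType} {d : nat}.
Local Notation E := 'rV[R]_d.
Local Notation vol := (@lebesgue_row R d).
Variables (Omega : set E) (oO : open Omega) (bO : bounded_set Omega).
Variables (w : E -> E -> R) (w_pw : piecewise_smooth Omega w).
Hypothesis w_smooth : forall x, Omega x -> smooth (w x).
Variables (L gamma : R) (L_gt0 : 0 < L) (gamma_gt0 : 0 < gamma).
Hypotheses (w_mono : forall x, Omega x -> forall u v,
    gamma * enorm (u - v) ^+ 2 <= dot (grad (w x) u - grad (w x) v) (u - v))
  (w_lip : forall x, Omega x -> forall u v,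
    enorm (grad (w x) u - grad (w x) v) <= L * enorm (u - v)).
Let mO : measurable Omega. Proof. exact: open_measurable_row. Qed.
Let vO : (vol Omega < +oo)%E. Proof. exact: lebesgue_row_bounded. Qed.

(** On each open piece [x |-> w x u] is the restriction of a smooth function on the whole space,
    hence Borel, and bounded because the bounded set [Omega] lies in a compact box. *)
Lemma density_pieces : exists D : set E, [/\ measurable D, D `<=` Omega,
  \forall x \ae vol, Omega x -> D x, forall u, measurable_fun D (w ^~ u) &
  forall u, exists M, forall x, D x -> `|w x u| <= M].
Proof.
have [N [U [hU _ neg hW]]] := w_pw.
pose V k : set E := if insub k is Some i then U (i : 'I_N) else set0.
have oV k : open (V k).
  by rewrite /V; case: insub => [i|]; [case: (hU i)|exact: open0].
have UV (i : 'I_N) : V i = U i by rewrite /V valK.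
exists (\bigcup_k V k); split.
- by apply: open_measurable_row; exact: bigcup_open.
- move=> x [k _]; rewrite /V; case: insub => [i|] //; exact: (hU i).2.
- have [A [mA A0 hA]] := neg; exists A; split=> // x h; apply: hA.
  split; first by apply: contrapT => nO; apply: h => /nO.
  by move=> [i _ Ui]; apply: h => _; exists (i : nat) => //; rewrite UV.
- move=> u; apply/measurable_fun_bigcup => k; first exact: open_measurable_row.
  rewrite /V; case: insub => [i|]; last exact: measurable_fun_set0.
  have [W [sW WE]] := hW i u.
  apply: (@eq_measurable_fun _ _ _ _ (U i) W) => [x|].
    by rewrite inE => Ux; rewrite WE.
  by apply: measurable_funTS; apply: continuous_measurable_row; exact: smooth_continuous.
- move=> u; have [M0 [M0r hM0]] := bO.
  have /choice[M hM] (i : 'I_N) : exists M, 0 <= M /\ forall x, U i x -> `|w x u| <= M.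
    have [W [sW WE]] := hW i u.
    pose B := closed_row_box (fun=> - (`|M0| + 1)) (fun=> `|M0| + 1) : set E.
    have cW : compact (W @` B).
      apply: continuous_compact; last exact: closed_row_box_compact.
      by apply: continuous_subspaceT; exact: smooth_continuous.
    have [K [Kr hK]] := compact_bounded cW.
    exists (`|K| + 1); split=> [|x Ux]; first by rewrite addr_ge0.
    rewrite WE//; apply: hK; first by have := ler_norm K; lra.
    exists x => // j; rewrite -ler_norml; apply: le_trans (coord_le_norm x j) _.
    by apply: hM0; [have := ler_norm M0; lra|exact: (hU i).2].
  exists (\sum_i M i) => x [k _]; rewrite /V; case: insub => [i|] // Ux.
  have [_ h] := hM i; apply: le_trans (h x Ux) _.
  by rewrite (bigD1 i)//= lerDl sumr_ge0// => l _; case: (hM l).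
Qed.

Lemma density_bounds x u v : Omega x ->
  w x u + dot (grad (w x) u) v + gamma / 2 * dot v v <= w x (u + v) /\
  w x (u + v) <= w x u + dot (grad (w x) u) v + L / 2 * dot v v.
Proof. by move=> Ox; apply: smooth_convex_bounds; [exact: w_smooth|exact: w_mono|exact: w_lip]. Qed.

Lemma compose_measurable (D : set E) (F : E -> E -> R) h : measurable D -> D `<=` Omega ->
  (\forall x \ae vol, Omega x -> D x) -> (forall u, measurable_fun D (F ^~ u)) ->
  (forall x, D x -> continuous (F x)) -> L2v Omega h -> ae_measurable vol Omega (fun x => F x (h x)).
Proof.
move=> mD DO aD mF cF hL.
have /choice[g hg] i : exists g, (fun x => h x ord0 i) = g %[ae vol in Omega] /\ measurable_fun Omega g.
  by have [g [e mg _]] := hL i; exists g.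
pose G x : E := \row_i g i x.
exists ((fun x => F x (G x)) \_ D).
  have e : \forall x \ae vol, forall i, Omega x -> h x ord0 i = g i x.
    by apply: filter_forall => i; case: (hg i).
  apply: filterS2 aD e => x aD e Ox; rewrite patchE mem_set; last exact: aD.
  by congr (F x _); apply/rowP => i; rewrite mxE e.
apply: measurable_funTS; apply/(measurable_restrictT _ mD).
apply: caratheodory_measurable => // i.
apply: (@eq_measurable_fun _ _ _ _ D (g i)) => [x _|]; first by rewrite mxE.
by apply: (measurable_funS mO DO); case: (hg i).
Qed.

(** A pointwise limit of difference quotients with increments [1/(n+1)], each measurable in [x]. *)
Lemma partial_measurable (D : set E) i u : measurable D -> D `<=` Omega ->
  (forall u, measurable_fun D (w ^~ u)) -> measurable_fun D (fun x => partial i (w x) u).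
Proof.
move=> mD DO mw.
apply: (@measurable_fun_cvg _ _ R D (fun n x => n.+1%:R * (w x (u + n.+1%:R^-1 *: delta_mx ord0 i) - w x u))).
  by move=> n; apply: measurable_funM => //; apply: measurable_funB.
move=> x Dx; have dw : differentiable (w x) u by apply: smooth_differentiable; apply: w_smooth; exact: DO.
have h : derivable (w x) u (delta_mx ord0 i) by exact: diff_derivable.
apply/cvgrPdist_lt => e e0.
have /cvgrPdist_lt /(_ _ e0) := h.
rewrite /= => H.
have /nbhs_ballP[r /= r0 hr] := H.
apply: filterS (near_infty_natSinv_lt (PosNum r0)) => n /= nr.
have n0 : n.+1%:R^-1 != 0 :> R by rewrite invr_eq0.
have := hr n.+1%:R^-1; rewrite -ball_normE /ball_/= sub0r normrN gtr0_norm// => /(_ nr n0).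
by rewrite invrK /GRing.scale /= [_ *: _ + u]addrC.
Qed.

(** By convexity, [w x 0 - w x (- e i)] and [w x (e i) - w x 0] enclose the [i]-th partial
    derivative at 0, and these values of [w] are bounded on the pieces. *)
Lemma gradient0_bounded (D : set E) : D `<=` Omega ->
  (forall u, exists M, forall x, D x -> `|w x u| <= M) ->
  exists2 B : R, 0 <= B & forall x, D x -> dot (grad (w x) 0) (grad (w x) 0) <= B.
Proof.
move=> DO bw; have /choice[M hM] := bw.
pose e i : E := delta_mx ord0 i.
pose b i := `|M (e i)| + `|M (- e i)| + `|M 0|.
exists (\sum_i b i ^+ 2); first by apply: sumr_ge0 => i _; exact: sqr_ge0.
move=> x Dx; apply: ler_sum => i _; rewrite -expr2 -[leLHS]real_normK ?num_real//.
have b0 : 0 <= b i by rewrite !addr_ge0.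
rewrite ler_pXn2r ?nnegrE//.
have de v : dot v (e i) = v ord0 i.
  rewrite /dot (bigD1 i)//= mxE !eqxx mulr1 big1 ?addr0// => l li.
  by rewrite mxE (negbTE li) andbF mulr0.
have g0 := ltW gamma_gt0.
have [h1 _] := density_bounds 0 (e i) (DO x Dx); have [h2 _] := density_bounds 0 (- e i) (DO x Dx).
rewrite !add0r in h1 h2.
have q1 : 0 <= gamma / 2 * dot (e i) (e i) by rewrite mulr_ge0 ?divr_ge0// dot_ge0.
have q2 : 0 <= gamma / 2 * dot (- e i) (- e i) by rewrite mulr_ge0 ?divr_ge0// dot_ge0.
rewrite (dotNr (grad (w x) 0)) (de (grad (w x) 0)) in h2; rewrite (de (grad (w x) 0)) in h1.
have m1 := le_trans (hM (e i) x Dx) (ler_norm _); have m2 := le_trans (hM (- e i) x Dx) (ler_norm _).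
have m3 := le_trans (hM 0 x Dx) (ler_norm _).
have a1 := ler_norm (w x (e i)); have a2 := ler_norm (w x (- e i)).
have a3 := ler_norm (- w x 0); rewrite normrN in a3.
have z1 := normr_ge0 (M (e i)); have z2 := normr_ge0 (M (- e i)).
rewrite ler_norml /b; apply/andP; split; lra.
Qed.

Lemma dot_le_sq (u v : E) : `|dot u v| <= (dot u u + dot v v) / 2.
Proof.
apply: le_trans (dot_cauchy u v) _; rewrite -!enorm_sq.
have := sqr_ge0 (enorm u - enorm v); nra.
Qed.

(** Linear growth: the Lipschitz bound compares the flux with its value at the zero field, which
    [gradient0_bounded] controls. *)
Lemma flux_L2 h : L2v Omega h -> L2v Omega (flux_density w h).
Proof.
move=> hL; have [D [mD DO aD mw bw]] := density_pieces.
have [B B0 hB] := gradient0_bounded DO bw.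
move=> i; apply/L2P; have am : ae_measurable vol Omega (fun x => flux_density w h x ord0 i).
  have := @compose_measurable D (fun x u => partial i (w x) u) h mD DO aD.
  rewrite (_ : (fun x => flux_density w h x ord0 i) = fun x => partial i (w x) (h x)); last first.
    by apply/funext => x; rewrite mxE.
  apply=> // [u|x Dx]; first exact: partial_measurable.
  by apply: smooth_continuous; apply: smooth_partial; apply: w_smooth; exact: DO.
split=> //.
have [ci _] := ae_cst_int (2 * B) mO vO.
apply: (ae_integrable_le mO (g := fun x => 2 * B + 2 * L ^+ 2 * dot (h x) (h x))).
- rewrite (_ : (fun _ => _) = fun x => flux_density w h x ord0 i * flux_density w h x ord0 i).
    exact: ae_measurableM.
  by apply/funext => x; rewrite expr2.
- apply: filterS aD => x aD Ox; rewrite ger0_norm ?sqr_ge0//.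
  have Dx := aD Ox; have hB' := hB x Dx.
  have c1 : flux_density w h x ord0 i ^+ 2 <= dot (grad (w x) (h x)) (grad (w x) (h x)).
    rewrite -enorm_sq -[leLHS]real_normK ?num_real// ler_pXn2r ?nnegrE ?enorm_ge0//.
    exact: coord_le_enorm.
  apply: le_trans c1 _.
  have l1 := w_lip Ox (h x) 0; rewrite subr0 in l1.
  set a := grad (w x) (h x) in l1 *; set a0 := grad (w x) 0 in l1 hB'.
  have l2 : dot (a - a0) (a - a0) <= L ^+ 2 * dot (h x) (h x).
    by rewrite -!enorm_sq -exprMn ler_pXn2r ?nnegrE ?mulr_ge0 ?enorm_ge0 ?(ltW L_gt0).
  have l3 := dot_ge0 (a - a0 - a0).
  have l4 : dot a a = dot (a - a0) (a - a0) + 2 * dot (a - a0) a0 + dot a0 a0.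
    by rewrite !dotBl !dotBr [dot a0 a]dotC; ring.
  rewrite l4 {l4}; move: (a - a0) l2 l3 => b l2 l3.
  rewrite dotBl !dotBr [dot a0 b]dotC in l3; lra.
- apply: (ae_integrableD mO) => //; apply: (ae_integrableZ mO); exact: (L2v_dot mO hL hL).
Qed.

Lemma density_integrable h : L2v Omega h -> ae_integrable vol Omega (fun x => w x (h x)).
Proof.
move=> hL; have [D [mD DO aD mw bw]] := density_pieces.
have [B B0 hB] := gradient0_bounded DO bw; have [M hM] := bw 0.
have [ci _] := ae_cst_int (M + B) mO vO.
apply: (ae_integrable_le mO (g := fun x => (M + B) + (1 + L + gamma) * dot (h x) (h x))).
- apply: (compose_measurable mD DO aD mw _ hL) => x Dx.
  by apply: smooth_continuous; apply: w_smooth; exact: DO.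
- apply: filterS aD => x aD Ox; have Dx := aD Ox.
  have [h1 h2] := density_bounds 0 (h x) Ox; rewrite add0r in h1 h2.
  have h3 := dot_le_sq (grad (w x) 0) (h x); have h4 := hB x Dx; have h5 := hM x Dx.
  have h6 := dot_ge0 (h x).
  have g1 : 0 <= gamma * dot (h x) (h x) by rewrite mulr_ge0// ltW.
  have g2 : 0 <= L * dot (h x) (h x) by rewrite mulr_ge0// ltW.
  have g3 := dot_ge0 (grad (w x) 0).
  move: h3 h5; rewrite !ler_norml => /andP[h3 h3'] /andP[h5 h5'].
  rewrite !mulrDl mul1r; apply/andP; split; lra.
- apply: (ae_integrableD mO) => //; apply: (ae_integrableZ mO); exact: (L2v_dot mO hL hL).
Qed.

Definition energy h : R := \int[vol]_(x in Omega) w x (h x).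

Lemma coenergyE h : L2v Omega h -> coenergy Omega w h = (energy h)%:E.
Proof. by move=> hL; apply: (ae_integrable_fin_EFin mO); exact: density_integrable. Qed.

Lemma energy_ae h h' : h = h' %[ae vol in Omega] -> energy h = energy h'.
Proof. by move=> e; apply: ae_eq_Rintegral; apply: filterS e => x e Ox; rewrite e. Qed.

(** The pointwise quadratic bounds, integrated. With [flux_L2], this is the form in which the
    minimization below takes the density. *)
Lemma energy_bounds h v : L2v Omega h -> L2v Omega v ->
  energy h + ip Omega (flux_density w h) v + gamma / 2 * ip Omega v v <= energy (fun x => h x + v x) /\
  energy (fun x => h x + v x) <= energy h + ip Omega (flux_density w h) v + L / 2 * ip Omega v v.
Proof.
move=> hL vL; have bL := flux_L2 hL.
have i1 := density_integrable hL; have i2 := L2v_dot mO bL vL; have i3 := L2v_dot mO vL vL.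
have i4 := density_integrable (L2vD mO hL vL).
have E1 k : energy h + ip Omega (flux_density w h) v + k * ip Omega v v =
    \int[vol]_(x in Omega) (w x (h x) + dot (flux_density w h x) (v x) + k * dot (v x) (v x)).
  rewrite /energy /ip RintD//; [|exact: ae_integrableD|exact: ae_integrableZ].
  rewrite RintD//; congr (_ + _); symmetry; exact: RintZ.
have iE k : ae_integrable vol Omega (fun x => w x (h x) + dot (flux_density w h x) (v x) + k * dot (v x) (v x)).
  by apply: (ae_integrableD mO); [exact: ae_integrableD|exact: ae_integrableZ].
by rewrite !E1; split; apply: (le_Rint mO) => //; apply: aeW => x Ox; have [] := density_bounds (h x) (v x) Ox.
Qed.

Lemma flux_ae h h' : h = h' %[ae vol in Omega] -> flux_density w h = flux_density w h' %[ae vol in Omega].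
Proof. by apply: filterS => x e Ox; rewrite /flux_density e. Qed.

Lemma flux_lipschitz h h' : L2v Omega h -> L2v Omega h' ->
  L2norm Omega (fun x => flux_density w h x - flux_density w h' x) <= L * L2norm Omega (fun x => h x - h' x).
Proof.
move=> hL hL'; have dL := L2vB mO hL hL'; have bL := L2vB mO (flux_L2 hL) (flux_L2 hL').
have n0 := L2norm_ge0 Omega (fun x => h x - h' x).
have n1 := L2norm_ge0 Omega (fun x => flux_density w h x - flux_density w h' x).
have aux (a b : R) : 0 <= a -> 0 <= b -> a ^+ 2 <= (L * b) ^+ 2 -> a <= L * b.
  by move=> a0 b0; rewrite ler_pXn2r// nnegrE ?mulr_ge0// ltW.
apply: (aux _ _ n1 n0).
rewrite exprMn L2norm_sq [X in _ <= _ * X]L2norm_sq.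
have <- : \int[vol]_(x in Omega) (L ^+ 2 * dot (h x - h' x) (h x - h' x)) = L ^+ 2 * ip Omega (fun x => h x - h' x) (fun x => h x - h' x).
  by apply: (RintZ mO); exact: (L2v_dot mO dL dL).
apply: (le_Rint mO).
- exact: (L2v_dot mO bL bL).
- by apply: (ae_integrableZ mO); exact: (L2v_dot mO dL dL).
- apply: aeW => x Ox; rewrite -!enorm_sq -exprMn ler_pXn2r ?nnegrE ?mulr_ge0 ?enorm_ge0 ?(ltW L_gt0)//.
  exact: w_lip.
Qed.

Lemma flux_monotone h h' : L2v Omega h -> L2v Omega h' ->
  gamma * L2norm Omega (fun x => h x - h' x) ^+ 2 <=
  ip Omega (fun x => flux_density w h x - flux_density w h' x) (fun x => h x - h' x).
Proof.
move=> hL hL'; have dL := L2vB mO hL hL'; have bL := L2vB mO (flux_L2 hL) (flux_L2 hL').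
rewrite L2norm_sq.
have <- : \int[vol]_(x in Omega) (gamma * dot (h x - h' x) (h x - h' x)) = gamma * ip Omega (fun x => h x - h' x) (fun x => h x - h' x).
  by apply: (RintZ mO); exact: (L2v_dot mO dL dL).
apply: (le_Rint mO).
- by apply: (ae_integrableZ mO); exact: (L2v_dot mO dL dL).
- exact: (L2v_dot mO bL dL).
- by apply: aeW => x Ox; rewrite -!enorm_sq; exact: w_mono.
Qed.

End coenergy_density.

(** * Uniqueness of weak derivatives *)

Section weak_uniqueness.
Context {R : realType} {d : nat}.
Local Notation E := 'rV[R]_d.
Local Notation vol := (@lebesgue_row R d).
Variables (Omega : set E) (oO : open Omega) (vO : (vol Omega < +oo)%E).
Let mO : measurable Omega. Proof. exact: open_measurable_row. Qed.

Lemma test_unique f f' : L2 Omega f -> L2 Omega f' ->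
  (forall th, test_function Omega th -> \int[vol]_(x in Omega) (f x * th x) = \int[vol]_(x in Omega) (f' x * th x)) ->
  f = f' %[ae vol in Omega].
Proof.
move=> fL fL' H.
have : (fun x => f x - f' x) = cst 0 %[ae vol in Omega].
  apply: (test_dense oO vO (L2B mO fL fL')) => th tt.
  transitivity (\int[vol]_(x in Omega) (f x * th x - f' x * th x)).
    by apply: eq_Rintegral => x _; rewrite mulrBl.
  by rewrite (RintB mO) ?H ?subrr//; exact: mul_test_aei.
by apply: filterS => x h Ox; apply/eqP; rewrite -subr_eq0; apply/eqP; exact: h.
Qed.

Lemma test_unique_row n (F F' : E -> 'rV[R]_n) : L2v Omega F -> L2v Omega F' ->
  (forall th k, test_function Omega th ->
     \int[vol]_(x in Omega) (F x ord0 k * th x) = \int[vol]_(x in Omega) (F' x ord0 k * th x)) ->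
  F = F' %[ae vol in Omega].
Proof.
move=> FL FL' H.
have : \forall x \ae vol, forall k, Omega x -> F x ord0 k = F' x ord0 k.
  by apply: filter_forall => k; apply: (test_unique (FL k) (FL' k)) => th tt; exact: H.
by apply: filterS => x h Ox; apply/rowP => k; exact: h.
Qed.

Lemma wcurlP h : Hcurl Omega h -> L2v Omega (wcurl Omega h) /\ is_weak_curl Omega h (wcurl Omega h).
Proof. by move=> [_ ex]; exact: (getPex ex). Qed.

Lemma wcurl_ae h c : L2v Omega c -> is_weak_curl Omega h c -> wcurl Omega h = c %[ae vol in Omega].
Proof.
move=> cL H.
have [wL wH] : L2v Omega (wcurl Omega h) /\ is_weak_curl Omega h (wcurl Omega h).
  by apply: (@getPex _ [set c | L2v Omega c /\ is_weak_curl Omega h c]); exists c.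
by apply: (test_unique_row wL cL) => th k tt; rewrite wH// H.
Qed.

Lemma wgradP psi : H1 Omega psi -> L2v Omega (wgrad Omega psi) /\ is_weak_grad Omega psi (wgrad Omega psi).
Proof. by move=> [_ ex]; exact: (getPex ex). Qed.

Lemma wgrad_ae psi g : L2v Omega g -> is_weak_grad Omega psi g -> wgrad Omega psi = g %[ae vol in Omega].
Proof.
move=> gL H.
have [wL wH] : L2v Omega (wgrad Omega psi) /\ is_weak_grad Omega psi (wgrad Omega psi).
  by apply: (@getPex _ [set g | L2v Omega g /\ is_weak_grad Omega psi g]); exists g.
by apply: (test_unique_row wL gL) => th k tt; rewrite wH// H.
Qed.

Lemma wdiv_ae (b : E -> E) f : L2 Omega f -> is_weak_div Omega (fun x => pad3 (b x)) f ->
  wdiv Omega b = f %[ae vol in Omega].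
Proof.
move=> fL H.
have [wL wH] : L2 Omega (wdiv Omega b) /\ is_weak_div Omega (fun x => pad3 (b x)) (wdiv Omega b).
  by apply: (@getPex _ [set f | L2 Omega f /\ is_weak_div Omega (fun x => pad3 (b x)) f]); exists f.
by apply: (test_unique wL fL) => th tt; rewrite wH// H.
Qed.

Lemma curl_eqP h j : L2v Omega j -> curl_eq Omega h j <-> L2v Omega h /\ is_weak_curl Omega h j.
Proof.
move=> jL; split=> [[hH e]|[hL H]].
  have [hL _] := hH; have [wL wH] := wcurlP hH; split=> //.
  have e' : j = wcurl Omega h %[ae vol in Omega] by apply: filterS e => x e Ox; rewrite e.
  by apply: weak_curl_ae e' wH; exact: aeW.
by split; [split=> //; exists j|exact: wcurl_ae].
Qed.

End weak_uniqueness.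

(** * Minimization of strongly convex functionals *)

Section minimization.
Context {R : realType} {d : nat}.
Local Notation E := 'rV[R]_d.
Local Notation vol := (@lebesgue_row R d).
Local Notation pair := ((E -> E) * (E -> 'rV[R]_3))%type.
Variables (Omega : set E) (oO : open Omega) (vO : (vol Omega < +oo)%E).
Variables (J : (E -> E) -> R) (b : (E -> E) -> E -> E) (L gamma : R).
Hypotheses (gamma_gt0 : 0 < gamma) (b_L2 : forall h, L2v Omega h -> L2v Omega (b h)).
Hypothesis J_bounds : forall h v, L2v Omega h -> L2v Omega v ->
  J h + ip Omega (b h) v + gamma / 2 * ip Omega v v <= J (fun x => h x + v x) /\
  J (fun x => h x + v x) <= J h + ip Omega (b h) v + L / 2 * ip Omega v v.
Variables (j : E -> 'rV[R]_3) (jL : L2v Omega j) (kappa : R) (kappa_gt0 : 0 < kappa).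
Let mO : measurable Omega. Proof. exact: open_measurable_row. Qed.

(** The second component is independent of the first; that it is the curl is left to the admissible
    set. On pairs whose second component is [j] the penalty vanishes, which covers the constrained
    problem. *)
Definition penalized (p : pair) : R := J p.1 + kappa / 2 * ip Omega (fun x => p.2 x - j x) (fun x => p.2 x - j x).
Definition first_variation (p v : pair) : R := ip Omega (b p.1) v.1 + kappa * ip Omega (fun x => p.2 x - j x) v.2.
Definition shift_pair (t : R) (p v : pair) : pair := (fun x => p.1 x + t *: v.1 x, fun x => p.2 x + t *: v.2 x).
Definition L2pair (p : pair) := L2v Omega p.1 /\ L2v Omega p.2.

Lemma penalized_bounds t p v : L2pair p -> L2pair v ->
  penalized p + t * first_variation p v + t ^+ 2 * (gamma / 2 * ip Omega v.1 v.1 + kappa / 2 * ip Omega v.2 v.2) <=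
    penalized (shift_pair t p v) /\
  penalized (shift_pair t p v) <=
  penalized p + t * first_variation p v + t ^+ 2 * (L / 2 * ip Omega v.1 v.1 + kappa / 2 * ip Omega v.2 v.2).
Proof.
move=> [p1 p2] [v1 v2]; have tv1 := L2vZ mO t v1; have tv2 := L2vZ mO t v2.
have [h1 h2] := J_bounds p1 tv1; have bL := b_L2 p1.
have cj := L2vB mO p2 jL.
have eq : ip Omega (fun x => (p.2 x + t *: v.2 x) - j x) (fun x => (p.2 x + t *: v.2 x) - j x) =
  ip Omega (fun x => p.2 x - j x) (fun x => p.2 x - j x) + 2 * t * ip Omega (fun x => p.2 x - j x) v.2
  + t ^+ 2 * ip Omega v.2 v.2.
  rewrite (_ : (fun x => _ - j x) = (fun x => (p.2 x - j x) + t *: v.2 x)); last first.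
    by apply/funext => x; rewrite addrAC.
  rewrite (ipDl mO cj tv2 (L2vD mO cj tv2)) (ipDr mO cj cj tv2) (ipDr mO tv2 cj tv2).
  rewrite (ipZl mO t v2 cj) (ipZl mO t v2 tv2) !(ipZr mO t) // (ipC Omega v.2 (fun x => p.2 x - j x)).
  ring.
have e1 : ip Omega (b p.1) (fun x => t *: v.1 x) = t * ip Omega (b p.1) v.1 by rewrite (ipZr mO).
have e2 : ip Omega (fun x => t *: v.1 x) (fun x => t *: v.1 x) = t ^+ 2 * ip Omega v.1 v.1.
  by rewrite (ipZl mO t v1 tv1) (ipZr mO t v1 v1); ring.
rewrite e1 e2 in h1 h2.
rewrite /penalized /first_variation /shift_pair /= eq.
move: h1 h2; set a := ip Omega v.1 v.1; set a2 := ip Omega v.2 v.2; set x := J (fun x => _).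
by split; lra.
Qed.

Lemma quadratic_ge0 (a B : R) : (forall t, 0 <= t * a + t ^+ 2 * B) -> a = 0.
Proof.
move=> h; have B0 : 0 < `|B| + 1 by rewrite ltr_wpDl.
(* At [t = - s] the linear term outweighs the quadratic one and leaves [0 <= - s^2]. *)
set s := a / (`|B| + 1).
have aE : a = s * (`|B| + 1) by rewrite /s mulfVK ?gt_eqF.
have h1 := h (- s); rewrite sqrrN [X in - s * X]aE in h1.
have h2 : B <= `|B| by exact: ler_norm.
have h3 : s ^+ 2 <= 0.
  have : s ^+ 2 * B <= s ^+ 2 * `|B| by rewrite ler_wpM2l// sqr_ge0.
  move: h1; set t := `|B|; set u := s ^+ 2.
  have -> : - s * (s * (t + 1)) = - (u * t) - u by rewrite /u; ring.
  lra.
have : s ^+ 2 == 0 by rewrite eq_le h3 sqr_ge0.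
by rewrite sqrf_eq0 => /eqP s0; rewrite aE s0 mul0r.
Qed.

Variable A : set pair.
Hypothesis AL : forall p, A p -> L2pair p.

Lemma minimizer_variation p v : L2pair v -> A p -> (forall t, A (shift_pair t p v)) ->
  (forall q, A q -> penalized p <= penalized q) -> first_variation p v = 0.
Proof.
move=> vL Ap Av pmin.
apply: (@quadratic_ge0 _ (L / 2 * ip Omega v.1 v.1 + kappa / 2 * ip Omega v.2 v.2)) => t.
have [_ h] := penalized_bounds t (AL Ap) vL; have := le_trans (pmin _ (Av t)) h; lra.
Qed.

Definition mid_pair (p q : pair) : pair :=
  (fun x => 2^-1 *: (p.1 x + q.1 x), fun x => 2^-1 *: (p.2 x + q.2 x)).
Hypothesis Amid : forall p q, A p -> A q -> A (mid_pair p q).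

(** The lower bound of [penalized_bounds] at the midpoint with [t = 1/2] and [t = - 1/2]: in the sum
    the first variations cancel and the quadratic terms remain. *)
Lemma penalized_mid p q : L2pair p -> L2pair q ->
  2 * penalized (mid_pair p q) + gamma / 4 * L2norm Omega (fun x => p.1 x - q.1 x) ^+ 2 +
    kappa / 4 * L2norm Omega (fun x => p.2 x - q.2 x) ^+ 2 <= penalized p + penalized q.
Proof.
move=> [p1 p2] [q1 q2]; pose r := mid_pair p q; pose v : pair := (fun x => p.1 x - q.1 x, fun x => p.2 x - q.2 x).
have rL : L2pair r by split; apply: (L2vZ mO); exact: (L2vD mO).
have vL : L2pair v by split; exact: (L2vB mO).
have half n (x y : 'rV[R]_n) : 2^-1 *: (x + y) + 2^-1 *: (x - y) = x /\ 2^-1 *: (x + y) + - 2^-1 *: (x - y) = y.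
  by split; apply/rowP => i; rewrite !mxE; field.
have e1 : shift_pair 2^-1 r v = p.
  by rewrite /shift_pair [RHS]surjective_pairing; congr (_, _); apply/funext => x; [exact: (half _ (p.1 x) (q.1 x)).1|exact: (half _ (p.2 x) (q.2 x)).1].
have e2 : shift_pair (- 2^-1) r v = q.
  by rewrite /shift_pair [RHS]surjective_pairing; congr (_, _); apply/funext => x; [exact: (half _ (p.1 x) (q.1 x)).2|exact: (half _ (p.2 x) (q.2 x)).2].
have [h1 _] := penalized_bounds 2^-1 rL vL; have [h2 _] := penalized_bounds (- 2^-1) rL vL.
rewrite e1 in h1; rewrite e2 in h2.
rewrite !L2norm_sq -/r; move: h1 h2; set a := ip Omega v.1 v.1; set a2 := ip Omega v.2 v.2.
rewrite -/a -/a2; lra.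
Qed.

Lemma minimizer_unique p q : A p -> A q -> (forall r, A r -> penalized p <= penalized r) ->
  (forall r, A r -> penalized q <= penalized r) -> p.1 = q.1 %[ae vol in Omega].
Proof.
move=> Ap Aq pm qm.
have [p1 p2] := AL Ap; have [q1 q2] := AL Aq.
have := penalized_mid (AL Ap) (AL Aq); have := pm _ (Amid Ap Aq); have := qm _ (Amid Ap Aq).
set N1 := L2norm _ _; set N2 := L2norm _ _.
have g1 : 0 <= gamma / 4 * N1 ^+ 2 by rewrite mulr_ge0 ?sqr_ge0// divr_ge0// ltW.
have g2 : 0 <= kappa / 4 * N2 ^+ 2 by rewrite mulr_ge0 ?sqr_ge0// divr_ge0// ltW.
move=> h1 h2 h3.
have : gamma / 4 * N1 ^+ 2 == 0 by rewrite eq_le g1 andbT; lra.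
rewrite mulf_eq0 mulf_eq0 gt_eqF// invr_eq0 pnatr_eq0/= sqrf_eq0 => /eqP n0.
have := L2norm_eq0 mO (L2vB mO p1 q1) n0.
by apply: filterS => x h Ox; apply/eqP; rewrite -subr_eq0; apply/eqP; exact: h.
Qed.

Hypothesis A0 : A !=set0.
Hypothesis Aclosed : forall p, L2pair p -> (forall e, 0 < e -> exists2 q, A q &
  L2norm Omega (fun x => p.1 x - q.1 x) <= e /\ L2norm Omega (fun x => p.2 x - q.2 x) <= e) -> A p.

Let z1 : L2v Omega (fun=> 0 : E). Proof. exact: L2v0. Qed.

Lemma penalized_lbound : exists m, forall p, A p -> m <= penalized p.
Proof.
(* The lower bound at the zero field, minimized over the norm of [p.1] by completing the square. *)
exists (J (fun=> 0) - L2norm Omega (b (fun=> 0)) ^+ 2 / (2 * gamma)) => p /AL[p1 p2].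
have [h _] := J_bounds z1 p1.
have e : (fun x => 0 + p.1 x) = p.1 by apply/funext => x; rewrite add0r.
rewrite e in h; rewrite /penalized.
have k0 : 0 <= kappa / 2 * ip Omega (fun x => p.2 x - j x) (fun x => p.2 x - j x).
  by rewrite mulr_ge0 ?ip_ge0// divr_ge0// ltW.
have := ip_cauchy mO (b_L2 z1) p1; rewrite ler_norml => /andP[h1 _].
rewrite -L2norm_sq in h.
move: h h1 k0; set N := L2norm _ (b _); set M := L2norm _ p.1; set I := ip Omega (b _) _ => h h1 k0.
have : 0 <= (N - gamma * M) ^+ 2 / (2 * gamma) by rewrite divr_ge0 ?sqr_ge0// mulr_ge0// ltW.
rewrite (_ : _ / _ = N ^+ 2 / (2 * gamma) - N * M + gamma / 2 * M ^+ 2); last by field; rewrite gt_eqF.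
lra.
Qed.

Lemma L2v_cauchy_small n (F : nat -> E -> 'rV[R]_n) (k : R) : 0 < k ->
  (forall p q, k * L2norm Omega (fun x => F p x - F q x) ^+ 2 <= p.+1%:R^-1 + q.+1%:R^-1) ->
  forall e, 0 < e -> exists N, forall p q, (N <= p)%N -> (N <= q)%N -> L2norm Omega (fun x => F p x - F q x) <= e.
Proof.
move=> k0 h e e0; have e1 : 0 < k * e ^+ 2 / 2 by rewrite divr_gt0// mulr_gt0// exprn_gt0.
have [N _ hN] := near_infty_natSinv_lt (PosNum e1).
exists N => p q Np Nq; have := hN p Np; have := hN q Nq => /= h1 h2.
rewrite -(@ler_pXn2r _ 2)// ?nnegrE ?L2norm_ge0 ?(ltW e0)// -(ler_pM2l k0).
apply: le_trans (h p q) _.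
move: h1 h2; move: (p.+1%:R^-1) (q.+1%:R^-1) (k * e ^+ 2) => u1 u2 u3; lra.
Qed.

Lemma le_of_lower_bound (m y z a1 a2 a3 u v1 : R) : u + y + (a1 + a2) <= z -> - a3 <= y ->
  z <= m + v1 -> 0 <= a1 -> 0 <= a2 -> u <= m + (v1 + a3).
Proof. lra. Qed.

(** Lower semicontinuity at the limit comes from the gradient inequality there: along the sequence
    the functional is at least its value at the limit plus a first variation that tends to 0. *)
Lemma minimizer_exists : exists2 p, A p & forall q, A q -> penalized p <= penalized q.
Proof.
have [m0 hm0] := penalized_lbound.
pose V : set R := [set a | exists2 p, A p & a = penalized p].
have hi : has_inf V.
  split; first by have [p Ap] := A0; exists (penalized p), p.
  by exists m0 => _ [p Ap ->]; exact: hm0.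
pose m := inf V.
have mle p : A p -> m <= penalized p by move=> Ap; apply: ge_inf; [case: hi|exists p].
have /choice[s hs] (n : nat) : exists p, A p /\ penalized p < m + n.+1%:R^-1.
  have n0 : 0 < n.+1%:R^-1 :> R by [].
  by have [_ [p Ap ->] h] := inf_adherent n0 hi; exists p.
have sA n : A (s n) by case: (hs n).
have s1 n : L2v Omega (s n).1 by case: (AL (sA n)).
have s2 n : L2v Omega (s n).2 by case: (AL (sA n)).
have key n k : gamma / 4 * L2norm Omega (fun x => (s n).1 x - (s k).1 x) ^+ 2 <= n.+1%:R^-1 + k.+1%:R^-1 /\
    kappa / 4 * L2norm Omega (fun x => (s n).2 x - (s k).2 x) ^+ 2 <= n.+1%:R^-1 + k.+1%:R^-1.
  have := penalized_mid (AL (sA n)) (AL (sA k)); have := mle _ (Amid (sA n) (sA k)).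
  have [_ h1] := hs n; have [_ h2] := hs k.
  set N1 := L2norm _ _; set N2 := L2norm _ _.
  have g1 : 0 <= gamma / 4 * N1 ^+ 2 by rewrite mulr_ge0 ?sqr_ge0// divr_ge0// ltW.
  have g2 : 0 <= kappa / 4 * N2 ^+ 2 by rewrite mulr_ge0 ?sqr_ge0// divr_ge0// ltW.
  move: h1 h2 g1 g2; move: (n.+1%:R^-1) (k.+1%:R^-1) (_ * N1 ^+ 2) (_ * N2 ^+ 2) => u1 u2 u3 u4 h1 h2 g1 g2 h3 h4; split; lra.
have g4 : 0 < gamma / 4 by rewrite divr_gt0.
have k4 : 0 < kappa / 4 by rewrite divr_gt0.
have [h hL hh] := L2v_complete mO s1 (L2v_cauchy_small g4 (fun n k => (key n k).1)).
have [c cL cc] := L2v_complete mO s2 (L2v_cauchy_small k4 (fun n k => (key n k).2)).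
have close e : 0 < e -> exists n, [/\ L2norm Omega (fun x => (s n).1 x - h x) <= e,
    L2norm Omega (fun x => (s n).2 x - c x) <= e & penalized (s n) <= m + e].
  move=> e0; have [N1 h1] := hh e e0; have [N2 h2] := cc e e0.
  have [N3 _ h3] := near_infty_natSinv_lt (PosNum e0).
  exists (N1 + N2 + N3)%N; split.
  - by apply: h1; rewrite -addnA leq_addr.
  - by apply: h2; rewrite addnAC leq_addl.
  - have [_ h4] := hs (N1 + N2 + N3)%N; have := h3 (N1 + N2 + N3)%N (leq_addl _ _) => /=.
    move: h4; move: (_%:R^-1) => u; lra.
have Ahc : A (h, c).
  apply: Aclosed => [|e e0]; first by split.
  have [n [h1 h2 _]] := close e e0; exists (s n); first exact: sA.
  split; first by apply: le_trans h1; rewrite (L2norm_subC _ h).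
  by apply: le_trans h2; rewrite (L2norm_subC _ c).
exists (h, c) => // q Aq; apply: le_trans (mle q Aq).
apply/ler_addgt0Pr => e e0.
have bL := b_L2 hL; have cj := L2vB mO cL jL.
(* Chosen so that errors [e / M] in both components and in the value add up to [e], the first
   variation at the limit included. *)
pose M := 1 + L2norm Omega (b h) + kappa * L2norm Omega (fun x => c x - j x).
have M0 : 0 < M by rewrite !ltr_wpDr ?mulr_ge0 ?L2norm_ge0// ltW.
have eM : 0 < e / M by rewrite divr_gt0.
have [n [h1 h2 h3]] := close _ eM.
pose v : pair := (fun x => (s n).1 x - h x, fun x => (s n).2 x - c x).
have vL : L2pair v by split; exact: (L2vB mO).
have sE : shift_pair 1 (h, c) v = s n.
  by rewrite /shift_pair [RHS]surjective_pairing; congr (_, _); apply/funext => x; rewrite /= scale1r addrC subrK.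
have [lb _] := penalized_bounds 1 (conj hL cL : L2pair (h, c)) vL.
rewrite sE mul1r expr1n mul1r in lb.
have g1 : 0 <= gamma / 2 * ip Omega v.1 v.1 by rewrite mulr_ge0 ?ip_ge0// divr_ge0// ltW.
have g2 : 0 <= kappa / 2 * ip Omega v.2 v.2 by rewrite mulr_ge0 ?ip_ge0// divr_ge0// ltW.
have vb : - (L2norm Omega (b h) * (e / M) + kappa * (L2norm Omega (fun x => c x - j x) * (e / M))) <= first_variation (h, c) v.
  have [vL1 vL2] := vL.
  have := ip_cauchy mO bL vL1; rewrite ler_norml => /andP[b1 _].
  have := ip_cauchy mO cj vL2; rewrite ler_norml => /andP[b2 _].
  have b3 : L2norm Omega (b h) * L2norm Omega v.1 <= L2norm Omega (b h) * (e / M) by rewrite ler_wpM2l// L2norm_ge0.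
  have b4 : L2norm Omega (fun x => c x - j x) * L2norm Omega v.2 <= L2norm Omega (fun x => c x - j x) * (e / M).
    by rewrite ler_wpM2l// L2norm_ge0.
  rewrite /first_variation opprD; apply: lerD; first by apply: le_trans b1; rewrite lerN2.
  by rewrite -mulrN ler_wpM2l ?(ltW kappa_gt0)//; apply: le_trans b2; rewrite lerN2.
have eE : e = e / M + (L2norm Omega (b h) * (e / M) + kappa * (L2norm Omega (fun x => c x - j x) * (e / M))).
  have Mn : M != 0 by rewrite gt_eqF.
  by move: Mn; rewrite /M => Mn; field.
rewrite [in leRHS]eE; exact: (le_of_lower_bound lb vb h3 g1 g2).
Qed.

End minimization.

(** Here [h] and [b] are the errors of field and flux in the final norms, [x] and [y] the L^2 errors
    of field and curl, [z] the norm of the penalized field and [n] that of the current. The factor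
    [eps] enters through [y] alone. *)
Lemma error_bound (R : realFieldType) (L K a eps x y z n h b : R) : 0 <= L -> 0 <= K -> 0 <= a ->
  0 <= eps -> 0 <= y -> h <= x + y -> b <= L * x -> x <= a * y -> y <= eps * (L * K) * z -> z <= a * n ->
  h + b <= (a + 1 + L * a) * (L * K * a) * eps * n.
Proof.
move=> L0 K0 a0 eps0 y0 e1 e2 e3 e4 e5.
have c0 : 0 <= a + 1 + L * a by rewrite addr_ge0 ?mulr_ge0// addr_ge0.
have e6 : L * x <= L * (a * y) by rewrite ler_wpM2l.
apply: (@le_trans _ _ ((a + 1 + L * a) * y)).
  rewrite (_ : _ * y = a * y + y + L * (a * y)); last by ring.
  by apply: lerD; lra.
rewrite (_ : _ * n = (a + 1 + L * a) * (eps * (L * K) * (a * n))); last by ring.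
by rewrite ler_wpM2l// (le_trans e4)// ler_wpM2l// mulr_ge0// mulr_ge0.
Qed.

(** * The magnetostatic problem *)

Section magnetostatics.
Context {R : realType} {d : nat}.
Local Notation E := 'rV[R]_d.
Local Notation vol := (@lebesgue_row R d).
Local Notation pair := ((E -> E) * (E -> 'rV[R]_3))%type.
Hypotheses (d0 : (0 < d)%N) (d3 : (d <= 3)%N).
Variables (Omega : set E) (bO : bounded_set Omega) (scO : simply_connected Omega) (lO : lipschitz_domain Omega).
Variables (w : E -> E -> R) (w_pw : piecewise_smooth Omega w).
Hypothesis w_smooth : forall x, Omega x -> smooth (w x).
Variables (L gamma : R) (L_gt0 : 0 < L) (gamma_gt0 : 0 < gamma).
Hypotheses (w_mono : forall x, Omega x -> forall u v,
    gamma * enorm (u - v) ^+ 2 <= dot (grad (w x) u - grad (w x) v) (u - v))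
  (w_lip : forall x, Omega x -> forall u v,
    enorm (grad (w x) u - grad (w x) v) <= L * enorm (u - v)).
Let oO : open Omega. Proof. by case: lO. Qed.
Let mO : measurable Omega. Proof. exact: open_measurable_row. Qed.
Let vO : (vol Omega < +oo)%E. Proof. exact: lebesgue_row_bounded. Qed.
Let V0 : 0 < fine (vol Omega).
Proof.
have [_ _ [x Ox] _] := lO; have /nbhs_ballP[r /= r0 rO] := open_nbhs_nbhs (conj oO Ox).
rewrite fine_gt0// vO andbT; apply: lt_le_trans (vol_ball_gt0 x r0) _.
by apply: le_measure; rewrite ?inE//; apply: open_measurable_row; exact: ball_open.
Qed.
Let J := energy Omega w.
Let b := flux_density w.
Let bL h : L2v Omega h -> L2v Omega (b h).
Proof. exact: (flux_L2 oO bO w_pw w_smooth L_gt0 gamma_gt0 w_mono w_lip). Qed.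
Let Jb := energy_bounds oO bO w_pw w_smooth L_gt0 gamma_gt0 w_mono w_lip.
Let JE := coenergyE oO bO w_pw w_smooth L_gt0 gamma_gt0 w_mono w_lip.
Let bmono := flux_monotone oO bO w_pw w_smooth L_gt0 gamma_gt0 w_mono w_lip.
Let blip := flux_lipschitz oO bO w_pw w_smooth L_gt0 gamma_gt0 w_mono w_lip.
Let z1 : L2v Omega (fun=> 0 : E). Proof. exact: L2v0. Qed.
Let z3 : L2v Omega (fun=> 0 : 'rV[R]_3). Proof. exact: L2v0. Qed.

Let ip0r n (F : E -> 'rV[R]_n) : ip Omega F (fun=> 0) = 0.
Proof.
transitivity (\int[vol]_(x in Omega) (0 : R)); last by rewrite /Rintegral integral0.
by apply: eq_Rintegral => x _; rewrite dotC dot0l.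
Qed.

Lemma admissible_shift t p v : admissible Omega p -> admissible Omega v -> admissible Omega (shift_pair t p v).
Proof.
move=> [pL cL H] [vL kL K]; have h := weak_curl_lin oO vO t vL pL kL cL K H.
split; [exact: (L2vD mO pL (L2vZ mO t vL))|exact: (L2vD mO cL (L2vZ mO t kL))|].
by apply: weak_curl_ae h; apply: aeW => x _; rewrite addrC.
Qed.

Lemma admissible_sub (h h' : E -> E) (c c' : E -> 'rV[R]_3) : L2v Omega h -> L2v Omega h' ->
  L2v Omega c -> L2v Omega c' -> is_weak_curl Omega h c -> is_weak_curl Omega h' c' ->
  is_weak_curl Omega (fun x => h x - h' x) (fun x => c x - c' x).
Proof.
move=> hL hL' cL cL' H H'; apply: weak_curl_ae (weak_curl_lin oO vO (-1) hL' hL cL' cL H' H);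
by apply: aeW => x _; rewrite scaleN1r addrC.
Qed.

Lemma admissible_mid p q : admissible Omega p -> admissible Omega q -> admissible Omega (mid_pair p q).
Proof.
move=> pa qa; have [pL cL H] := pa; have [qL kL K] := qa.
have da : admissible Omega (fun x => p.1 x - q.1 x, fun x => p.2 x - q.2 x).
  by split; [exact: (L2vB mO)|exact: (L2vB mO)|exact: admissible_sub].
have half n (x y : 'rV[R]_n) : y + 2^-1 *: (x - y) = 2^-1 *: (x + y).
  by apply/rowP => i; rewrite !mxE; field.
have := admissible_shift 2^-1 qa da; congr (admissible _ _); rewrite /shift_pair /mid_pair.
by congr (_, _); apply/funext => x; exact: half.
Qed.

Lemma admissible_closed p : L2pair Omega p -> (forall e, 0 < e -> exists2 q, admissible Omega q &
  L2norm Omega (fun x => p.1 x - q.1 x) <= e /\ L2norm Omega (fun x => p.2 x - q.2 x) <= e) ->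
  admissible Omega p.
Proof.
move=> [p1 p2] H; split=> //; apply: (weak_curl_closed oO vO p1 p2) => e e0.
by have [q [q1 q2 Hq] [h1 h2]] := H e e0; exists q.1, q.2.
Qed.

Lemma test_weak_grad phi : test_function Omega phi -> is_weak_grad Omega phi (grad phi).
Proof.
move=> tp th tt i; have sp := test_smooth tp; have st := test_smooth tt.
have i1 := mul_test_aei oO vO (L2_test mO vO (test_partial i tp)) tt.
have i2 := mul_test_aei oO vO (L2_test mO vO tp) (test_partial i tt).
apply/eqP; rewrite -subr_eq0 opprK; apply/eqP.
transitivity (\int[vol]_(x in Omega) (partial i phi x * th x + phi x * partial i th x)).
  rewrite RintD//; congr (_ + _); apply: eq_Rintegral => x _; by rewrite mxE.
transitivity (\int[vol]_(x in Omega) partial i (fun x => phi x * th x) x).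
  by apply: eq_Rintegral => x _; rewrite partialM//; exact: smooth_differentiable.
have tpt := testM tp st.
by rewrite (Rint_test (test_partial i tpt)) (Rint_partial_test i d0 tpt).
Qed.

Lemma curl_free_H1 (z : E -> E) : L2v Omega z -> is_weak_curl Omega z (fun=> 0) ->
  exists2 psi, H1_mod_R Omega psi & wgrad Omega psi = z %[ae vol in Omega].
Proof.
move=> zL H; have [psi pL pH] := curl_free_potential d0 d3 scO lO bO zL H.
pose a := (\int[vol]_(x in Omega) psi x) / fine (vol Omega).
have [ai aE] := ae_cst_int (- a) mO vO.
have aL : L2 Omega (cst (- a)).
  apply: (@bounded_aei_L2 _ _ _ mO _ `|a| vO); first exact: ae_measurable_cst.
  by move=> x _; rewrite /cst normrN.
have g : is_weak_grad Omega (fun x => 1 * psi x + cst (- a) x) z.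
  have := weak_grad_lin oO vO 1 pL aL zL z1 pH (@weak_grad_cst R d Omega (- a) d0).
  by apply: weak_grad_ae; apply: aeW => x _; [by []|rewrite scale1r addr0].
exists (fun x => 1 * psi x + cst (- a) x); last exact: (wgrad_ae oO vO zL g).
split; first by split; [apply: (L2D mO) => //; exact: (L2Z mO)|exists z].
have pi := L2_aei mO vO pL.
transitivity (\int[vol]_(x in Omega) (psi x + (- a))); first by apply: eq_Rintegral => x _; rewrite mul1r.
by rewrite (RintD mO pi ai) aE mulNr /a mulfVK ?subrr// gt_eqF.
Qed.

Lemma wgrad_curl_free psi : H1 Omega psi -> L2v Omega (wgrad Omega psi) /\ is_weak_curl Omega (wgrad Omega psi) (fun=> 0).
Proof.
move=> pH; have [gL gH] := wgradP pH; split=> //; apply: (weak_curl_grad oO vO _ gL gH); by case: pH.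
Qed.

Section source.
Variables (j : E -> 'rV[R]_3) (jL : L2v Omega j).

Definition constrained_min h := [/\ L2v Omega h, is_weak_curl Omega h j &
  forall h', L2v Omega h' -> is_weak_curl Omega h' j -> J h <= J h'].

(** The second component equals [j] only almost everywhere, since a limit in L^2 determines it no
    better. *)
Let A1 : set pair := [set p | admissible Omega p /\ p.2 = j %[ae vol in Omega]].

Let A1_L2 p : A1 p -> L2pair Omega p. Proof. by move=> [[]]. Qed.

Let A1_mid p q : A1 p -> A1 q -> A1 (mid_pair p q).
Proof.
move=> [pa pj] [qa qj]; split; first exact: admissible_mid.
apply: filterS2 pj qj => x e1 e2 Ox; rewrite /= e1// e2//.
by apply/rowP => i; rewrite !mxE; field.
Qed.

Let A1_closed p : L2pair Omega p -> (forall e, 0 < e -> exists2 q, A1 q &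
  L2norm Omega (fun x => p.1 x - q.1 x) <= e /\ L2norm Omega (fun x => p.2 x - q.2 x) <= e) -> A1 p.
Proof.
move=> pL H; split.
  by apply: admissible_closed => // e e0; have [q [qa _] h] := H e e0; exists q.
have [p1 p2] := pL.
have n0 : L2norm Omega (fun x => p.2 x - j x) = 0.
  apply/eqP; rewrite eq_le L2norm_ge0 andbT; apply/ler_addgt0Pr => e e0; rewrite add0r.
  have [q [_ qj] [_ h]] := H e e0.
  rewrite (L2norm_ae (G := fun x => p.2 x - q.2 x))//.
  by apply: filterS qj => x e' Ox; rewrite e'.
have := L2norm_eq0 mO (L2vB mO p2 jL) n0.
by apply: filterS => x h Ox; apply/eqP; rewrite -subr_eq0; apply/eqP; exact: h.
Qed.

(** The penalty vanishes on [A1], so the weight 1 is an arbitrary choice that makes the constrained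
    problem an instance of [minimizer_exists]. *)
Let penalizedA1 p : A1 p -> penalized Omega J j 1 p = J p.1.
Proof.
move=> [_ pj]; rewrite /penalized (ip_ae (F' := fun=> 0) (G' := fun=> 0)) ?ip0r ?mulr0 ?addr0//.
all: by apply: filterS pj => x e Ox; rewrite e// subrr.
Qed.

Let A1_in h : L2v Omega h -> is_weak_curl Omega h j -> A1 (h, j).
Proof. by move=> hL H; split; [split|exact: aeW]. Qed.

Let A1_out p : A1 p -> L2v Omega p.1 /\ is_weak_curl Omega p.1 j.
Proof.
move=> [[pL cL H] pj]; split=> //; apply: weak_curl_ae H; first exact: aeW.
by apply: filterS pj => x e Ox; rewrite e.
Qed.

Let A1_min h : constrained_min h -> forall q, A1 q -> penalized Omega J j 1 (h, j) <= penalized Omega J j 1 q.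
Proof.
move=> [hL H hmin] q Aq; rewrite !penalizedA1//; last exact: A1_in.
by have [qL qH] := A1_out Aq; exact: hmin.
Qed.

Lemma constrained_min_exists hs : L2v Omega hs -> is_weak_curl Omega hs j -> exists h, constrained_min h.
Proof.
move=> hL H; have A0 : A1 !=set0 by exists (hs, j); exact: A1_in.
have [p Ap pmin] := minimizer_exists oO gamma_gt0 bL Jb jL ltr01 A1_L2 A1_mid A0 A1_closed.
exists p.1; have [pL pH] := A1_out Ap; split=> // h hL' H'.
have := pmin _ (A1_in hL' H'); by rewrite !penalizedA1//; exact: A1_in.
Qed.

Lemma constrained_min_unique h h' : constrained_min h -> constrained_min h' -> h = h' %[ae vol in Omega].
Proof.
move=> hm hm'; have [hL H _] := hm; have [hL' H' _] := hm'.
exact: (minimizer_unique oO gamma_gt0 bL Jb jL ltr01 A1_L2 A1_mid (A1_in hL H) (A1_in hL' H') (A1_min hm) (A1_min hm')).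
Qed.

Lemma constrained_min_ae h h' : L2v Omega h' -> h' = h %[ae vol in Omega] -> constrained_min h -> constrained_min h'.
Proof.
move=> hL' e [hL H hmin]; split=> //; first by apply: weak_curl_ae H; [exact: e|exact: aeW].
by move=> k kL K; rewrite /J (energy_ae w e); exact: hmin.
Qed.

Lemma constrained_min_orthogonal h z : constrained_min h -> L2v Omega z -> is_weak_curl Omega z (fun=> 0) ->
  ip Omega (b h) z = 0.
Proof.
move=> hm zL zH; have [hL H _] := hm.
have vL : L2pair Omega (z, fun=> 0 : 'rV[R]_3) by split.
have := minimizer_variation oO bL Jb jL A1_L2 vL (A1_in hL H) _ (A1_min hm).
rewrite /first_variation /= ip0r mulr0 addr0; apply=> t; split.
  by apply: admissible_shift; split.
by apply: aeW => x _; rewrite /= scaler0 addr0.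
Qed.

Lemma constrained_minE h : is_minimizer [set h | curl_eq Omega h j] (coenergy Omega w) h <-> constrained_min h.
Proof.
split=> [[/(curl_eqP oO vO h jL)[hL H] hmin]|[hL H hmin]].
  split=> // h' hL' H'; have := hmin h' ((curl_eqP oO vO h' jL).2 (conj hL' H')).
  by rewrite !JE// lee_fin.
split; first exact/(curl_eqP oO vO h jL).
by move=> h' /(curl_eqP oO vO h' jL)[hL' H']; rewrite !JE// lee_fin; exact: hmin.
Qed.

Section reduced.
Variables (hs : E -> E) (hsL : L2v Omega hs) (hsH : is_weak_curl Omega hs j).

Lemma reduced_field_curl psi : H1 Omega psi ->
  L2v Omega (reduced_field Omega hs psi) /\ is_weak_curl Omega (reduced_field Omega hs psi) j.
Proof.
move=> pH; have [gL gC] := wgrad_curl_free pH; split; first exact: (L2vB mO).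
apply: weak_curl_ae (admissible_sub hsL gL jL z3 hsH gC); first exact: aeW.
by apply: aeW => x _; rewrite subr0.
Qed.

Lemma reduced_field_onto h : L2v Omega h -> is_weak_curl Omega h j ->
  exists2 psi, H1_mod_R Omega psi & reduced_field Omega hs psi = h %[ae vol in Omega].
Proof.
move=> hL H; have zL := L2vB mO hsL hL.
have [|psi pH e] := @curl_free_H1 (fun x => hs x - h x) zL.
  apply: weak_curl_ae (admissible_sub hsL hL jL jL hsH H); first exact: aeW.
  by apply: aeW => x _; rewrite subrr.
exists psi => //; apply: filterS e => x e Ox; rewrite /reduced_field e//.
by rewrite opprB addrC subrK.
Qed.

(** Every field with curl [j] is almost everywhere the reduced field of a potential of mean zero
    ([reduced_field_onto]), so both problems range over the same energies. *)
Lemma reduced_minE psi : is_minimizer (H1_mod_R Omega) (reduced_coenergy Omega w hs) psi <->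
  H1_mod_R Omega psi /\ constrained_min (reduced_field Omega hs psi).
Proof.
split=> [[pH pmin]|[pH [hL H hmin]]].
  have [hL H] := reduced_field_curl pH.1; split=> //; split=> // h' hL' H'.
  have [psi' pH' e] := reduced_field_onto hL' H'.
  have [kL K] := reduced_field_curl pH'.1.
  have e1 := JE hL; have e2 := JE kL.
  have := pmin psi' pH'; rewrite /reduced_coenergy e1 e2 lee_fin.
  by rewrite [X in _ <= X](energy_ae w e).
split; first exact: pH.
move=> psi' pH'; have [kL K] := reduced_field_curl pH'.1.
have e1 := JE hL; have e2 := JE kL.
rewrite /reduced_coenergy e1 e2 lee_fin.
exact: (hmin _ kL K).
Qed.

Lemma reduced_min_exists : exists psi, is_minimizer (H1_mod_R Omega) (reduced_coenergy Omega w hs) psi.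
Proof.
have [h hm] := constrained_min_exists hsL hsH; have [hL H _] := hm.
have [psi pH e] := reduced_field_onto hL H; exists psi; apply/reduced_minE; split=> //.
by apply: constrained_min_ae e hm; case: (reduced_field_curl pH.1).
Qed.

(** Equal minimizing fields give equal gradients; on the connected set [Omega] the potentials then
    differ by a constant, which the zero mean removes. *)
Lemma reduced_min_unique psi psi' : is_minimizer (H1_mod_R Omega) (reduced_coenergy Omega w hs) psi ->
  is_minimizer (H1_mod_R Omega) (reduced_coenergy Omega w hs) psi' -> psi = psi' %[ae vol in Omega].
Proof.
move=> /reduced_minE[[pH p0] hm] /reduced_minE[[pH' p0'] hm'].
have [gL gH] := wgradP pH; have [gL' gH'] := wgradP pH'.
have [pL _] := pH; have [pL' _] := pH'.
have e : wgrad Omega psi = wgrad Omega psi' %[ae vol in Omega].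
  apply: filterS (constrained_min_unique hm hm') => x e Ox; have := e Ox.
  by rewrite /reduced_field => /addrI /oppr_inj.
have H' : is_weak_grad Omega psi' (wgrad Omega psi).
  by apply: weak_grad_ae gH'; [exact: aeW|exact: e].
have [_ cO _ _] := lO.
have dL : L2 Omega (fun x => -1 * psi' x + psi x) by apply: (L2D mO) => //; exact: (L2Z mO).
have [c hc] := weak_grad0_connected oO cO dL (weak_grad_diff0 oO vO pL pL' gL gH H').
have [ci cE] := ae_cst_int c mO vO.
have c0 : c = 0.
  have : c * fine (vol Omega) = 0.
    rewrite -cE -[RHS](subrr (0 : R)) -{1}p0 -p0' -(RintB mO (L2_aei mO vO pL) (L2_aei mO vO pL')).
    by apply/esym/ae_eq_Rintegral; apply: filterS hc => x h Ox; rewrite -(h Ox : _ = c); ring.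
  by move/eqP; rewrite mulf_eq0 [fine _ == 0]gt_eqF// orbF => /eqP.
apply: filterS hc => x h Ox; have : -1 * psi' x + psi x = c := h Ox.
by rewrite c0 mulN1r addrC => /eqP; rewrite subr_eq0 => /eqP.
Qed.

End reduced.

(** For uniqueness, the difference of two weak solutions is curl-free, hence a gradient, to which
    both fluxes are orthogonal; strong monotonicity forces it to vanish. *)
Lemma constrained_min_weak_solution h : constrained_min h -> weak_solution Omega w j h (b h) /\
  forall h' b', weak_solution Omega w j h' b' ->
    h' = h %[ae vol in Omega] /\ b' = b h %[ae vol in Omega].
Proof.
move=> hm; have [hL H _] := hm; split.
  split; [exact/(curl_eqP oO vO h jL)|exact: bL|exact: aeW|].
  move=> phi pH; have [gL gC] := wgrad_curl_free pH.
  exact: (constrained_min_orthogonal hm gL gC).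
move=> h' b' [/(curl_eqP oO vO h' jL)[hL' H'] bL' be ort].
have zL := L2vB mO hL' hL.
have zC : is_weak_curl Omega (fun x => h' x - h x) (fun=> 0).
  apply: weak_curl_ae (admissible_sub hL' hL jL jL H' H); first exact: aeW.
  by apply: aeW => x _; rewrite subrr.
have [psi [pH _] pe] := curl_free_H1 zL zC.
have e1 : ip Omega (b h') (fun x => h' x - h x) = 0.
  rewrite -(ort psi pH); apply: ip_ae.
    by apply: filterS be => x e Ox; rewrite e.
  by apply: filterS pe => x e Ox; rewrite e.
have e2 := constrained_min_orthogonal hm zL zC.
have := bmono hL' hL; rewrite (ipBl mO (bL hL') (bL hL) zL) e1 e2 subrr.
set n := L2norm _ _ => h0.
have /eqP : gamma * n ^+ 2 = 0.
  by apply/eqP; rewrite eq_le h0 mulr_ge0 ?sqr_ge0// ltW.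
rewrite mulf_eq0 gt_eqF//= sqrf_eq0 => /eqP n0.
have e : h' = h %[ae vol in Omega].
  have := L2norm_eq0 mO zL n0.
  by apply: filterS => x k Ox; apply/eqP; rewrite -subr_eq0; apply/eqP; exact: k.
split=> //; apply: filterS2 be (flux_ae w e) => x k1 k2 Ox.
by rewrite k1// k2.
Qed.

(** * The penalized problem *)

Section penalty.
Variables (eps : R) (eps_gt0 : 0 < eps).
Let k0 : 0 < eps^-1. Proof. by rewrite invr_gt0. Qed.

(** Minimality among all admissible pairs, the form that the abstract minimization provides;
    [penalty_minE] identifies it with minimality among fields. *)
Definition penalty_min h := Hcurl Omega h /\
  forall q, admissible Omega q -> penalized Omega J j eps^-1 (h, wcurl Omega h) <= penalized Omega J j eps^-1 q.

Lemma penalized_coenergyE h : Hcurl Omega h ->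
  penalized_coenergy Omega w j eps h = (penalized Omega J j eps^-1 (h, wcurl Omega h))%:E.
Proof.
move=> hH; have [hL _] := hH; have [cL _] := wcurlP hH.
have dL := L2vB mO cL jL; have di := L2v_dot mO dL dL.
have wi := density_integrable oO bO w_pw w_smooth L_gt0 gamma_gt0 w_mono w_lip hL.
have e : (fun x => w x (h x) + (2 * eps)^-1 * enorm (wcurl Omega h x - j x) ^+ 2) =
    (fun x => w x (h x) + (eps^-1 / 2) * dot (wcurl Omega h x - j x) (wcurl Omega h x - j x)).
  by apply/funext => x; rewrite enorm_sq invfM [2^-1 * _]mulrC.
have ti : ae_integrable vol Omega (fun x => w x (h x) + (eps^-1 / 2) * dot (wcurl Omega h x - j x) (wcurl Omega h x - j x)).
  by apply: (ae_integrableD mO) => //; exact: (ae_integrableZ mO).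
rewrite /penalized_coenergy (eq_integral (fun x => ((fun x => w x (h x) + (eps^-1 / 2) * dot (wcurl Omega h x - j x) (wcurl Omega h x - j x)) x)%:E)); last first.
  by move=> x _; congr (_%:E); exact: (congr1 (fun f => f x) e).
rewrite (ae_integrable_fin_EFin mO ti); congr (_%:E).
rewrite (RintD mO wi); last exact: (ae_integrableZ mO).
by congr (_ + _); apply: (RintZ mO).
Qed.

Lemma penalized_wcurl q : admissible Omega q ->
  penalized Omega J j eps^-1 (q.1, wcurl Omega q.1) = penalized Omega J j eps^-1 q.
Proof.
move=> [qL cL H]; have e := wcurl_ae oO vO cL H; rewrite /penalized; congr (_ + _ * _).
by apply: ip_ae; apply: filterS e => x e Ox; rewrite /= e.
Qed.

Let wcurl_admissible h : Hcurl Omega h -> admissible Omega (h, wcurl Omega h).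
Proof. by move=> hH; have [hL _] := hH; have [cL H] := wcurlP hH. Qed.

Lemma penalty_minE h : is_minimizer (Hcurl Omega) (penalized_coenergy Omega w j eps) h <-> penalty_min h.
Proof.
split=> [[hH hmin]|[hH hmin]]; split; [exact: hH|move=> q qa|exact: hH|move=> h' hH'].
  have [qL cL H] := qa; have qH : Hcurl Omega q.1 by split=> //; exists q.2.
  by have := hmin _ qH; rewrite (penalized_coenergyE hH) (penalized_coenergyE qH) lee_fin (penalized_wcurl qa).
rewrite (penalized_coenergyE hH) (penalized_coenergyE hH') lee_fin.
exact: (hmin _ (wcurl_admissible hH')).
Qed.

Let admissibleL2 p : admissible Omega p -> L2pair Omega p. Proof. by case. Qed.

Lemma penalty_min_exists hs : L2v Omega hs -> is_weak_curl Omega hs j -> exists h, penalty_min h.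
Proof.
move=> hL H; have A0 : [set p | admissible Omega p] !=set0 by exists (hs, j).
have [p pa pmin] := minimizer_exists oO gamma_gt0 bL Jb jL k0 (A := [set p | admissible Omega p])
  admissibleL2 admissible_mid A0 admissible_closed.
exists p.1; have [pL cL K] := pa; split; first by split=> //; exists p.2.
by move=> q qa; rewrite penalized_wcurl//; exact: pmin.
Qed.

Lemma penalty_min_unique h h' : penalty_min h -> penalty_min h' -> h = h' %[ae vol in Omega].
Proof.
move=> [hH hm] [hH' hm'].
exact: (minimizer_unique oO gamma_gt0 bL Jb jL k0 (A := [set p | admissible Omega p]) admissibleL2 admissible_mid
  (wcurl_admissible hH) (wcurl_admissible hH') hm hm').
Qed.

Lemma penalty_min_variation h v : penalty_min h -> admissible Omega v ->
  ip Omega (b h) v.1 + eps^-1 * ip Omega (fun x => wcurl Omega h x - j x) v.2 = 0.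
Proof.
move=> [hH hm] va.
have := minimizer_variation oO bL Jb jL (A := [set p | admissible Omega p]) admissibleL2 (admissibleL2 va)
  (wcurl_admissible hH) _ hm.
by apply=> t; apply: admissible_shift => //; exact: wcurl_admissible.
Qed.

End penalty.
End source.

(** * Stability and error estimates for the penalized problem *)

Section estimates.
Variables (K : R) (K0 : 0 <= K).
Hypothesis lifting : forall (v : E -> E) c, L2v Omega v -> L2v Omega c ->
  is_weak_curl Omega v c -> exists v' : E -> E,
  [/\ L2v Omega v', is_weak_curl Omega v' c & L2norm Omega v' <= K * L2norm Omega c].
Hypothesis flux0 : (fun x => grad (w x) 0) = cst 0 %[ae vol in Omega].
Variables (j : E -> 'rV[R]_3) (jL : L2v Omega j) (h : E -> E) (hm : constrained_min j h).
Variables (eps : R) (eps_gt0 : 0 < eps) (he : E -> E) (hem : penalty_min j eps he).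

Lemma le_of_quadratic (x y : R) : 0 <= x -> 0 <= y -> gamma * x ^+ 2 <= L * x * y -> x <= L / gamma * y.
Proof.
move=> x0 y0; have [->|xn0] := eqVneq x 0; first by rewrite mulr_ge0// divr_ge0// ltW.
have xp : 0 < x by rewrite lt_def xn0.
rewrite (_ : gamma * x ^+ 2 = x * (gamma * x)); last by ring.
rewrite (_ : L * x * y = x * (L * y)); last by ring.
by rewrite ler_pM2l// mulrAC ler_pdivlMr// mulrC.
Qed.

Let heL : L2v Omega he. Proof. by case: hem => -[]. Qed.
Let heH : Hcurl Omega he. Proof. by case: hem. Qed.
Let ceL : L2v Omega (wcurl Omega he). Proof. by case: (wcurlP heH). Qed.
Let ceH : is_weak_curl Omega he (wcurl Omega he). Proof. by case: (wcurlP heH). Qed.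
Let hL : L2v Omega h. Proof. by case: hm. Qed.
Let hH : is_weak_curl Omega h j. Proof. by case: hm. Qed.
Let r (x : E) : 'rV[R]_3 := wcurl Omega he x - j x.
Let rL : L2v Omega r. Proof. exact: (L2vB mO). Qed.
Let delta (x : E) : E := he x - h x.
Let deltaL : L2v Omega delta. Proof. exact: (L2vB mO). Qed.
Let deltaH : is_weak_curl Omega delta r. Proof. exact: admissible_sub. Qed.
Let beL : L2v Omega (b he). Proof. exact: bL. Qed.
Let bhL : L2v Omega (b h). Proof. exact: bL. Qed.

Let EL v c : L2v Omega v -> L2v Omega c -> is_weak_curl Omega v c ->
  ip Omega (b he) v + eps^-1 * ip Omega r c = 0.
Proof. by move=> vL cL H; have va : admissible Omega (v, c) by []; exact: (penalty_min_variation jL hem va). Qed.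

Let EL0 z : L2v Omega z -> is_weak_curl Omega z (fun=> 0) -> ip Omega (b he) z = 0.
Proof. by move=> zL zH; have := EL zL z3 zH; rewrite ip0r mulr0 addr0. Qed.

Let EL_lift v c v' : L2v Omega v -> L2v Omega v' -> L2v Omega c -> is_weak_curl Omega v c ->
  is_weak_curl Omega v' c -> is_weak_curl Omega (fun x => v x - v' x) (fun=> 0).
Proof.
move=> vL vL' cL H H'; apply: weak_curl_ae (admissible_sub vL vL' cL cL H H'); first exact: aeW.
by apply: aeW => x _; rewrite subrr.
Qed.

(** [flux0] enters here and in [be_ge]: it turns comparisons with the flux of the zero field into
    bounds by the field itself. *)
Let be_le : L2norm Omega (b he) <= L * L2norm Omega he.
Proof.
have := blip heL z1; rewrite (L2norm_ae (F := fun x => he x - 0) (G := he)); last first.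
  by apply: aeW => x _; rewrite subr0.
rewrite (L2norm_ae (G := b he))//.
by apply: filterS flux0 => x e Ox; have := e Ox; rewrite /flux_density /cst => ->; rewrite subr0.
Qed.

Let be_ge : gamma * L2norm Omega he ^+ 2 <= ip Omega (b he) he.
Proof.
have := bmono heL z1; rewrite (L2norm_ae (F := fun x => he x - 0) (G := he)); last first.
  by apply: aeW => x _; rewrite subr0.
rewrite (ip_ae (F' := b he) (G' := he))//.
  by apply: filterS flux0 => x e Ox; have := e Ox; rewrite /flux_density /cst => ->; rewrite subr0.
by apply: aeW => x _; rewrite subr0.
Qed.

(** Test the Euler-Lagrange equation with the penalized field itself: the flux term is nonnegative,
    so the residual pairs nonpositively with the curl, and Cauchy-Schwarz gives the constant 1. *)
Lemma curl_stability : L2norm Omega (wcurl Omega he) <= L2norm Omega j.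
Proof.
set c := wcurl Omega he.
have h1 := EL heL ceL ceH; have n0 := L2norm_ge0 Omega he.
have g0 : 0 <= gamma * L2norm Omega he ^+ 2 by rewrite mulr_ge0 ?sqr_ge0// ltW.
have h2 : ip Omega r c <= 0.
  have : eps^-1 * ip Omega r c <= 0 by have := le_trans g0 be_ge; lra.
  by rewrite pmulr_rle0// invr_gt0.
rewrite /r (ipBl mO ceL jL ceL) -L2norm_sq in h2.
have h3 := ip_le mO jL ceL; have c0 := L2norm_ge0 Omega c.
have [->|cn0] := eqVneq (L2norm Omega c) 0; first exact: L2norm_ge0.
have cp : 0 < L2norm Omega c by rewrite lt_def cn0.
rewrite -(ler_pM2r cp) -expr2; apply: le_trans h3; rewrite -subr_le0; exact: h2.
Qed.

(** The field minus a lift of its curl is curl-free, hence orthogonal to the flux. So the flux pairs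
    with the field as with the lift, whose norm is bounded by the curl. *)
Lemma field_stability : L2norm Omega he <= L / gamma * (K * L2norm Omega j).
Proof.
have [v [vL vH vn]] := lifting heL ceL ceH.
have K1 : L2norm Omega v <= K * L2norm Omega j by apply: le_trans vn _; rewrite ler_wpM2l// curl_stability.
apply: le_of_quadratic; [exact: L2norm_ge0|by rewrite mulr_ge0 ?L2norm_ge0|].
apply: le_trans be_ge _.
have zL := L2vB mO heL vL.
have := EL0 zL (EL_lift heL vL ceL ceH vH); rewrite (ipBr mO beL heL vL) => /eqP; rewrite subr_eq0 => /eqP ->.
apply: le_trans (ip_le mO beL vL) _.
by apply: ler_pM => //; exact: L2norm_ge0.
Qed.

(** Tested with a lift [v] of the residual, the Euler-Lagrange equation reads
    [eps^-1 |r|^2 = - <b he, v>]; this is the source of the factor [eps]. *)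
Lemma curl_residual : L2norm Omega r <= eps * (L * K) * L2norm Omega he.
Proof.
have [v [vL vH vn]] := lifting deltaL rL deltaH.
have h1 := EL vL rL vH; rewrite -L2norm_sq in h1.
set N := L2norm Omega r in h1 vn *.
have N0 : 0 <= N by exact: L2norm_ge0.
have h2 : eps^-1 * N ^+ 2 <= L * L2norm Omega he * (K * N).
  have := ip_cauchy mO beL vL; rewrite ler_norml => /andP[h2 _].
  have h3 : L2norm Omega (b he) * L2norm Omega v <= L * L2norm Omega he * (K * N).
    by apply: ler_pM => //; exact: L2norm_ge0.
  by move: (ip Omega _ _) (eps^-1 * _) (L2norm _ _ * L2norm _ _) (L * _ * _) h1 h2 h3 => u1 u2 u3 u4; lra.
have [->|Nn0] := eqVneq N 0; first by rewrite !mulr_ge0 ?L2norm_ge0// ltW.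
have Np : 0 < N by rewrite lt_def Nn0.
rewrite -(ler_pM2r Np) -(ler_pM2l (_ : 0 < eps^-1)) ?invr_gt0//.
apply: le_trans (_ : L * L2norm Omega he * (K * N) <= _).
  by rewrite -expr2.
by rewrite le_eqVlt; apply/orP; left; apply/eqP; field; rewrite gt_eqF.
Qed.

(** Strong monotonicity for the two fields: the error minus a lift of the residual is curl-free and
    orthogonal to both fluxes, so only the pairing with the lift remains. *)
Lemma field_error : L2norm Omega delta <= L / gamma * (K * L2norm Omega r).
Proof.
have [v [vL vH vn]] := lifting deltaL rL deltaH.
apply: le_of_quadratic; [exact: L2norm_ge0|by rewrite mulr_ge0 ?L2norm_ge0|].
apply: le_trans (bmono heL hL) _.
have zL := L2vB mO deltaL vL; have zH := EL_lift deltaL vL rL deltaH vH.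
have dbL := L2vB mO beL bhL.
have : ip Omega (fun x => b he x - b h x) (fun x => delta x - v x) = 0.
  by rewrite (ipBl mO beL bhL zL) (EL0 zL zH) (constrained_min_orthogonal jL hm zL zH) subrr.
rewrite (ipBr mO dbL deltaL vL) => /eqP; rewrite subr_eq0 => /eqP ->.
apply: le_trans (ip_le mO dbL vL) _.
apply: ler_pM; [exact: L2norm_ge0|exact: L2norm_ge0|exact: (blip heL hL)|exact: vn].
Qed.

(** Gradients of test functions are curl-free, so both fluxes are orthogonal to them. *)
Lemma flux_error_div : is_weak_div Omega (fun x => pad3 (b he x - b h x)) (fun=> 0).
Proof.
move=> phi tp.
have gL := L2v_grad_test oO vO tp.
have gH := weak_curl_grad oO vO (L2_test mO vO tp) gL (test_weak_grad tp).
transitivity (0 : R).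
  transitivity (\int[vol]_(x in Omega) (0 : R)); last by rewrite /Rintegral integral0.
  by apply: eq_Rintegral => x _; rewrite mul0r.
apply/esym/eqP; rewrite oppr_eq0; apply/eqP.
transitivity (ip Omega (fun x => b he x - b h x) (grad phi)).
  by apply: eq_Rintegral => x _; rewrite (dot_pad3 d3).
by rewrite (ipBl mO beL bhL gL) (EL0 gL gH) (constrained_min_orthogonal jL hm gL gH) subrr.
Qed.

Lemma graph_norm_le (x y : R) : 0 <= x -> 0 <= y -> Num.sqrt (x ^+ 2 + y ^+ 2) <= x + y.
Proof.
move=> x0 y0; rewrite -[leRHS]ger0_norm ?addr_ge0// -sqrtr_sqr ler_wsqrtr//.
by have := mulr_ge0 x0 y0; nra.
Qed.

Lemma Hcurl_norm_le (v : E -> E) c : L2v Omega c -> is_weak_curl Omega v c ->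
  Hcurl_norm Omega v <= L2norm Omega v + L2norm Omega c.
Proof.
move=> cL H; rewrite /Hcurl_norm (L2norm_ae (wcurl_ae oO vO cL H)).
by apply: graph_norm_le; exact: L2norm_ge0.
Qed.

Let a := L / gamma * K.
Let a0 : 0 <= a. Proof. by rewrite mulr_ge0// divr_ge0// ltW. Qed.

Lemma penalty_stability : Hcurl_norm Omega he <= (a + 1) * L2norm Omega j.
Proof.
apply: le_trans (Hcurl_norm_le ceL ceH) _; rewrite mulrDl mul1r lerD ?curl_stability//.
by rewrite /a -mulrA field_stability.
Qed.

Lemma penalty_error :
  [/\ Hdiv Omega (fun x => b he x - b h x) &
  Hcurl_norm Omega delta + Hdiv_norm Omega (fun x => b he x - b h x) <=
  (a + 1 + L * a) * (L * K * a) * eps * L2norm Omega j].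
Proof.
have dbL := L2vB mO beL bhL; have o0 := @L20 R d Omega.
split; first by split=> //; exists (fun=> 0); split; [exact: o0|exact: flux_error_div].
have wd := wdiv_ae oO vO o0 flux_error_div.
have -> : Hdiv_norm Omega (fun x => b he x - b h x) = L2norm Omega (fun x => b he x - b h x).
  rewrite /Hdiv_norm (_ : \int[vol]_(x in Omega) _ = 0) ?addr0 ?sqrtr_sqr ?ger0_norm ?L2norm_ge0//.
  transitivity (\int[vol]_(x in Omega) (0 : R)); last by rewrite /Rintegral integral0.
  by apply: ae_eq_Rintegral; apply: filterS wd => x e Ox; rewrite e// expr0n.
have e1 := Hcurl_norm_le rL deltaH; have e2 := blip heL hL.
have e3 := field_error; have e4 := curl_residual; have e5 := field_stability.
rewrite mulrA -/a in e3; rewrite mulrA -/a in e5.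
exact: (error_bound (ltW L_gt0) K0 a0 (ltW eps_gt0) (L2norm_ge0 _ _) e1 e2 e3 e4 e5).
Qed.

End estimates.
End magnetostatics.

Theorem theorem1 (R : realType) (d : nat) (hd : d = 2%N \/ d = 3%N)
  (Omega : set 'rV[R]_d)
  (Omega_bounded : bounded_set Omega)
  (Omega_sc : simply_connected Omega)
  (Omega_lip : lipschitz_domain Omega)
  (w : 'rV[R]_d -> 'rV[R]_d -> R)
  (w_pw : piecewise_smooth Omega w)
  (w_smooth : forall x, Omega x -> smooth (w x))
  (L gamma : R) (L_gt0 : 0 < L) (gamma_gt0 : 0 < gamma)
  (w_mono : forall x, Omega x -> forall u v,
    gamma * enorm (u - v) ^+ 2 <= dot (grad (w x) u - grad (w x) v) (u - v))
  (w_lip : forall x, Omega x -> forall u v,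
    enorm (grad (w x) u - grad (w x) v) <= L * enorm (u - v)) :
  (forall (j : 'rV[R]_d -> 'rV[R]_3) (hs : 'rV[R]_d -> 'rV[R]_d),
     current_density Omega j -> curl_eq Omega hs j ->
     [/\ uniquely_solvable Omega [set h | curl_eq Omega h j] (coenergy Omega w),
         uniquely_solvable Omega (H1_mod_R Omega) (reduced_coenergy Omega w hs),
         forall psi,
           is_minimizer (H1_mod_R Omega) (reduced_coenergy Omega w hs) psi ->
           let h := reduced_field Omega hs psi in
           let b := flux_density w h in
           weak_solution Omega w j h b /\
           forall h' b', weak_solution Omega w j h' b' ->
             h' = h %[ae lebesgue_row d in Omega] /\
             b' = b %[ae lebesgue_row d in Omega]
       & forall eps, 0 < eps ->
           uniquely_solvable Omega (Hcurl Omega)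
             (penalized_coenergy Omega w j eps)]) /\
  ((fun x => grad (w x) 0) = cst 0 %[ae lebesgue_row d in Omega] ->
   exists C C' : R,
   forall (j : 'rV[R]_d -> 'rV[R]_3) (hs : 'rV[R]_d -> 'rV[R]_d),
     current_density Omega j -> curl_eq Omega hs j ->
     forall psi,
       is_minimizer (H1_mod_R Omega) (reduced_coenergy Omega w hs) psi ->
     forall eps h_eps, 0 < eps ->
       is_minimizer (Hcurl Omega) (penalized_coenergy Omega w j eps) h_eps ->
       let h := reduced_field Omega hs psi in
       let b := flux_density w h in
       let b_eps := flux_density w h_eps in
       [/\ Hcurl_norm Omega h_eps <= C * L2norm Omega j,
           Hdiv Omega (fun x => b_eps x - b x)
         & Hcurl_norm Omega (fun x => h_eps x - h x)
           + Hdiv_norm Omega (fun x => b_eps x - b x)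
           <= C' * eps * L2norm Omega j]).
Proof.
have d0 : (0 < d)%N by case: hd => ->.
have d3 : (d <= 3)%N by case: hd => ->.
have [oO _ _ _] := Omega_lip.
have vO : (lebesgue_row d Omega < +oo)%E.
  by apply: lebesgue_row_bounded => //; exact: open_measurable_row.
split=> [j hs [jL _ _] hsj|flux0].
  have /(curl_eqP oO vO hs jL)[hsL hsH] := hsj.
  split.
  - split.
      have [h hm] := constrained_min_exists Omega_bounded Omega_lip w_pw w_smooth L_gt0 gamma_gt0 w_mono w_lip jL hsL hsH.
      by exists h; exact/(constrained_minE Omega_bounded Omega_lip w_pw w_smooth L_gt0 gamma_gt0 w_mono w_lip jL h).
    move=> h h' /(constrained_minE Omega_bounded Omega_lip w_pw w_smooth L_gt0 gamma_gt0 w_mono w_lip jL h)hm.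
    move=> /(constrained_minE Omega_bounded Omega_lip w_pw w_smooth L_gt0 gamma_gt0 w_mono w_lip jL h')hm'.
    exact: (constrained_min_unique Omega_bounded Omega_lip w_pw w_smooth L_gt0 gamma_gt0 w_mono w_lip jL hm hm').
  - split.
      exact: (reduced_min_exists d0 d3 Omega_bounded Omega_sc Omega_lip w_pw w_smooth L_gt0 gamma_gt0 w_mono w_lip jL hsL hsH).
    move=> psi psi'.
    exact: (reduced_min_unique d0 d3 Omega_bounded Omega_sc Omega_lip w_pw w_smooth L_gt0 gamma_gt0 w_mono w_lip jL hsL hsH).
  - move=> psi /(reduced_minE d0 d3 Omega_bounded Omega_sc Omega_lip w_pw w_smooth L_gt0 gamma_gt0 w_mono w_lip jL hsL hsH)[_ hm].
    exact: (constrained_min_weak_solution d0 d3 Omega_bounded Omega_sc Omega_lip w_pw w_smooth L_gt0 gamma_gt0 w_mono w_lip jL hm).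
  - move=> eps eps0; split.
      have [h hm] := penalty_min_exists Omega_bounded Omega_lip w_pw w_smooth L_gt0 gamma_gt0 w_mono w_lip jL eps0 hsL hsH.
      by exists h; exact/(penalty_minE Omega_bounded Omega_lip w_pw w_smooth L_gt0 gamma_gt0 w_mono w_lip jL eps h).
    move=> h h' /(penalty_minE Omega_bounded Omega_lip w_pw w_smooth L_gt0 gamma_gt0 w_mono w_lip jL eps h)hm.
    move=> /(penalty_minE Omega_bounded Omega_lip w_pw w_smooth L_gt0 gamma_gt0 w_mono w_lip jL eps h')hm'.
    exact: (penalty_min_unique Omega_bounded Omega_lip w_pw w_smooth L_gt0 gamma_gt0 w_mono w_lip jL eps0 hm hm').
have [K K0 lifting] := curl_lifting d0 d3 Omega_lip Omega_bounded.
(* The lifting constant [K] is obtained from [Omega] alone, before [j], the source field and [eps]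
   are introduced, which makes the two constants uniform in them. *)
pose a := L / gamma * K.
exists (a + 1), ((a + 1 + L * a) * (L * K * a)) => j hs [jL _ _] hsj psi psim eps h_eps eps0 hem.
have /(curl_eqP oO vO hs jL)[hsL hsH] := hsj.
have [_ hm] := (reduced_minE d0 d3 Omega_bounded Omega_sc Omega_lip w_pw w_smooth L_gt0 gamma_gt0 w_mono w_lip jL hsL hsH psi).1 psim.
have hm' := (penalty_minE Omega_bounded Omega_lip w_pw w_smooth L_gt0 gamma_gt0 w_mono w_lip jL eps h_eps).1 hem.
have st := penalty_stability Omega_bounded Omega_lip w_pw w_smooth L_gt0 gamma_gt0 w_mono w_lip K0 lifting flux0 jL eps0 hm'.
have [dv er] := penalty_error d0 d3 Omega_bounded Omega_lip w_pw w_smooth L_gt0 gamma_gt0 w_mono w_lip K0 lifting flux0 jL hm eps0 hm'.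
split; [exact: st|exact: dv|exact: er].
Qed.
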